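(* For any constants $\alpha,\eta,\nu\in(0,1)$ the following holds. Given a system $\Psi$ of linear equations over $\mathbb{F}_2$ in variables $X_1,\dots,X_n$, each equation involving exactly $4$ variables, it is $\mathsf{NP}$-hard to distinguish between the following cases: (YES) there exists an assignment to the variables which satisfies at least a $(1-\eta)$-fraction of the equations in $\Psi$; (NO) no subset $S$ of the variables of size at least $\alpha n$ induces a system of equations for which there exists an assignment satisfying at least a $(1/2+\nu)$ fraction of the induced equations.
   Context: The system induced by a subset $S$ of variables consists of those equations of $\Psi$ all of whose variables lie in $S$. *)

(* Defs.v *)
From mathcomp Require Import all_boot all_order all_algebra.
From mathcomp Require Import reals.

Set Implicit Arguments.
Unset Strict Implicit.
Unset Printing Implicit Defensive.

Import Order.TTheory GRing.Theory Num.Theory.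
Local Open Scope ring_scope.

(* Deterministic single-tape Turing machines, the tape being infinite in both
   directions. A tape symbol is blank ([None]), an input/output bit
   ([Some (inl b)]) or an auxiliary symbol ([Some (inr g)]). The machine halts
   when its transition function returns [None]. *)
Inductive move := MoveLeft | MoveStay | MoveRight.

Definition tape_symbol (G : finType) := option (bool + G).

Record turing_machine := TuringMachine {
  tm_state : finType;
  tm_aux : finType;
  tm_start : tm_state;
  tm_delta : tm_state -> tape_symbol tm_aux ->
             option (tm_state * tape_symbol tm_aux * move)
}.

(* [cfg_left] lists the cells to the left of the head, nearest first;
   [cfg_right] lists the scanned cell and the cells to its right. All cells not
   listed are blank. *)
Record config (M : turing_machine) := Config {
  cfg_state : tm_state M;
  cfg_left : seq (tape_symbol (tm_aux M));
  cfg_right : seq (tape_symbol (tm_aux M))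
}.

Definition tm_init (M : turing_machine) (x : seq bool) : config M :=
  Config (tm_start M) [::] [seq Some (inl b) | b <- x].

Definition tm_step (M : turing_machine) (c : config M) : option (config M) :=
  let: Config q l r := c in
  match tm_delta q (head None r) with
  | None => None
  | Some (q', a, MoveLeft) =>
      Some (Config q' (behead l) (head None l :: a :: behead r))
  | Some (q', a, MoveStay) => Some (Config q' l (a :: behead r))
  | Some (q', a, MoveRight) => Some (Config q' (a :: l) (behead r))
  end.

(* The halting configuration, if it is reached in at most [t] steps. *)
Fixpoint tm_run (M : turing_machine) (t : nat) (c : config M) :
    option (config M) :=
  match tm_step c, t with
  | None, _ => Some c
  | Some c', t'.+1 => tm_run t' c'
  | Some _, 0%N => None
  end.

Fixpoint read_bits (G : finType) (s : seq (tape_symbol G)) : seq bool :=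
  if s is Some (inl b) :: s' then b :: read_bits s' else [::].

(* The output is the maximal block of bits that starts at the scanned cell. *)
Definition tm_output (M : turing_machine) (c : config M) : seq bool :=
  read_bits (cfg_right c).

Definition polytime (f : seq bool -> seq bool) : Prop :=
  exists (M : turing_machine) (p : {poly nat}),
    forall x : seq bool, exists2 c : config M,
      tm_run p.[size x] (tm_init M x) = Some c & tm_output c = f x.

(* Self-delimiting: the length of [x] is given in unary first. *)
Definition encode_pair (x w : seq bool) : seq bool :=
  nseq (size x) true ++ false :: x ++ w.

Definition in_NP (L : seq bool -> Prop) : Prop :=
  exists (V : seq bool -> seq bool) (p : {poly nat}),
    polytime V /\
    forall x : seq bool,
      L x <-> exists2 w : seq bool,
        (size w <= p.[size x])%N & V (encode_pair x w) = [:: true].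

(* NP-hardness, under polynomial-time many-one reductions, of telling the
   instances satisfying [Yes] from those satisfying [No]. *)
Definition NP_hard_to_distinguish (T : Type) (encode : T -> seq bool)
    (Yes No : T -> Prop) : Prop :=
  forall L : seq bool -> Prop, in_NP L ->
    exists r : seq bool -> T,
      polytime (encode \o r) /\
      forall x : seq bool, (L x -> Yes (r x)) /\ (~ L x -> No (r x)).

(* [(c, b)] is the equation [\sum_i c 0 i * X_i = b]. *)
Definition equation (n : nat) : Type := ('rV['F_2]_n * 'F_2)%type.

Definition equation_vars (n : nat) (e : equation n) : {set 'I_n} :=
  [set i | e.1 0 i != 0].

Definition satisfies (n : nat) (a : {ffun 'I_n -> 'F_2}) (e : equation n) :
    bool :=
  \sum_(i < n) e.1 0 i * a i == e.2.

(* Written without division, so that every assignment satisfies any given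
   fraction of an empty system. *)
Definition satisfies_fraction (R : realType) (n : nat) (c : R)
    (a : {ffun 'I_n -> 'F_2}) (Psi : seq (equation n)) : Prop :=
  c * (size Psi)%:R <= (count (satisfies a) Psi)%:R.

Definition induced_system (n : nat) (S : {set 'I_n}) (Psi : seq (equation n)) :
    seq (equation n) :=
  [seq e <- Psi | equation_vars e \subset S].

Record system4 := System4 {
  nvars : nat;
  equations : seq (equation nvars);
  equations_4vars : all (fun e => #|equation_vars e| == 4%N) equations
}.

(* The augmented-matrix row of [e], as bits. *)
Definition encode_equation (n : nat) (e : equation n) : seq bool :=
  rcons [seq e.1 0 i != 0 | i <- enum 'I_n] (e.2 != 0).

(* Self-delimiting: the number of variables is given in unary first. *)
Definition encode_system (Psi : system4) : seq bool :=
  nseq (nvars Psi) true ++ false ::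
  flatten [seq encode_equation e | e <- equations Psi].

Definition yes_case (R : realType) (eta : R) (Psi : system4) : Prop :=
  exists a : {ffun 'I_(nvars Psi) -> 'F_2},
    satisfies_fraction (1 - eta) a (equations Psi).

Definition no_case (R : realType) (alpha nu : R) (Psi : system4) : Prop :=
  forall S : {set 'I_(nvars Psi)},
    alpha * (nvars Psi)%:R <= #|S|%:R ->
    ~ exists a : {ffun 'I_(nvars Psi) -> 'F_2},
        satisfies_fraction (1 / 2 + nu) a (induced_system S (equations Psi)).

(* Main.v *)
(** Membership in an NP language is first turned into constraint satisfaction on a
cyclic grid, the computation tableau of the verifier, with an expander on the
same vertices; expanders of all sizes come from zig-zag products. Following
Dinur, rounds of powering along random walks and of alphabet reduction by
constant-size long code gadgets then double the fraction of violated constraints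
until it is constant. Every round is a local rewriting of a labelled graph with
an absolute-constant loss, so that logarithmically many of them take polynomial
time.

The value of the resulting game is made arbitrarily small by parallel repetition.
The game is fortified beforehand: a vertex is replaced by the end of a random walk
from it, hence the game restricted to any large set of questions still has a gap,
and the repeated value decreases geometrically by an elementary induction.

Finally a strategy is encoded by folded long codes, and the test reads two
noisily related points of each of the tables of two neighbours [w], [w'] of a random
question: f_w(x) f_w(x + g.p + noise) f_w'(x') f_w'(x' + g.p' + noise'). All terms in
the Fourier expansion of its expectation are nonnegative. For a folded function that
may vanish off a set of variables the expectation is bounded by the value of the
game times a constant, while for the indicator of a set of density [alpha] it is at
least [alpha^4]. So almost exactly half of the equations induced by any set of
density [alpha] can be satisfied. *)
Require Import Defs.
From mathcomp Require Import all_boot all_order all_algebra all_field.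
From mathcomp Require Import reals boolp.
From mathcomp Require Import ring lra zify.
Set Implicit Arguments.
Unset Strict Implicit.
Unset Printing Implicit Defensive.
Import Order.TTheory GRing.Theory Num.Theory.
Local Open Scope ring_scope.

(** * Expanders *)

(** Three obstacles shape the construction. The reduction is a function on bit strings, so every
    object, expanders included, must be computable: graphs are families of permutations indexed by a
    fixed finite set of generators, and they grow by rules that look only at a bounded
    neighbourhood. Equations must have exactly four distinct variables: tests that read a folded
    point twice are dropped, and their share, at most [kap] = 12 (1 - 1/m)^|L|, is made negligible
    by enlarging the label set. Fortification has an additive error which each product multiplies by
    an alphabet size, so the walk length [T] is chosen after the number [k] of repetitions. The
    order of choices is therefore: the noise 1/m from [eta]; [k] from [m], [alpha], [nu] and the
    constant gap; then [T], which controls the additive error and, through |L| >= T, also [kap].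
    Probabilities are averages over finite types, and second singular values enter through their
    squares, so that no square root is taken and most of the argument lives in an arbitrary
    [realFieldType]. *)

Section Average.

Variable R : realFieldType.

(** On an empty type the value is 0, division by zero being 0; only identities that involve the
    average of a constant see the difference. *)
Definition avg (T : finType) (f : T -> R) : R := (\sum_x f x) / #|T|%:R.

Implicit Types (T A B : finType).

Lemma eq_avg T (f g : T -> R) : f =1 g -> avg f = avg g.
Proof. by move=> e; congr (_ / _); apply: eq_bigr => x _; exact: e. Qed.

Lemma avg_cst T (c : R) : (0 < #|T|)%N -> avg (fun _ : T => c) = c.
Proof.
by move=> h; rewrite /avg sumr_const -[c *+ _]mulr_natr mulfK // pnatr_eq0 -lt0n.
Qed.

Lemma avg0 T : avg (fun _ : T => 0 : R) = 0.
Proof. by rewrite /avg big1 ?mul0r. Qed.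

Lemma avgD T (f g : T -> R) : avg (fun x => f x + g x) = avg f + avg g.
Proof. by rewrite /avg big_split mulrDl. Qed.

Lemma avgN T (f : T -> R) : avg (fun x => - f x) = - avg f.
Proof. by rewrite /avg sumrN mulNr. Qed.

Lemma avgB T (f g : T -> R) : avg (fun x => f x - g x) = avg f - avg g.
Proof. by rewrite avgD avgN. Qed.

Lemma avgZ T (c : R) (f : T -> R) : avg (fun x => c * f x) = c * avg f.
Proof. by rewrite /avg -mulr_sumr mulrA. Qed.

Lemma avgZr T (c : R) (f : T -> R) : avg (fun x => f x * c) = avg f * c.
Proof. by rewrite mulrC -avgZ; apply: eq_avg => x; rewrite mulrC. Qed.

Lemma le_avg T (f g : T -> R) : (forall x, f x <= g x) -> avg f <= avg g.
Proof.
by move=> h; rewrite ler_wpM2r ?invr_ge0 ?ler0n //; apply: ler_sum => x _.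
Qed.

Lemma avg_ge0 T (f : T -> R) : (forall x, 0 <= f x) -> 0 <= avg f.
Proof. by move=> h; rewrite -(avg0 T); apply: le_avg. Qed.

Lemma avg_sum T (I : Type) (r : seq I) (P : pred I) (F : I -> T -> R) :
  avg (fun x => \sum_(i <- r | P i) F i x) = \sum_(i <- r | P i) avg (F i).
Proof. by rewrite /avg exchange_big -mulr_suml. Qed.

Lemma avgC A B (f : A -> B -> R) :
  avg (fun x => avg (f x)) = avg (fun y => avg (fun x => f x y)).
Proof.
rewrite /avg -!mulr_suml [in RHS]exchange_big /= mulrAC; congr (_ / _).
Qed.

Lemma avg_pair A B (f : A * B -> R) :
  avg f = avg (fun a => avg (fun b => f (a, b))).
Proof.
rewrite /avg -mulr_suml card_prod natrM invfM mulrA mulrAC; congr (_ / _ / _).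
by rewrite pair_bigA; apply: eq_bigr => -[].
Qed.

Lemma sum_pair A B (F : A * B -> R) : \sum_p F p = \sum_i \sum_j F (i, j).
Proof. by rewrite pair_bigA; apply: eq_bigr => -[]. Qed.

Lemma avg_can A B (h : A -> B) (g : B -> A) (f : B -> R) :
  cancel h g -> cancel g h -> avg (fun a => f (h a)) = avg f.
Proof.
move=> hg gh; rewrite /avg (reindex h) /=; last by exists g => x _; [apply: hg|apply: gh].
by rewrite (bij_eq_card (Bijective hg gh)).
Qed.

Lemma avg_inj T (h : T -> T) (f : T -> R) :
  injective h -> avg (fun a => f (h a)) = avg f.
Proof. by move=> hi; apply: (@avg_can _ _ h (finv h)); [exact: finv_f|exact: f_finv]. Qed.

Lemma avg_var T (f : T -> R) : (0 < #|T|)%N ->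
  avg (fun x => (f x - avg f) ^+ 2) = avg (fun x => f x ^+ 2) - avg f ^+ 2.
Proof.
move=> h; set m := avg f.
transitivity (avg (fun x => (f x ^+ 2 - (2 * m) * f x) + m ^+ 2)).
  by apply: eq_avg => x; ring.
by rewrite avgD avgB avgZ avg_cst // -/m; ring.
Qed.

Lemma avg_sqr T (f : T -> R) : avg f ^+ 2 <= avg (fun x => f x ^+ 2).
Proof.
case: (posnP #|T|) => h.
  by rewrite /avg h invr0 !mulr0 expr0n.
rewrite -subr_ge0 -avg_var //; apply: avg_ge0 => x; exact: sqr_ge0.
Qed.

(** A weighted arithmetic-geometric inequality. The free weight [c] stands in for the square root
    that the Cauchy-Schwarz inequality would produce. *)
Lemma avg_absM T (f g : T -> R) (c : R) : 0 < c ->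
  avg (fun x => f x * g x) <= (c * avg (fun x => f x ^+ 2) + avg (fun x => g x ^+ 2) / c) / 2.
Proof.
move=> c0; rewrite -avgZ -avgZr -avgD -avgZr; apply: le_avg => x.
rewrite -subr_ge0.
have -> : (c * f x ^+ 2 + g x ^+ 2 / c) / 2 - f x * g x = (c * f x - g x) ^+ 2 / (c * 2).
  by field; lra.
by rewrite divr_ge0 ?sqr_ge0 // mulr_ge0 // ltW.
Qed.

Lemma avg_tuple_recl (K : finType) n (f : n.+1.-tuple K -> R) :
  avg f = avg (fun k => avg (fun s : n.-tuple K => f [tuple of k :: s])).
Proof.
rewrite -(avg_pair (fun p : K * n.-tuple K => f [tuple of p.1 :: p.2])).
rewrite (avg_can (g := fun t : n.+1.-tuple K => (thead t, [tuple of behead t]))) //.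
- by move=> [k s] /=; congr pair; apply: val_inj.
- by move=> t /=; rewrite [RHS]tuple_eta; apply: val_inj.
Qed.

Lemma avg_tuple0 (K : finType) (f : 0.-tuple K -> R) : avg f = f [tuple].
Proof.
rewrite /avg card_tuple expn0 divr1 (big_pred1 [tuple]) // => t.
by rewrite /= [t]tuple0; apply/esym/eqP.
Qed.

Lemma le_avg1 T (f : T -> R) c : 0 <= c -> (forall x, f x <= c) -> avg f <= c.
Proof.
move=> c0 h; case: (posnP #|T|) => h0; first by rewrite /avg h0 invr0 mulr0.
by rewrite -(avg_cst c h0); apply: le_avg.
Qed.

Lemma avg_count T (P : pred T) : avg (fun x => (P x)%:R) = #|P|%:R / #|T|%:R.
Proof. by rewrite /avg -natr_sum -sum1_card [in RHS]big_mkcond. Qed.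

End Average.

(** * Walks along symmetric families of permutations *)

Definition walk (V K : Type) (act : K -> V -> V) (s : seq K) (v : V) : V :=
  foldl (fun v k => act k v) v s.

(** A regular undirected multigraph given by permutations: generator [k] crosses an edge and [inv k]
    crosses it back. Loops and multiple edges are allowed. *)
Definition isg (V K : Type) (act : K -> V -> V) (inv : K -> K) : Prop :=
  (forall k v, act (inv k) (act k v) = v) /\ involutive inv.

Definition winv (K : Type) (inv : K -> K) (s : seq K) := rev (map inv s).

Section Walk.
Variables (V K : Type) (act : K -> V -> V) (inv : K -> K).
Hypothesis sg : isg act inv.

Lemma walk_cat s1 s2 v : walk act (s1 ++ s2) v = walk act s2 (walk act s1 v).
Proof. exact: foldl_cat. Qed.

Lemma isg_inj k : injective (act k).
Proof. by move=> a b e; rewrite -(sg.1 k a) e sg.1. Qed.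

Lemma isgV k v : act k (act (inv k) v) = v.
Proof. by have := sg.1 (inv k) v; rewrite sg.2. Qed.

Lemma walk_winv s v : walk act (winv inv s) (walk act s v) = v.
Proof.
elim: s v => //= k s ih v.
by rewrite /winv /= rev_cons -cats1 walk_cat /= -/(winv inv s) ih sg.1.
Qed.

Lemma winvK s : winv inv (winv inv s) = s.
Proof. by rewrite /winv map_rev revK; elim: s => //= k s ->; rewrite sg.2. Qed.

Lemma size_winv s : size (winv inv s) = size s.
Proof. by rewrite size_rev size_map. Qed.

End Walk.

(** * Spectral contraction and zig-zag products *)

Section Contraction.

Variable R : realFieldType.
Implicit Types (V K J A B : finType).

(* [L] bounds the square of the second singular value of the averaging
   operator, so that no square roots are needed. *)
Definition contr V K (act : K -> V -> V) (L : R) : Prop :=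
  forall f : V -> R, avg f = 0 ->
    avg (fun v => avg (fun k => f (act k v)) ^+ 2) <= L * avg (fun v => f v ^+ 2).

Lemma avg_act V K (act : K -> V -> V) inv (f : V -> R) : isg act inv -> (0 < #|K|)%N ->
  avg (fun v => avg (fun k => f (act k v))) = avg f.
Proof.
move=> sg k0; rewrite avgC -[RHS](@avg_cst _ K) //; apply: eq_avg => k.
by apply: avg_inj; apply: isg_inj sg k.
Qed.

Lemma contr_var V K (act : K -> V -> V) (L : R) (f : V -> R) :
  contr act L -> (0 < #|K|)%N -> (0 < #|V|)%N ->
  avg (fun v => (avg (fun k => f (act k v)) - avg f) ^+ 2)
    <= L * (avg (fun v => f v ^+ 2) - avg f ^+ 2).
Proof.
move=> c k0 v0; rewrite -avg_var //.
have -> : avg (fun v => (avg (fun k => f (act k v)) - avg f) ^+ 2) =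
  avg (fun v => avg (fun k => f (act k v) - avg f) ^+ 2).
  by apply: eq_avg => v; rewrite avgB avg_cst.
apply: (c (fun v => f v - avg f)); by rewrite avgB avg_cst // subrr.
Qed.

Lemma contr_mean V K (act : K -> V -> V) inv (L : R) (f : V -> R) :
  isg act inv -> contr act L -> 0 <= L -> (0 < #|K|)%N -> (0 < #|V|)%N ->
  avg (fun v => avg (fun k => f (act k v)) ^+ 2)
    <= avg f ^+ 2 + L * avg (fun v => f v ^+ 2).
Proof.
move=> sg c L0 k0 v0; have := contr_var f c k0 v0.
have e := avg_act f sg k0.
have := @avg_var _ _ (fun v => avg (fun k => f (act k v))) v0; rewrite e => ->.
have : 0 <= L * avg f ^+ 2 by rewrite mulr_ge0 ?sqr_ge0.
by lra.
Qed.

Definition act2 V K1 K2 (a1 : K1 -> V -> V) (a2 : K2 -> V -> V) (k : K1 * K2) v :=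
  a2 k.2 (a1 k.1 v).

Lemma contr_act2 V K1 K2 (a1 : K1 -> V -> V) (a2 : K2 -> V -> V) inv2 (L1 L2 : R) :
  isg a2 inv2 -> (0 < #|K2|)%N -> 0 <= L1 -> contr a1 L1 -> contr a2 L2 ->
  contr (act2 a1 a2) (L1 * L2).
Proof.
move=> sg k0 L10 c1 c2 f f0.
have e : forall v, avg (fun k => f (act2 a1 a2 k v)) =
   avg (fun k => (fun w => avg (fun k' => f (a2 k' w))) (a1 k v)).
  by move=> v; rewrite avg_pair.
under eq_avg do rewrite e.
apply: le_trans (c1 (fun w => avg (fun k' => f (a2 k' w))) _) _; first by rewrite (avg_act f sg).
by rewrite -mulrA ler_wpM2l //; apply: c2.
Qed.

Lemma isg_act2 V K (act : K -> V -> V) inv : isg act inv ->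
  isg (act2 act act) (fun k => (inv k.2, inv k.1)).
Proof.
move=> sg; split=> [[k1 k2] v|[k1 k2]] /=; first by rewrite /act2 /= !sg.1.
by rewrite !sg.2.
Qed.

(** The zig-zag product: a step inside the cloud selects an edge [j] of the large graph, that edge
    is crossed, and a second small step starts from its name [invJ j] in the cloud reached. *)
Definition zigzag V J KH (step : J -> V -> V) (invJ : J -> J) (h : KH -> J -> J)
    (k : KH * KH) (p : V * J) : V * J :=
  (step (h k.1 p.2) p.1, h k.2 (invJ (h k.1 p.2))).

Section Zigzag.
Variables (V J KH : finType) (step : J -> V -> V) (invJ : J -> J).
Variables (h : KH -> J -> J) (hinv : KH -> KH) (L2 LH : R).
Hypotheses (sgs : isg step invJ) (sgh : isg h hinv).
Hypotheses (cs : contr step L2) (ch : contr h LH).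
Hypotheses (L20 : 0 <= L2) (LH0 : 0 <= LH).
Hypotheses (kh0 : (0 < #|KH|)%N) (j0 : (0 < #|J|)%N).

Lemma isg_zigzag : isg (zigzag step invJ h) (fun k => (hinv k.2, hinv k.1)).
Proof.
split=> [[k1 k2] [v j]|[k1 k2]] /=; last by rewrite !sgh.2.
by rewrite /zigzag /= sgh.1 sgs.1 sgs.2 sgh.1.
Qed.

(** The function splits into its cloud averages [fb] and the rest [fp]. On [fb], the first small
    step makes the edge crossed almost uniform, which gives [L2 + LH]. On [fp], of mean 0 in each
    cloud, the last small step alone contracts by [LH] and the other two steps do not increase the
    norm. The factor 2 comes from (a + b)^2 <= 2a^2 + 2b^2. *)
Lemma contr_zigzag : contr (zigzag step invJ h) (2 * (L2 + LH)).
Proof.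
move=> f f0.
pose fb v := avg (fun j => f (v, j)).
pose fp v j := f (v, j) - fb v.
pose gp v j := avg (fun k => fp v (h k j)).
pose u1 v j := fb (step j v).
pose u2 v j := gp (step j v) (invJ j).
pose z1 v j := avg (fun k => u1 v (h k j)).
pose z2 v j := avg (fun k => u2 v (h k j)).
have eZ v j : avg (fun k => f (zigzag step invJ h k (v, j))) = z1 v j + z2 v j.
  rewrite avg_pair -avgD; apply: eq_avg => k1.
  rewrite /u1 /u2 /gp /fp /zigzag /= avgB avg_cst //; ring.
have fb0 : avg fb = 0 by rewrite -f0 avg_pair.
have fp0 v : avg (fp v) = 0 by rewrite /fp avgB avg_cst // subrr.
have efp : avg (fun p => f p ^+ 2) =
    avg (fun v => fb v ^+ 2) + avg (fun v => avg (fun j => fp v j ^+ 2)).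
  rewrite avg_pair -avgD; apply: eq_avg => v.
  by rewrite /fp (avg_var (fun j => f (v, j))) // addrC subrK.
have h1 : avg (fun v => avg (fun j => z1 v j ^+ 2)) <= (L2 + LH) * avg (fun v => fb v ^+ 2).
  apply: le_trans (_ : _ <= avg (fun v => avg (u1 v) ^+ 2 + LH * avg (fun j => u1 v j ^+ 2))) _.
    by apply: le_avg => v; apply: contr_mean sgh _ _ _ _.
  rewrite avgD avgZ mulrDl lerD //; first exact: cs.
  by rewrite ler_wpM2l // (avg_act (fun w => fb w ^+ 2) sgs).
have h2 : avg (fun v => avg (fun j => z2 v j ^+ 2))
    <= LH * avg (fun v => avg (fun j => fp v j ^+ 2)).
  apply: le_trans (_ : _ <= avg (fun v => avg (fun j => avg (fun k => u2 v (h k j) ^+ 2)))) _.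
    by apply: le_avg => v; apply: le_avg => j; apply: avg_sqr.
  under eq_avg => v do rewrite (avg_act (fun j => u2 v j ^+ 2) sgh) //.
  rewrite -(avg_pair (fun p => u2 p.1 p.2 ^+ 2)) /u2 /=.
  rewrite (avg_inj (h := fun p : V * J => (step p.2 p.1, invJ p.2)) (fun p => gp p.1 p.2 ^+ 2)); last first.
    move=> [a i] [b j] [] /= e1 e2; have e3 : i = j by rewrite -(sgs.2 i) e2 sgs.2.
    by rewrite e3 in e1 *; rewrite (isg_inj sgs e1).
  rewrite avg_pair -avgZ; apply: le_avg => v; exact: ch.
rewrite avg_pair.
under eq_avg => v do under eq_avg => j do rewrite eZ.
apply: le_trans (_ : _ <= avg (fun v => avg (fun j => 2 * z1 v j ^+ 2 + 2 * z2 v j ^+ 2))) _.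
  by apply: le_avg => v; apply: le_avg => j; have := sqr_ge0 (z1 v j - z2 v j); nra.
under eq_avg => v do rewrite avgD !avgZ.
rewrite avgD !avgZ efp.
have : 0 <= avg (fun v => fb v ^+ 2) by apply: avg_ge0 => v; apply: sqr_ge0.
have : 0 <= avg (fun v => avg (fun j => fp v j ^+ 2)).
  by apply: avg_ge0 => v; apply: avg_ge0 => j; apply: sqr_ge0.
move=> p1 p2; have := mulr_ge0 L20 p1; have := mulr_ge0 LH0 p1.
have := mulr_ge0 L20 p2; have := mulr_ge0 LH0 p2; lra.
Qed.
End Zigzag.

(** The affine plane graph: (a, b) and (c, d) are adjacent when b + d = ac, and the edge is named a
    + c. The name is symmetric in the two ends, so each generator is an involution. *)
Definition ap_act (F : finFieldType) (k : F) (p : F * F) : F * F :=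
  (k - p.1, p.1 * (k - p.1) - p.2).

Lemma isg_ap (F : finFieldType) : isg (@ap_act F) id.
Proof. by split=> // k [a b] /=; rewrite /ap_act /=; congr pair; ring. Qed.

(** Expanding the square produces pairs of columns c, c'. For distinct columns a -> d + a (c' - c)
    is a bijection, so the pair contributes the product of two column sums. Over all pairs these
    products sum to 0 because [f] has mean 0, so those off the diagonal sum to minus a sum of
    squares. The bound left is the diagonal one, with factor 1/q. *)
Lemma contr_ap (F : finFieldType) : contr (@ap_act F) (#|F|%:R^-1).
Proof.
move=> f f0; set q : R := #|F|%:R.
have q0 : 0 < q by rewrite ltr0n; apply/card_gt0P; exists 0.
have sf0 : \sum_c \sum_d f (c, d) = 0.
  have : \sum_p f p = 0.
    have /eqP := f0; rewrite /avg mulf_eq0 invr_eq0 pnatr_eq0 card_prod => /orP[/eqP //|].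
    by rewrite muln_eq0 orbb => /eqP e; move: q0; rewrite /q e ltxx.
  by move=> h; rewrite -[RHS]h pair_bigA /=; apply: eq_bigr => -[].
have key : \sum_a \sum_b (\sum_c f (c, a * c - b)) ^+ 2 <= q * \sum_c \sum_d f (c, d) ^+ 2.
  have -> : \sum_a \sum_b (\sum_c f (c, a * c - b)) ^+ 2 =
     \sum_c \sum_c' \sum_d f (c, d) * \sum_a f (c', d + a * (c' - c)).
    transitivity (\sum_a \sum_b \sum_c \sum_c' f (c, a * c - b) * f (c', a * c' - b)).
      apply: eq_bigr => a _; apply: eq_bigr => b _.
      by rewrite expr2 mulr_suml; apply: eq_bigr => c _; rewrite mulr_sumr.
    transitivity (\sum_c \sum_c' \sum_a \sum_b f (c, a * c - b) * f (c', a * c' - b)).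
      under eq_bigr => a _ do (rewrite exchange_big; under eq_bigr => c _ do rewrite exchange_big).
      by rewrite exchange_big; apply: eq_bigr => c _; rewrite exchange_big.
    apply: eq_bigr => c _; apply: eq_bigr => c' _.
    transitivity (\sum_a \sum_d f (c, d) * f (c', d + a * (c' - c))).
      apply: eq_bigr => a _; rewrite (reindex_inj (subrI (a * c))) /=.
      apply: eq_bigr => d _; congr (f (_, _) * f (_, _)); ring.
    by rewrite exchange_big; apply: eq_bigr => d _; rewrite mulr_sumr.
  pose S c := \sum_d f (c, d).
  have e c c' : \sum_d f (c, d) * \sum_a f (c', d + a * (c' - c)) =
     if c' == c then q * \sum_d f (c, d) ^+ 2 else S c * S c'.
    case: eqP => [->|/eqP ne].
      rewrite mulr_sumr; apply: eq_bigr => d _; under eq_bigr => a _ do rewrite subrr mulr0 addr0.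
      by rewrite sumr_const -mulr_natr -/q; ring.
    rewrite mulr_suml; apply: eq_bigr => d _; congr (_ * _).
    rewrite [RHS](reindex (fun a => d + a * (c' - c))) //=.
    have nz : c' - c != 0 by rewrite subr_eq0.
    by exists (fun a => (a - d) / (c' - c)) => a _ /=; field.
  under eq_bigr => c _ do under eq_bigr => c' _ do rewrite e.
  have e2 c : \sum_c' (if c' == c then q * \sum_d f (c, d) ^+ 2 else S c * S c') =
     q * \sum_d f (c, d) ^+ 2 - S c ^+ 2.
    have : \sum_c' S c * S c' = 0 by rewrite -mulr_sumr /S sf0 mulr0.
    rewrite (bigD1 c) //= => h; rewrite (bigD1 c) //= eqxx.
    have -> : \sum_(c' | c' != c) (if c' == c then q * \sum_d f (c, d) ^+ 2 else S c * S c') =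
      \sum_(c' | c' != c) S c * S c' by apply: eq_bigr => c' ne; rewrite (negbTE ne).
    by move: h; rewrite -expr2; lra.
  under eq_bigr => c _ do rewrite e2.
  rewrite sumrB -mulr_sumr gerBl; apply: sumr_ge0 => c _; exact: sqr_ge0.
rewrite /avg card_prod natrM -/q.
have -> : \sum_v ((\sum_k f (ap_act k v)) / q) ^+ 2 =
    (\sum_a \sum_b (\sum_c f (c, a * c - b)) ^+ 2) / q ^+ 2.
  rewrite mulr_suml; under [RHS]eq_bigr do rewrite mulr_suml.
  rewrite pair_bigA /=; apply: eq_bigr => -[a b] _; rewrite exprMn exprVn; congr (_ ^+ 2 / _).
  by rewrite (reindex_inj (addrI a)) /=; apply: eq_bigr => c _; rewrite /ap_act /= addrC addKr.
have -> : \sum_x f x ^+ 2 = \sum_c \sum_d f (c, d) ^+ 2.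
  by rewrite pair_bigA; apply: eq_bigr => -[].
move: key; set X := \sum_a _; set Y := \sum_c _ => key.
have -> : X / q ^+ 2 / (q * q) = X / q ^+ 4 by field; lra.
have -> : q^-1 * (Y / (q * q)) = q * Y / q ^+ 4 by field; lra.
by rewrite ler_wpM2r // invr_ge0 exprn_ge0 // ltW.
Qed.

End Contraction.

(** * A base expander and its recursive enlargement *)

Section Family.

Variable R : realFieldType.
Implicit Types (A B K J V M : finType).

Lemma card_eq_can A B : #|A| = #|B| -> exists (h : A -> B) (g : B -> A), cancel h g /\ cancel g h.
Proof.
move=> e; exists (fun a => enum_val (cast_ord e (enum_rank a))).
exists (fun b => enum_val (cast_ord (esym e) (enum_rank b))).
by split=> x; rewrite enum_valK ?cast_ordK ?cast_ordKV enum_rankK.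
Qed.

Lemma contr_transport A B K (act : K -> A -> A) inv (L : R) : #|A| = #|B| ->
  isg act inv -> contr act L -> exists2 act' : K -> B -> B, isg act' inv & contr act' L.
Proof.
move=> e sg c; have [h [g [hg gh]]] := card_eq_can e.
exists (fun k b => h (act k (g b))).
  by split=> [k b|]; [rewrite hg sg.1 gh|exact: sg.2].
move=> f f0.
have := c (fun a => f (h a)); rewrite (avg_can _ hg gh) => /(_ f0).
rewrite (avg_can (fun b => f b ^+ 2) hg gh); congr (_ <= _).
rewrite -(avg_can _ hg gh); apply: eq_avg => a; congr (_ ^+ 2).
by apply: eq_avg => k; rewrite hg.
Qed.

Lemma contr_weaken A K (act : K -> A -> A) (L L' : R) : L <= L' -> contr act L -> contr act L'.
Proof.
move=> h c f f0; apply: le_trans (c f f0) _; rewrite ler_wpM2r //.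
by apply: avg_ge0 => v; apply: sqr_ge0.
Qed.

(** Two zig-zag products, starting from the affine plane over the field of order 2^14, each with the
    affine plane over the field of order 2^7. With these orders the cardinals match: degree |K0| on
    |K0|^4 vertices, as the recursion of the family requires. The contraction obtained is 4/2^14 +
    6/2^7 <= 1/16. *)
Lemma base_expander : exists (K0 : finType) (inv0 : K0 -> K0)
    (act0 : K0 -> ((K0 * K0) * (K0 * K0)) -> ((K0 * K0) * (K0 * K0))),
  [/\ (1 < #|K0|)%N, isg act0 inv0 & contr act0 (1 / 16%:R : R)].
Proof.
have [F _ cF] := @pPrimePowerField 2 7 isT isT.
have [F2 _ cF2] := @pPrimePowerField 2 14 isT isT.
have qF : (0 < #|F|)%N by rewrite cF expn_gt0.
have qF2 : (0 < #|F2|)%N by rewrite cF2 expn_gt0.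
have e1 : #|{: F * F}| = #|F2| by rewrite card_prod cF cF2 -expnD.
pose b : R := #|F|%:R^-1; pose b2 : R := #|F2|%:R^-1.
have b0 : 0 <= b by rewrite invr_ge0 ler0n.
have b20 : 0 <= b2 by rewrite invr_ge0 ler0n.
have [h1 s1 c1] := contr_transport (B := F2) e1 (isg_ap F) (@contr_ap R F).
pose i2 (k : F * F) := (k.2, k.1).
have s2 : isg _ i2 := isg_zigzag (isg_ap F2) s1.
have c2 : contr (zigzag (@ap_act F2) id h1) (2 * (b2 + b)).
  by apply: contr_zigzag (isg_ap F2) s1 (@contr_ap R F2) c1 _ _ _ _.
have s3 : isg _ i2 := isg_zigzag s2 (isg_ap F).
have c3 : contr (zigzag (zigzag (@ap_act F2) id h1) i2 (@ap_act F)) (2 * (2 * (b2 + b) + b)).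
  apply: contr_zigzag s2 (isg_ap F) c2 (@contr_ap R F) _ _ _ _ => //.
  - by rewrite mulr_ge0 ?addr_ge0.
  - by rewrite card_prod muln_gt0 qF.
have e2 : #|{: (F2 * F2) * F2 * (F * F)}| = #|{: ((F * F) * (F * F)) * ((F * F) * (F * F))}|.
  have e1' : #|F2| = (#|F| * #|F|)%N by rewrite -e1 card_prod.
  by rewrite !card_prod e1' !mulnA.
have c3' : contr (zigzag (zigzag (@ap_act F2) id h1) i2 (@ap_act F)) (1 / 16%:R : R).
  apply: (contr_weaken _ c3); rewrite /b /b2 cF cF2.
  have -> : (2 ^ 7 = 128)%N by [].
  have -> : ((2 ^ 14)%:R = 128%:R * 128%:R :> R) by rewrite -natrM -[128%N]/(2 ^ 7)%N -expnD.
  by lra.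
have [act sa ca] := contr_transport e2 s3 c3'.
exists (F * F)%type, i2, act; split=> //.
by rewrite card_prod cF -expnD.
Qed.

(** Squaring takes 1/4 to 1/16 and the degree to |K0|^4, the number of vertices of the base graph.
    The zig-zag product with the base graph restores the degree |K0|^2 and the bound 2 (1/16 + 1/16)
    = 1/4. *)
Theorem expander_family : exists (K1 : finType) (inv1 : K1 -> K1),
  (1 < #|K1|)%N /\
  forall i M, #|M| = ((#|K1| ^ 2) ^ i)%N ->
    exists2 act : K1 -> M -> M, isg act inv1 & contr act (1 / 4%:R : R).
Proof.
have [K0 [inv0 [act0 [k0 s0 c0]]]] := base_expander.
have k0' : (0 < #|K0|)%N by apply: leq_trans k0.
pose inv1 (k : K0 * K0) := (inv0 k.2, inv0 k.1).
exists (K0 * K0)%type, inv1; split; first by rewrite card_prod; nia.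
elim=> [|i ih] M cM.
  exists (fun _ => id); first by split=> //; case=> a b; rewrite /inv1 /= !s0.2.
  move=> f; rewrite /avg; have [x xM] : exists x : M, x \in M by apply/card_gt0P; rewrite cM.
  have e : forall y : M, y = x.
    by move=> y; apply/esym/(fintype_le1P _ y x); rewrite cM.
  have e1 (g : M -> R) : \sum_y g y = g x.
    by rewrite (bigD1 x) //= big1 ?addr0 // => y /eqP; rewrite (e y).
  rewrite !e1 cM expn0 !divr1 => ->.
  by rewrite big1 // mul0r expr0n mulr0.
pose M' : finType := 'I_((#|{: K0 * K0}| ^ 2) ^ i).
have [act sa ca] := ih M' (card_ord _).
have k1 : (0 < #|{: K0 * K0}|)%N by rewrite card_prod muln_gt0 k0'.
have s2 := isg_act2 sa.
have c2 : contr (act2 act act) (1 / 16%:R : R).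
  apply: contr_weaken (contr_act2 sa k1 _ ca ca) => //; lra.
have s3 := isg_zigzag s2 s0.
have c3 := contr_zigzag s2 s0 c2 c0.
have [||act' sa' ca'] := @contr_transport _ M _ _ _ (1 / 4%:R : R) _ s3 _.
- by rewrite card_prod card_ord cM (expnSr _ i); congr (_ * _)%N; rewrite [LHS]card_prod mulnn.
- have p16 : 0 <= 1 / 16%:R :> R by lra.
  apply: contr_weaken (c3 p16 p16 k0' _); first lra.
  by rewrite card_prod muln_gt0 k1.
- by exists act'.
Qed.

(** Enlarges an expander on [V] to one on V * J with the same generators. The words [lw] and targets
    [lt] are chosen before [V], so the enlargement is a local rule that a machine can iterate,
    whereas [expander_family] gives bare existence. The exponent is at least 4 so that [J] covers
    the |K1|^8 pairs of generators evenly. *)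
Lemma lift_gens (K1 : finType) (inv1 : K1 -> K1) J (h : K1 -> J -> J) i :
  (1 < #|K1|)%N -> (3 < i)%N -> #|J| = ((#|K1| ^ 2) ^ i)%N ->
  isg h inv1 -> contr h (1 / 4%:R : R) ->
  let K : finType := ((K1 * K1) * (K1 * K1))%type in
  let invK (k : K) := ((inv1 k.2.2, inv1 k.2.1), (inv1 k.1.2, inv1 k.1.1)) in
  exists (lw : K -> J -> K * K) (lt : K -> J -> J),
  forall V (act : K -> V -> V), isg act invK -> contr act (1 / 4%:R : R) ->
   let act' k (p : V * J) := (act (lw k p.2).2 (act (lw k p.2).1 p.1), lt k p.2) in
   isg act' invK /\ contr act' (1 / 4%:R : R).
Proof.
move=> k1 hi cJ sh ch K invK.
have k10 : (0 < #|K1|)%N by apply: leq_trans k1.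
have j0 : (0 < #|J|)%N by rewrite cJ !expn_gt0 k10.
(* [S] absorbs the surplus of [J]: a position in the cloud names a pair of generators and an idle
   component. *)
pose S : finType := 'I_((#|K1| ^ 2) ^ (i - 4)).
have cK : #|{: K}| = (#|K1| ^ 2 ^ 2)%N by rewrite !card_prod !expnS !expn0 !muln1; lia.
have eJ : #|J| = #|{: (K * K) * S}|.
  rewrite cJ card_prod card_prod card_ord cK -expnD -!expnM -expnD; congr (_ ^ _)%N; lia.
have [g [g' [gK g'K]]] := card_eq_can eJ.
have s2 := isg_act2 sh.
have c2 : contr (act2 h h) (1 / 16%:R : R).
  apply: contr_weaken (contr_act2 sh k10 _ ch ch) => //; lra.
pose invJ j := g' ((invK (g j).1.2, invK (g j).1.1), (g j).2).
exists (fun k j => (g (act2 h h k.1 j)).1), (fun k j => act2 h h k.2 (invJ (act2 h h k.1 j))).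
move=> V act sa ca act'.
pose step j v := act (g j).1.2 (act (g j).1.1 v).
have sst : isg step invJ.
  split=> [j v|j]; first by rewrite /step /invJ g'K /= !sa.1.
  by rewrite /invJ g'K /= !sa.2 -[RHS]gK; congr g'; case: (g j) => -[].
have kk0 : (0 < #|{: K}|)%N by rewrite cK !expn_gt0 k10.
have cst : contr step (1 / 16%:R : R).
  have c3 : contr (act2 act act) (1 / 16%:R : R).
    apply: contr_weaken (contr_act2 sa kk0 _ ca ca) => //; lra.
  move=> f f0; apply: le_trans (c3 f f0); apply: le_avg => v.
  rewrite /step (avg_can (fun p : (K * K) * S => f (act p.1.2 (act p.1.1 v))) gK g'K).
  rewrite avg_pair le_eqVlt; apply/orP; left; apply/eqP; congr (_ ^+ 2).
  by apply: eq_avg => k /=; rewrite avg_cst // card_ord !expn_gt0 k10.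
have e : act' = zigzag step invJ (act2 h h) by [].
split; rewrite e; first exact: isg_zigzag sst s2.
apply: (@contr_weaken _ _ _ (2 * (1 / 16%:R + 1 / 16%:R))); first lra.
have p16 : 0 <= 1 / 16%:R :> R by lra.
have kk1 : (0 < #|{: K1 * K1}|)%N by rewrite card_prod muln_gt0 k10.
exact: (contr_zigzag sst s2 cst c2 p16 p16 kk1 j0).

Qed.

End Family.

(** * Gap amplification *)

Lemma avg_CS (R : realFieldType) (T : finType) (f g : T -> R) :
  avg (fun x => f x * g x) ^+ 2 <= avg (fun x => f x ^+ 2) * avg (fun x => g x ^+ 2).
Proof.
set X := avg (fun x => g x ^+ 2); set Y := avg (fun x => f x * g x).
set F := avg (fun x => f x ^+ 2).
have X0 : 0 <= X by apply: avg_ge0 => x; apply: sqr_ge0.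
have h : 0 <= X * (X * F - Y ^+ 2).
  have -> : X * (X * F - Y ^+ 2) = avg (fun x => (X * f x - Y * g x) ^+ 2).
    transitivity (avg (fun x => X ^+ 2 * f x ^+ 2 - (2 * X * Y) * (f x * g x) + Y ^+ 2 * g x ^+ 2)).
      by rewrite avgD avgB !avgZ -/X -/Y -/F; ring.
    by apply: eq_avg => x; ring.
  by apply: avg_ge0 => x; apply: sqr_ge0.
case: (ltrgt0P X) X0 => // [Xp|X0] _.
  by move: h; rewrite pmulr_rge0 // subr_ge0 mulrC.
suff -> : Y = 0 by rewrite X0 expr0n mulr0.
have gz x : g x = 0.
  have : \sum_x g x ^+ 2 = 0.
    move/eqP: X0; rewrite /X /avg mulf_eq0 invr_eq0 pnatr_eq0 => /orP[/eqP //|/eqP e].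
    by move: (fintype0 x e).
  move/psumr_eq0P => /(_ (fun i _ => sqr_ge0 (g i)) x isT) /eqP.
  by rewrite expf_eq0 /= => /eqP.
rewrite /Y -(avg0 R T); apply: eq_avg => x; by rewrite gz mulr0.
Qed.

(** * Averages over words and mixing of random walks *)

Section Words.

Variables (R : realFieldType) (E : finType).

(** Nested averages over plain sequences, so that words can be cut, concatenated and reversed
    without dependent lengths. *)
Fixpoint wavg (n : nat) (f : seq E -> R) : R :=
  if n is m.+1 then avg (fun e => wavg m (fun s => f (e :: s))) else f [::].

Lemma wavgE n f : wavg n f = avg (fun t : n.-tuple E => f t).
Proof.
elim: n f => [|n ih] f /=; first by rewrite avg_tuple0.
by rewrite avg_tuple_recl; apply: eq_avg => e; rewrite ih.
Qed.

Lemma eq_wavg n (f g : seq E -> R) :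
  (forall s, size s = n -> f s = g s) -> wavg n f = wavg n g.
Proof. by move=> h; rewrite !wavgE; apply: eq_avg => t; rewrite h ?size_tuple. Qed.

Lemma wavg_cat m n (f : seq E -> R) :
  wavg (m + n) f = wavg m (fun s => wavg n (fun s' => f (s ++ s'))).
Proof. by elim: m f => //= m ih f; apply: eq_avg => e; rewrite ih. Qed.

Lemma wavg_cst n (c : R) : (0 < #|E|)%N -> wavg n (fun _ => c) = c.
Proof. by move=> h; elim: n => //= n ih; rewrite ih avg_cst. Qed.

Lemma wavgZ n (c : R) (f : seq E -> R) : wavg n (fun s => c * f s) = c * wavg n f.
Proof. by rewrite !wavgE avgZ. Qed.

Lemma wavgD n (f g : seq E -> R) : wavg n (fun s => f s + g s) = wavg n f + wavg n g.
Proof. by rewrite !wavgE avgD. Qed.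

Lemma wavg_sum (I : Type) (r : seq I) (P : pred I) n (F : I -> seq E -> R) :
  wavg n (fun x => \sum_(i <- r | P i) F i x) = \sum_(i <- r | P i) wavg n (F i).
Proof. by rewrite wavgE avg_sum; apply: eq_bigr => i _; rewrite wavgE. Qed.

Lemma wavg_winv (inv : E -> E) n (f : seq E -> R) : involutive inv ->
  wavg n (fun s => f (winv inv s)) = wavg n f.
Proof.
move=> ii; rewrite !wavgE.
rewrite -(avg_inj (h := fun t : n.-tuple E => [tuple of rev (map inv t)]) (fun t => f t)) //.
move=> s t /(congr1 val) /= /(can_inj revK) /(inj_map (can_inj ii)); exact: val_inj.
Qed.

Lemma avg_wavg (V : finType) n (F : V -> seq E -> R) :
  avg (fun v => wavg n (F v)) = wavg n (fun s => avg (fun v => F v s)).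
Proof. by rewrite wavgE avgC; apply: eq_avg => v; rewrite wavgE. Qed.

End Words.

Section Mixing.

Variables (R : realFieldType) (V E : finType) (act : E -> V -> V) (inv : E -> E).
Hypotheses (sg : isg act inv) (E0 : (0 < #|E|)%N) (V0 : (0 < #|V|)%N).

Lemma avg_walk s (F : V -> R) : avg (fun v => F (walk act s v)) = avg F.
Proof.
apply: avg_inj => a b e.
by rewrite -(walk_winv sg s a) e walk_winv.
Qed.

Lemma avg_act1 e (F : V -> R) : avg (fun v => F (act e v)) = avg F.
Proof. exact: (avg_walk [:: e]). Qed.

Definition pw r (h : V -> R) v : R := wavg r (fun s => h (walk act s v)).

Lemma pwS r h v : pw r.+1 h v = avg (fun e => pw r h (act e v)).
Proof. by []. Qed.

Lemma avg_pw r h : avg (pw r h) = avg h.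
Proof.
rewrite avg_wavg -[RHS](wavg_cst r _ E0); apply: eq_wavg => s _.
exact: avg_walk.
Qed.

Lemma contr_pw (L : R) r h : 0 <= L -> contr act L ->
  avg (fun v => (pw r h v - avg h) ^+ 2) <= L ^+ r * avg (fun v => h v ^+ 2).
Proof.
move=> L0 ctr; elim: r => [|r ih].
  rewrite expr0 mul1r /pw /= avg_var //.
  by rewrite lerBlDr lerDl sqr_ge0.
rewrite exprS -mulrA; apply: le_trans (ler_wpM2l L0 ih).
have e v : pw r.+1 h v - avg h = avg (fun e => (fun w => pw r h w - avg h) (act e v)).
  by rewrite avgB avg_cst.
under eq_avg do rewrite e.
by apply: ctr; rewrite avgB avg_cst // avg_pw subrr.
Qed.

(** Functions of equal mean read [r] steps apart are independent up to an error decaying like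
    [th ^+ r]. The mean is split off, and the rest is bounded by [avg_absM] with weight [th ^+ r],
    which balances the two squares. *)
Lemma pw_mix (th : R) r g h : 0 < th -> contr act (th ^+ 2) ->
  (forall v, 0 <= g v <= 1) -> (forall v, 0 <= h v <= 1) -> avg g = avg h ->
  avg (fun v => g v * pw r h v) <= avg h ^+ 2 + th ^+ r * avg h.
Proof.
move=> th0 ctr hg hh egh; set mu := avg h.
have sq1 (f : V -> R) : (forall v, 0 <= f v <= 1) -> avg (fun v => f v ^+ 2) <= avg f.
  by move=> hf; apply: le_avg => v; have := hf v; nra.
have tr : 0 < th ^+ r by apply: exprn_gt0.
have -> : avg (fun v => g v * pw r h v) = mu ^+ 2 + avg (fun v => g v * (pw r h v - mu)).
  under [X in _ = _ + X]eq_avg do rewrite mulrBr.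
  by rewrite avgB avgZr egh -/mu; ring.
rewrite lerD2l; apply: le_trans (avg_absM _ _ tr) _.
have := @contr_pw (th ^+ 2) r h (sqr_ge0 _) ctr; rewrite -/mu exprAC => hc.
have h1 := sq1 _ hg; have h2 := sq1 _ hh; rewrite egh -/mu in h1; rewrite -/mu in h2.
set X := avg _ in h1 *; set Y := avg _ in hc *; set Z := avg _ in hc h2 *.
have : Y / th ^+ r <= th ^+ r * mu.
  rewrite ler_pdivrMr //; apply: le_trans hc _.
  by have := ler_wpM2l (sqr_ge0 (th ^+ r)) h2; lra.
have : th ^+ r * X <= th ^+ r * mu by rewrite ler_pM2l.
by lra.
Qed.

End Mixing.

(** * Soundness of powering *)

Section Power.

Variables (R : realFieldType) (V E S : finType) (act : E -> V -> V) (inv : E -> E).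
Hypotheses (sg : isg act inv) (E0 : (0 < #|E|)%N) (V0 : (0 < #|V|)%N).
Variables (s0 : S) (cst : V -> E -> S -> S -> bool) (B : nat).
Hypothesis ctr : contr act (16%:R / 25%:R : R).
Hypothesis B0 : (0 < B)%N.

Notation K := ('I_(B + B) * (B + B).-tuple E)%type.

(* A path of [L.+1] steps is accepted when each step lying less than [B] steps
   from both ends satisfies its constraint, the endpoints giving the values. *)
Definition pcst (v : V) (k : K) (fa fb : seq E -> S) : bool :=
  [forall j : 'I_B, forall m : 'I_B, (j + m == k.1)%N ==>
    (if drop j k.2 is e :: u then
       cst (walk act (take j k.2) v) e (fa (take j k.2)) (fb (winv inv (take m u)))
     else true)].

Variable A : V -> seq E -> S.

Definition pend (v : V) (k : K) : V := walk act (take k.1.+1 k.2) v.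

Definition prej : R := avg (fun v => avg (fun k : K => (~~ pcst v k (A v) (A (pend v k)))%:R)).

(** Popularity of the value [s] at [v]: the share of the walks of [j] steps ending at [v] whose
    starting point attributes [s] to [v]. As paths have random length, [opn] averages it over j <
    B. *)
Definition opw j v (s : S) : R := wavg j (fun w => (A (walk act (winv inv w) v) w == s)%:R).
Definition opn v s : R := avg (fun j : 'I_B => opw j v s).

Lemma opn_sum v : \sum_s opn v s = 1.
Proof.
rewrite -avg_sum -[RHS](@avg_cst _ 'I_B) ?card_ord //; apply: eq_avg => j.
rewrite -wavg_sum -[RHS](wavg_cst j 1 E0); apply: eq_wavg => w _.
by rewrite (bigD1 (A (walk act (winv inv w) v) w)) //= eqxx big1 ?addr0 // => s /negbTE; rewrite eq_sym => ->.
Qed.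

Definition sgm v : S := [arg max_(s > s0) opn v s]%O.

Lemma opn_sgm v : #|S|%:R^-1 <= opn v (sgm v).
Proof.
have S0 : (0 < #|S|)%N by apply/card_gt0P; exists s0.
rewrite /sgm; case: arg_maxP => //= s _ h.
have : 1 <= \sum_(i : S) opn v s by rewrite -(opn_sum v); apply: ler_sum => i _; apply: h.
by rewrite sumr_const -[_ *+ _]mulr_natl => h1; rewrite -ler_pdivrMl ?ltr0n // in h1 *; rewrite mulr1 in h1.
Qed.

Definition chi v e : R := (~~ cst v e (sgm v) (sgm (act e v)))%:R.
Definition mu : R := avg (fun v => avg (chi v)).

Fixpoint msum v (w : seq E) : R := if w is e :: w' then chi v e + msum (act e v) w' else 0.

(** Violated steps charged to their source ([h]) and to their target ([g]). *)
Let h v := avg (chi v).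
Let g v := avg (fun e => chi (act (inv e) v) e).

Lemma chi01 v e : 0 <= chi v e <= 1.
Proof. by rewrite /chi; case: (~~ _); rewrite /= ?lexx ler01. Qed.

Lemma h01 v : 0 <= h v <= 1.
Proof.
rewrite /h avg_ge0 => [|e]; last by case/andP: (chi01 v e).
by apply: le_avg1 => // e; case/andP: (chi01 v e).
Qed.

Lemma g01 v : 0 <= g v <= 1.
Proof.
rewrite /g avg_ge0 => [|e]; last by case/andP: (chi01 (act (inv e) v) e).
by apply: le_avg1 => // e; case/andP: (chi01 (act (inv e) v) e).
Qed.

Lemma chi_push (F : V -> R) :
  avg (fun v => avg (fun e => chi v e * F (act e v))) = avg (fun v => g v * F v).
Proof.
rewrite avgC; transitivity (avg (fun e => avg (fun v => chi (act (inv e) v) e * F v))).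
  apply: eq_avg => e; rewrite -[RHS](avg_act1 sg e); apply: eq_avg => v.
  by rewrite sg.1.
by rewrite avgC; apply: eq_avg => v; rewrite avgZr.
Qed.

Lemma avg_g : avg g = mu.
Proof.
rewrite -[LHS](eq_avg (fun v => mulr1 (g v))) -(chi_push (fun _ => 1)).
by apply: eq_avg => v; apply: eq_avg => e; rewrite mulr1.
Qed.

Lemma wavg_msum n v : wavg n (msum v) = \sum_(r < n) pw act r h v.
Proof.
elim: n v => [|n ih] v /=; first by rewrite big_ord0.
rewrite big_ord_recl /= {1}/pw /=.
transitivity (avg (fun e => chi v e + \sum_(r < n) pw act r h (act e v))).
  by apply: eq_avg => e; rewrite wavgD wavg_cst // ih.
rewrite avgD avg_sum; congr (_ + _); apply: eq_bigr => r _; exact: pwS.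
Qed.

(** The ratio 4/5 is the square root of the contraction bound 16/25. *)
Lemma geom_le5 n : \sum_(r < n) (4%:R / 5%:R : R) ^+ r <= 5%:R.
Proof.
suff -> : \sum_(r < n) (4%:R / 5%:R : R) ^+ r = 5%:R * (1 - (4%:R / 5%:R) ^+ n).
  have : 0 <= (4%:R / 5%:R : R) ^+ n by apply: exprn_ge0; lra.
  by lra.
elim: n => [|n ih]; first by rewrite big_ord0 expr0 subrr mulr0.
by rewrite big_ord_recr /= ih exprS; field.
Qed.

Lemma mu_ge0 : 0 <= mu.
Proof. by apply: avg_ge0 => v; case/andP: (h01 v). Qed.

(** The first step of the walk is split off. Its square contributes [mu], its products with later
    steps are bounded by [pw_mix], and the geometric series gives 11 = 1 + 2 * 5. *)
Lemma second_moment n :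
  avg (fun v => wavg n (fun w => msum v w ^+ 2)) <= n%:R * (11%:R * mu) + n%:R ^+ 2 * mu ^+ 2.
Proof.
have m0 := mu_ge0.
elim: n => [|n ih].
  by rewrite /= expr0n /= avg0 mul0r mul0r addr0.
set Q := avg _ in ih.
have -> : avg (fun v => wavg n.+1 (fun w => msum v w ^+ 2)) =
    mu + 2 * avg (fun v => g v * \sum_(r < n) pw act r h v) + Q.
  rewrite /= -chi_push -avgZ /mu -avgD.
  transitivity (avg (fun v => avg (fun e => chi v e + 2 * (chi v e * \sum_(r < n) pw act r h (act e v))))
     + avg (fun v => avg (fun e => wavg n (fun w => msum (act e v) w ^+ 2)))).
    rewrite -avgD; apply: eq_avg => v; rewrite -avgD; apply: eq_avg => e.
    rewrite -wavg_msum.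
    transitivity (wavg n (fun w => chi v e + (2 * chi v e) * msum (act e v) w + msum (act e v) w ^+ 2)).
      2: by rewrite !wavgD wavg_cst // wavgZ; ring.
    apply: eq_wavg => w _; have : chi v e ^+ 2 = chi v e by rewrite /chi; case: (~~ _); rewrite ?expr0n ?expr1n.
    by move: (chi v e) => c e1; rewrite sqrrD e1; ring.
  congr (_ + _).
    by apply: eq_avg => v; rewrite avgD avgZ.
  rewrite avgC -[RHS](@avg_cst _ E) //; apply: eq_avg => e.
  exact: (avg_act1 sg e (fun v => wavg n (fun w => msum v w ^+ 2))).
have hm : avg (fun v => g v * \sum_(r < n) pw act r h v) <= n%:R * mu ^+ 2 + 5%:R * mu.
  under eq_avg do rewrite mulr_sumr.
  rewrite avg_sum.
  apply: le_trans (_ : _ <= \sum_(r < n) (mu ^+ 2 + (4%:R / 5%:R) ^+ r * mu)) _.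
    apply: ler_sum => r _; apply: (@pw_mix _ _ _ _ _ sg E0 V0 (4%:R / 5%:R) r _ _ _ _ g01 h01 avg_g); first by lra.
    have -> : (4%:R / 5%:R : R) ^+ 2 = 16%:R / 25%:R by field.
    exact: ctr.
  rewrite big_split /= sumr_const card_ord -mulr_suml -[_ *+ _]mulr_natl lerD2l.
  by rewrite ler_wpM2r // geom_le5.
rewrite -[n.+1]addn1 natrD; have : 0 <= n%:R :> R by rewrite ler0n.
have := sqr_ge0 mu; set q := mu ^+ 2 in ih hm *; nra.
Qed.

Definition term v j m (t : seq E) : R :=
  if drop j t is e :: u then
    chi (walk act (take j t) v) e
    * ((A v (take j t) == sgm (walk act (take j t) v))%:R
    * (A (walk act (take (j + m).+1 t) v) (winv inv (take m u)) == sgm (walk act (take j.+1 t) v))%:R)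
  else 0.

Definition Nf v (k : K) : R := \sum_(j < B) \sum_(m < B) ((j + m)%N == k.1)%:R * term v j m k.2.

Lemma take_cons_drop (j : nat) (t : seq E) e u : drop j t = e :: u -> take j.+1 t = rcons (take j t) e.
Proof.
elim: j t => [|j ih] [|x t] //=; first by case=> -> _; rewrite take0.
by move=> /ih ->.
Qed.

Lemma walk_rcons s e v : walk act (rcons s e) v = act e (walk act s v).
Proof. by rewrite -cats1 walk_cat. Qed.

(** A path with a counted step is rejected, since its two ends attribute to that step exactly the
    values that violate it. This permits Cauchy-Schwarz against the indicator of rejection. *)
Lemma Nf_rej v k : Nf v k = Nf v k * (~~ pcst v k (A v) (A (pend v k)))%:R.
Proof.
case: (boolP (pcst _ _ _ _)) => [/forallP hp|_]; last by rewrite mulr1.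
rewrite mulr0; rewrite /Nf big1 // => j _; rewrite big1 // => m _.
case: eqP => [ejm|_]; last by rewrite mul0r.
have /forallP/(_ m) := hp j; rewrite ejm eqxx /= /term /pend -ejm.
case ed: (drop j k.2) => [|e u] //; first by rewrite mulr0.
case: (altP (A v _ =P _)) => [->|_]; last by rewrite mul0r !mulr0.
case: (altP (A _ _ =P _)) => [->|_]; last by rewrite !mulr0.
by rewrite (take_cons_drop ed) walk_rcons /chi => ->; rewrite mul0r mulr0.
Qed.

Lemma term_le v j m t : term v j m t <= (if drop j t is e :: _ then chi (walk act (take j t) v) e else 0).
Proof.
rewrite /term; case: (drop j t) => // e u.
have /andP[c0 _] := chi01 (walk act (take j t) v) e.
by case: (_ == _); case: (_ == _); rewrite /= ?mulr1 ?mulr0 ?mul0r ?mulr0.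
Qed.

Lemma term_ge0 v j m t : 0 <= term v j m t.
Proof.
rewrite /term; case: (drop j t) => // e u.
by rewrite !mulr_ge0 ?ler0n //; case/andP: (chi01 (walk act (take j t) v) e).
Qed.

Lemma msumE n v t : msum v (take n t) =
  \sum_(j < n) (if drop j t is e :: _ then chi (walk act (take j t) v) e else 0).
Proof.
elim: n v t => [|n ih] v t; first by rewrite take0 big_ord0.
case: t => [|e t] /=; first by rewrite big1.
by rewrite big_ord_recl /= ih.
Qed.

Lemma Nf_le v k : 0 <= Nf v k <= msum v (take B k.2).
Proof.
apply/andP; split.
  by apply: sumr_ge0 => j _; apply: sumr_ge0 => m _; rewrite mulr_ge0 ?ler0n ?term_ge0.
rewrite msumE; apply: ler_sum => j _; set X := (X in _ <= X).
have X0 : 0 <= X.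
  by rewrite /X; case: (drop j k.2) => // e u; case/andP: (chi01 (walk act (take j k.2) v) e).
apply: le_trans (_ : _ <= \sum_(m < B) ((j + m)%N == k.1)%:R * X) _.
  by apply: ler_sum => m _; rewrite ler_wpM2l ?ler0n ?term_le.
rewrite -mulr_suml -[X in _ <= X]mul1r ler_wpM2r // -natr_sum -[1]/(1%:R) ler_nat.
case: (ltnP (k.1 - j)%N B) => hB; last first.
  rewrite big1 // => m _; case: eqP => // e.
  by move: (ltn_ord m); rewrite ltnNge (leq_trans hB) // -e addKn.
rewrite (bigD1 (Ordinal hB)) //= big1 => [|m]; first by case: (_ == _).
by rewrite -val_eqE /=; case: eqP => //= e; case: eqP => // e2; lia.
Qed.

(** The walk is recentred at the source of step [j]. Reversibility turns the part before it into a
    walk of [j] steps arriving there, and the part after it is a walk of [m] steps from the other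
    end, so given the step the two opinions are independent. *)
Lemma avg_term (j m : 'I_B) :
  avg (fun v => wavg (B + B) (term v j m)) =
  avg (fun v => avg (fun e => chi v e * (opw j v (sgm v) * opw m (act e v) (sgm (act e v))))).
Proof.
have -> : (B + B = j + (1 + (m + (B + B - (j + m).+1))))%N by move: (ltn_ord j) (ltn_ord m); lia.
transitivity (avg (fun v => wavg j (fun s => avg (fun e => wavg m (fun u =>
   chi (walk act s v) e * ((A v s == sgm (walk act s v))%:R *
   (A (walk act u (act e (walk act s v))) (winv inv u) == sgm (act e (walk act s v)))%:R)))))).
  apply: eq_avg => v; rewrite wavg_cat; apply: eq_wavg => s zs; rewrite wavg_cat /=.
  apply: eq_avg => e; rewrite wavg_cat; apply: eq_wavg => u zu.
  rewrite -[RHS](wavg_cst (B + B - (j + m).+1) _ E0); apply: eq_wavg => u' _.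
  have z2 : size (s ++ e :: u) = (j + m).+1 by rewrite size_cat /= zs zu addnS.
  have t2 : take (j + m).+1 (s ++ e :: u ++ u') = s ++ e :: u.
    by rewrite -cat_cons catA take_size_cat.
  have t3 : take j.+1 (s ++ e :: u ++ u') = rcons s e.
    by rewrite -cat_rcons take_size_cat // size_rcons zs.
  rewrite /term t2 t3 drop_size_cat // (take_size_cat _ zs) (take_size_cat _ zu).
  by rewrite walk_rcons walk_cat.
rewrite avg_wavg.
transitivity (wavg j (fun s => avg (fun v => avg (fun e => wavg m (fun u =>
   chi v e * ((A (walk act (winv inv s) v) s == sgm v)%:R *
   (A (walk act u (act e v)) (winv inv u) == sgm (act e v))%:R)))))).
  apply: eq_wavg => s _; rewrite -[RHS](avg_walk sg s); apply: eq_avg => v.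
  by rewrite walk_winv.
rewrite -avg_wavg; apply: eq_avg => v; rewrite -avg_wavg; apply: eq_avg => e.
transitivity (wavg j (fun s => chi v e * ((A (walk act (winv inv s) v) s == sgm v)%:R * opw m (act e v) (sgm (act e v))))).
  apply: eq_wavg => s _; rewrite !wavgZ; congr (_ * (_ * _)).
  rewrite -(wavg_winv _ _ sg.2) /opw; apply: eq_wavg => u _; by rewrite (winvK sg).
rewrite wavgZ; congr (_ * _); rewrite -[X in X * _]/(wavg _ _) mulrC -wavgZ.
by apply: eq_wavg => s _; rewrite mulrC.
Qed.

(** Each of the B^2 pairs (j, m) has the right length with probability 1/(2B), whence B/2; each of
    the two opinions is the popular one with probability at least 1/|S|. *)
Lemma first_moment :
  B%:R * mu / (2 * #|S|%:R ^+ 2) <= avg (fun v => avg (Nf v)).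
Proof.
have b0 : 0 < B%:R :> R by rewrite ltr0n.
have S0 : 0 < #|S|%:R :> R by rewrite ltr0n; apply/card_gt0P; exists s0.
have -> : avg (fun v => avg (Nf v)) = B%:R / 2 *
    avg (fun v => avg (fun e => chi v e * (opn v (sgm v) * opn (act e v) (sgm (act e v))))).
  transitivity (\sum_(j < B) \sum_(m < B) (B + B)%:R^-1 * avg (fun v => wavg (B + B) (term v j m))).
    transitivity (avg (fun v => \sum_(j < B) \sum_(m < B) (B + B)%:R^-1 * wavg (B + B) (term v j m))).
      apply: eq_avg => v; rewrite avg_pair /Nf /=.
      transitivity (avg (fun L : 'I_(B + B) => \sum_(j < B) \sum_(m < B) ((j + m)%N == L)%:R * wavg (B + B) (term v j m))).
        apply: eq_avg => L; rewrite avg_sum; apply: eq_bigr => j _; rewrite avg_sum; apply: eq_bigr => m _.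
        by rewrite avgZ wavgE.
      rewrite avg_sum; apply: eq_bigr => j _; rewrite avg_sum; apply: eq_bigr => m _.
      rewrite avgZr; congr (_ * _).
      have hjm : (j + m < B + B)%N by move: (ltn_ord j) (ltn_ord m); lia.
      rewrite /avg card_ord (bigD1 (Ordinal hjm)) //= eqxx big1 ?addr0 ?mul1r // => L.
      by rewrite -val_eqE /= eq_sym => /negbTE ->.
    rewrite avg_sum; apply: eq_bigr => j _; rewrite avg_sum; apply: eq_bigr => m _.
    by rewrite avgZ.
  transitivity (\sum_(j < B) \sum_(m < B) (B + B)%:R^-1 *
    avg (fun v => avg (fun e => chi v e * (opw j v (sgm v) * opw m (act e v) (sgm (act e v)))))).
    by apply: eq_bigr => j _; apply: eq_bigr => m _; rewrite avg_term.
  under eq_bigr => j _ do rewrite -mulr_sumr -avg_sum.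
  rewrite -mulr_sumr -avg_sum.
  have -> : (B + B)%:R^-1 = B%:R / 2 * (B%:R * B%:R)^-1 :> R by rewrite natrD; field; lra.
  rewrite -mulrA -avgZ; congr (_ * _); apply: eq_avg => v.
  transitivity ((B%:R * B%:R)^-1 * avg (fun e => \sum_(j < B) \sum_(m < B)
      chi v e * (opw j v (sgm v) * opw m (act e v) (sgm (act e v))))).
    by congr (_ * _); rewrite avg_sum; apply: eq_bigr => j _; rewrite avg_sum.
  rewrite -avgZ; apply: eq_avg => e.
  rewrite /opn /avg card_ord invfM.
  under eq_bigr => j _ do rewrite -mulr_sumr -mulr_sumr.
  rewrite -mulr_sumr -mulr_suml; ring.
have -> : B%:R * mu / (2 * #|S|%:R ^+ 2) = B%:R / 2 * (mu * (#|S|%:R^-1 * #|S|%:R^-1)) by field; lra.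
rewrite ler_wpM2l ?divr_ge0 ?ler0n // /mu -avgZr; apply: le_avg => v.
rewrite -avgZr; apply: le_avg => e; apply: ler_wpM2l; first by case/andP: (chi01 v e).
by apply: ler_pM; rewrite ?invr_ge0 ?ler0n ?opn_sgm.
Qed.

(* Second moment method, applied to the number of middle steps of the path that
   violate the plurality assignment [sgm] and see both endpoints agree with it. *)
Theorem power_sound :
  (B%:R * mu / (2 * #|S|%:R ^+ 2)) ^+ 2 <= prej * (B%:R * (11%:R * mu) + B%:R ^+ 2 * mu ^+ 2).
Proof.
have S0 : 0 < #|S|%:R :> R by rewrite ltr0n; apply/card_gt0P; exists s0.
have fm := first_moment.
have lhs0 : 0 <= B%:R * mu / (2 * #|S|%:R ^+ 2).
  apply: divr_ge0; apply: mulr_ge0; rewrite ?ler0n ?sqr_ge0 //; exact: mu_ge0.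
apply: le_trans (_ : avg (fun v => avg (Nf v)) ^+ 2 <= _).
  by rewrite ler_sqr ?nnegrE // (le_trans lhs0).
pose rj (p : V * K) : R := (~~ pcst p.1 p.2 (A p.1) (A (pend p.1 p.2)))%:R.
have -> : avg (fun v => avg (Nf v)) = avg (fun p : V * K => Nf p.1 p.2 * rj p).
  by rewrite avg_pair; apply: eq_avg => v; apply: eq_avg => k; rewrite /rj /= -Nf_rej.
apply: le_trans (avg_CS _ _) _; rewrite mulrC.
have -> : avg (fun p => rj p ^+ 2) = prej.
  rewrite avg_pair; apply: eq_avg => v; apply: eq_avg => k.
  by rewrite /rj; case: (~~ _); rewrite ?expr0n ?expr1n.
rewrite ler_wpM2l //; first by apply: avg_ge0 => v; apply: avg_ge0 => k; rewrite ler0n.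
apply: le_trans (second_moment B).
rewrite avg_pair; apply: le_avg => v.
apply: le_trans (_ : avg (fun k : K => msum v (take B k.2) ^+ 2) <= _).
  by apply: le_avg => k /=; have /andP[h1 h2] := Nf_le v k; rewrite ler_sqr ?nnegrE // (le_trans h1).
rewrite avg_pair /= avg_cst ?card_ord; last by lia.
rewrite -(wavgE (B + B) (fun t => msum v (take B t) ^+ 2)) wavg_cat le_eqVlt; apply/orP; left; apply/eqP.
by apply: eq_wavg => s zs; rewrite -[RHS](wavg_cst B _ E0); apply: eq_wavg => u _; rewrite take_size_cat.
Qed.

End Power.

(** * Fourier analysis and the long assignment test *)

Definition cube (T : finType) : finType := {ffun T -> bool}.
Definition xadd (T : finType) (x y : cube T) : cube T := [ffun i => x i (+) y i].
Definition xand (T : finType) (x y : cube T) : cube T := [ffun i => x i && y i].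
Definition xone (T : finType) (i : T) : cube T := [ffun j => j == i].
Definition lin (T : finType) (W : {set T}) (x : cube T) : bool := \big[addb/false]_(i in W) x i.

Section CubeAlgebra.
Variable T : finType.
Implicit Types (x y z : cube T) (W : {set T}).

Lemma xaddK y : involutive (fun x => xadd x y).
Proof. by move=> x; apply/ffunP => i; rewrite !ffunE -addbA addbb addbF. Qed.

Lemma xaddKl x : involutive (xadd x).
Proof. by move=> y; apply/ffunP => i; rewrite !ffunE addbA addbb. Qed.

Lemma linD W x y : lin W (xadd x y) = lin W x (+) lin W y.
Proof. by rewrite /lin -big_split; apply: eq_bigr => i _; rewrite ffunE. Qed.

Lemma lin1 i x : lin [set i] x = x i.
Proof. by rewrite /lin big_set1. Qed.

Lemma lin_xone W i : lin W (xone i) = (i \in W).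
Proof.
rewrite /lin; case: (boolP (i \in W)) => h.
  rewrite (bigD1 i) //= ffunE eqxx big1 // => j /andP[_ /negbTE ne].
  by rewrite ffunE.
by rewrite big1 // => j hj; rewrite ffunE; case: eqP => // e; rewrite -e hj in h.
Qed.

End CubeAlgebra.

Section Fourier.
Variables (R : realFieldType) (T : finType).
Implicit Types (x y z : cube T) (W : {set T}) (f : cube T -> R).

Definition sgn (b : bool) : R := (-1) ^+ b.

Lemma sgnD a b : sgn (a (+) b) = sgn a * sgn b.
Proof. by rewrite /sgn signr_addb. Qed.

Lemma sgn_sqr b : sgn b * sgn b = 1.
Proof. by case: b; rewrite /sgn ?expr1 ?expr0 ?mulrNN mulr1. Qed.

Definition chr W x : R := sgn (lin W x).

Lemma chrD W x y : chr W (xadd x y) = chr W x * chr W y.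
Proof. by rewrite /chr linD sgnD. Qed.

Lemma cube_gt0 : (0 < #|cube T|)%N.
Proof. by apply/card_gt0P; exists [ffun=> false]. Qed.

Lemma avg_shift z f : avg (fun x => f (xadd x z)) = avg f.
Proof. exact: avg_inj (inv_inj (xaddK z)). Qed.

Lemma sum_chr x : \sum_W chr W x = (x == [ffun=> false])%:R * (2 ^ #|T|)%:R.
Proof.
case: eqP => [->|/eqP ne].
  rewrite mul1r (eq_bigr (fun _ => 1)) => [|W _]; last first.
    by rewrite /chr /lin big1 // => i _; rewrite ffunE.
  rewrite sumr_const; congr _%:R; transitivity #|[set: {set T}]|; first by rewrite cardsT.
  by rewrite -powersetT card_powerset cardsT.
rewrite mul0r.
have [i xi] : exists i, x i.
  apply/existsP; apply: contraR ne; rewrite negb_exists => /forallP h.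
  by apply/eqP/ffunP => i; rewrite ffunE; apply/negbTE/h.
pose tog W := if i \in W then W :\ i else i |: W.
have togK : involutive tog.
  move=> W; rewrite /tog; case: (boolP (i \in W)) => h.
    by rewrite setD11 setD1K.
  by rewrite setU11 setU1K.
have e W : chr (tog W) x = - chr W x.
  rewrite /chr /tog; case: (boolP (i \in W)) => h.
    rewrite -{2}(setD1K h) /lin big_setU1 ?setD11 //= xi sgnD /sgn expr1; ring.
  by rewrite /lin big_setU1 //= xi sgnD /sgn expr1; ring.
have : \sum_W chr W x = - \sum_W chr W x.
  by rewrite {1}(reindex_inj (inv_inj togK)) /= -sumrN; apply: eq_bigr => W _; rewrite e.
by lra.
Qed.

Definition fhat f W : R := avg (fun x => f x * chr W x).

Lemma fourier_inv f x : f x = \sum_W fhat f W * chr W x.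
Proof.
have -> : \sum_W fhat f W * chr W x = avg (fun y => f y * \sum_W chr W (xadd y x)).
  under [RHS]eq_avg do rewrite mulr_sumr.
  rewrite avg_sum; apply: eq_bigr => W _; rewrite -avgZr; apply: eq_avg => y.
  by rewrite chrD mulrA.
under eq_avg do rewrite sum_chr.
rewrite /avg (bigD1 x) //= big1 ?addr0; last first.
  move=> y ne; case: eqP => [e|]; last by rewrite mul0r mulr0.
  suff : y = x by move/eqP; rewrite (negbTE ne).
  apply/ffunP => i; move/ffunP/(_ i): e; rewrite !ffunE; by case: (y i); case: (x i).
have -> : (xadd x x == [ffun=> false]) by apply/eqP/ffunP => i; rewrite !ffunE addbb.
rewrite mul1r card_ffun card_bool mulfK // pnatr_eq0 -lt0n expn_gt0 //.
Qed.

Lemma autocorr f h : avg (fun x => f x * f (xadd x h)) = \sum_W fhat f W ^+ 2 * chr W h.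
Proof.
transitivity (avg (fun x => \sum_W fhat f W * chr W h * (f x * chr W x))).
  apply: eq_avg => x; rewrite [X in _ * X]fourier_inv mulr_sumr; apply: eq_bigr => W _.
  by rewrite chrD; ring.
by rewrite avg_sum; apply: eq_bigr => W _; rewrite avgZ -/(fhat f W); ring.
Qed.

Lemma parseval f : \sum_W fhat f W ^+ 2 = avg (fun x => f x ^+ 2).
Proof.
have := autocorr f [ffun=> false].
have c0 W : chr W [ffun=> false] = 1 by rewrite /chr /lin big1 // => i _; rewrite ffunE.
under eq_bigr do rewrite c0 mulr1.
move=> <-; apply: eq_avg => x; rewrite expr2; congr (_ * f _).
by apply/ffunP => i; rewrite !ffunE addbF.
Qed.

Lemma sgnE b : sgn b = 1 - 2 * b%:R.
Proof. by case: b; rewrite /sgn ?expr1 ?expr0 /=; ring. Qed.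

(* The linearity test: the cubes of the Fourier coefficients sum to the
   acceptance bias, while their squares sum to one. *)
Lemma blr (g : cube T -> bool) (e : R) :
  avg (fun y => avg (fun z => (g y (+) g z != g (xadd y z))%:R)) <= e ->
  exists W, avg (fun y => (g y != lin W y)%:R) <= e.
Proof.
move=> he; pose G x := sgn (g x).
have nb a b c : (a (+) b != c)%:R = (1 - sgn a * sgn b * sgn c) / 2 :> R.
  by case: a; case: b; case: c; rewrite /sgn ?expr1 ?expr0 /=; field.
have nb2 a b : (a != b)%:R = (1 - sgn a * sgn b) / 2 :> R.
  by case: a; case: b; rewrite /sgn ?expr1 ?expr0 /=; field.
have e3 : avg (fun y => avg (fun z => G y * G z * G (xadd y z))) = \sum_W fhat G W ^+ 3.
  transitivity (avg (fun y => \sum_W (G y * chr W y) * (fhat G W * fhat G W))).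
    apply: eq_avg => y; transitivity (avg (fun z => \sum_W (G y * chr W y) * fhat G W * (G z * chr W z))).
      apply: eq_avg => z; rewrite [X in _ * X]fourier_inv mulr_sumr; apply: eq_bigr => W _.
      by rewrite chrD; ring.
    by rewrite avg_sum; apply: eq_bigr => W _; rewrite avgZ -/(fhat G W); ring.
  by rewrite avg_sum; apply: eq_bigr => W _; rewrite avgZr -/(fhat G W); ring.
have h3 : 1 - 2 * e <= \sum_W fhat G W ^+ 3.
  rewrite -e3; have := he.
  have -> : avg (fun y => avg (fun z => (g y (+) g z != g (xadd y z))%:R)) =
     (1 - avg (fun y => avg (fun z => G y * G z * G (xadd y z)))) / 2.
    rewrite -[X in (X - _) / 2](@avg_cst _ (cube T) _ cube_gt0) -avgB -avgZr; apply: eq_avg => y.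
    rewrite -[X in (X - _) / 2](@avg_cst _ (cube T) _ cube_gt0) -avgB -avgZr; apply: eq_avg => z.
    exact: nb.
  by lra.
have p1 : \sum_W fhat G W ^+ 2 = 1.
  by rewrite parseval -[RHS](@avg_cst _ (cube T) _ cube_gt0); apply: eq_avg => x; rewrite expr2 sgn_sqr.
have [W hW] : exists W, 1 - 2 * e <= fhat G W.
  apply/existsP; rewrite -[X in is_true X]negbK negb_exists; apply/negP => /forallP h.
  have hlt W : fhat G W < 1 - 2 * e by rewrite ltNge; apply: h.
  have le W : fhat G W ^+ 3 <= fhat G W ^+ 2 * (1 - 2 * e).
    rewrite exprS mulrC ler_wpM2l ?sqr_ge0 //; exact: ltW (hlt W).
  have : exists2 W, W \in [set: {set T}] & fhat G W ^+ 2 != 0.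
    apply/exists_inP; rewrite -[X in is_true X]negbK negb_exists_in; apply/negP => /forall_inP hz.
    have : \sum_W fhat G W ^+ 2 = 0 by rewrite big1 // => W _; apply/eqP; rewrite -[_ == _]negbK; apply: hz; rewrite inE.
    by rewrite p1 => /eqP; rewrite oner_eq0.
  case=> W0 _ nz.
  have : \sum_W fhat G W ^+ 3 < \sum_W fhat G W ^+ 2 * (1 - 2 * e).
    rewrite (bigD1 W0) //= [X in _ < X](bigD1 W0) //=; apply: ltr_leD; last by apply: ler_sum => W _; apply: le.
    rewrite exprS mulrC ltr_pM2l; first exact: hlt.
    by rewrite lt_def nz sqr_ge0.
  by rewrite -mulr_suml p1 mul1r; move: h3; lra.
exists W; under eq_avg do rewrite nb2.
rewrite avgZr avgB avg_cst ?cube_gt0 //.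
by move: hW; rewrite /fhat /G /chr; lra.
Qed.

End Fourier.

(** * The long code gadget for one constraint *)

Section Gadget.
Variables (R : realFieldType) (A Dl : finType) (sat : A -> A -> Dl -> bool).

(** The edge table is a long code over triples (near value, far value, constraint). With the
    constraint as a component the queries are the same for all constraints, and only the last test
    looks at [dl]. *)
Definition U : finType := (A * A * Dl)%type.
Definition Rand : finType := (cube A * cube Dl * (cube U * cube U * cube U))%type.
Definition Query : Type := (cube A + cube A + cube U)%type.

Definition lift1 (x : cube A) : cube U := [ffun u : U => x u.1.1].
Definition lift2 (x : cube A) : cube U := [ffun u : U => x u.1.2].
Definition lift3 (d : cube Dl) : cube U := [ffun u : U => d u.2].
Definition csat : cube U := [ffun u : U => sat u.1.1 u.1.2 u.2].

(** The six tests: linearity; multiplicativity, self-corrected by [t]; satisfaction of the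
    constraint; agreement with the near table, with the far table, and with the given constraint.
    Spare slots query random points, so that every test makes four queries. *)
Definition tq (tau : 'I_6) (r : Rand) (s : 'I_4) : Query :=
  let: (x, d, (y, z, t)) := r in
  match nat_of_ord tau, nat_of_ord s with
  | 0, 0 => inr y | 0, 1 => inr z | 0, 2 => inr (xadd y z) | 0, _ => inr t
  | 1, 0 => inr y | 1, 1 => inr z | 1, 2 => inr t | 1, _ => inr (xadd t (xand y z))
  | 2, 0 => inr t | 2, 1 => inr (xadd t csat) | 2, 2 => inr y | 2, _ => inr z
  | 3, 0 => inr t | 3, 1 => inr (xadd t (lift1 x)) | 3, 2 => inr y | 3, _ => inl (inl x)
  | 4, 0 => inr t | 4, 1 => inr (xadd t (lift2 x)) | 4, 2 => inr y | 4, _ => inl (inr x)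
  | _, 0 => inr t | _, 1 => inr (xadd t (lift3 d)) | _, 2 => inr y | _, _ => inr z
  end.

Definition o4 (i : nat) : 'I_4 := inord i.

Definition tpred (tau : 'I_6) (r : Rand) (dl : Dl) (b : 'I_4 -> bool) : bool :=
  let: (x, d, (y, z, t)) := r in
  match nat_of_ord tau with
  | 0 => b (o4 0) (+) b (o4 1) == b (o4 2)
  | 1 => (b (o4 0) && b (o4 1)) == b (o4 2) (+) b (o4 3)
  | 2 => b (o4 0) (+) b (o4 1)
  | 3 | 4 => b (o4 3) == b (o4 0) (+) b (o4 1)
  | _ => b (o4 0) (+) b (o4 1) == d dl
  end.

(* The part of the randomness that, with the query, determines all of it. *)
Definition restU (tau : 'I_6) (s : 'I_4) (r : Rand) : cube A * cube Dl * (cube U * cube U) :=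
  let: (x, d, (y, z, t)) := r in
  (x, d, match nat_of_ord tau, nat_of_ord s with
         | 0, 0 | 1, 0 | 2, 2 | 3, 2 | 4, 2 | 5, 2 => (z, t)
         | 0, 1 | 0, 2 | 1, 1 | 2, 3 | 5, 3 => (y, t)
         | _, _ => (y, z)
         end).
Definition restA (r : Rand) : cube Dl * (cube U * cube U * cube U) := (r.1.2, r.2).

Lemma tq_injU tau s r r' q : tq tau r s = inr q -> tq tau r' s = inr q ->
  restU tau s r = restU tau s r' -> r = r'.
Proof.
case: r => -[x d] [[y z] t]; case: r' => -[x' d'] [[y' z'] t'].
rewrite /tq /restU.
have K (a b c : cube U) : xadd a c = xadd b c -> a = b by apply: (inv_inj (xaddK c)).
have K' (a b c : cube U) : xadd c a = xadd c b -> a = b by apply: (inv_inj (xaddKl c)).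
case: tau => -[|[|[|[|[|[|//]]]]]] ? /=; case: s => -[|[|[|[|//]]]] ? //= [<-] [e] [] *; subst;
  rewrite ?(K _ _ _ e) ?(K' _ _ _ e) //.
Qed.

Lemma tq_injA tau s r r' q : tq tau r s = inl q -> tq tau r' s = inl q ->
  restA r = restA r' -> r = r'.
Proof.
case: r => -[x d] [[y z] t]; case: r' => -[x' d'] [[y' z'] t'].
rewrite /tq /restA.
by case: tau => -[|[|[|[|[|[|//]]]]]] ? /=; case: s => -[|[|[|[|//]]]] ? //= [<-] // [e] [] *; subst.
Qed.

Definition answers (f1 f2 : cube A -> bool) (g : cube U -> bool) (q : Query) : bool :=
  match q with inl (inl x) => f1 x | inl (inr x) => f2 x | inr y => g y end.

Lemma gadget_complete tau r a b dl : sat a b dl ->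
  tpred tau r dl (fun s => answers (fun x => x a) (fun x => x b) (fun y => y (a, b, dl)) (tq tau r s)).
Proof.
case: r => -[x d] [[y z] t] h; rewrite /tpred /tq.
case: tau => -[|[|[|[|[|[|//]]]]]] ? /=; rewrite !inordK //= !ffunE //= ?h.
all: by rewrite ?addbA ?addbb ?addFb ?eqxx.
Qed.

Definition grej (f1 f2 : cube A -> bool) (g : cube U -> bool) (dl : Dl) (tau : 'I_6) : R :=
  avg (fun r => (~~ tpred tau r dl (fun s => answers f1 f2 g (tq tau r s)))%:R).

Lemma avg_rand (F : cube A -> cube Dl -> cube U -> cube U -> cube U -> R) :
  avg (fun r : Rand => F r.1.1 r.1.2 r.2.1.1 r.2.1.2 r.2.2) =
  avg (fun x => avg (fun d => avg (fun y => avg (fun z => avg (fun t => F x d y z t))))).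
Proof.
rewrite avg_pair avg_pair; apply: eq_avg => x; apply: eq_avg => d.
by rewrite avg_pair avg_pair.
Qed.

Lemma dict_half (T : finType) (a b : T) : a != b ->
  avg (fun x : cube T => (x a != x b)%:R) = 2^-1 :> R.
Proof.
move=> ne.
have : avg (fun x : cube T => (x a != x b)%:R + (xadd x (xone a) a != xadd x (xone a) b)%:R) = 1 :> R.
  rewrite -[RHS](@avg_cst _ (cube T) _ (cube_gt0 T)); apply: eq_avg => x.
  rewrite !ffunE eqxx [b == a]eq_sym (negbTE ne).
  by case: (x a); case: (x b); rewrite /= ?addr0 ?add0r.
by rewrite avgD (avg_shift (xone a) (fun x : cube T => (x a != x b)%:R)); lra.
Qed.

(** For distinct i, j in [W], shift (y, z) in the four ways by the unit vectors of i and j. The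
    number of failures is odd: the product of the two unit parities is 1, while the pointwise
    product of the unit vectors is 0. Hence the failure rate is at least 1/4. *)
Lemma mult_test (T : finType) (W : {set T}) :
  avg (fun y : cube T => avg (fun z => ((lin W y && lin W z) != lin W (xand y z))%:R)) < 4%:R^-1 :> R ->
  (#|W| <= 1)%N.
Proof.
move=> h; rewrite leqNgt; apply/negP => /card_gt1P [i [j [iW jW ij]]].
pose D (y z : cube T) : R := ((lin W y && lin W z) != lin W (xand y z))%:R.
have h4 : 1 <= avg (fun y => avg (fun z => D y z + D (xadd y (xone i)) z +
      D y (xadd z (xone j)) + D (xadd y (xone i)) (xadd z (xone j)))).
  rewrite -[X in X <= _](@avg_cst _ (cube T) _ (cube_gt0 T)); apply: le_avg => y.
  rewrite -[X in X <= _](@avg_cst _ (cube T) _ (cube_gt0 T)); apply: le_avg => z.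
  rewrite /D.
  have e1 : xand (xadd y (xone i)) z = xadd (xand y z) (xand (xone i) z).
    by apply/ffunP => k; rewrite !ffunE; case: (y k); case: (z k); case: (k == i).
  have e2 : xand y (xadd z (xone j)) = xadd (xand y z) (xand y (xone j)).
    by apply/ffunP => k; rewrite !ffunE; case: (y k); case: (z k); case: (k == j).
  have e3 : xand (xadd y (xone i)) (xadd z (xone j)) =
     xadd (xadd (xand y z) (xand (xone i) z)) (xand y (xone j)).
    apply/ffunP => k; rewrite !ffunE; case: (altP (k =P i)) => [->|_].
      by rewrite (negbTE ij); case: (y i); case: (z i).
    by case: (y k); case: (z k); case: (k == j).
  rewrite e1 e2 e3 !linD !lin_xone iW jW.
  set p := lin W y; set q := lin W z; set r := lin W (xand y z).
  set u := lin W (xand (xone i) z); set w := lin W (xand y (xone j)).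
  rewrite -!natrD -[1]/(1%:R) ler_nat.
  by case: p; case: q; case: r; case: u; case: w.
move: h4; suff -> : avg (fun y => avg (fun z => D y z + D (xadd y (xone i)) z +
      D y (xadd z (xone j)) + D (xadd y (xone i)) (xadd z (xone j)))) = 4%:R * avg (fun y => avg (D y)).
  by have hD : avg (fun y => avg (D y)) < 4%:R^-1 := h; lra.
under eq_avg do rewrite !avgD.
rewrite !avgD (avg_shift (xone i) (fun y => avg (fun z => D y z))).
have -> : avg (fun y => avg (fun z => D y (xadd z (xone j)))) = avg (fun y => avg (D y)).
  by apply: eq_avg => y; rewrite (avg_shift (xone j) (D y)).
have -> : avg (fun y => avg (fun z => D (xadd y (xone i)) (xadd z (xone j)))) = avg (fun y => avg (D y)).
  rewrite (avg_shift (xone i) (fun y => avg (fun z => D y (xadd z (xone j))))).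
  by apply: eq_avg => y; rewrite (avg_shift (xone j) (D y)).
by ring.
Qed.

(** Linearity puts the edge table within 1/24 of a parity over some [W]. That parity passes the
    multiplicativity test up to 5/24 < 1/4, so [W] has at most one element, and the third test
    forbids it to be empty. Its element is the triple sought. *)
Lemma gadget_sound f1 f2 g dl :
  (forall tau, grej f1 f2 g dl tau <= 24%:R^-1) ->
  exists a b, [/\ sat a b dl, avg (fun x => (f1 x != x a)%:R) <= 8%:R^-1 :> R
    & avg (fun x => (f2 x != x b)%:R) <= 8%:R^-1 :> R].
Proof.
move=> H.
have cA := cube_gt0 A; have cD := cube_gt0 Dl; have cU := cube_gt0 U.
pose F (tau : 'I_6) x d y z t : R :=
  (~~ tpred tau (x, d, (y, z, t)) dl (fun s => answers f1 f2 g (tq tau (x, d, (y, z, t)) s)))%:R.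
have HF tau : avg (fun x => avg (fun d => avg (fun y => avg (fun z => avg (fun t => F tau x d y z t)))))
    <= 24%:R^-1.
  apply: le_trans (H tau); rewrite -avg_rand /grej le_eqVlt; apply/orP; left; apply/eqP.
  by apply: eq_avg => -[[x d] [[y z] t]].
pose o i : 'I_6 := inord i.
have T0 : avg (fun y => avg (fun z => (g y (+) g z != g (xadd y z))%:R)) <= 24%:R^-1 :> R.
  apply: le_trans (HF (o 0%N)); rewrite le_eqVlt; apply/orP; left; apply/eqP.
  rewrite -[LHS](avg_cst _ cA); apply: eq_avg => x; rewrite -[LHS](avg_cst _ cD); apply: eq_avg => d.
  apply: eq_avg => y; apply: eq_avg => z; rewrite -[LHS](avg_cst _ cU); apply: eq_avg => t.
  by rewrite /F /tpred /tq /= !inordK.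
have [W hW] := blr T0.
pose bad y : R := (g y != lin W y)%:R.
have bad0 y : 0 <= bad y by rewrite ler0n.
have T1 : avg (fun y : cube U => avg (fun z => ((lin W y && lin W z) != lin W (xand y z))%:R)) <= 5%:R / 24%:R :> R.
  have h1 := HF (o 1%N).
  have : avg (fun y : cube U => avg (fun z => ((lin W y && lin W z) != lin W (xand y z))%:R)) <=
     avg (fun x => avg (fun d => avg (fun y => avg (fun z => avg (fun t => F (o 1%N) x d y z t))))) +
     avg (fun y => avg (fun z => avg (fun t => bad y + bad z + bad t + bad (xadd t (xand y z))))).
    have -> : avg (fun x => avg (fun d => avg (fun y => avg (fun z => avg (fun t => F (o 1%N) x d y z t))))) =
       avg (fun y => avg (fun z => avg (fun t => ((g y && g z) != g t (+) g (xadd t (xand y z)))%:R))).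
      rewrite -[RHS](avg_cst _ cA); apply: eq_avg => x; rewrite -[RHS](avg_cst _ cD); apply: eq_avg => d.
      apply: eq_avg => y; apply: eq_avg => z; apply: eq_avg => t.
      by rewrite /F /tpred /tq /= !inordK.
    rewrite -avgD; apply: le_avg => y; rewrite -avgD; apply: le_avg => z; rewrite -avgD.
    rewrite -[X in X <= _](avg_cst _ cU); apply: le_avg => t.
    have -> : lin W (xand y z) = lin W t (+) lin W (xadd t (xand y z)) by rewrite linD addbA addbb.
    rewrite /bad -!natrD ler_nat.
    by case: (g y); case: (g z); case: (g t); case: (g _); case: (lin W y); case: (lin W z); case: (lin W t); case: (lin W _).
  have -> : avg (fun y => avg (fun z => avg (fun t => bad y + bad z + bad t + bad (xadd t (xand y z))))) = 4%:R * avg bad.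
    transitivity (avg (fun y => avg (fun z => bad y + bad z + avg bad + avg bad))).
      apply: eq_avg => y; apply: eq_avg => z; rewrite !avgD (avg_cst _ cU) (avg_cst _ cU).
      by rewrite (avg_shift (xand y z) bad).
    transitivity (avg (fun y => bad y + avg bad + avg bad + avg bad)).
      by apply: eq_avg => y; rewrite !avgD !(avg_cst _ cU).
    by rewrite !avgD !(avg_cst _ cU); ring.
  by move: h1 hW; rewrite -/bad; lra.
have W1 : (#|W| <= 1)%N by apply: mult_test; apply: le_lt_trans T1 _; lra.
(* Self-correction: the parity at a point [c] is read from two random points of the table, at a cost
   of twice 1/24. This gives the final 1/24 + 1/12 = 1/8. *)
have lin2 (c : cube U) (p : bool -> bool) (Y : R) : (p = id \/ p = negb) ->
  avg (fun t => (p (g t (+) g (xadd t c)))%:R) <= Y -> (p (lin W c))%:R <= Y + 12%:R^-1.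
  move=> hp hY; have : (p (lin W c))%:R <= avg (fun t => (p (g t (+) g (xadd t c)))%:R + bad t + bad (xadd t c)).
    rewrite -[X in X <= _](avg_cst _ cU); apply: le_avg => t.
    have -> : lin W c = lin W t (+) lin W (xadd t c) by rewrite linD addbA addbb.
    rewrite /bad -!natrD ler_nat.
    by case: hp => ->; case: (g t); case: (g _); case: (lin W t); case: (lin W _).
  rewrite !avgD (avg_shift c bad); move: hW; rewrite -/bad; lra.
have T2 : lin W csat.
  have : (~~ lin W csat)%:R <= 24%:R^-1 + 12%:R^-1 :> R.
    apply: (lin2 _ negb); first by right.
    apply: le_trans (HF (o 2%N)); rewrite le_eqVlt; apply/orP; left; apply/eqP.
    rewrite -[LHS](avg_cst _ cA); apply: eq_avg => x; rewrite -[LHS](avg_cst _ cD); apply: eq_avg => d.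
    rewrite -[LHS](avg_cst _ cU); apply: eq_avg => y; rewrite -[LHS](avg_cst _ cU); apply: eq_avg => z.
    by apply: eq_avg => t; rewrite /F /tpred /tq /= !inordK.
  by case: (lin W csat) => //=; lra.
have [u eW] : exists u, W = [set u].
  apply/cards1P; rewrite eqn_leq W1 card_gt0; apply/eqP => e; move: T2.
  by rewrite e /lin big_set0.
move: u eW => [[a b] dl'] eW; rewrite eW lin1 ffunE /= in T2.
have linW c : lin W c = c (a, b, dl') by rewrite eW lin1.
have T5 : dl' = dl.
  apply/eqP; rewrite -[_ == _]negbK; apply/negP => ne.
  have : avg (fun d : cube Dl => (d dl' != d dl)%:R) <= 24%:R^-1 + 12%:R^-1 :> R.
    have h5 := HF (o 5%N).
    apply: le_trans (_ : _ <= avg (fun d => avg (fun t => (g t (+) g (xadd t (lift3 d)) != d dl)%:R) + 12%:R^-1)) _.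
      apply: le_avg => d.
      have := @lin2 (lift3 d) (fun b => b != d dl) _ _ (lexx _).
      rewrite linW ffunE /=; apply.
      by case: (d dl); [right|left]; apply: funext => -[].
    rewrite avgD (avg_cst _ cD) lerD2r.
    apply: le_trans h5; rewrite le_eqVlt; apply/orP; left; apply/eqP.
    rewrite -[LHS](avg_cst _ cA); apply: eq_avg => x; apply: eq_avg => d.
    rewrite -[LHS](avg_cst _ cU); apply: eq_avg => y; rewrite -[LHS](avg_cst _ cU); apply: eq_avg => z.
    by apply: eq_avg => t; rewrite /F /tpred /tq /= !inordK.
  by rewrite dict_half //; lra.
subst dl'; exists a, b; split=> //.
- have h3 := HF (o 3%N).
  apply: le_trans (_ : _ <= avg (fun x => avg (fun t => (f1 x != g t (+) g (xadd t (lift1 x)))%:R) + 12%:R^-1)) _.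
    apply: le_avg => x.
    have := @lin2 (lift1 x) (fun b => f1 x != b) _ _ (lexx _).
    rewrite linW ffunE /=; apply.
    by case: (f1 x); [right|left]; apply: funext => -[].
  rewrite avgD (avg_cst _ cA).
  suff : avg (fun x => avg (fun t => (f1 x != g t (+) g (xadd t (lift1 x)))%:R)) <= 24%:R^-1 :> R by lra.
  apply: le_trans h3; rewrite le_eqVlt; apply/orP; left; apply/eqP.
  apply: eq_avg => x; rewrite -[LHS](avg_cst _ cD); apply: eq_avg => d.
  rewrite -[LHS](avg_cst _ cU); apply: eq_avg => y; rewrite -[LHS](avg_cst _ cU); apply: eq_avg => z.
  by apply: eq_avg => t; rewrite /F /tpred /tq /= !inordK.
- have h3 := HF (o 4%N).
  apply: le_trans (_ : _ <= avg (fun x => avg (fun t => (f2 x != g t (+) g (xadd t (lift2 x)))%:R) + 12%:R^-1)) _.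
    apply: le_avg => x.
    have := @lin2 (lift2 x) (fun b => f2 x != b) _ _ (lexx _).
    rewrite linW ffunE /=; apply.
    by case: (f2 x); [right|left]; apply: funext => -[].
  rewrite avgD (avg_cst _ cA).
  suff : avg (fun x => avg (fun t => (f2 x != g t (+) g (xadd t (lift2 x)))%:R)) <= 24%:R^-1 :> R by lra.
  apply: le_trans h3; rewrite le_eqVlt; apply/orP; left; apply/eqP.
  apply: eq_avg => x; rewrite -[LHS](avg_cst _ cD); apply: eq_avg => d.
  rewrite -[LHS](avg_cst _ cU); apply: eq_avg => y; rewrite -[LHS](avg_cst _ cU); apply: eq_avg => z.
  by apply: eq_avg => t; rewrite /F /tpred /tq /= !inordK.
Qed.

(** Two distinct coordinate functions differ on half of the cube, so at most one lies within 1/8 of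
    [f]. *)
Definition decode (f : cube A -> bool) (a0 : A) : A :=
  odflt a0 [pick a | avg (fun x => (f x != x a)%:R) <= 8%:R^-1 :> R].

Lemma decodeE f a0 a : avg (fun x : cube A => (f x != x a)%:R) <= 8%:R^-1 :> R -> decode f a0 = a.
Proof.
move=> ha; rewrite /decode; case: pickP => [b hb|/(_ a)]; last by rewrite ha.
apply/eqP; rewrite -[_ == _]negbK; apply/negP => ne.
have : avg (fun x : cube A => (x b != x a)%:R) <= avg (fun x => (f x != x b)%:R + (f x != x a)%:R) :> R.
  apply: le_avg => x; rewrite -natrD ler_nat; by case: (f x); case: (x a); case: (x b).
by rewrite avgD dict_half //; lra.
Qed.

(** One of the six tests rejects with probability above 1/24, and 144 = 6 * 24. *)
Lemma gadget_reject f1 f2 g dl a0 : ~~ sat (decode f1 a0) (decode f2 a0) dl ->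
  144%:R^-1 <= avg (grej f1 f2 g dl).
Proof.
move=> ns.
have [tau ht] : exists tau, 24%:R^-1 < grej f1 f2 g dl tau.
  apply/existsP; rewrite -[X in is_true X]negbK negb_exists; apply/negP => /forallP h.
  have [|a [b [h1 h2 h3]]] := @gadget_sound f1 f2 g dl.
    by move=> tau; rewrite leNgt; apply: h.
  by move: ns; rewrite (decodeE a0 h2) (decodeE a0 h3) h1.
rewrite /avg card_ord (bigD1 tau) //=.
have : 0 <= \sum_(i < 6 | i != tau) grej f1 f2 g dl i.
  by apply: sumr_ge0 => i _; apply: avg_ge0 => r; rewrite ler0n.
rewrite ler_pdivlMr; lra.
Qed.

End Gadget.

(** * Alphabet reduction *)

Section Cloud.
Variables (R : realFieldType) (M K : finType) (h : K -> M -> M) (inv : K -> K).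
Hypotheses (sg : isg h inv) (ctr : contr h (1 / 4%:R : R)) (M0 : (0 < #|M|)%N) (K0 : (0 < #|K|)%N).

Definition maj (b : M -> bool) : bool := 2^-1 < avg (fun m => (b m)%:R) :> R.

(** Edge expansion from the spectral bound: for a minority of density s <= 1/2 the contraction
    limits the edges inside it, so that at least s - s^2 >= s/2 of the edges are cut. *)
Lemma cloud (b : M -> bool) :
  avg (fun m => (b m != maj b)%:R) <= 4%:R * avg (fun m => avg (fun k => (b m != b (h k m))%:R)) :> R.
Proof.
pose f m : R := (b m != maj b)%:R; set s := avg f.
have f2 m : f m ^+ 2 = f m by rewrite /f; case: (_ != _); rewrite ?expr0n ?expr1n.
have s2 : s <= 2^-1.
  rewrite /s /f; case E: (maj b).
    move/idP: E; rewrite /maj.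
    have -> : avg (fun m => (b m)%:R) = 1 - avg (fun m => (b m != true)%:R) :> R.
      rewrite -[X in X - _](avg_cst _ M0) -avgB; apply: eq_avg => m; case: (b m); rewrite /=; ring.
    by lra.
  move/negbT: E; rewrite /maj -leNgt; apply: le_trans; rewrite le_eqVlt; apply/orP; left; apply/eqP.
  by apply: eq_avg => m; case: (b m).
have s0 : 0 <= s by apply: avg_ge0 => m; rewrite ler0n.
have eP : avg (fun m => avg (fun k => f (h k m))) = s by apply: avg_act sg K0.
have -> : avg (fun m => avg (fun k => (b m != b (h k m))%:R)) =
    2 * s - 2 * avg (fun m => f m * avg (fun k => f (h k m))).
  have -> : 2 * s = avg f + avg (fun m => avg (fun k => f (h k m))) by rewrite eP -/s; ring.
  rewrite -avgZ -avgD -avgB; apply: eq_avg => m.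
  transitivity (avg (fun k => f m + f (h k m) - 2 * (f m * f (h k m)))); last first.
    by rewrite avgB avgD avg_cst // !avgZ.
  apply: eq_avg => k; rewrite /f; case: (b m); case: (b (h k m)); case: (maj b); rewrite /=; ring.
have V2 : avg (fun m => (f m - s) ^+ 2) = s - s ^+ 2.
  by rewrite avg_var //; congr (_ - _); apply: eq_avg => m; rewrite f2.
have cv : avg (fun m => (avg (fun k => f (h k m)) - s) ^+ 2) <= 1 / 4%:R * (s - s ^+ 2).
  have := contr_var f ctr K0 M0; rewrite -/s => /le_trans; apply.
  by rewrite le_eqVlt; apply/orP; left; apply/eqP; congr (_ * (_ - _)); apply: eq_avg => m; rewrite f2.
have key : avg (fun m => f m * avg (fun k => f (h k m))) <= s ^+ 2 + (s - s ^+ 2) / 2.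
  have -> : avg (fun m => f m * avg (fun k => f (h k m))) =
      s ^+ 2 + avg (fun m => (f m - s) * (avg (fun k => f (h k m)) - s)).
    have -> : avg (fun m => (f m - s) * (avg (fun k => f (h k m)) - s)) =
        avg (fun m => f m * avg (fun k => f (h k m))) - s * s.
      transitivity (avg (fun m => f m * avg (fun k => f (h k m)) - f m * s - s * avg (fun k => f (h k m)) + s * s)).
        by apply: eq_avg => m; ring.
      by rewrite avgD !avgB avgZr avgZ (avg_cst _ M0) eP -/s; ring.
    by ring.
  rewrite lerD2l; apply: le_trans (avg_absM _ _ (_ : 0 < 2^-1)) _; first by lra.
  by rewrite V2; set X := avg _ in cv *; lra.
rewrite -/s; nra.
Qed.

End Cloud.

Lemma sum_inj_le (R : realFieldType) (I J : finType) (ph : I -> J) (F : J -> R) :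
  injective ph -> (forall j, 0 <= F j) -> \sum_i F (ph i) <= \sum_j F j.
Proof.
move=> phi F0; rewrite [X in X <= _](_ : _ = \sum_(j in ph @: setT) F j); last first.
  by rewrite big_imset /=; [apply: eq_bigl => i; rewrite inE|exact: in2W].
rewrite [X in _ <= X](bigID (mem (ph @: setT))) /= lerDl.
by apply: sumr_ge0 => j _; apply: F0.
Qed.

Section AlphabetReduction.
Variables (R : realFieldType) (V K A : finType) (act : K -> V -> V) (inv : K -> K).
Hypotheses (sg : isg act inv).
Notation Dl := {ffun A * A -> bool}.
Let sat (a b : A) (d : Dl) : bool := d (a, b).
Variables (cst : V -> K -> Dl) (a0 : A).

Variables (K1 Mv Me Dummy : finType) (inv1 : K1 -> K1).
Notation Rnd := (Rand A {ffun A * A -> bool}).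
Notation RU := (cube A * cube {ffun A * A -> bool} * (cube (U A {ffun A * A -> bool}) * cube (U A {ffun A * A -> bool})))%type.
Notation RA := (cube {ffun A * A -> bool} * (cube (U A {ffun A * A -> bool}) * cube (U A {ffun A * A -> bool}) * cube (U A {ffun A * A -> bool})))%type.
Variables (iv : K * bool * RA -> Mv) (ie : 'I_6 * 'I_4 * RU -> Me).
Hypotheses (iv_inj : injective iv) (ie_inj : injective ie).
Variables (hv : K1 -> Mv -> Mv) (he : K1 -> Me -> Me).
Hypotheses (sgv : isg hv inv1) (sge : isg he inv1).
Hypotheses (cv : contr hv (1 / 4%:R : R)) (ce : contr he (1 / 4%:R : R)) (k10 : (0 < #|K1|)%N).

(** Each old vertex becomes a set of checks, one for each generator, test and random string, and of
    copies of table points, with room for one copy per use. [Dummy] pads their number to that of an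
    available expander. *)
Definition ar_chk : finType := (K * 'I_6 * Rnd)%type.
Definition ar_copy : finType := ((cube A * Mv) + (K * cube (U A Dl) * Me))%type.
Definition ar_J : finType := (ar_chk + ar_copy + Dummy)%type.
Definition ar_D : finType := ('I_4 + K1)%type.
Definition ar_S : finType := {ffun 'I_4 -> bool}.
Definition ar_inv (g : ar_D) : ar_D := if g is inr h then inr (inv1 h) else g.

(* The boolean tells whether the queried table belongs to the far endpoint. *)
Definition slot (s : 'I_4) (c : ar_chk) : bool * ar_copy :=
  let: (k, tau, r) := c in
  match tq sat tau r s with
  | inl (inl x) => (false, inl (x, iv (k, false, restA r)))
  | inl (inr x) => (true, inl (x, iv (k, true, restA r)))
  | inr y => (false, inr (k, y, ie (tau, s, restU tau s r)))
  end.

Lemma tq_src tau r s x : tq sat tau r s = inl (inl x) -> nat_of_ord tau = 3%N.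
Proof.
case: r => -[x' d'] [[y' z'] t']; rewrite /tq.
by case: tau => -[|[|[|[|[|[|//]]]]]] ? /=; case: s => -[|[|[|[|//]]]] ?.
Qed.

Lemma tq_dst tau r s x : tq sat tau r s = inl (inr x) -> nat_of_ord tau = 4%N.
Proof.
case: r => -[x' d'] [[y' z'] t']; rewrite /tq.
by case: tau => -[|[|[|[|[|[|//]]]]]] ? /=; case: s => -[|[|[|[|//]]]] ?.
Qed.

(** The index of a copy records the part of the check that the point read does not determine, so for
    a fixed slot a copy belongs to at most one check. Hence a slot is a matching and acts as an
    involution. For vertex tables the flag in the index determines the test, by [tq_src] and
    [tq_dst]. *)
Lemma slot_inj s : injective (fun c => (slot s c).2).
Proof.
move=> [[k tau] r] [[k' tau'] r']; rewrite /slot.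
case E: (tq sat tau r s) => [[x|x]|y]; case E': (tq sat tau' r' s) => [[x'|x']|y'] //= [].
- move=> ex /iv_inj [ek er1 er2]; have et : tau = tau' by apply: val_inj; rewrite /= (tq_src E) (tq_src E').
  have er : restA r = restA r' by rewrite /restA er1 er2.
  by subst; rewrite (@tq_injA _ _ sat tau' s r r' (inl x')).
- by move=> ex /iv_inj [].
- by move=> ex /iv_inj [].
- move=> ex /iv_inj [ek er1 er2]; have et : tau = tau' by apply: val_inj; rewrite /= (tq_dst E) (tq_dst E').
  have er : restA r = restA r' by rewrite /restA er1 er2.
  by subst; rewrite (@tq_injA _ _ sat tau' s r r' (inr x')).
- move=> ek ey /ie_inj [et er]; subst.
  by rewrite (@tq_injU _ _ sat tau' s r r' y').
Qed.

Definition jword (g : ar_D) (j : ar_J) : seq K :=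
  match g, j with
  | inl s, inl (inl c) => if (slot s c).1 then [:: c.1.1] else [::]
  | inl s, inl (inr jc) =>
      if [pick c | (slot s c).2 == jc] is Some c
      then if (slot s c).1 then [:: inv c.1.1] else [::] else [::]
  | _, _ => [::]
  end.

Definition jtgt (g : ar_D) (j : ar_J) : ar_J :=
  match g, j with
  | inl s, inl (inl c) => inl (inr (slot s c).2)
  | inl s, inl (inr jc) => if [pick c | (slot s c).2 == jc] is Some c then inl (inl c) else j
  | inr h, inl (inr (inl (x, m))) => inl (inr (inl (x, hv h m)))
  | inr h, inl (inr (inr (k, y, m))) => inl (inr (inr (k, y, he h m)))
  | _, _ => j
  end.

Definition jact (g : ar_D) (p : V * ar_J) : V * ar_J := (walk act (jword g p.2) p.1, jtgt g p.2).

Lemma pick_slot s c : [pick c' | (slot s c').2 == (slot s c).2] = Some c.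
Proof.
case: pickP => [c' /eqP /slot_inj -> //|/(_ c)]; by rewrite eqxx.
Qed.

Lemma isg_jact : isg jact ar_inv.
Proof.
split=> [g [v j]|[s|h]]; last 2 first.
- by [].
- by rewrite /= (proj2 sgv).
case: g => [s|h].
- case: j => [[c|jc]|d] //.
  + rewrite /jact /= pick_slot; case: (slot s c) => -[] //= jc'.
    by rewrite sg.1.
  + rewrite /jact /=; case: pickP => [c /eqP e|e] /=.
      by rewrite e; case E: (slot s c).1 => //=; rewrite (isgV sg).
    by case: pickP => [c|] //=; rewrite e.
- case: j => [[c|[[x m]|[[k y] m]]]|d] //; rewrite /jact /=.
  + by rewrite (proj1 sgv).
  + by rewrite (proj1 sge).
Qed.

(** The whole test is imposed on each of the four slot edges of a check, with the agreement of the
    bit read; a copy stores its bit at [ord0]. A slot edge leaving a copy is free, its reversal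
    carrying the constraint. *)
Definition jcst (dl : K -> Dl) (g : ar_D) (j : ar_J) (L L' : ar_S) : bool :=
  match g, j with
  | inl s, inl (inl (k, tau, r)) => tpred tau r (dl k) L && (L s == L' ord0)
  | inr h, inl (inr _) => L ord0 == L' ord0
  | _, _ => true
  end.

(** For fortification, where an answer violating a constraint is replaced by a satisfying one. *)
Lemma jcst_nonempty dl g j : exists L L', jcst dl g j L L'.
Proof.
case: g => [s|h]; case: j => [[[[k tau] r]|jc]|d] /=; try by exists [ffun=> false], [ffun=> false].
have [b hb] : exists b : ar_S, tpred tau r (dl k) b.
  case: r => -[x d] [[y z] t]; rewrite /tpred.
  case: tau => -[|[|[|[|[|[|//]]]]]] ? /=;
    try (by exists [ffun=> false]; rewrite !ffunE);
    try (by exists [ffun i => i == o4 0]; rewrite !ffunE eqxx -!val_eqE /= !inordK).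
  case: (d (dl k)); last by exists [ffun=> false]; rewrite !ffunE.
  by exists [ffun i => i == o4 0]; rewrite !ffunE eqxx -!val_eqE /= !inordK.
exists b, [ffun=> b s]; by rewrite hb ffunE eqxx.
Qed.

Lemma ar_complete (a : V -> A) : (forall v k, cst v k (a v, a (act k v))) ->
  exists a' : V * ar_J -> ar_S, forall p g, jcst (cst p.1) g p.2 (a' p) (a' (jact g p)).
Proof.
move=> ha.
pose gt v k (y : cube (U A Dl)) := y (a v, a (act k v), cst v k).
pose ans v k := answers (fun x : cube A => x (a v)) (fun x => x (a (act k v))) (gt v k).
pose cp v (jc : ar_copy) := match jc with inl (x, m) => x (a v) | inr (k, y, m) => gt v k y end.
exists (fun p => match p.2 with
  | inl (inl (k, tau, r)) => [ffun s => ans p.1 k (tq sat tau r s)]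
  | inl (inr jc) => [ffun=> cp p.1 jc]
  | inr _ => [ffun=> false] end).
move=> [v j] [s|h]; case: j => [[[[k tau] r]|jc]|d] //=; last first.
  by case: jc => [[x m]|[[k y] m]] /=; rewrite !ffunE.
apply/andP; split.
  have := @gadget_complete _ _ sat tau r (a v) (a (act k v)) (cst v k) (ha v k).
  rewrite /tpred; case: r => -[x d] [[y z] t].
  by case: (nat_of_ord tau) => [|[|[|[|[|n]]]]]; rewrite !ffunE.
rewrite /jact /= !ffunE /slot /ans.
by case: (tq sat tau r s) => [[x|x]|y].
Qed.

Section Sound.
Variable a : V * ar_J -> ar_S.
Let bitv v x (m : Mv) : bool := a (v, inl (inr (inl (x, m)))) ord0.
Let bite v k y (m : Me) : bool := a (v, inl (inr (inr (k, y, m)))) ord0.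
Let fv v x := maj R (bitv v x).
Let ge v k y := maj R (bite v k y).
Let copymaj v (jc : ar_copy) := match jc with inl (x, m) => fv v x | inr (k, y, m) => ge v k y end.
Let bit v (jc : ar_copy) := a (v, inl (inr jc)) ord0.
Definition ar_sigma v : A := decode R (fv v) a0.

Let viol (p : V * ar_J) (g : ar_D) : R := (~~ jcst (cst p.1) g p.2 (a p) (a (jact g p)))%:R.
Let minor v jc : R := (bit v jc != copymaj v jc)%:R.
Definition ar_VV : R := \sum_p \sum_g viol p g.
Definition ar_X : R := \sum_v \sum_k (~~ cst v k (ar_sigma v, ar_sigma (act k v)))%:R.

Let base (s : 'I_4) v (c : ar_chk) := if (slot s c).1 then act c.1.1 v else v.

(** When the majority tables fail a test, either a slot edge of the check is violated or some copy
    that it reads is in the minority of its cloud. *)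
Lemma test_bound v k tau r :
  (~~ tpred tau r (cst v k) (fun s => answers (fv v) (fv (act k v)) (ge v k) (tq sat tau r s)))%:R
  <= \sum_s (viol (v, inl (inl (k, tau, r))) (inl s) + minor (base s v (k, tau, r)) (slot s (k, tau, r)).2).
Proof.
set c := (k, tau, r); set L := a (v, inl (inl c)).
have nn s : 0 <= viol (v, inl (inl c)) (inl s) + minor (base s v c) (slot s c).2.
  by rewrite addr_ge0 ?ler0n.
case: (boolP (tpred _ _ _ _)) => [_|ht] /=; first by apply: sumr_ge0.
suff [s hs] : exists s, 1 <= viol (v, inl (inl c)) (inl s) + minor (base s v c) (slot s c).2.
  by rewrite (bigD1 s) //= -[X in X <= _]addr0 lerD // sumr_ge0.
apply/existsP; rewrite -[X in is_true X]negbK negb_exists; apply: contra ht => /forallP h.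
have hs s : (tpred tau r (cst v k) L && (L s == bit (base s v c) (slot s c).2)) &&
     (bit (base s v c) (slot s c).2 == copymaj (base s v c) (slot s c).2).
  have := h s; rewrite -ltNge /viol /minor /jcst /jact /= -/L -/c.
  have -> : walk act (if (slot s c).1 then [:: k] else [::]) v = base s v c.
    by rewrite /base; case: (slot s c).1.
  rewrite -/(bit _ _); case: (tpred _ _ _ _ && _); case: (_ == _) => //=; rewrite ?addr0 ?add0r ?ltxx //.
  by rewrite ltNge lerDl ler01.
have ht : tpred tau r (cst v k) L by have /andP[/andP[]] := hs ord0.
suff e s : L s = answers (fv v) (fv (act k v)) (ge v k) (tq sat tau r s).
  move: ht; rewrite /tpred; case: r @c @L h hs e nn => -[x d] [[y z] t] c L h hs e nn.
  by case: (nat_of_ord tau) => [|[|[|[|[|n]]]]]; rewrite !e.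
have /andP[/andP[_ /eqP ->] /eqP ->] := hs s.
rewrite /base /slot /c; by case: (tq sat tau r s) => [[x|x]|y].
Qed.

Lemma minor_slot s :
  \sum_v \sum_c minor (base s v c) (slot s c).2 <= \sum_v \sum_jc minor v jc.
Proof.
rewrite pair_bigA pair_bigA /=.
pose ph (p : V * ar_chk) := (base s p.1 p.2, (slot s p.2).2).
have phi : injective ph.
  move=> [v c] [v' c'] [] /= e1 e2; have ec : c = c' by apply: slot_inj e2.
  subst c'; move: e1; rewrite /base; case: (slot s c).1 => [/(isg_inj sg)|] -> //.
by apply: (sum_inj_le (F := fun q : V * ar_copy => minor q.1 q.2) phi) => q; rewrite ler0n.
Qed.

Lemma cloud_sum (M : finType) (h : K1 -> M -> M) (b : M -> bool) : isg h inv1 -> contr h (1 / 4%:R : R) ->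
  \sum_m (b m != maj R b)%:R <= 4%:R * \sum_m \sum_k (b m != b (h k m))%:R :> R.
Proof.
move=> sgh ch; case: (posnP #|M|) => M0.
  have e (F : M -> R) : \sum_m F m = 0 by apply: big1 => m; move: (fintype0 m M0).
  by rewrite !e mulr0.
have := cloud sgh ch M0 k10 b; rewrite /avg -mulr_suml mulrA ler_pM2r; last first.
  by rewrite invr_gt0 ltr0n.
move/le_trans; apply; rewrite ler_wpM2l // ler_pdivrMr ?ltr0n // ler_peMr //.
  by apply: sumr_ge0 => m _; apply: sumr_ge0 => k _; rewrite ler0n.
by rewrite -[1]/(1%:R) ler_nat.
Qed.

Lemma minor_bound v :
  \sum_jc minor v jc <= 4%:R * \sum_jc \sum_h viol (v, inl (inr jc)) (inr h).
Proof.
rewrite !big_sumType mulrDr lerD //=.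
- have -> : \sum_i minor v (inl i) = \sum_x \sum_m (bitv v x m != maj R (bitv v x))%:R.
    by rewrite pair_bigA; apply: eq_bigr => -[x m].
  have -> : \sum_i \sum_h viol (v, inl (inr (inl i))) (inr h) =
      \sum_x \sum_m \sum_h (bitv v x m != bitv v x (hv h m))%:R.
    by rewrite sum_pair.
  by rewrite mulr_sumr; apply: ler_sum => x _; apply: cloud_sum.
- have -> : \sum_i minor v (inr i) = \sum_ky \sum_m (bite v ky.1 ky.2 m != maj R (bite v ky.1 ky.2))%:R.
    by rewrite pair_bigA; apply: eq_bigr => -[[k y] m].
  have -> : \sum_i \sum_h viol (v, inl (inr (inr i))) (inr h) =
      \sum_ky \sum_m \sum_h (bite v ky.1 ky.2 m != bite v ky.1 ky.2 (he h m))%:R.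
    by rewrite sum_pair; apply: eq_bigr => -[k y].
  by rewrite mulr_sumr; apply: ler_sum => x _; apply: cloud_sum.
Qed.

(** A constraint violated by the decoded assignment makes at least 6 |Rnd| / 144 = |Rnd| / 24 of its
    checks fail on the majority tables. Failures are charged to violated edges or to minority
    copies; four slots and the factor 4 of the clouds give 16, and 384 = 24 * 16. *)
Theorem ar_sound : #|{: Rnd}|%:R * ar_X <= 384%:R * ar_VV.
Proof.
pose P := \sum_v \sum_c \sum_s viol (v, inl (inl c)) (inl s).
pose Q := \sum_v \sum_jc \sum_h viol (v, inl (inr jc)) (inr h).
have v0 p g : 0 <= viol p g by rewrite ler0n.
have Q0 : 0 <= Q by do 3 (apply: sumr_ge0 => ? _).
have P0 : 0 <= P by do 3 (apply: sumr_ge0 => ? _).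
have hVV : P + Q <= ar_VV.
  rewrite /ar_VV; have -> : \sum_p \sum_g viol p g = \sum_v \sum_j \sum_g viol (v, j) g.
    by rewrite sum_pair.
  rewrite -big_split; apply: ler_sum => v _ /=.
  rewrite !big_sumType /= -[X in X <= _]addr0 lerD ?lerD //; last by do 2 (apply: sumr_ge0 => ? _).
  + by apply: ler_sum => c _; rewrite big_sumType /= lerDl; apply: sumr_ge0.
  + by apply: ler_sum => c _; rewrite big_sumType /= lerDr; apply: sumr_ge0.
  + by apply: ler_sum => jc _; rewrite big_sumType /= lerDr; apply: sumr_ge0.
pose tst v (c : ar_chk) : R := (~~ tpred c.1.2 c.2 (cst v c.1.1)
   (fun s => answers (fv v) (fv (act c.1.1 v)) (ge v c.1.1) (tq sat c.1.2 c.2 s)))%:R.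
have h1 : \sum_v \sum_c tst v c <= P + 16%:R * Q.
  apply: le_trans (_ : _ <= \sum_v \sum_c \sum_s (viol (v, inl (inl c)) (inl s) + minor (base s v c) (slot s c).2)) _.
    by apply: ler_sum => v _; apply: ler_sum => -[[k tau] r] _; apply: test_bound.
  have -> : \sum_v \sum_c \sum_s (viol (v, inl (inl c)) (inl s) + minor (base s v c) (slot s c).2) =
     P + \sum_s \sum_v \sum_c minor (base s v c) (slot s c).2.
    rewrite [X in _ + X]exchange_big -big_split; apply: eq_bigr => v _ /=.
    rewrite [X in _ + X]exchange_big -big_split; apply: eq_bigr => c _ /=.
    by rewrite big_split.
  rewrite lerD2l; apply: le_trans (_ : _ <= \sum_(s < 4) (4%:R * Q)) _.
    apply: ler_sum => s _; apply: le_trans (minor_slot s) _.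
    by rewrite mulr_sumr; apply: ler_sum => v _; apply: minor_bound.
  by rewrite sumr_const card_ord -[_ *+ _]mulr_natl; lra.
have h2 : #|{: Rnd}|%:R * ar_X <= 24%:R * \sum_v \sum_c tst v c.
  rewrite /ar_X !mulr_sumr; apply: ler_sum => v _.
  have -> : \sum_c tst v c = \sum_k \sum_tau \sum_r tst v (k, tau, r).
    by rewrite sum_pair sum_pair.
  rewrite !mulr_sumr; apply: ler_sum => k _.
  have e : \sum_tau \sum_r tst v (k, tau, r) =
     6%:R * #|{: Rnd}|%:R * avg (grej R sat (fv v) (fv (act k v)) (ge v k) (cst v k)).
    transitivity (#|{: Rnd}|%:R * \sum_tau grej R sat (fv v) (fv (act k v)) (ge v k) (cst v k) tau).
      2: by rewrite /avg card_ord; field.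
    rewrite mulr_sumr; apply: eq_bigr => tau _; rewrite /grej /avg mulrC divfK //.
    rewrite pnatr_eq0 -lt0n; apply/card_gt0P.
    by exists ([ffun=> false], [ffun=> false], ([ffun=> false], [ffun=> false], [ffun=> false])).
  rewrite e; case: (boolP (cst v k _)) => hc /=.
    rewrite mulr0; apply: mulr_ge0 => //; apply: mulr_ge0; first by apply: mulr_ge0; rewrite ?ler0n.
    by apply: avg_ge0 => tau; apply: avg_ge0 => r; rewrite ler0n.
  have := @gadget_reject R _ _ sat (fv v) (fv (act k v)) (ge v k) (cst v k) a0 hc.
  set X := avg _ => hX; rewrite mulr1.
  have : 0 <= #|{: Rnd}|%:R :> R by rewrite ler0n.
  by set N := #|_|%:R; nra.
have H (p q t vv : R) : 0 <= p -> 0 <= q -> t <= p + 16%:R * q -> p + q <= vv -> 24%:R * t <= 384%:R * vv.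
  by move=> *; lra.
exact: le_trans h2 (H _ _ _ _ P0 Q0 h1 hVV).
Qed.

End Sound.
End AlphabetReduction.

(** * Fortified parallel repetition *)

Section Game.
Variable R : realFieldType.
Implicit Types (V Th L S : finType).

(* Agreement form of a projection game: a referee at [y] sends [w y th] to a
   player and projects the answer [l] to [p y th l]; two independent players
   must agree. *)
Definition Qval V Th L S (w : V -> Th -> V) (p : V -> Th -> L -> S) (phi : V -> L -> R) : R :=
  avg (fun y => \sum_b avg (fun th => \sum_l (p y th l == b)%:R * phi (w y th) l) ^+ 2).

(** Missing mass stands for questions left unanswered, which is how a game is restricted to a set of
    questions. *)
Definition subd V L (phi : V -> L -> R) : Prop :=
  (forall v l, 0 <= phi v l) /\ (forall v, \sum_l phi v l <= 1).

(** The average on the right is what the strategy would score if all its answers agreed. Up to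
    [del], restricting the questions cannot raise the relative value above [rho]. *)
Definition fortified V Th L S (w : V -> Th -> V) (p : V -> Th -> L -> S) (rho del : R) : Prop :=
  forall phi, subd phi ->
    Qval w p phi <= rho * avg (fun y => avg (fun th => \sum_l phi (w y th) l) ^+ 2) + del.

Definition val_le V Th L S (w : V -> Th -> V) (p : V -> Th -> L -> S) (b : R) : Prop :=
  forall phi, subd phi -> Qval w p phi <= b.

Definition wprod V1 T1 V2 T2 (w1 : V1 -> T1 -> V1) (w2 : V2 -> T2 -> V2)
    (y : V1 * V2) (th : T1 * T2) : V1 * V2 := (w1 y.1 th.1, w2 y.2 th.2).
Definition pprod V1 T1 L1 S1 V2 T2 L2 S2 (p1 : V1 -> T1 -> L1 -> S1) (p2 : V2 -> T2 -> L2 -> S2)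
    (y : V1 * V2) (th : T1 * T2) (l : L1 * L2) : S1 * S2 := (p1 y.1 th.1 l.1, p2 y.2 th.2 l.2).

(** For a fixed referee choice y2 and projected answer b2 of the second game, the product strategy
    is a sub-strategy of the first game, to which fortification applies; summing [del] over b2 gives
    the factor |S2|. The mass term that remains is, for each y1, a value of the second game. *)
Lemma game_product V1 (T1 : finType) L1 S1 V2 (T2 : finType) L2 S2 (w1 : V1 -> T1 -> V1) (w2 : V2 -> T2 -> V2)
    (p1 : V1 -> T1 -> L1 -> S1) (p2 : V2 -> T2 -> L2 -> S2) (rho del b : R) :
  (0 < #|V1|)%N -> (0 < #|V2|)%N -> 0 <= rho -> 0 <= del -> fortified w1 p1 rho del -> val_le w2 p2 b ->
  val_le (wprod w1 w2) (pprod p1 p2) (rho * b + #|S2|%:R * del).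
Proof.
move=> v10 v20 rho0 del0 hf hv psi [psi0 psi1].
pose phi y2 b2 v1 l1 := avg (fun t2 => \sum_l2 (p2 y2 t2 l2 == b2)%:R * psi (v1, w2 y2 t2) (l1, l2)).
have sphi y2 b2 : subd (phi y2 b2).
  split=> [v l|v].
    by apply: avg_ge0 => t; apply: sumr_ge0 => l2 _; rewrite mulr_ge0 ?ler0n.
  rewrite /phi -avg_sum; apply: le_avg1 => // t; apply: le_trans (psi1 (v, w2 y2 t)).
  rewrite sum_pair; apply: ler_sum => l1 _; apply: ler_sum => l2 _.
  by case: (_ == _); rewrite ?mul1r ?mul0r.
have eQ : Qval (wprod w1 w2) (pprod p1 p2) psi = avg (fun y2 => \sum_b2 Qval w1 p1 (phi y2 b2)).
  rewrite /Qval avg_pair avgC; apply: eq_avg => y2.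
  rewrite -avg_sum; apply: eq_avg => y1; rewrite sum_pair exchange_big; apply: eq_bigr => b2 _.
  apply: eq_bigr => b1 _; congr (_ ^+ 2); rewrite avg_pair; apply: eq_avg => t1.
  transitivity (avg (fun t2 => \sum_l1 (p1 y1 t1 l1 == b1)%:R *
      \sum_l2 (p2 y2 t2 l2 == b2)%:R * psi (w1 y1 t1, w2 y2 t2) (l1, l2))).
    apply: eq_avg => t2; rewrite sum_pair; apply: eq_bigr => l1 _; rewrite mulr_sumr; apply: eq_bigr => l2 _.
    by rewrite /pprod /= xpair_eqE mulrA; case: (_ == _); case: (_ == _); rewrite /= ?mulr1 ?mulr0 ?mul0r.
  by rewrite avg_sum; apply: eq_bigr => l1 _; rewrite avgZ.
rewrite eQ.
apply: le_trans (_ : _ <= avg (fun y2 => \sum_b2 (rho * avg (fun y1 => avg (fun t1 => \sum_l1 phi y2 b2 (w1 y1 t1) l1) ^+ 2) + del))) _.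
  by apply: le_avg => y2; apply: ler_sum => b2 _; apply: hf.
under eq_avg do rewrite big_split /= sumr_const -mulr_sumr.
rewrite avgD avgZ (avg_cst _ v20) -[del *+ _]mulr_natl lerD2r ler_wpM2l //.
pose psi' y1 v2 l2 := avg (fun t1 => \sum_l1 psi (w1 y1 t1, v2) (l1, l2)).
have spsi y1 : subd (psi' y1).
  split=> [v l|v].
    by apply: avg_ge0 => t; apply: sumr_ge0 => l1 _.
  rewrite /psi' -avg_sum; apply: le_avg1 => // t; apply: le_trans (psi1 (w1 y1 t, v)).
  by rewrite sum_pair exchange_big.
have -> : avg (fun y2 => \sum_b2 avg (fun y1 => avg (fun t1 => \sum_l1 phi y2 b2 (w1 y1 t1) l1) ^+ 2)) =
   avg (fun y1 => Qval w2 p2 (psi' y1)).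
  rewrite /Qval avgC; apply: eq_avg => y2; rewrite -avg_sum; apply: eq_avg => y1; apply: eq_bigr => b2 _.
  congr (_ ^+ 2); rewrite /phi /psi'.
  transitivity (avg (fun t1 => avg (fun t2 => \sum_l1 \sum_l2 (p2 y2 t2 l2 == b2)%:R * psi (w1 y1 t1, w2 y2 t2) (l1, l2)))).
    by apply: eq_avg => t1; rewrite avg_sum.
  rewrite avgC; apply: eq_avg => t2.
  transitivity (\sum_l2 avg (fun t1 => (p2 y2 t2 l2 == b2)%:R * \sum_l1 psi (w1 y1 t1, w2 y2 t2) (l1, l2))).
    by rewrite -avg_sum; apply: eq_avg => t1; rewrite exchange_big; apply: eq_bigr => l2 _; rewrite mulr_sumr.
  by apply: eq_bigr => l2 _; rewrite avgZ.
rewrite -(avg_cst b v10); apply: le_avg => y1; exact: hv.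
Qed.

End Game.

(** * Fortification of a constraint graph by random walks *)

Section Fortify.
Variables (R : realFieldType) (V K D S : finType).
Variables (act : K -> V -> V) (inv : K -> K) (actD : D -> V -> V) (invD : D -> D).
Hypotheses (sg : isg act inv) (sgD : isg actD invD).
Hypotheses (V0 : (0 < #|V|)%N) (K0 : (0 < #|K|)%N) (D0 : (0 < #|D|)%N).
Hypothesis ctr : contr act (1 / 4%:R : R).
Variable c : V -> D -> S -> S -> bool.
Hypothesis cne : forall v i, exists a b, c v i a b.
Variables (mu : R) (T : nat).
Hypothesis mu0 : 0 <= mu.
Hypothesis gap : forall sg : V -> S, mu <= avg (fun v => avg (fun i => (~~ c v i (sg v) (sg (actD i v)))%:R)).

(** A question is the end of a hidden walk. The answer gives, for every way of walking back and
    every generator, values for the two ends of the edge found there. *)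
Definition fg_L : finType := {ffun T.-tuple K * D -> S * S}.
Definition fg_Th : finType := (D * bool * T.-tuple K)%type.

Definition fixc (v : V) (i : D) (q : S * S) : S * S :=
  if c v i q.1 q.2 then q else odflt q [pick q' | c v i q'.1 q'.2].

Lemma fixcP v i q : c v i (fixc v i q).1 (fixc v i q).2.
Proof.
rewrite /fixc; case: ifP => // _; case: pickP => //= h.
by have [a [b hab]] := cne v i; have := h (a, b); rewrite hab.
Qed.

Definition tinv (u : T.-tuple K) : T.-tuple K := [tuple of rev (map inv u)].

(** The source of the edge selected at [y]: the vertex itself, or its predecessor when [y] is the
    target. *)
Definition fg_v (y : V) (th : fg_Th) : V := if th.1.2 then actD (invD th.1.1) y else y.
Definition fg_w (y : V) (th : fg_Th) : V := walk act th.2 (fg_v y th).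
Definition fg_p (y : V) (th : fg_Th) (l : fg_L) : S :=
  let q := fixc (fg_v y th) th.1.1 (l (tinv th.2, th.1.1)) in if th.1.2 then q.2 else q.1.

Lemma fg_w_inj th : injective (fun y => fg_w y th).
Proof.
move=> y y'; rewrite /fg_w => e.
have e2 : fg_v y th = fg_v y' th by rewrite -(walk_winv sg th.2 (fg_v y th)) e walk_winv.
move: e2; rewrite /fg_v; case: th.1.2 => // e2; exact: (isg_inj sgD e2).
Qed.

Lemma fg_complete (a : V -> S) : (forall v i, c v i (a v) (a (actD i v))) ->
  exists l : V -> fg_L, forall y th, fg_p y th (l (fg_w y th)) = a y.
Proof.
move=> ha; exists (fun v => [ffun q : T.-tuple K * D => (a (walk act q.1 v), a (actD q.2 (walk act q.1 v)))]).
move=> y [[i sd] u]; rewrite /fg_p ffunE /=.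
have -> : walk act (rev [seq inv i | i <- u]) (fg_w y (i, sd, u)) = fg_v y (i, sd, u).
  exact: (walk_winv sg).
rewrite /fixc /= ha /fg_v /=; case: sd => //=.
by rewrite (isgV sgD).
Qed.

Lemma abs_avg (T' : finType) (f : T' -> R) (k : R) : 0 < k ->
  avg (fun x => f x ^+ 2) <= k ^+ 2 -> avg (fun x => `|f x|) <= k.
Proof.
move=> k0 h; case: (posnP #|T'|) => t0; first by rewrite /avg t0 invr0 mulr0 ltW.
apply: le_trans (_ : _ <= avg (fun x => (k + f x ^+ 2 / k) / 2)) _.
  apply: le_avg => x; rewrite ler_pdivlMr // -subr_ge0.
  have -> : k + f x ^+ 2 / k - `|f x| * 2 = (k - `|f x|) ^+ 2 / k.
    by rewrite -(real_normK (num_real (f x))); field; lra.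
  by rewrite divr_ge0 ?sqr_ge0 // ltW.
rewrite avgZr avgD (avg_cst _ t0) avgZr ler_pdivrMr //.
have : avg (fun x => f x ^+ 2) / k <= k by rewrite ler_pdivrMr // -expr2.
by lra.
Qed.

(** The walk brings the mass seen from [y] close to its mean [sb] on average. Let [sg0] be the
    heaviest projected value at each vertex. Corrected answers satisfy their constraint, so on an
    edge violated by [sg0] an answer agrees with it at one end at most, which costs half of [mu].
    The error 2^-T enters twice, through the weight of [sg0] and through the mass [M]. *)
Theorem game_fortified : fortified fg_w fg_p (1 - mu / 2) (2 * 2^-1 ^+ T).
Proof.
move=> phi [phi0 phi1].
pose s v := \sum_l phi v l; pose sb := avg s.
have s01 v : 0 <= s v <= 1 by rewrite phi1 andbT; apply: sumr_ge0.
have sb01 : 0 <= sb <= 1.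
  by rewrite avg_ge0 => [|v]; [apply: le_avg1 => // v|]; case/andP: (s01 v).
pose m v := avg (fun u : T.-tuple K => s (walk act u v)).
have em v : m v = pw act T s v by rewrite /pw wavgE.
have am : avg m = sb by rewrite (eq_avg em) (avg_pw sg K0).
set k := 2^-1 ^+ T : R; have k0 : 0 < k by apply: exprn_gt0; lra.
have vm : avg (fun v => (m v - sb) ^+ 2) <= k ^+ 2.
  under eq_avg do rewrite em.
  have q0 : 0 <= 1 / 4%:R :> R by lra.
  apply: le_trans (contr_pw sg K0 V0 T s q0 ctr) _.
  have -> : k ^+ 2 = (1 / 4%:R) ^+ T by rewrite /k exprAC; congr (_ ^+ _); field.
  rewrite -[X in _ <= X]mulr1 ler_wpM2l ?exprn_ge0 //; apply: le_avg1 => // v.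
  by case/andP: (s01 v) => h1 h2; rewrite exprn_ile1.
have dm := abs_avg k0 vm.
pose M y := avg (fun th => s (fg_w y th)).
have eM y : M y = avg (fun ib : D * bool => m (if ib.2 then actD (invD ib.1) y else y)).
  by rewrite /M (avg_pair (fun th : (D * bool) * T.-tuple K => s (fg_w y th))).
have aM : avg M = sb.
  rewrite /M avgC -[RHS](@avg_cst _ fg_Th); last first.
    by rewrite !card_prod card_bool card_tuple !muln_gt0 D0 expn_gt0 K0.
  apply: eq_avg => th; rewrite /sb -(avg_inj s (fg_w_inj (th := th))) //.
have dM : avg (fun y => `|M y - sb|) <= k.
  apply: le_trans dm; rewrite -[X in _ <= X](@avg_cst _ (D * bool)%type); last first.
    by rewrite card_prod card_bool muln_gt0 D0.
  apply: le_trans (_ : _ <= avg (fun y => avg (fun ib : D * bool => `|m (if ib.2 then actD (invD ib.1) y else y) - sb|))) _.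
    apply: le_avg => y; rewrite eM.
    have c0 : (0 < #|{: D * bool}|)%N by rewrite card_prod card_bool muln_gt0 D0.
    rewrite -[X in _ - X](avg_cst sb c0) -avgB /avg normrM (ger0_norm (_ : 0 <= _^-1)) ?invr_ge0 ?ler0n //.
    by rewrite ler_wpM2r ?invr_ge0 ?ler0n // ler_norm_sum.
  rewrite avgC le_eqVlt; apply/orP; left; apply/eqP; apply: eq_avg => -[i []] /=; last by [].
  exact: (avg_act1 sgD (invD i) (fun v => `|m v - sb|)).
pose r y b := avg (fun th => \sum_l (fg_p y th l == b)%:R * phi (fg_w y th) l).
have r0 y b : 0 <= r y b by apply: avg_ge0 => th; apply: sumr_ge0 => l _; rewrite mulr_ge0 ?ler0n.
have rM y : \sum_b r y b = M y.
  rewrite /r -avg_sum; apply: eq_avg => th; rewrite exchange_big; apply: eq_bigr => l _.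
  rewrite -mulr_suml (bigD1 (fg_p y th l)) //= eqxx big1 ?addr0 ?mul1r // => b /negbTE.
  by rewrite eq_sym => ->.
have [y0 _] : exists y0 : V, y0 \in V by apply/card_gt0P.
have [i0 _] : exists i0 : D, i0 \in D by apply/card_gt0P.
have [b0 _] := cne y0 i0.
pose sg0 y : S := [arg max_(b > b0) r y b]%O.
have rsg y b : r y b <= r y (sg0 y) by rewrite /sg0; case: arg_maxP => //= b' _; apply.
have r1 y : r y (sg0 y) <= 1.
  apply: le_trans (_ : _ <= M y) _.
    by rewrite -rM (bigD1 (sg0 y)) //= lerDl sumr_ge0.
  by apply: le_avg1 => // th; case/andP: (s01 (fg_w y th)).
have hQ : Qval fg_w fg_p phi <= avg (fun y => r y (sg0 y) * M y).
  apply: le_avg => y; rewrite -rM mulr_sumr; apply: ler_sum => b _.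
  by rewrite -/(r y b) expr2 ler_wpM2r.
have key : avg (fun y => r y (sg0 y)) <= sb * (1 - mu / 2) + k.
  pose q v i (sd : bool) b := avg (fun u : T.-tuple K => \sum_(l : fg_L)
     ((if sd then (fixc v i (l (tinv u, i))).2 else (fixc v i (l (tinv u, i))).1) == b)%:R * phi (walk act u v) l).
  have er y : r y (sg0 y) = avg (fun i => (q y i false (sg0 y) + q (actD (invD i) y) i true (sg0 y)) / 2).
    rewrite /r avg_pair avg_pair; apply: eq_avg => i.
    rewrite {1}/avg card_bool big_bool /= addrC; congr ((_ + _) / _).
  under eq_avg do rewrite er.
  rewrite avgC.
  (* Both ends of an edge are charged to its source. *)
  have -> : avg (fun i => avg (fun y => (q y i false (sg0 y) + q (actD (invD i) y) i true (sg0 y)) / 2)) =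
     avg (fun v => avg (fun i => (q v i false (sg0 v) + q v i true (sg0 (actD i v))) / 2)).
    rewrite [RHS]avgC; apply: eq_avg => i; rewrite !avgZr !avgD; congr ((_ + _) / _).
    rewrite -(avg_act1 sgD i (fun y => q (actD (invD i) y) i true (sg0 y))); apply: eq_avg => v.
    by rewrite sgD.1.
  apply: le_trans (_ : _ <= avg (fun v => avg (fun i => m v * (1 - (~~ c v i (sg0 v) (sg0 (actD i v)))%:R / 2)))) _.
    apply: le_avg => v; apply: le_avg => i; rewrite ler_pdivrMr //.
    set nc := (~~ _)%:R.
    have -> : m v * (1 - nc / 2) * 2 = m v * (2 - nc) by field.
    rewrite /q -avgD /m -avgZr; apply: le_avg => u; rewrite -big_split /s mulr_suml; apply: ler_sum => l _ /=.
    have := fixcP v i (l (tinv u, i)); move: (fixc _ _ _) => [a1 a2] /= hc.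
    rewrite -mulrDl mulrC ler_wpM2l // /nc.
    case: (altP (a1 =P _)) => e1; case: (altP (a2 =P _)) => e2 /=; case: (boolP (c v i _ _)) => hn /=; try lra.
    by move: hn; rewrite -e1 -e2 hc.
  have e v : avg (fun i => m v * (1 - (~~ c v i (sg0 v) (sg0 (actD i v)))%:R / 2)) =
     sb * (1 - avg (fun i => (~~ c v i (sg0 v) (sg0 (actD i v)))%:R) / 2) +
     (m v - sb) * (1 - avg (fun i => (~~ c v i (sg0 v) (sg0 (actD i v)))%:R) / 2).
    by rewrite avgZ avgB avgZr (avg_cst _ D0); ring.
  under eq_avg do rewrite e.
  rewrite avgD; apply: lerD.
    rewrite avgZ avgB avgZr (avg_cst _ V0); have := gap sg0; case/andP: sb01 => h1 h2 hg.
    rewrite ler_wpM2l //; lra.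
  apply: le_trans dm; apply: le_avg => v.
  set z := avg _; have : 0 <= z <= 1.
    rewrite /z avg_ge0 => [|i]; last by rewrite ler0n.
    by apply: le_avg1 => // i; rewrite lern1; case: (~~ _).
  move=> hz; apply: le_trans (ler_norm _) _; rewrite normrM -[X in _ <= X]mulr1 ler_wpM2l //.
  by rewrite ger0_norm; lra.
have hQ2 : avg (fun y => r y (sg0 y) * M y) <= sb * avg (fun y => r y (sg0 y)) + k.
  rewrite -avgZ; apply: le_trans (_ : _ <= avg (fun y => sb * r y (sg0 y)) + avg (fun y => `|M y - sb|)) _.
    rewrite -avgD; apply: le_avg => y.
    have -> : r y (sg0 y) * M y = sb * r y (sg0 y) + r y (sg0 y) * (M y - sb) by ring.
    rewrite lerD2l; apply: le_trans (ler_norm _) _; rewrite normrM -[X in _ <= X]mul1r ler_wpM2r //.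
    by rewrite ger0_norm.
  by rewrite lerD2l.
have hM : sb ^+ 2 <= avg (fun y => M y ^+ 2) by rewrite -aM avg_sqr.
have mu1 : mu <= 1.
  apply: le_trans (gap sg0) _; apply: le_avg1 => // v; apply: le_avg1 => // i.
  by rewrite lern1; case: (~~ _).
apply: le_trans hQ _; apply: le_trans hQ2 _.
have h1 : sb * avg (fun y => r y (sg0 y)) <= sb ^+ 2 * (1 - mu / 2) + k.
  case/andP: sb01 => h1 h2; have := ler_wpM2l h1 key.
  have : sb * k <= k by rewrite -[X in _ <= X]mul1r ler_wpM2r // ltW.
  by rewrite expr2; lra.
have : (1 - mu / 2) * sb ^+ 2 <= (1 - mu / 2) * avg (fun y => M y ^+ 2).
  by rewrite ler_wpM2l //; lra.
by rewrite -/M; lra.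
Qed.

End Fortify.

(** * The four-query long code test *)

Section CubeMore.
Variables (R : realFieldType) (T : finType).

Lemma chr_orth (W W' : {set T}) : avg (fun x => chr R W x * chr R W' x) = (W == W')%:R.
Proof.
case: eqP => [->|/eqP ne].
  by rewrite -[RHS](@avg_cst _ (cube T)) ?cube_gt0 //; apply: eq_avg => x; rewrite sgn_sqr.
have [i hi] : exists i, (i \in W) != (i \in W').
  apply/existsP; apply: contraR ne; rewrite negb_exists => /forallP h.
  by apply/eqP/setP => i; apply/eqP; rewrite -[_ == _]negbK.
have : avg (fun x => chr R W x * chr R W' x) = - avg (fun x => chr R W x * chr R W' x).
  rewrite -{1}(avg_shift (xone i) (fun x => chr R W x * chr R W' x)) -avgN; apply: eq_avg => x.
  rewrite !chrD /chr !lin_xone; case: (i \in W) (i \in W') hi => -[] //= _; rewrite /sgn ?expr0 ?expr1; ring.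
by rewrite /=; lra.
Qed.

Lemma lin_true (W : {set T}) : lin W [ffun=> true] = odd #|W|.
Proof.
rewrite /lin (eq_bigr (fun _ => true)) => [|i _]; last by rewrite ffunE.
rewrite big_const; elim: #|W| => //= n ->; by case: (odd n).
Qed.

Lemma fhat_odd (f : cube T -> R) (W : {set T}) :
  (forall x, f (xadd x [ffun=> true]) = - f x) -> ~~ odd #|W| -> fhat f W = 0.
Proof.
move=> ho hW; have : fhat f W = - fhat f W.
  rewrite {1}/fhat -(avg_shift [ffun=> true]) -avgN; apply: eq_avg => x.
  by rewrite ho chrD /chr lin_true (negbTE hW) /sgn expr0 mulr1 mulNr.
by lra.
Qed.

End CubeMore.

Section LongCodeTest.
Variables (R : realFieldType) (V Th L S : finType) (w : V -> Th -> V) (p : V -> Th -> L -> S).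
Variable m : nat.
Hypotheses (m1 : (1 < m)%N) (V0 : (0 < #|V|)%N) (Th0 : (0 < #|Th|)%N).
Hypothesis winj : forall th, injective (fun y => w y th).

Definition noise : finType := {ffun L -> 'I_m}.
Definition nu (n : noise) : cube L := [ffun l => nat_of_ord (n l) == 0%N].
Definition pull y th (g : cube S) : cube L := [ffun l => g (p y th l)].
Definition shiftx y th g n : cube L := xadd (pull y th g) (nu n).

Let rho : R := 1 - 2 / m%:R.

Lemma rho01 : 0 <= rho < 1.
Proof.
have h : 2 <= m%:R :> R by rewrite -[2]/(2%:R) ler_nat.
have h2 : 0 < 2 / m%:R :> R by rewrite divr_gt0 //; lra.
have h3 : 2 / m%:R <= 1 :> R by rewrite ler_pdivrMr; lra.
by rewrite /rho; apply/andP; split; lra.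
Qed.

Lemma chr_prod (W : {set L}) x : chr R W x = \prod_l (if l \in W then sgn R (x l) else 1).
Proof.
rewrite /chr /lin -big_mkcond /=.
by apply: (big_morph (sgn R) (sgnD R)); rewrite /sgn expr0.
Qed.

Lemma avg_ffun (F : L -> 'I_m -> R) :
  avg (fun n : noise => \prod_l F l (n l)) = \prod_l avg (F l).
Proof.
rewrite /avg card_ffun card_ord big_split /= bigA_distr_bigA /=.
by rewrite prodr_const natrX exprVn.
Qed.

Lemma avg_ord0 : avg (fun i : 'I_m => (nat_of_ord i == 0%N)%:R) = m%:R^-1 :> R.
Proof.
have h : (0 < m)%N by apply: ltnW.
rewrite /avg card_ord (bigD1 (Ordinal h)) //= big1 ?addr0 ?mul1r // => i.
by rewrite -val_eqE /= => /negbTE ->.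
Qed.

(** Coordinates are flipped independently with probability 1/m, and each one in [W] scales the
    character by 1 - 2/m. *)
Lemma avg_noise (W : {set L}) : avg (fun n => chr R W (nu n)) = rho ^+ #|W|.
Proof.
have m0 : (0 < #|'I_m|)%N by rewrite card_ord ltnW.
transitivity (\prod_l avg (fun i : 'I_m => if l \in W then sgn R (nat_of_ord i == 0%N) else 1)).
  by rewrite -avg_ffun; apply: eq_avg => n; rewrite chr_prod; apply: eq_bigr => l _; rewrite ffunE.
rewrite (eq_bigr (fun l => if l \in W then rho else 1)) => [|l _].
  by rewrite -big_mkcond prodr_const.
case: ifP => _; last by rewrite avg_cst.
under eq_avg do rewrite sgnE.
by rewrite avgB avgZ avg_ord0 avg_cst.
Qed.

(** A character at a point constant on the fibres of the projection only sees the fibres that [W]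
    meets an odd number of times. *)
Definition push y th (W : {set L}) : {set S} := [set b | odd #|[set l in W | p y th l == b]|].

Lemma lin_pull y th W g : lin W (pull y th g) = lin (push y th W) g.
Proof.
rewrite {1}/lin.
transitivity (\big[addb/false]_b \big[addb/false]_(l in W | p y th l == b) g b).
  rewrite (partition_big (p y th) xpredT) //=; apply: eq_bigr => b _.
  by apply: eq_bigr => l /andP[_ /eqP e]; rewrite ffunE e.
rewrite /lin [RHS]big_mkcond; apply: eq_bigr => b _; rewrite inE.
rewrite big_const cardsE; have -> : #|[pred l in W | p y th l == b]| = #|[set l in W | p y th l == b]| by rewrite cardsE.
by elim: #|_| => //= n ->; case: (odd n); case: (g b).
Qed.

Variable f : V -> cube L -> R.
Hypothesis f1 : forall v x, `|f v x| <= 1.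

Definition Fyg y g := avg (fun th => avg (fun n => avg (fun x =>
  f (w y th) x * f (w y th) (xadd x (shiftx y th g n))))).

(** Given y and g the two halves of the test are independent, so the mean product of the four values
    is the mean of a square. *)
Definition Tval := avg (fun y => avg (fun g => Fyg y g ^+ 2)).

Let e2 v (W : {set L}) : R := fhat (f v) W ^+ 2.

(** The Fourier coefficient of [Fyg y] at [be]. *)
Definition cyb y (be : {set S}) : R :=
  avg (fun th => \sum_W (push y th W == be)%:R * (e2 (w y th) W * rho ^+ #|W|)).

Lemma e2_ge0 v W : 0 <= e2 v W. Proof. exact: sqr_ge0. Qed.

Lemma rhoX_ge0 n : 0 <= rho ^+ n. Proof. by apply: exprn_ge0; case/andP: rho01. Qed.

Ltac nonneg := repeat first [exact: ler0n | exact: e2_ge0 | exact: rhoX_ge0 | exact: sqr_ge0 | apply: divr_ge0 | apply: mulr_ge0].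

Lemma cyb_ge0 y be : 0 <= cyb y be.
Proof.
apply: avg_ge0 => th; apply: sumr_ge0 => W _.
by nonneg.
Qed.

Lemma FygE y g : Fyg y g = \sum_be cyb y be * chr R be g.
Proof.
transitivity (avg (fun th => \sum_be (\sum_W (push y th W == be)%:R * (e2 (w y th) W * rho ^+ #|W|)) * chr R be g)); last first.
  by rewrite avg_sum; apply: eq_bigr => be _; rewrite avgZr.
apply: eq_avg => th.
transitivity (avg (fun n => \sum_W e2 (w y th) W * chr R W (pull y th g) * chr R W (nu n))).
  by apply: eq_avg => n; rewrite autocorr; apply: eq_bigr => W _; rewrite chrD mulrA.
rewrite avg_sum; transitivity (\sum_W \sum_be (push y th W == be)%:R * (e2 (w y th) W * rho ^+ #|W|) * chr R be g).
  apply: eq_bigr => W _; rewrite avgZ avg_noise (bigD1 (push y th W)) //= eqxx big1 ?addr0.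
    have -> : chr R W (pull y th g) = chr R (push y th W) g by rewrite /chr lin_pull.
    by rewrite /=; ring.
  by move=> be; rewrite eq_sym => /negbTE ->; rewrite !mul0r.
by rewrite exchange_big; apply: eq_bigr => be _; rewrite mulr_suml.
Qed.

Lemma TvalE : Tval = avg (fun y => \sum_be cyb y be ^+ 2).
Proof.
apply: eq_avg => y; rewrite -(parseval (Fyg y)); apply: eq_bigr => be _; congr (_ ^+ 2).
rewrite /fhat; transitivity (avg (fun g => \sum_be' cyb y be' * (chr R be' g * chr R be g))).
  by apply: eq_avg => g; rewrite FygE mulr_suml; apply: eq_bigr => be' _; rewrite mulrA.
rewrite avg_sum (bigD1 be) //= avgZ chr_orth eqxx mulr1 big1 ?addr0 // => be' /negbTE ne.
by rewrite avgZ chr_orth ne mulr0.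
Qed.

Lemma sum_e2 v : \sum_W e2 v W <= 1.
Proof.
rewrite parseval; apply: le_avg1 => // x.
by rewrite -(real_normK (num_real _)) exprn_ile1.
Qed.

(** The strategy extracted from the tables: [W] is drawn with its squared Fourier coefficient as
    weight, then an element of [W] uniformly. *)
Definition psi v l : R := \sum_(W : {set L} | l \in W) e2 v W / #|W|%:R.

Lemma subd_psi : subd psi.
Proof.
split=> [v l|v].
  by apply: sumr_ge0 => W _; rewrite divr_ge0 ?e2_ge0 ?ler0n.
apply: le_trans (sum_e2 v); rewrite /psi.
rewrite (exchange_big_dep xpredT) //=; apply: ler_sum => W _.
rewrite sumr_const -[_ *+ _]mulr_natr.
case: (posnP #|W|) => h; first by rewrite h mulr0 e2_ge0.
by rewrite divfK // pnatr_eq0 -lt0n.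
Qed.

(** The number n rho^n is below the geometric sum, hence below 1/(1 - rho) = m/2. Thus the noise
    pays for the factor 1/|W| lost in drawing an element of [W]. *)
Lemma rho_card n : (0 < n)%N -> rho ^+ n <= m%:R / 2 / n%:R.
Proof.
move=> n0; have /andP[r0 r1] := rho01.
have m0 : 0 < m%:R :> R by rewrite ltr0n ltnW.
have g : n%:R * rho ^+ n <= \sum_(j < n) rho ^+ j.
  have -> : n%:R * rho ^+ n = \sum_(j < n) rho ^+ n by rewrite sumr_const card_ord mulr_natl.
  apply: ler_sum => j _.
  by rewrite ler_wiXn2l // ?ltW // ltnW.
have : (1 - rho) * \sum_(j < n) rho ^+ j <= 1.
  have -> : (1 - rho) * \sum_(j < n) rho ^+ j = 1 - rho ^+ n by rewrite -opprB mulNr -subrX1 opprB.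
  by have := rhoX_ge0 n; lra.
have -> : 1 - rho = 2 / m%:R by rewrite /rho; ring.
move=> h; rewrite ler_pdivlMr ?ltr0n // mulrC; apply: le_trans g _.
set X := \sum_(j < n) _ in h *.
have -> : X = m%:R / 2 * (2 / m%:R * X) by field; lra.
by rewrite -[X in _ <= X]mulr1 ler_wpM2l // divr_ge0 // ltW.
Qed.

Lemma push_odd y th W : odd #|push y th W| = odd #|W|.
Proof.
have := lin_pull y th W [ffun=> true]; rewrite lin_true => <-.
rewrite -lin_true; congr lin; by apply/ffunP => l; rewrite !ffunE.
Qed.

(** Folding leaves only odd [W], whose images are odd and so nonempty. Images are grouped by a
    chosen element b', and a sum of squares of nonnegative numbers is at most the square of their
    sum. Some element of [W] projects to b', so the extracted strategy gives b' enough weight. *)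
Theorem Tval_upper (b : R) : (forall v x, f v (xadd x [ffun=> true]) = - f v x) ->
  val_le w p b -> Tval <= (m%:R / 2) ^+ 2 * b.
Proof.
move=> hodd hb; have m0 : 0 < m%:R :> R by rewrite ltr0n ltnW.
apply: le_trans (ler_wpM2l (sqr_ge0 _) (hb _ subd_psi)).
rewrite TvalE /Qval -avgZ; apply: le_avg => y.
have z0 v (W : {set L}) : ~~ odd #|W| -> e2 v W = 0 by move=> h; rewrite /e2 fhat_odd ?expr0n.
have c0 : cyb y set0 = 0.
  rewrite /cyb -[RHS](avg0 R Th); apply: eq_avg => th; rewrite big1 // => W _.
  case: eqP => [e|_]; last by rewrite mul0r.
  by rewrite z0 ?mul0r ?mulr0 // -(push_odd y th) e cards0.
case: (pickP (mem [set: S])) => [b0 _|noS]; last first.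
  rewrite (eq_bigr (fun _ => 0)) => [|be _].
    rewrite big1_eq mulr_ge0 ?sqr_ge0 // sumr_ge0 // => b' _; exact: sqr_ge0.
  have -> : be = set0 by apply/setP => i; have := noS i; rewrite !inE.
  by rewrite c0 expr0n.
(* The default [b0] is only met at the empty set, whose coefficient is 0. *)
pose bb (be : {set S}) : S := odflt b0 [pick b' in be].
rewrite (partition_big bb xpredT) //= mulr_sumr; apply: ler_sum => b' _.
apply: le_trans (_ : _ <= (\sum_(be | bb be == b') cyb y be) ^+ 2) _.
  rewrite expr2 mulr_suml; apply: ler_sum => be hbe; rewrite expr2 ler_wpM2l ?cyb_ge0 //.
  by rewrite (bigD1 be) //= lerDl sumr_ge0 // => ? _; apply: cyb_ge0.
rewrite -exprMn ler_sqr ?nnegrE; last 2 first.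
- by apply: sumr_ge0 => be _; apply: cyb_ge0.
- apply: mulr_ge0; first by nonneg.
  apply: avg_ge0 => th; apply: sumr_ge0 => l _.
  by apply: mulr_ge0; [exact: ler0n|case: subd_psi].
rewrite /cyb -avg_sum -avgZ; apply: le_avg => th; rewrite exchange_big /=.
apply: le_trans (_ : _ <= \sum_(W : {set L}) \sum_(l in W) (p y th l == b')%:R * (m%:R / 2 * (e2 (w y th) W / #|W|%:R))) _.
  apply: ler_sum => W _; rewrite -!mulr_suml.
  case: (posnP #|W|) => W0.
    by rewrite z0 ?W0 // !mul0r !mulr0.
  case: (boolP (odd #|W|)) => oW; last first.
    by rewrite z0 // !mul0r !mulr0.
  have pne : push y th W != set0 by apply: contraTneq oW => e; rewrite -(push_odd y th) e cards0.
  have nn : 0 <= m%:R / 2 * (e2 (w y th) W / #|W|%:R).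
    by nonneg.
  have le1 : e2 (w y th) W * rho ^+ #|W| <= m%:R / 2 * (e2 (w y th) W / #|W|%:R).
    have := ler_wpM2l (e2_ge0 (w y th) W) (rho_card W0).
    by congr (_ <= _); ring.
  apply: ler_pM; [by apply: sumr_ge0 => be _; rewrite ler0n|by nonneg| |exact: le1].
  rewrite -!natr_sum ler_nat.
  case: (boolP (bb (push y th W) == b')) => hbb; last first.
    rewrite big1 // => be hbe; case: eqP => // e; by rewrite e hbe in hbb.
  rewrite (bigD1 (push y th W)) //= eqxx big1 ?addn0 => [|be /andP[_]]; last by rewrite eq_sym => /negbTE ->.
  move/eqP: hbb; rewrite /bb; case: pickP => [b1 hb1 /= eb|hno _]; last first.
    by move: pne; case/set0Pn => b1 hb1; have := hno b1; rewrite hb1.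
  move: hb1; rewrite inE eb => od.
  have : [set l in W | p y th l == b'] != set0 by apply: contraTneq od => ->; rewrite cards0.
  case/set0Pn => l; rewrite inE => /andP[lW pl].
  by rewrite (bigD1 l) //= pl.
rewrite (exchange_big_dep xpredT) //= mulr_sumr; apply: ler_sum => l _.
rewrite -mulr_sumr mulrCA ler_wpM2l ?ler0n // /psi -mulr_sumr //.
Qed.

(** Only the terms of the empty set are kept; convexity does the rest, the questions being uniform
    by [winj]. *)
Theorem Tval_lower : (forall v x, 0 <= f v x) -> avg (fun v => avg (f v)) ^+ 4 <= Tval.
Proof.
move=> f0; rewrite TvalE.
apply: le_trans (_ : _ <= avg (fun y => (avg (fun th => avg (f (w y th)) ^+ 2)) ^+ 2)) _; last first.
  apply: le_avg => y; rewrite (bigD1 set0) //=.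
  apply: le_trans (_ : _ <= cyb y set0 ^+ 2) _; last by rewrite lerDl sumr_ge0 // => be _; apply: sqr_ge0.
  rewrite ler_sqr ?nnegrE ?cyb_ge0 //; last by apply: avg_ge0 => th; apply: sqr_ge0.
  apply: le_avg => th; rewrite (bigD1 set0) //=.
  have -> : push y th set0 = set0.
    apply/setP => b; rewrite !inE (_ : [set l in set0 | p y th l == b] = set0) ?cards0 //.
    by apply/setP => l; rewrite !inE.
  have -> : e2 (w y th) set0 = avg (f (w y th)) ^+ 2.
    rewrite /e2 /fhat; congr (_ ^+ 2); apply: eq_avg => x.
    by rewrite /chr /lin big_set0 /sgn expr0 mulr1.
  rewrite eqxx cards0 expr0 mulr1 mul1r lerDl sumr_ge0 // => W _.
  by nonneg.
apply: le_trans _ (avg_sqr _); rewrite -[4%N]/(2 * 2)%N exprM ler_sqr ?nnegrE ?sqr_ge0 //; last first.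
  by apply: avg_ge0 => y; apply: avg_ge0 => th; apply: sqr_ge0.
have -> : avg (fun y => avg (fun th => avg (f (w y th)) ^+ 2)) = avg (fun v => avg (f v) ^+ 2).
  rewrite avgC -[RHS](avg_cst _ Th0); apply: eq_avg => th.
  exact: (avg_inj (fun v => avg (f v) ^+ 2) (winj (th := th))).
exact: avg_sqr.
Qed.

End LongCodeTest.

(** * Equations of the test *)

Section FoldedEquations.
Variables (R : realFieldType) (V Th L S : finType) (w : V -> Th -> V) (p : V -> Th -> L -> S).
Variables (m : nat) (l0 : L).
Hypotheses (m1 : (1 < m)%N) (V0 : (0 < #|V|)%N) (Th0 : (0 < #|Th|)%N).
Hypothesis winj : forall th, injective (fun y => w y th).

(* Tables are folded over complementation: only the points vanishing at [l0] are
   variables, the other ones are read with a flip that goes to the right-hand side. *)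
Definition X0 : finType := {x : cube L | ~~ x l0}.
Definition foldc (x : cube L) : cube L := if x l0 then xadd x [ffun=> true] else x.

Lemma foldcP x : ~~ foldc x l0.
Proof. by rewrite /foldc; case: ifP => [h|->//]; rewrite !ffunE h. Qed.

Definition foldx (x : cube L) : X0 := exist (fun x : cube L => ~~ x l0) (foldc x) (foldcP x).

Definition gvar : finType := (V * X0)%type.
Definition hlf : finType := (Th * noise L m * cube L)%type.
Definition Omega : finType := (V * cube S * hlf * hlf)%type.

Definition hshift y g (t : hlf) : cube L := shiftx p y t.1.1 g t.1.2.
Definition hpts y g (t : hlf) : seq (V * cube L) :=
  [:: (w y t.1.1, t.2); (w y t.1.1, xadd t.2 (hshift y g t))].
Definition pts (o : Omega) : seq (V * cube L) :=
  hpts o.1.1.1 o.1.1.2 o.1.2 ++ hpts o.1.1.1 o.1.1.2 o.2.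
Definition vfold (q : V * cube L) : gvar := (q.1, foldx q.2).
Definition gvars (o : Omega) : seq gvar := map vfold (pts o).
Definition grhs (o : Omega) : bool := \big[addb/false]_(q <- pts o) q.2 l0.
Definition gsat (a : gvar -> bool) (o : Omega) : bool :=
  (\big[addb/false]_(z <- gvars o) a z) == grhs o.

Let qq : R := (1 - m%:R^-1) ^+ #|L|.
(** Six pairs among four points, each pair colliding after folding with probability at most 2 (1 -
    1/m)^|L|. *)
Definition kap : R := 12%:R * qq.

Lemma foldx_eq x y : foldx x = foldx y -> y = x \/ y = xadd x [ffun=> true].
Proof.
move/(congr1 val) => /=; rewrite /foldc.
case: ifP => _; case: ifP => _ e.
- by left; rewrite -[y](xaddK [ffun=> true]) -e xaddK.
- by right.
- by right; rewrite e xaddK.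
- by left.
Qed.

Lemma m_inv : (0 < m%:R^-1 :> R) && (m%:R^-1 <= 2^-1 :> R).
Proof.
have h : 2 <= m%:R :> R by rewrite -[2]/(2%:R) ler_nat.
by apply/andP; split; [rewrite invr_gt0; lra|rewrite lef_pV2 ?posrE; lra].
Qed.

Lemma qq_ge0 : 0 <= qq.
Proof. by apply: exprn_ge0; case/andP: m_inv => *; lra. Qed.

Lemma avg_nu (c : cube L) : avg (fun n : noise L m => (nu n == c)%:R) <= qq.
Proof.
have m0 : (0 < #|'I_m|)%N by rewrite card_ord ltnW.
have -> : avg (fun n : noise L m => (nu n == c)%:R) =
    \prod_l avg (fun i : 'I_m => ((nat_of_ord i == 0%N) == c l)%:R) :> R.
  rewrite -avg_ffun; apply: eq_avg => n.
  case: (altP (nu n =P c)) => [<-|/eqP ne].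
    by rewrite big1 // => l _; rewrite ffunE eqxx.
  have [l hl] : exists l, nu n l != c l.
    apply/existsP; rewrite -negb_forall; apply/negP => /forallP h; apply: ne.
    by apply/ffunP => l; apply/eqP.
  by rewrite (bigD1 l) //= -[nat_of_ord _ == _](ffunE (fun l => nat_of_ord (n l) == 0%N)) (negbTE hl) mul0r.
rewrite /qq -prodr_const; apply: ler_prod => l _; apply/andP; split.
  by apply: avg_ge0 => i; rewrite ler0n.
have e0 := @avg_ord0 R m m1; have /andP[h1 h2] := m_inv.
case: (c l).
  by under eq_avg do rewrite eqb_id; rewrite e0; lra.
have -> : avg (fun i : 'I_m => ((nat_of_ord i == 0%N) == false)%:R) =
   1 - avg (fun i : 'I_m => (nat_of_ord i == 0%N)%:R) :> R.
  rewrite -[X in X - _](avg_cst _ m0) -avgB; apply: eq_avg => i.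
  by case: (nat_of_ord i == 0%N); rewrite /= ?subrr ?subr0.
by rewrite e0.
Qed.

Lemma avg_foldx (F : X0 -> R) : avg (fun x => F (foldx x)) = avg F.
Proof.
pose h x := (foldx x, x l0).
pose g (q : X0 * bool) : cube L := if q.2 then xadd (val q.1) [ffun=> true] else val q.1.
have hg : cancel h g.
  by move=> x; rewrite /h /g /= /foldc; case: (x l0) => //; rewrite xaddK.
have gh : cancel g h.
  move=> [[x hx] b]; rewrite /h /g /=; congr pair.
    by apply: val_inj; rewrite /= /foldc; case: b; rewrite ?ffunE ?(negbTE hx) //= ?xaddK.
  by case: b; rewrite ?ffunE (negbTE hx).
transitivity (avg (fun x => (fun q : X0 * bool => F q.1) (h x))); first by [].
rewrite (avg_can (fun q : X0 * bool => F q.1) hg gh) avg_pair; apply: eq_avg => x /=.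
by rewrite avg_cst // card_bool.
Qed.

Lemma card_X0 : #|X0|%:R^-1 <= 2 * qq :> R.
Proof.
have e : #|cube L| = (#|X0| * 2)%N.
  have [h hh] : exists h : cube L -> X0 * bool, bijective h.
    exists (fun x => (foldx x, x l0)).
    exists (fun q : X0 * bool => if q.2 then xadd (val q.1) [ffun=> true] else val q.1).
      by move=> x /=; rewrite /foldc; case: (x l0) => //; rewrite xaddK.
    move=> [[x hx] b] /=; congr pair; last by case: b; rewrite ?ffunE (negbTE hx).
    apply: val_inj; rewrite /= /foldc; case: b; rewrite ?(negbTE hx) //.
    by rewrite !ffunE (negbTE hx) /= xaddK.
  by rewrite (bij_eq_card hh) card_prod card_bool.
have c0 : (0 < #|X0|)%N by have := cube_gt0 L; rewrite e; lia.
have -> : #|X0|%:R^-1 = 2 * #|cube L|%:R^-1 :> R.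
  by rewrite e natrM; field; rewrite pnatr_eq0 -lt0n c0.
rewrite ler_wpM2l // card_ffun card_bool natrX -exprVn /qq.
by apply: lerXn2r; rewrite ?nnegrE; case/andP: m_inv => *; lra.
Qed.

Lemma avg_hit (z : gvar) (v : V) (h : cube L) :
  avg (fun x => (z == vfold (v, xadd x h))%:R) <= 2 * qq.
Proof.
rewrite (avg_shift h (fun x => (z == vfold (v, x))%:R)).
apply: le_trans card_X0; rewrite -[X in _ <= X](_ : avg (fun x : X0 => (x == z.2)%:R) = _).
  rewrite -(avg_foldx (fun x => (x == z.2)%:R)); apply: le_avg => x.
  by rewrite ler_nat /vfold; case: z => z1 z2; rewrite xpair_eqE /= [z2 == _]eq_sym; case: (z1 == v).
rewrite /avg (bigD1 z.2) //= eqxx big1 ?addr0 ?mul1r // => x /negbTE -> //.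
Qed.

Lemma hlf_gt0 : (0 < #|hlf|)%N.
Proof.
rewrite !card_prod !muln_gt0 Th0 (cube_gt0 L) andbT card_ffun card_ord expn_gt0 (ltnW m1) //.
Qed.

(** The two points of one half fold to the same variable only if their difference is constant, that
    is, if the noise is the pulled-back [g] or its complement. *)
Lemma avg_self y g (t0 : Th) : avg (fun n : noise L m => avg (fun x : cube L =>
   (vfold (w y t0, x) == vfold (w y t0, xadd x (hshift y g (t0, n, x))))%:R)) <= 2 * qq.
Proof.
apply: le_trans (_ : _ <= avg (fun n : noise L m => (nu n == pull p y t0 g)%:R + (nu n == xadd (pull p y t0 g) [ffun=> true])%:R)) _.
  apply: le_avg => n; apply: le_avg1; first by rewrite addr_ge0 ?ler0n.
  move=> x; rewrite -natrD ler_nat; case: eqP => //= e.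
  have {}e : foldx x = foldx (xadd x (hshift y g (t0, n, x))) := congr1 snd e.
  have [e1|e1] := foldx_eq e.
    have : hshift y g (t0, n, x) = [ffun=> false].
      by rewrite -[LHS](xaddKl x) e1; apply/ffunP => i; rewrite !ffunE addbb.
    rewrite /hshift /shiftx /= => e2; suff -> : nu n == pull p y t0 g by [].
    apply/eqP/ffunP => i; move/ffunP/(_ i): e2; rewrite !ffunE.
    by case: (g _); case: (_ == _).
  have : hshift y g (t0, n, x) = [ffun=> true].
    by rewrite -[LHS](xaddKl x) e1 xaddKl.
  rewrite /hshift /shiftx /= => e2; suff -> : nu n == xadd (pull p y t0 g) [ffun=> true] by rewrite addn1.
  apply/eqP/ffunP => i; move/ffunP/(_ i): e2; rewrite !ffunE.
  by case: (g _); case: (_ == _).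
by rewrite avgD; have := avg_nu (pull p y t0 g); have := avg_nu (xadd (pull p y t0 g) [ffun=> true]); lra.
Qed.

Lemma avg_self_hlf y g : avg (fun t : hlf => (vfold (w y t.1.1, t.2) == vfold (w y t.1.1, xadd t.2 (hshift y g t)))%:R) <= 2 * qq.
Proof.
rewrite avg_pair (avg_pair (fun a : Th * noise L m => avg (fun x => _))).
apply: le_avg1; first by have := qq_ge0; lra.
by move=> t0; apply: avg_self.
Qed.

Lemma avg_deg : avg (fun o : Omega => (~~ uniq (gvars o))%:R) <= kap.
Proof.
have q0 := qq_ge0.
rewrite avg_pair avg_pair (avg_pair (fun a : V * cube S => _)).
have k0 : 0 <= kap by rewrite mulr_ge0.
apply: le_avg1 => // y; apply: le_avg1 => // g /=.
pose z0 (t : hlf) := vfold (w y t.1.1, t.2).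
pose z1 (t : hlf) := vfold (w y t.1.1, xadd t.2 (hshift y g t)).
apply: le_trans (_ : _ <= avg (fun t => avg (fun t' => (z0 t == z1 t)%:R + (z0 t' == z1 t')%:R +
   (z0 t == z0 t')%:R + (z0 t == z1 t')%:R + (z1 t == z0 t')%:R + (z1 t == z1 t')%:R))) _.
  apply: le_avg => t; apply: le_avg => t'.
  rewrite /gvars /pts /= !inE -/(z0 t) -/(z1 t) -/(z0 t') -/(z1 t') -!natrD ler_nat.
  by case: (_ == _); case: (_ == _); case: (_ == _); case: (_ == _); case: (_ == _); case: (_ == _).
have H (z : gvar) (F : hlf -> cube L) :
    (forall a x, F (a, x) = F (a, [ffun=> false])) ->
    avg (fun t' : hlf => (z == vfold (w y t'.1.1, xadd t'.2 (F t')))%:R) <= 2 * qq.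
  move=> hF; rewrite avg_pair; apply: le_avg1; first by lra.
  move=> a /=; under eq_avg do rewrite hF.
  exact: avg_hit.
have x00 x : x = xadd x [ffun=> false] :> cube L by apply/ffunP => i; rewrite !ffunE addbF.
have h0 z : avg (fun t' => (z == z0 t')%:R) <= 2 * qq.
  apply: le_trans (H z (fun _ => [ffun=> false]) _) => //; apply: le_avg => t'.
  by rewrite /z0 -x00.
have h1 z : avg (fun t' => (z == z1 t')%:R) <= 2 * qq by apply: H.
have hs : avg (fun t => (z0 t == z1 t)%:R) <= 2 * qq by apply: avg_self_hlf.
apply: le_trans (_ : _ <= avg (fun t => (z0 t == z1 t)%:R + 10%:R * qq)) _.
  apply: le_avg => t; rewrite !avgD (avg_cst _ hlf_gt0).
  have := h0 (z0 t); have := h1 (z0 t); have := h0 (z1 t); have := h1 (z1 t); move: hs.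
  by move: (avg _) (avg _) (avg _) (avg _) (avg _) => *; lra.
rewrite avgD (avg_cst _ hlf_gt0) /kap; lra.
Qed.

Section Sat.
Variables (P : pred gvar) (a : gvar -> bool).

(** [P] is the chosen set of variables. The signed table is odd under complementation and vanishes
    off [P], so products of four of its values only count induced equations. *)
Definition fsa v (x : cube L) : R := (P (v, foldx x))%:R * sgn R (a (v, foldx x) (+) x l0).
Definition fs v (x : cube L) : R := (P (v, foldx x))%:R.

Lemma avg_prod4 (F : V -> cube L -> R) :
  avg (fun o : Omega => \prod_(q <- pts o) F q.1 q.2) = Tval w p m F.
Proof.
rewrite avg_pair avg_pair (avg_pair (fun b : V * cube S => _)); apply: eq_avg => y; apply: eq_avg => g.
pose A (t : hlf) := F (w y t.1.1) t.2 * F (w y t.1.1) (xadd t.2 (hshift y g t)).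
transitivity (avg (fun t => avg (fun t' => A t * A t'))).
  apply: eq_avg => t; apply: eq_avg => t'; rewrite /pts /= !big_cons big_nil /A mulr1; ring.
under eq_avg do rewrite avgZ.
rewrite avgZr expr2; suff -> : avg A = Fyg w p m F y g by [].
by rewrite avg_pair avg_pair.
Qed.

Lemma foldx_true x : foldx (xadd x [ffun=> true]) = foldx x.
Proof.
apply: val_inj; rewrite /= /foldc !ffunE; case: (x l0) => //=; by rewrite xaddK.
Qed.

Lemma prod_sgn (I : Type) (s : seq I) (F : I -> bool) :
  \prod_(q <- s) sgn R (F q) = sgn R (\big[addb/false]_(q <- s) F q).
Proof. by rewrite (big_morph (sgn R) (sgnD R) (erefl : sgn R false = 1)). Qed.

Lemma prod_ind (I : Type) (s : seq I) (F : pred I) : \prod_(q <- s) (F q)%:R = (all F s)%:R :> R.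
Proof. by elim: s => [|i s ih]; rewrite ?big_nil // big_cons ih /=; case: (F i); rewrite ?mul1r ?mul0r. Qed.

Lemma prod_fsa o : \prod_(q <- pts o) fsa q.1 q.2 =
  (all P (gvars o))%:R * (2 * (gsat a o)%:R - 1).
Proof.
have -> : all P (gvars o) = all (fun q => P (q.1, foldx q.2)) (pts o) by rewrite /gvars all_map.
rewrite /fsa big_split prod_sgn (prod_ind (pts o) (fun q => P (q.1, foldx q.2))); congr (_ * _).
rewrite big_split /gsat /grhs /gvars big_map sgnE.
by case: (\big[addb/false]_(_ <- _) _); case: (\big[addb/false]_(_ <- _) _); rewrite /=; ring.
Qed.

Lemma prod_fs o : \prod_(q <- pts o) fs q.1 q.2 = (all P (gvars o))%:R.
Proof. by rewrite (prod_ind (pts o) (fun q => P (q.1, foldx q.2))) /gvars all_map. Qed.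

Lemma avg_fs : avg (fun v => avg (fs v)) = #|P|%:R / #|gvar|%:R.
Proof.
rewrite -avg_count avg_pair; apply: eq_avg => v.
exact: (avg_foldx (fun x => (P (v, x))%:R)).
Qed.

(** Over the induced tests, [Tval] of [fsa] is the excess of satisfied over violated ones and [Tval]
    of [fs] their density; discarding degenerate tests changes either by at most [kap]. *)
Theorem eqs_sound (b al nuu : R) : val_le w p b -> 0 <= al -> 0 < nuu ->
  (m%:R / 2) ^+ 2 * b + kap < 2 * nuu * (al ^+ 4 - kap) ->
  al * #|gvar|%:R <= #|P|%:R ->
  #|[pred o : Omega | [&& uniq (gvars o), all P (gvars o) & gsat a o]]|%:R
    < (1 / 2 + nuu) * #|[pred o : Omega | uniq (gvars o) && all P (gvars o)]|%:R.
Proof.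
move=> hb al0 nu0 hk hP.
have g0 : (0 < #|gvar|)%N.
  rewrite card_prod muln_gt0 V0 /=; apply/card_gt0P.
  by exists (foldx [ffun=> false]).
have o0 : (0 < #|Omega|)%N.
  by rewrite card_prod card_prod card_prod !muln_gt0 V0 (cube_gt0 S) hlf_gt0.
have n0 : 0 < #|Omega|%:R :> R by rewrite ltr0n.
pose iS o : R := (all P (gvars o))%:R; pose un o : R := (uniq (gvars o))%:R.
pose sg o : R := 2 * (gsat a o)%:R - 1.
have up : avg (fun o => iS o * sg o) <= (m%:R / 2) ^+ 2 * b.
  have -> : avg (fun o => iS o * sg o) = Tval w p m fsa.
    by rewrite -avg_prod4; apply: eq_avg => o; rewrite prod_fsa.
  apply: Tval_upper => //.
  - move=> v x; rewrite /fsa; case: (P _); case: (_ (+) _); rewrite /sgn /= ?expr0 ?expr1 ?mul0r ?mul1r ?normr0 ?normrN ?normr1 //.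
  - move=> v x; rewrite /fsa foldx_true !ffunE addbT -mulrN; congr (_ * _).
    by case: (a _); case: (x l0); rewrite /sgn /= ?expr0 ?expr1 ?opprK.
have lo : al ^+ 4 <= avg iS.
  have -> : avg iS = Tval w p m fs by rewrite -avg_prod4; apply: eq_avg => o; rewrite prod_fs.
  apply: le_trans (_ : _ <= avg (fun v => avg (fs v)) ^+ 4) _; last apply: Tval_lower => //.
  apply: lerXn2r; rewrite ?nnegrE //; first by rewrite avg_fs divr_ge0 ?ler0n.
  by rewrite avg_fs ler_pdivlMr ?ltr0n.
have dg := avg_deg.
have sgb o : -1 <= sg o <= 1 by rewrite /sg; case: (gsat a o); rewrite /=; apply/andP; split; lra.
have h1 : avg (fun o => un o * iS o * sg o) <= (m%:R / 2) ^+ 2 * b + kap.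
  apply: le_trans (lerD up dg); rewrite -avgD; apply: le_avg => o.
  rewrite /un /iS; have := sgb o; case: (uniq _); case: (all _ _); rewrite /= ?mul1r ?mul0r ?addr0 //; lra.
have h2 : al ^+ 4 - kap <= avg (fun o => un o * iS o).
  apply: le_trans (lerB lo dg) _; rewrite -avgB; apply: le_avg => o.
  by rewrite /un /iS; case: (uniq _); case: (all _ _); rewrite /= ?mul1r ?mul0r ?subr0 ?subrr //; lra.
have e1 : #|[pred o : Omega | uniq (gvars o) && all P (gvars o)]|%:R = #|Omega|%:R * avg (fun o => un o * iS o).
  have -> : avg (fun o => un o * iS o) = avg (fun o => ([pred o : Omega | uniq (gvars o) && all P (gvars o)] o)%:R).
    apply: eq_avg => o; rewrite /un /iS -[X in _ = X%:R]/(nat_of_bool (uniq (gvars o) && all P (gvars o))).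
    by case: (uniq (gvars o)); case: (all P (gvars o)); rewrite ?mul1r ?mul0r.
  by rewrite avg_count mulrC divfK ?gt_eqF.
have e2 : #|[pred o : Omega | [&& uniq (gvars o), all P (gvars o) & gsat a o]]|%:R =
   #|Omega|%:R * ((avg (fun o => un o * iS o * sg o) + avg (fun o => un o * iS o)) / 2).
  have -> : (avg (fun o => un o * iS o * sg o) + avg (fun o => un o * iS o)) / 2 =
      avg (fun o => ([pred o : Omega | [&& uniq (gvars o), all P (gvars o) & gsat a o]] o)%:R).
    rewrite -avgD -avgZr; apply: eq_avg => o; rewrite /un /iS /sg.
    rewrite -[X in _ = X%:R]/(nat_of_bool [&& uniq (gvars o), all P (gvars o) & gsat a o]).
    by case: (uniq (gvars o)); case: (all P (gvars o)); case: (gsat a o); rewrite /=; field.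
  by rewrite avg_count mulrC divfK ?gt_eqF.
rewrite e2 e1 [X in _ < X]mulrCA ltr_pM2l //.
move: h1 h2 hk; move: (avg _) (avg _) => A C h1 h2 hk.
have : 2 * nuu * (al ^+ 4 - kap) <= 2 * nuu * A by rewrite ler_pM2l //; lra.
by lra.
Qed.

End Sat.

(** For long codes of the labels the values of [g] cancel between the two halves, so a test fails
    only if the noise flips the coordinate read in one of them, with probability at most 2/m. *)
Theorem eqs_complete (l : V -> L) (ka : V -> S) (eta : R) :
  (forall y th, p y th (l (w y th)) = ka y) -> 2 / m%:R + kap <= eta ->
  exists a : gvar -> bool,
  (1 - eta) * #|[pred o : Omega | uniq (gvars o)]|%:R
    <= #|[pred o : Omega | uniq (gvars o) && gsat a o]|%:R.
Proof.
move=> hl he; pose a (z : gvar) := val z.2 (l z.1); exists a.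
have o0 : (0 < #|Omega|)%N.
  by rewrite card_prod card_prod card_prod !muln_gt0 V0 (cube_gt0 S) hlf_gt0.
have n0 : 0 < #|Omega|%:R :> R by rewrite ltr0n.
have ea q : a (vfold q) = q.2 (l q.1) (+) q.2 l0.
  by rewrite /a /vfold /= /foldc; case: (q.2 l0); rewrite ?ffunE ?addbT ?addbF.
pose bd (t : hlf) y : R := (nu t.1.2 (l (w y t.1.1)))%:R.
have hs o : (~~ gsat a o)%:R <= bd o.1.2 o.1.1.1 + bd o.2 o.1.1.1 :> R.
  case: o => [[[y g] t] t']; rewrite /gsat /grhs /gvars big_map.
  have -> : \big[addb/false]_(q <- pts (y, g, t, t')) a (vfold q) =
     (\big[addb/false]_(q <- pts (y, g, t, t')) q.2 (l q.1)) (+) \big[addb/false]_(q <- pts (y, g, t, t')) q.2 l0.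
    by rewrite -big_split; apply: eq_bigr => q _; rewrite ea.
  have -> : \big[addb/false]_(q <- pts (y, g, t, t')) q.2 (l q.1) =
      nu t.1.2 (l (w y t.1.1)) (+) nu t'.1.2 (l (w y t'.1.1)).
    rewrite /pts /= !big_cons big_nil /= /hshift /shiftx !ffunE !hl.
    by case: (t.2 _); case: (t'.2 _); case: (g _); case: (_ == _); case: (_ == _).
  rewrite /bd /= -natrD ler_nat; case: (nu _ _); case: (nu _ _) => //=; by case: (\big[_/_]_(_ <- _) _).
have hb y : avg (fun t : hlf => bd t y) = m%:R^-1.
  rewrite avg_pair (avg_pair (fun b : Th * noise L m => _)) /=.
  rewrite -[RHS](avg_cst _ Th0); apply: eq_avg => t0.
  transitivity (avg (fun n : noise L m => (nu n (l (w y t0)))%:R) : R).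
    by apply: eq_avg => n; rewrite /bd /= avg_cst // cube_gt0.
  have m0 : (0 < #|'I_m|)%N by rewrite card_ord ltnW.
  transitivity (\prod_l' avg (fun i : 'I_m => if l' == l (w y t0) then (nat_of_ord i == 0%N)%:R else 1) : R).
    rewrite -avg_ffun; apply: eq_avg => n; rewrite (bigD1 (l (w y t0))) //= eqxx big1 ?mulr1 ?ffunE //.
    by move=> l' /negbTE ->.
  rewrite (bigD1 (l (w y t0))) //= eqxx big1 ?mulr1; first exact: avg_ord0.
  by move=> l' /negbTE ->; rewrite avg_cst.
have h1 : avg (fun o : Omega => (~~ gsat a o)%:R) <= 2 / m%:R :> R.
  apply: le_trans (le_avg hs) _; rewrite avgD.
  have -> : avg (fun o : Omega => bd o.1.2 o.1.1.1) = m%:R^-1.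
    rewrite avg_pair avg_pair (avg_pair (fun b : V * cube S => _)) /= -[RHS](avg_cst _ V0); apply: eq_avg => y.
    rewrite -[RHS](@avg_cst _ (cube S)) ?cube_gt0 //; apply: eq_avg => g.
    by rewrite -(hb y); apply: eq_avg => t; rewrite avg_cst // hlf_gt0.
  have -> : avg (fun o : Omega => bd o.2 o.1.1.1) = m%:R^-1.
    rewrite avg_pair avg_pair (avg_pair (fun b : V * cube S => _)) /= -[RHS](avg_cst _ V0); apply: eq_avg => y.
    rewrite -[RHS](@avg_cst _ (cube S)) ?cube_gt0 //; apply: eq_avg => g.
    by rewrite -[RHS](@avg_cst _ hlf) ?hlf_gt0 //; apply: eq_avg => t; rewrite hb.
  by lra.
have dg := avg_deg.
have e1 (Q : pred Omega) : #|Q|%:R = #|Omega|%:R * avg (fun o => (Q o)%:R) :> R.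
  by rewrite avg_count mulrC divfK ?gt_eqF.
rewrite (e1 [pred o : Omega | uniq (gvars o)]) (e1 [pred o : Omega | uniq (gvars o) && gsat a o]).
rewrite mulrCA ler_pM2l //.
have k0 : 0 <= kap by rewrite mulr_ge0 ?qq_ge0.
have h2 : avg (fun o => ([pred o : Omega | uniq (gvars o)] o)%:R) <= 1 :> R.
  by apply: le_avg1 => // o; rewrite lern1; case: (_ o).
have h3 : 1 - avg (fun o : Omega => (~~ gsat a o)%:R) - avg (fun o : Omega => (~~ uniq (gvars o))%:R) <=
   avg (fun o => ([pred o : Omega | uniq (gvars o) && gsat a o] o)%:R) :> R.
  rewrite -[X in X - _ - _](avg_cst _ o0) -!avgB; apply: le_avg => o.
  rewrite -[X in _ <= X%:R]/(nat_of_bool (uniq (gvars o) && gsat a o)).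
  by case: (uniq (gvars o)); case: (gsat a o); rewrite /=; lra.
case: (lerP eta 1) => et.
  have : 0 <= (1 - eta) * (1 - avg (fun o => ([pred o : Omega | uniq (gvars o)] o)%:R)) by rewrite mulr_ge0; lra.
  by move: h1 dg h3; move: (avg _) (avg _) (avg _) (avg _) => *; lra.
apply: le_trans (_ : _ <= 0) _; last by apply: avg_ge0 => o; rewrite ler0n.
rewrite mulr_le0_ge0 //; first by lra.
by apply: avg_ge0 => o; rewrite ler0n.
Qed.

End FoldedEquations.

(** * Register programs and Turing machines *)

Section Reach.
Variables (T : Type) (step : T -> option T).

Fixpoint reach (n : nat) (a b : T) : Prop :=
  if n is m.+1 then exists2 c, step a = Some c & reach m c b else a = b.

Lemma reach_cat m n a b c : reach m a b -> reach n b c -> reach (m + n)%N a c.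
Proof.
elim: m a => [|m ih] a /=; first by move=> ->.
by case=> d e h1 h2; exists d => //; apply: ih.
Qed.

Lemma reachS n a b c : step a = Some c -> reach n c b -> reach n.+1 a b.
Proof. by move=> e h; exists c. Qed.

Lemma reach1 a b : step a = Some b -> reach 1 a b.
Proof. by move=> e; exists b. Qed.
End Reach.
Arguments reach : simpl never.

Definition store := nat -> seq bool.

Definition upd (s : store) (r : nat) (l : seq bool) : store :=
  fun i => if i == r then l else s i.

Inductive instr := IPush of nat & bool | IPop of nat | ICase of nat & nat & nat & nat.

Definition istep (code : seq instr) (c : nat * store) : option (nat * store) :=
  let: (pc, s) := c in
  match onth code pc with
  | None => None
  | Some (IPush r b) => Some (pc.+1, upd s r (b :: s r))
  | Some (IPop r) => Some (pc.+1, upd s r (behead (s r)))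
  | Some (ICase r l0 l1 l2) =>
      Some (match s r with [::] => l0 | false :: _ => l1 | true :: _ => l2 end, s)
  end.

Inductive cmd :=
  | Nop
  | Push of nat & bool
  | Pop of nat
  | Seq of cmd & cmd
  | Case of nat & cmd & cmd & cmd
  | While of nat & cmd.

(** The last argument is a time bound that also covers the jumps inserted by compilation. *)
Inductive exec : cmd -> store -> store -> nat -> Prop :=
  | ENop s : exec Nop s s 0
  | EPush r b s : exec (Push r b) s (upd s r (b :: s r)) 1
  | EPop r s : exec (Pop r) s (upd s r (behead (s r))) 1
  | ESeq c1 c2 s s1 s2 t1 t2 :
      exec c1 s s1 t1 -> exec c2 s1 s2 t2 -> exec (Seq c1 c2) s s2 (t1 + t2)
  | ECase r c0 c1 c2 s s' t :
      exec (match s r with [::] => c0 | false :: _ => c1 | true :: _ => c2 end) s s' t ->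
      exec (Case r c0 c1 c2) s s' t.+2
  | EWhile0 r c s : s r = [::] -> exec (While r c) s s 1
  | EWhile1 r c s s1 s2 t1 t2 : s r <> [::] ->
      exec c s s1 t1 -> exec (While r c) s1 s2 t2 -> exec (While r c) s s2 (t1 + t2).+2.

Fixpoint csize (c : cmd) : nat :=
  match c with
  | Nop => 0
  | Push _ _ | Pop _ => 1
  | Seq c1 c2 => csize c1 + csize c2
  | Case _ c0 c1 c2 => (csize c0 + csize c1 + csize c2).+3
  | While _ c => (csize c).+2
  end.

Definition jmp l := ICase 0 l l l.

Fixpoint compile (p : nat) (c : cmd) : seq instr :=
  match c with
  | Nop => [::]
  | Push r b => [:: IPush r b]
  | Pop r => [:: IPop r]
  | Seq c1 c2 => compile p c1 ++ compile (p + csize c1) c2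
  | Case r c0 c1 c2 =>
      let p1 := (p.+1 + csize c0).+1 in
      let p2 := (p1 + csize c1).+1 in
      let e := (p2 + csize c2)%N in
      ICase r p.+1 p1 p2 ::
        (compile p.+1 c0 ++ jmp e :: compile p1 c1) ++ jmp e :: compile p2 c2
  | While r c =>
      let e := (p.+1 + csize c).+1 in
      rcons (ICase r e p.+1 p.+1 :: compile p.+1 c) (jmp p)
  end.

Lemma size_compile p c : size (compile p c) = csize c.
Proof.
elim: c p => //= [c1 h1 c2 h2|r c0 h0 c1 h1 c2 h2|r c h] p.
- by rewrite size_cat h1 h2.
- by rewrite size_cat /= size_cat /= h0 h1 h2; lia.
- by rewrite size_rcons h.
Qed.

Lemma onth_cat_size (T : Type) (a : seq T) x b : onth (a ++ x :: b) (size a) = Some x.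
Proof. by elim: a => //=. Qed.

(** Labels are absolute addresses; quantifying over the surrounding code lets the induction enter
    subprograms. *)
Lemma compile_correct c s s' t : exec c s s' t ->
  forall pre post, exists2 n, (n <= t)%N &
    reach (istep (pre ++ compile (size pre) c ++ post)) n
      (size pre, s) ((size pre + csize c)%N, s').
Proof.
elim=> {c s s' t}.
- by move=> s pre post; exists 0%N => //=; rewrite addn0 /reach.
- move=> r b s pre post; exists 1%N => //; apply: reach1.
  by rewrite /= onth_cat_size addn1.
- move=> r s pre post; exists 1%N => //; apply: reach1.
  by rewrite /= onth_cat_size addn1.
- move=> c1 c2 s s1 s2 t1 t2 _ h1 _ h2 pre post /=.
  have [n1 l1 r1] := h1 pre (compile (size pre + csize c1) c2 ++ post).
  have [n2 l2 r2] := h2 (pre ++ compile (size pre) c1) post.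
  exists (n1 + n2)%N; first exact: leq_add.
  rewrite -catA; apply: reach_cat r1 _.
  by rewrite size_cat size_compile -catA in r2; rewrite addnA.
- move=> r c0 c1 c2 s s' t _ h pre post.
  set C := pre ++ _; set p := size pre.
  pose p1 := (p.+1 + csize c0).+1; pose p2 := (p1 + csize c1).+1; pose e := (p2 + csize c2)%N.
  have e0 : istep C (p, s) =
     Some (match s r with [::] => p.+1 | false :: _ => p1 | true :: _ => p2 end, s).
    by rewrite /= /C onth_cat_size.
  have eC1 : C = (pre ++ [:: ICase r p.+1 p1 p2]) ++ compile p.+1 c0 ++
       jmp e :: compile p1 c1 ++ jmp e :: compile p2 c2 ++ post.
    by rewrite /C /= -!catA /= -?catA.
  have eC2 : C = (pre ++ ICase r p.+1 p1 p2 :: compile p.+1 c0 ++ [:: jmp e]) ++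
       compile p1 c1 ++ jmp e :: compile p2 c2 ++ post.
    by rewrite /C /= -!catA /= -?catA /= -?catA.
  have eC3 : C = (pre ++ ICase r p.+1 p1 p2 :: compile p.+1 c0 ++ jmp e :: compile p1 c1 ++ [:: jmp e])
      ++ compile p2 c2 ++ post.
    by rewrite /C /= -!catA /= -?catA /= -?catA /= -?catA.
  have -> : (p + csize (Case r c0 c1 c2))%N = e by rewrite /e /p2 /p1 /=; lia.
  have z1 : size (pre ++ [:: ICase r p.+1 p1 p2]) = p.+1 by rewrite size_cat addn1.
  have z2 : size (pre ++ ICase r p.+1 p1 p2 :: compile p.+1 c0 ++ [:: jmp e]) = p1.
    by rewrite size_cat /= size_cat /= size_compile /p1 /p; lia.
  have z3 : size (pre ++ ICase r p.+1 p1 p2 :: compile p.+1 c0 ++ jmp e :: compile p1 c1 ++ [:: jmp e]) = p2.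
    by rewrite size_cat /= size_cat /= size_cat /= !size_compile /p2 /p1 /p; lia.
  case: (s r) h e0 => [|[] l] h e0.
  + have [n ln rn] := h (pre ++ [:: ICase r p.+1 p1 p2])
        (jmp e :: compile p1 c1 ++ jmp e :: compile p2 c2 ++ post).
    exists (1 + n + 1)%N; first lia.
    rewrite z1 -eC1 in rn.
    apply: reach_cat; first by apply: reach_cat (reach1 e0) rn.
    apply: reach1; rewrite /istep.
    have -> : onth C (p.+1 + csize c0) = Some (jmp e).
      have -> : C = (pre ++ ICase r p.+1 p1 p2 :: compile p.+1 c0) ++ jmp e ::
          (compile p1 c1 ++ jmp e :: compile p2 c2 ++ post).
        by rewrite eC1 -!catA.
      have -> : (p.+1 + csize c0)%N = size (pre ++ ICase r p.+1 p1 p2 :: compile p.+1 c0).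
        by rewrite size_cat /= size_compile /p; lia.
      exact: onth_cat_size.
    by rewrite /jmp; case: (s' 0%N) => [|[] ?].
  + have [n ln rn] := h (pre ++ ICase r p.+1 p1 p2 :: compile p.+1 c0 ++ jmp e :: compile p1 c1 ++ [:: jmp e]) post; rewrite z3 -eC3 in rn.
    exists (1 + n)%N; first lia.
    by apply: reach_cat (reach1 e0) _; exact: rn.
  + have [n ln rn] := h (pre ++ ICase r p.+1 p1 p2 :: compile p.+1 c0 ++ [:: jmp e])
       (jmp e :: compile p2 c2 ++ post).
    rewrite z2 -eC2 in rn.
    exists (1 + n + 1)%N; first lia.
    apply: reach_cat; first by apply: reach_cat (reach1 e0) rn.
    apply: reach1; rewrite /istep.
    have -> : onth C (p1 + csize c1) = Some (jmp e).
      have -> : C = (pre ++ ICase r p.+1 p1 p2 :: compile p.+1 c0 ++ jmp e :: compile p1 c1)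
          ++ jmp e :: (compile p2 c2 ++ post).
        by rewrite eC2 -!catA /= -!catA.
      have -> : (p1 + csize c1)%N = size (pre ++ ICase r p.+1 p1 p2 :: compile p.+1 c0 ++ jmp e :: compile p1 c1).
        by rewrite size_cat /= size_cat /= !size_compile /p1 /p; lia.
      exact: onth_cat_size.
    by rewrite /jmp; case: (s' 0%N) => [|[] ?].
- move=> r c s e pre post; exists 1%N => //; apply: reach1.
  rewrite /= onth_cat_size e; congr (Some (_, _)); lia.
- move=> r c s s1 s2 t1 t2 ne _ h1 _ h2 pre post.
  set C := pre ++ _; set p := size pre.
  have [n1 l1 r1] := h1 (pre ++ [:: ICase r (p.+1 + csize c).+1 p.+1 p.+1]) (jmp p :: post).
  have [n2 l2 r2] := h2 pre post; rewrite -/C in r2.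
  have eC : C = (pre ++ [:: ICase r (p.+1 + csize c).+1 p.+1 p.+1]) ++ compile p.+1 c ++ jmp p :: post.
    by rewrite /C /= -catA /= cat_rcons.
  have z1 : size (pre ++ [:: ICase r (p.+1 + csize c).+1 p.+1 p.+1]) = p.+1 by rewrite size_cat addn1.
  rewrite z1 -eC in r1.
  exists (1 + n1 + 1 + n2)%N; first lia.
  apply: reach_cat r2; apply: reach_cat.
    apply: reach_cat r1; apply: reach1; rewrite /= /C onth_cat_size.
    by case: (s r) ne => // -[].
  apply: reach1; rewrite /istep.
  have -> : onth C (p.+1 + csize c) = Some (jmp p).
    have -> : C = (pre ++ ICase r (p.+1 + csize c).+1 p.+1 p.+1 :: compile p.+1 c) ++ jmp p :: post.
      by rewrite eC -!catA.
    have e9 : (p.+1 + csize c)%N = size (pre ++ ICase r (p.+1 + csize c).+1 p.+1 p.+1 :: compile p.+1 c).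
      by rewrite size_cat /= size_compile /p; lia.
    by rewrite [X in onth _ X]e9 onth_cat_size.
  by rewrite /jmp; case: (s1 0%N) => [|[] ?].
Qed.

(** * Simulation of register programs by a Turing machine *)

Section Simulation.

Variable code : seq instr.

Definition ireg i := match i with IPush r _ | IPop r | ICase r _ _ _ => r end.
Definition ilab i := match i with ICase _ a b c => (a + b + c)%N | _ => 0%N end.

Definition kreg := sumn (map ireg code).
Definition nlab := (size code + sumn (map ilab code))%N.

Definition track : finType := {ffun 'I_kreg.+1 -> option bool}.
Notation sym := (tape_symbol (option track)).

(* The stack of register [r] occupies track [r], its bottom next to the marker. *)
Definition trk (a : sym) (r : nat) : option bool :=
  match a with
  | Some (inl b) => if r == 0%N then Some b else None
  | Some (inr (Some f)) => f (inord r)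
  | _ => None
  end.

Definition setk (a : sym) (r : nat) (v : option bool) : sym :=
  Some (inr (Some [ffun i : 'I_kreg.+1 => if i == inord r then v else trk a i])).

Definition mark : sym := Some (inr None).

Lemma trk_setk a r v r' : (r <= kreg)%N -> (r' <= kreg)%N ->
  trk (setk a r v) r' = if r' == r then v else trk a r'.
Proof.
move=> h h'; rewrite /= ffunE inordK //.
by rewrite -val_eqE /= !inordK.
Qed.

Definition simstate : finType := ('I_9 * 'I_nlab.+1)%type.
Definition st (m : nat) (pc : nat) : simstate := (inord m, inord pc).

(** State 0 steps left and 1 writes the marker. State 2 starts an instruction on the marker; 3 scans
    right to the first cell free on the track of the register, where it pushes; 4 pops or inspects
    the top of the stack; 5 returns to the marker. After the last instruction 6 rewrites track 0 as
    plain bits closed by a blank, 7 returns, and 8 halts on the first output cell. *)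
Definition simdelta (q : simstate) (a : sym) : option (simstate * sym * move) :=
  let pc := nat_of_ord q.2 in
  match nat_of_ord q.1 with
  | 0 => Some (st 1 0, a, MoveLeft)
  | 1 => Some (st 2 0, mark, MoveStay)
  | 2 => if (pc < size code)%N then Some (st 3 pc, a, MoveRight) else Some (st 6 pc, a, MoveRight)
  | 3 => match onth code pc with
         | None => None
         | Some i => if trk a (ireg i) then Some (st 3 pc, a, MoveRight) else
             if i is IPush r b then Some (st 5 pc.+1, setk a r (Some b), MoveLeft)
             else Some (st 4 pc, a, MoveLeft)
         end
  | 4 => match onth code pc with
         | Some (IPop r) => if a == mark then Some (st 2 pc.+1, a, MoveStay)
                            else Some (st 5 pc.+1, setk a r None, MoveLeft)
         | Some (ICase r l0 l1 l2) => if a == mark then Some (st 2 l0, a, MoveStay)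
              else Some (st 5 (if trk a r is Some true then l2 else l1), a, MoveLeft)
         | _ => None
         end
  | 5 => if a == mark then Some (st 2 pc, a, MoveStay) else Some (st 5 pc, a, MoveLeft)
  | 6 => if trk a 0 is Some b then Some (st 6 pc, Some (inl b), MoveRight)
         else Some (st 7 pc, None, MoveLeft)
  | 7 => if a == mark then Some (st 8 pc, a, MoveRight) else Some (st 7 pc, a, MoveLeft)
  | _ => None
  end.

Definition simtm : turing_machine :=
  @TuringMachine simstate (option track) (st 0 0) simdelta.

Notation cf m pc l r := (@Config simtm (st m pc) l r).

Lemma st1 m pc : (m < 9)%N -> nat_of_ord (st m pc).1 = m.
Proof. by move=> h; rewrite /= inordK. Qed.

Lemma st2 m pc : (pc <= nlab)%N -> nat_of_ord (st m pc).2 = pc.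
Proof. by move=> h; rewrite /= inordK. Qed.

Lemma onth_sumn (f : instr -> nat) (c : seq instr) i pc : onth c pc = Some i -> (f i <= sumn (map f c))%N.
Proof. by elim: c pc => [|j c ih] [|pc] //= => [[->]|/ih]; lia. Qed.

Lemma onth_ltn (T : Type) (c : seq T) i pc : onth c pc = Some i -> (pc < size c)%N.
Proof. by elim: c pc => [|j c ih] [|pc] //= /ih. Qed.

Definition nomark (cs : seq sym) := all (fun a => a != mark) cs.

Definition rep (s : store) (cs : seq sym) :=
  forall r, (r <= kreg)%N -> forall i, trk (nth None cs i) r = onth (rev (s r)) i.

Lemma fwd_scan pc i cs l r : (pc <= nlab)%N -> onth code pc = Some i ->
  all (fun a => trk a (ireg i) : bool) cs ->
  reach (@tm_step simtm) (size cs) (cf 3 pc l (cs ++ r)) (cf 3 pc (rev cs ++ l) r).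
Proof.
move=> hpc hi; elim: cs l => [|a cs ih] l //= /andP[ha hc].
apply: (@reachS _ _ _ _ _ (cf 3 pc (a :: l) (cs ++ r))).
  by rewrite /= /simdelta st1 // st2 // hi ha.
by rewrite rev_cons cat_rcons; exact: ih.
Qed.

Lemma back_scan m pc L l0 x r : (m == 5) || (m == 7) -> (pc <= nlab)%N ->
  nomark L -> x != mark ->
  reach (@tm_step simtm) (size L).+1 (cf m pc (L ++ mark :: l0) (x :: r))
     (cf m pc l0 (mark :: rev L ++ x :: r)).
Proof.
move=> hm hpc; elim: L x r => [|a L ih] x r /=.
  move=> _ hx; apply: (@reachS _ _ _ _ _ (cf m pc l0 (mark :: x :: r))) => //.
  by rewrite /= /simdelta; case/orP: hm => /eqP ->; rewrite st1 // st2 // (negPf hx).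
move=> /andP[ha hL] hx.
apply: (@reachS _ _ _ _ _ (cf m pc (L ++ mark :: l0) (a :: x :: r))).
  by rewrite /= /simdelta; case/orP: hm => /eqP ->; rewrite st1 // st2 // (negPf hx).
by have := ih a (x :: r) hL ha; rewrite rev_cons cat_rcons.
Qed.

Lemma rep_size s cs r : rep s cs -> (r <= kreg)%N -> (size (s r) <= size cs)%N.
Proof.
move=> h hr; case: leqP => // hlt.
have := h r hr (size cs); rewrite nth_default //= => e.
have := onthE (rev (s r)) (size cs).
have hs : (size cs < size (rev (s r)))%N by rewrite size_rev.
by rewrite -e; move: hs; elim: (rev (s r)) (size cs) e => [|b t iht] [|n] //=; apply: iht.
Qed.

Lemma onth_some (T : Type) (c : seq T) i : (i < size c)%N -> exists x, onth c i = Some x.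
Proof. elim: c i => // x c ih [|i] /= h; [by exists x|exact: ih]. Qed.

Lemma onth_none (T : Type) (c : seq T) i : (size c <= i)%N -> onth c i = None.
Proof. by elim: c i => [|x c ih] [|i] //= h; exact: ih. Qed.

Lemma rep_take s cs r : rep s cs -> (r <= kreg)%N ->
  all (fun a => trk a r : bool) (take (size (s r)) cs).
Proof.
move=> h hr; apply/(all_nthP None) => i; rewrite size_takel ?(rep_size h hr) // => hi.
rewrite nth_take // h //.
by have [|x ->] := @onth_some _ (rev (s r)) i; rewrite ?size_rev.
Qed.

Lemma rep_upd s cs r v l : rep s cs -> (r <= kreg)%N ->
  forall m, (forall i, onth (rev l) i = if i == m then v else onth (rev (s r)) i) ->
  rep (upd s r l) (set_nth None cs m (setk (nth None cs m) r v)).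
Proof.
move=> h hr m hl r' hr' i; rewrite nth_set_nth /= /upd.
case: (altP (i =P m)) => [->|ne].
  by rewrite trk_setk //; case: (altP (r' =P r)) => [_|//]; rewrite ?hl ?eqxx ?h.
by rewrite h //; case: eqP => // ->; rewrite hl (negPf ne).
Qed.

Lemma onth_rcons (T : Type) (t : seq T) b i :
  onth (rcons t b) i = if i == size t then Some b else onth t i.
Proof. by elim: t i => [|x t ih] [|i] //=; case: i. Qed.

Lemma split_set_nth (cs : seq sym) m y : (m <= size cs)%N ->
  take m cs ++ y :: behead (drop m cs) = set_nth None cs m y.
Proof.
move=> h; rewrite set_nthE -drop1 drop_drop; case: ltnP => h2; first by rewrite add1n.
have e : m = size cs by apply/eqP; rewrite eqn_leq h h2.
by rewrite take_oversize // drop_oversize ?add1n ?e // subnn.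
Qed.

Lemma back_all pc L l0 r : (pc <= nlab)%N -> nomark L ->
  reach (@tm_step simtm) (size L).+1
    (cf 5 pc (behead (L ++ mark :: l0)) (head None (L ++ mark :: l0) :: r))
    (cf 2 pc l0 (mark :: rev L ++ r)).
Proof.
move=> hpc; case: L => [|a L] /= hL.
  by apply: reach1; rewrite /= /simdelta st1 // st2 // eqxx.
case/andP: hL => ha hL; rewrite -[(size L).+2]addn1.
apply: reach_cat (@back_scan 5 pc L l0 a r isT hpc hL ha) _.
apply: reach1; rewrite /= /simdelta st1 // st2 // eqxx /=.
by rewrite rev_cons cat_rcons.
Qed.

Lemma back7 pc L l0 r : (pc <= nlab)%N -> nomark L ->
  reach (@tm_step simtm) (size L)
    (cf 7 pc (behead (L ++ mark :: l0)) (head None (L ++ mark :: l0) :: r))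
    (cf 7 pc l0 (mark :: rev L ++ r)).
Proof.
move=> hpc; case: L => [|a L] /= hL; first by [].
case/andP: hL => ha hL; rewrite rev_cons cat_rcons.
exact: (@back_scan 7 pc L l0 a r isT hpc hL ha).
Qed.

Lemma sim_step s pc s' pc' cs l0 N : rep s cs -> nomark cs -> (pc <= nlab)%N ->
  (forall r, (size (s r) <= N)%N) ->
  istep code (pc, s) = Some (pc', s') ->
  exists n cs', [/\ reach (@tm_step simtm) n (cf 2 pc l0 (mark :: cs)) (cf 2 pc' l0 (mark :: cs')),
    rep s' cs', nomark cs', (pc' <= nlab)%N & (n <= 2 * N + 5)%N].
Proof.
move=> hrep hnm hpc hN; rewrite /istep; case E : (onth code pc) => [i|//] hs.
have hr : (ireg i <= kreg)%N := onth_sumn ireg E.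
have hl : (ilab i <= sumn (map ilab code))%N := onth_sumn ilab E.
have hpc1 := onth_ltn E.
have hpc2 : (pc.+1 <= nlab)%N by rewrite /nlab; lia.
have [r er] : exists r, r = ireg i by exists (ireg i).
rewrite -er in hr; set m := size (s r).
have hm : (m <= size cs)%N := rep_size hrep hr.
have hmN : (m <= N)%N := hN r.
have nmt : nomark (take m cs).
  by move: hnm; rewrite /nomark -{1}(cat_take_drop m cs) all_cat => /andP[].
have nmd : nomark (behead (drop m cs)).
  move: hnm; rewrite /nomark -{1}(cat_take_drop m cs) all_cat => /andP[_].
  by case: (drop m cs) => //= ? ? /andP[].
have nmr : nomark (rev (take m cs)) by rewrite /nomark all_rev.
set x := head None (drop m cs).
have ex : x = nth None cs m by rewrite /x -nth0 nth_drop addn0.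
have nmx : x != mark.
  rewrite ex; case: (ltnP m (size cs)) => h; last by rewrite nth_default.
  exact: (allP hnm _ (mem_nth _ h)).
have tx : trk x r = None by rewrite ex hrep // onth_none // size_rev.
set P := rev (take m cs) ++ mark :: l0.
have go : reach (@tm_step simtm) (1 + m) (cf 2 pc l0 (mark :: cs)) (cf 3 pc P (drop m cs)).
  apply: (@reach_cat _ _ _ _ _ (cf 3 pc (mark :: l0) cs)).
    by apply: reach1; rewrite /= /simdelta st1 // st2 // hpc1.
  have := @fwd_scan pc i (take m cs) (mark :: l0) (drop m cs) hpc E.
  by rewrite cat_take_drop size_takel // -er; apply; apply: rep_take.
have szr : size (rev (take m cs)) = m by rewrite size_rev size_takel.
pose cs1 := take m cs ++ x :: behead (drop m cs).
have ecs1 : cs1 = set_nth None cs m x by rewrite /cs1 split_set_nth.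
have hrep1 : rep s cs1.
  by move=> r' hr' j; rewrite ecs1 nth_set_nth /=; case: eqP => [->|_]; rewrite ?ex hrep.
have nm1 : nomark cs1 by rewrite /nomark all_cat /= nmx; apply/andP.
case: i E hl er hs => [r' b|r'|r' la lb lc] E hl /= er [<- <-]; subst r'.
- exists (1 + m + 1 + m.+1)%N, (take m cs ++ setk x r (Some b) :: behead (drop m cs)).
  split=> //; last lia.
  + apply: (@reach_cat _ _ _ _ _ (cf 5 pc.+1 (behead P) (head None P :: setk x r (Some b) :: behead (drop m cs)))).
      apply: reach_cat go _; apply: reach1.
      by rewrite /= /simdelta st1 // st2 // E /= -/x tx.
    by have := @back_all pc.+1 (rev (take m cs)) l0 (setk x r (Some b) :: behead (drop m cs)) hpc2 nmr; rewrite szr revK.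
  + rewrite split_set_nth // ex; apply: rep_upd => // j.
    by rewrite rev_cons onth_rcons size_rev.
  + by rewrite /nomark all_cat /=; apply/andP.
- have go2 : reach (@tm_step simtm) (1 + m + 1) (cf 2 pc l0 (mark :: cs))
     (cf 4 pc (behead P) (head None P :: x :: behead (drop m cs))).
    apply: reach_cat go _; apply: reach1.
    by rewrite /= /simdelta st1 // st2 // E /= -/x tx.
  case Em : (s r) => [|b l].
    exists (1 + m + 1 + 1)%N, cs1; split=> //; last lia.
    + apply: reach_cat go2 _; apply: reach1.
      by rewrite /cs1 /P /m Em take0 /= /simdelta st1 // st2 // E eqxx.
    + by move=> r' hr' j; rewrite hrep1 // /upd; case: eqP => // ->; rewrite Em.
  have m1 : m = (size l).+1 by rewrite /m Em.
  have [T [a eT]] : exists T a, take m cs = rcons T a.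
    case/lastP: (take m cs) (size_takel hm) => [|T a]; last by exists T, a.
    by rewrite m1.
  have zT : size T = size l by move: (size_takel hm); rewrite eT size_rcons m1 => -[].
  have /andP[nma nmT] : (a != mark) && nomark T by move: nmt; rewrite eT /nomark all_rcons.
  have ea : a = nth None cs1 (size l) by rewrite /cs1 eT cat_rcons nth_cat zT ltnn subnn.
  exists (1 + m + 1 + 1 + (size T).+1)%N, (T ++ setk a r None :: x :: behead (drop m cs)).
  split=> //.
  + apply: reach_cat; first apply: reach_cat go2 _; first apply: reach1.
      rewrite /= /simdelta st1 // st2 // E /P eT rev_rcons /= (negPf nma); reflexivity.
    have := @back_all pc.+1 (rev T) l0 (setk a r None :: x :: behead (drop m cs)) hpc2.
    by rewrite /nomark all_rev size_rev revK => /(_ nmT).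
  + have -> : T ++ setk a r None :: x :: behead (drop m cs) = set_nth None cs1 (size l) (setk (nth None cs1 (size l)) r None).
      rewrite -ea -split_set_nth; last by rewrite /cs1 eT cat_rcons size_cat zT leq_addr.
      by rewrite /cs1 eT cat_rcons take_size_cat // drop_size_cat.
    apply: rep_upd => // j; rewrite Em /= rev_cons onth_rcons size_rev.
    by case: eqP => // ->; rewrite onth_none // size_rev.
  + by rewrite /nomark all_cat /= nmx; apply/and3P; split.
  + lia.
- have go2 : reach (@tm_step simtm) (1 + m + 1) (cf 2 pc l0 (mark :: cs))
     (cf 4 pc (behead P) (head None P :: x :: behead (drop m cs))).
    apply: reach_cat go _; apply: reach1.
    by rewrite /= /simdelta st1 // st2 // E /= -/x tx.
  case Em : (s r) => [|b l].
    rewrite /= in hl; exists (1 + m + 1 + 1)%N, cs1; split=> //; try (rewrite /nlab; lia).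
    apply: reach_cat go2 _; apply: reach1.
    by rewrite /cs1 /P /m Em take0 /= /simdelta st1 // st2 // E eqxx.
  have m1 : m = (size l).+1 by rewrite /m Em.
  have [T [a eT]] : exists T a, take m cs = rcons T a.
    case/lastP: (take m cs) (size_takel hm) => [|T a]; last by exists T, a.
    by rewrite m1.
  have zT : size T = size l by move: (size_takel hm); rewrite eT size_rcons m1 => -[].
  have /andP[nma nmT] : (a != mark) && nomark T by move: nmt; rewrite eT /nomark all_rcons.
  have ea : a = nth None cs1 (size l) by rewrite /cs1 eT cat_rcons nth_cat zT ltnn subnn.
  have ta : trk a r = Some b.
    by rewrite ea hrep1 // Em rev_cons onth_rcons size_rev eqxx.
  set pc2 := (if b then lc else lb).
  have hpc3 : (pc2 <= nlab)%N by rewrite /= in hl; rewrite /pc2 /nlab; case: (b); lia.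
  exists (1 + m + 1 + 1 + (size T).+1)%N, cs1; split=> //; last lia.
  apply: reach_cat; first apply: reach_cat go2 _; first apply: reach1.
    rewrite /= /simdelta st1 // st2 // E /P eT rev_rcons /= (negPf nma) ta; reflexivity.
  have -> : (if Some b is Some true then lc else lb) = pc2 by rewrite /pc2; case: (b).
  have := @back_all pc2 (rev T) l0 (a :: x :: behead (drop m cs)) hpc3.
  by rewrite /nomark all_rev size_rev revK /cs1 eT cat_rcons => /(_ nmT).
Qed.

Lemma istep_size s pc s' pc' N : (forall r, (size (s r) <= N)%N) ->
  istep code (pc, s) = Some (pc', s') -> forall r, (size (s' r) <= N.+1)%N.
Proof.
move=> h; rewrite /istep; case: (onth code pc) => [[r b|r|r a b c]|] // [_ <-] r'; rewrite ?/upd.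
- by case: ifP => _ /=; have := h r'; have := h r; lia.
- by case: ifP => _ /=; rewrite ?size_behead; have := h r'; have := h r; lia.
- by have := h r'; lia.
Qed.

Lemma sim_run n s pc s' pc' cs l0 N : rep s cs -> nomark cs -> (pc <= nlab)%N ->
  (forall r, (size (s r) <= N)%N) ->
  reach (istep code) n (pc, s) (pc', s') ->
  exists m cs', [/\ reach (@tm_step simtm) m (cf 2 pc l0 (mark :: cs)) (cf 2 pc' l0 (mark :: cs')),
    rep s' cs', nomark cs', (forall r, size (s' r) <= N + n)%N & (m <= n * (2 * (N + n) + 5))%N].
Proof.
elim: n s pc cs N => [|n ih] s pc cs N hrep hnm hpc hN; rewrite /reach -/reach.
  by case=> <- <-; exists 0%N, cs; split=> // r; rewrite addn0.
case=> -[pc1 s1] e1 h.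
have [m1 [cs1 [r1 rep1 nm1 hpc1 b1]]] := sim_step l0 hrep hnm hpc hN e1.
have hN1 := istep_size hN e1.
have [m2 [cs2 [r2 rep2 nm2 hN2 b2]]] := ih _ _ _ _ rep1 nm1 hpc1 hN1 h.
exists (m1 + m2)%N, cs2; split=> //.
- exact: reach_cat r1 r2.
- by move=> r; have := hN2 r; lia.
- by nia.
Qed.

Definition outb (b : bool) : sym := Some (inl b).

Lemma out_scan pc bs cs l r : (pc <= nlab)%N -> map (fun a => trk a 0) cs = map Some bs ->
  reach (@tm_step simtm) (size cs) (cf 6 pc l (cs ++ r)) (cf 6 pc (rev (map outb bs) ++ l) r).
Proof.
move=> hpc; elim: cs bs l => [|a cs ih] [|b bs] l //= [ha hc].
apply: (@reachS _ _ _ _ _ (cf 6 pc (outb b :: l) (cs ++ r))); first by rewrite /= /simdelta st1 // st2 // ha.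
by rewrite rev_cons cat_rcons; exact: ih.
Qed.

Lemma read_bits_out (bs : seq bool) r : read_bits (map outb bs ++ None :: r) = bs.
Proof. by elim: bs => //= b bs ->. Qed.

Lemma sim_out s cs pc l0 : rep s cs -> nomark cs -> pc = size code ->
  exists2 c, reach (@tm_step simtm) (2 * size (s 0%N) + 3) (cf 2 pc l0 (mark :: cs)) c &
    tm_step c = None /\ tm_output c = rev (s 0%N).
Proof.
move=> hrep hnm epc; have hpc : (pc <= nlab)%N by rewrite epc leq_addr.
set bs := rev (s 0%N); set m := size (s 0%N).
have hm : (m <= size cs)%N := rep_size hrep (leq0n _).
have zb : size bs = m by rewrite size_rev.
have eb : map (fun a => trk a 0) (take m cs) = map Some bs.
  apply: (@eq_from_nth _ None); first by rewrite !size_map size_takel // zb.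
  move=> j; rewrite size_map size_takel // => hj.
  rewrite (nth_map None) ?size_takel // nth_take // hrep // onthE -/bs.
  by rewrite (nth_map false) ?zb // (nth_map false) ?zb.
set x := head None (drop m cs).
have ex : x = nth None cs m by rewrite /x -nth0 nth_drop addn0.
have tx : trk x 0 = None by rewrite ex hrep // onth_none // size_rev.
exists (cf 8 pc (mark :: l0) (map outb bs ++ None :: behead (drop m cs))); last first.
  by split; [rewrite /= /simdelta st1|rewrite /tm_output /= read_bits_out].
set P := rev (map outb bs) ++ mark :: l0.
have -> : (2 * m + 3 = 1 + m + 1 + m + 1)%N by lia.
apply: (@reach_cat _ _ _ _ _ (cf 7 pc l0 (mark :: map outb bs ++ None :: behead (drop m cs)))); last first.
  by apply: reach1; rewrite /= /simdelta st1 // st2 // eqxx.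
apply: (@reach_cat _ _ _ _ _ (cf 7 pc (behead P) (head None P :: None :: behead (drop m cs)))).
  apply: (@reach_cat _ _ _ _ _ (cf 6 pc P (drop m cs))).
    apply: (@reach_cat _ _ _ _ _ (cf 6 pc (mark :: l0) cs)).
      by apply: reach1; rewrite /= /simdelta st1 // st2 // epc ltnn.
    by have := @out_scan pc bs (take m cs) (mark :: l0) (drop m cs) hpc eb; rewrite cat_take_drop size_takel.
  by apply: reach1; rewrite /= /simdelta st1 // st2 // -/x tx.
have := @back7 pc (rev (map outb bs)) l0 (None :: behead (drop m cs)) hpc.
rewrite size_rev size_map zb revK; apply.
by rewrite /nomark all_rev; elim: (bs).
Qed.


Lemma tm_run_reach (M : turing_machine) n (c c' : config M) t : (n <= t)%N ->
  reach (@tm_step M) n c c' -> tm_step c' = None -> tm_run t c = Some c'.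
Proof.
move=> h; elim: n t c h => [|n ih] t c h.
  by move=> <- e; case: t {h} => [|t] /=; rewrite e.
case: t h => // t h [c1 e1 h1] e /=; rewrite e1; exact: ih.
Qed.

(** The input tape already represents the store whose register 0 is rev x: plain bits are read as
    track 0, and the bottom of a stack lies next to the marker. *)
Lemma simtm_correct n s' x :
  reach (istep code) n (0%N, fun r => if r == 0%N then rev x else [::]) (size code, s') ->
  exists2 c, tm_run (2 + n * (2 * (size x + n) + 5) + (2 * (size x + n) + 3)) (tm_init simtm x) = Some c
    & tm_output c = rev (s' 0%N).
Proof.
move=> hn; set s0 := fun r => _ in hn; set l := map outb x.
(* The first move writes the scanned cell back, so it is listed even when the input is empty. *)
pose cs := head None l :: behead l.
have ncs j : nth None cs j = nth None l j.
  by rewrite /cs; case: (l) j => [|a t] [|j] //=; rewrite nth_nil.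
have hrep : rep s0 cs.
  move=> r hr j; rewrite ncs /s0 /l.
  case: (ltnP j (size x)) => h.
    rewrite (nth_map false) //=; case: eqP => _; last by case: (j).
    by rewrite revK onthE (nth_map false).
  by rewrite nth_default ?size_map //=; case: ifP => _; rewrite onth_none // revK.
have hnm : nomark cs by rewrite /nomark /cs /l; case: (x) => //= b t; elim: t.
have hN r : (size (s0 r) <= size x)%N by rewrite /s0; case: ifP; rewrite // size_rev.
have [m [cs' [r1 rep1 nm1 hN1 b1]]] := sim_run [::] hrep hnm (leq0n _) hN hn.
have [c r2 [e2 o2]] := sim_out [::] rep1 nm1 erefl.
exists c => //.
apply: (@tm_run_reach _ (2 + (m + (2 * size (s' 0%N) + 3)))) e2.
  by have := hN1 0%N; lia.
apply: (@reachS _ _ _ _ _ (cf 1 0 [::] (None :: cs))); first by rewrite /= /simdelta st1.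
apply: (@reachS _ _ _ _ _ (cf 2 0 [::] (mark :: cs))); first by rewrite /= /simdelta st1.
exact: reach_cat r1 r2.
Qed.

End Simulation.

(** * Polynomial bounds *)

Definition pbd (g : nat -> nat) : Prop := exists k, forall n, (g n <= n.+2 ^ k)%N.

Lemma pbd_le g h : (forall n, (g n <= h n)%N) -> pbd h -> pbd g.
Proof. by move=> e [k hk]; exists k => n; apply: leq_trans (e n) (hk n). Qed.

Lemma pbd_cst c : pbd (fun _ => c).
Proof.
exists c => n; apply: leq_trans (ltnW (ltn_expl c (isT : 1 < 2)%N)) _.
by case: c => // c; rewrite leq_exp2r.
Qed.

Lemma pbd_id : pbd id.
Proof. by exists 1%N => n; rewrite expn1; lia. Qed.

Lemma pbd_add g h : pbd g -> pbd h -> pbd (fun n => g n + h n)%N.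
Proof.
move=> [k hk] [l hl]; exists (maxn k l).+1 => n.
have h1 := leq_trans (hk n) (leq_pexp2l (isT : 0 < n.+2)%N (leq_maxl k l)).
have h2 := leq_trans (hl n) (leq_pexp2l (isT : 0 < n.+2)%N (leq_maxr k l)).
rewrite expnS; nia.
Qed.

Lemma pbd_mul g h : pbd g -> pbd h -> pbd (fun n => g n * h n)%N.
Proof. by move=> [k hk] [l hl]; exists (k + l)%N => n; rewrite expnD leq_mul. Qed.

Lemma pbd_exp g k : pbd g -> pbd (fun n => g n ^ k)%N.
Proof.
move=> hg; elim: k => [|k ih]; first exact: pbd_cst.
by under eq_fun do rewrite expnS; apply: pbd_mul.
Qed.

Lemma pbd_comp g h : pbd g -> pbd h -> pbd (fun n => g (h n)).
Proof.
move=> [k hk] ph; apply: pbd_le (fun n => hk (h n)) _; apply: pbd_exp.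
apply: (@pbd_le _ (fun n => h n + 2)%N) => [n|]; first lia.
by apply: pbd_add => //; apply: pbd_cst.
Qed.

Lemma pbd_poly g : pbd g -> exists p : {poly nat}, forall n, (g n <= p.[n])%N.
Proof.
move=> [k hk]; exists (('X + 2%:P) ^+ k) => n; apply: leq_trans (hk n) _.
rewrite horner_exp hornerD hornerX hornerC -[_ + _]/(n + 2)%N addn2.
by have -> : forall m, ((n.+2 : nat) ^+ m = n.+2 ^ m)%N by elim=> // m ih; rewrite exprS expnS ih.
Qed.

Theorem polytime_exec (c : cmd) (f : seq bool -> seq bool) (g : nat -> nat) : pbd g ->
  (forall x, exists s' t, [/\ exec c (fun r => if r == 0%N then rev x else [::]) s' t,
     (t <= g (size x))%N & s' 0%N = rev (f x)]) -> polytime f.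
Proof.
move=> pg h; pose code := compile 0 c.
pose b n := (2 + g n * (2 * (n + g n) + 5) + (2 * (n + g n) + 3))%N.
have [p hp] : exists p : {poly nat}, forall n, (b n <= p.[n])%N.
  apply: pbd_poly; rewrite /b; repeat (apply: pbd_add || apply: pbd_mul || apply: pbd_cst || apply: pg || apply: pbd_id).
exists (simtm code), p => x; have [s' [t [ex ht es]]] := h x.
have [n hn] := compile_correct ex [::] [::].
rewrite cats0 /= add0n -(size_compile 0 c) -/code => /simtm_correct [cf hr ho].
exists cf; last by rewrite ho es revK.
have := hp (size x); rewrite /b => hb.
have [m hm e] : exists2 m, (m <= 2 + n * (2 * (size x + n) + 5) + (2 * (size x + n) + 3))%N &
   reach (@tm_step _) m (tm_init (simtm code) x) cf /\ tm_step cf = None.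
  elim: (2 + _ + _)%N (tm_init _ _) hr => [|k ih] c0 /=.
    by case e: (tm_step c0) => // -[<-]; exists 0%N.
  case e: (tm_step c0) => [c1|]; last by case=> <-; exists 0%N.
  by move/ih=> [m hm [h1 h2]]; exists m.+1 => //; split=> //; apply: reachS e h1.
apply: tm_run_reach e.1 e.2; apply: leq_trans hm _; apply: leq_trans hb; nia.
Qed.

(** * Polynomial-time functions on trees *)

Inductive tree := Lf | Nd of tree & tree.

(** Preorder, one bit per node. The code is self-delimiting, so that concatenated codes can be
    parsed with one counter. *)
Fixpoint tcode (t : tree) : seq bool :=
  if t is Nd a b then true :: tcode a ++ tcode b else [:: false].

Definition tsize (t : tree) : nat := size (tcode t).

Lemma tsize_gt0 t : (0 < tsize t)%N.
Proof. by case: t. Qed.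

Lemma tsize_Nd a b : tsize (Nd a b) = (tsize a + tsize b).+1.
Proof. by rewrite /tsize /= size_cat. Qed.

Definition st0 (l : seq bool) : store := fun r => if r == 0%N then l else [::].

Fixpoint ren (f : nat -> nat) (c : cmd) : cmd :=
  match c with
  | Nop => Nop
  | Push r b => Push (f r) b
  | Pop r => Pop (f r)
  | Seq a b => Seq (ren f a) (ren f b)
  | Case r a b d => Case (f r) (ren f a) (ren f b) (ren f d)
  | While r a => While (f r) (ren f a)
  end.

Lemma exec_ren f c s s' n : injective f -> exec c s s' n ->
  forall S : store, (forall r, S (f r) = s r) ->
  exists S', [/\ exec (ren f c) S S' n, forall r, S' (f r) = s' r
    & forall r, (forall i, r != f i) -> S' r = S r].
Proof.
move=> fi; elim=> {c s s' n}.
- by move=> s S e; exists S; split=> //; constructor.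
- move=> r b s S e; exists (upd S (f r) (b :: S (f r))); split; first by constructor.
    by move=> i; rewrite /upd (inj_eq fi) !e.
  by move=> i h; rewrite /upd (negbTE (h r)).
- move=> r s S e; exists (upd S (f r) (behead (S (f r)))); split; first by constructor.
    by move=> i; rewrite /upd (inj_eq fi) !e.
  by move=> i h; rewrite /upd (negbTE (h r)).
- move=> c1 c2 s s1 s2 t1 t2 _ h1 _ h2 S e.
  have [S1 [x1 e1 o1]] := h1 S e; have [S2 [x2 e2 o2]] := h2 S1 e1.
  exists S2; split=> //; first exact: ESeq x1 x2.
  by move=> r hr; rewrite o2 // o1.
- move=> r c0 c1 c2 s s' t _ h S e; have [S1 [x1 e1 o1]] := h S e.
  exists S1; split=> //; constructor; rewrite e.
  by case: (s r) x1 => [|[] ?].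
- by move=> r c s e S eS; exists S; split=> //; apply: EWhile0; rewrite eS.
- move=> r c s s1 s2 t1 t2 ne _ h1 _ h2 S e.
  have [S1 [x1 e1 o1]] := h1 S e; have [S2 [x2 e2 o2]] := h2 S1 e1.
  exists S2; split=> //; first by apply: EWhile1 x1 x2; rewrite e.
  by move=> i hi; rewrite o2 // o1.
Qed.

Lemma exec_size c s s' n : exec c s s' n -> forall r, (size (s' r) <= size (s r) + n)%N.
Proof.
elim=> {c s s' n} //=.
- by move=> s r; lia.
- by move=> r b s i; rewrite /upd; case: eqP => [->|_] /=; lia.
- by move=> r s i; rewrite /upd; case: eqP => [->|_] /=; rewrite ?size_behead; lia.
- by move=> c1 c2 s s1 s2 t1 t2 _ h1 _ h2 r; have := h1 r; have := h2 r; lia.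
- by move=> r c0 c1 c2 s s' t _ h i; have := h i; lia.
- by move=> r c s _ i; lia.
- by move=> r c s s1 s2 t1 t2 _ _ h1 _ h2 i; have := h1 i; have := h2 i; lia.
Qed.

Definition shiftr (m i : nat) : nat := if i is 0 then 0 else i + m.

(* Runs a program in a store whose registers [1..m] are in use elsewhere. *)
Lemma exec_shift m c l l' n (S : store) : exec c (st0 l) (st0 l') n ->
  S 0%N = l -> (forall i, (m < i)%N -> S i = [::]) ->
  exec (ren (shiftr m) c) S (upd S 0 l') n.
Proof.
move=> h e0 em.
have inj : injective (shiftr m) by case=> [|i] [|j] //=; lia.
have [|S' [x e o]] := @exec_ren (shiftr m) _ _ _ _ inj h S.
  by case=> [|i] //=; rewrite em //; lia.
have <- : S' = upd S 0 l' => //.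
apply: funext => i; rewrite /upd; case: eqP => [->|/eqP i0]; first exact: (e 0%N).
case: (leqP i m) => him.
  by apply: o => -[|j] //=; lia.
have -> : i = shiftr m (i - m) by rewrite /shiftr; case E: (i - m)%N; lia.
rewrite e /st0 em; last by rewrite /shiftr; case E: (i - m)%N; lia.
by case: eqP => //; lia.
Qed.

Definition mv (r s : nat) : cmd :=
  While r (Case r Nop (Seq (Pop r) (Push s false)) (Seq (Pop r) (Push s true))).

Lemma exec_mv r s S : r != s ->
  exec (mv r s) S (upd (upd S s (rev (S r) ++ S s)) r [::]) (6 * size (S r) + 1).
Proof.
move=> rs; move El : (S r) => l; elim: l S El => [|b l ih] S El.
  have -> : upd (upd S s (rev [::] ++ S s)) r [::] = S; last exact: EWhile0.
  by apply: funext => i; rewrite /upd; case: eqP => [->|_] //; case: eqP => [->|].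
pose S1 := upd (upd S r l) s (b :: S s).
have -> : (6 * size (b :: l) + 1 = (4 + (6 * size l + 1)).+2)%N by rewrite /=; lia.
apply: (@EWhile1 _ _ _ S1); first by rewrite El.
  have x1 : exec (Seq (Pop r) (Push s b)) S S1 2.
    rewrite -[2%N]/(1 + 1)%N; apply: ESeq (EPop r S) _; rewrite El /=.
    have -> : S1 = upd (upd S r l) s (b :: upd S r l s); last exact: EPush.
    by congr (upd _ _ (_ :: _)); rewrite /upd eq_sym (negbTE rs).
  by constructor; rewrite El; case: (b) x1.
have := ih S1; rewrite /S1 {1}/upd (negbTE rs) {1}/upd eqxx => /(_ erefl) x2.
move: x2; congr exec; apply: funext => i; rewrite /upd; case: eqP => // _.
case: eqP => // _; rewrite eqxx rev_cons cat_rcons //.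
Qed.

Definition mv2 (r s1 s2 : nat) : cmd :=
  While r (Case r Nop (Seq (Pop r) (Seq (Push s1 false) (Push s2 false)))
                      (Seq (Pop r) (Seq (Push s1 true) (Push s2 true)))).

Lemma exec_mv2 r s1 s2 S : r != s1 -> r != s2 -> s1 != s2 ->
  exec (mv2 r s1 s2) S
    (upd (upd (upd S s1 (rev (S r) ++ S s1)) s2 (rev (S r) ++ S s2)) r [::]) (7 * size (S r) + 1).
Proof.
move=> rs1 rs2 ss; move El : (S r) => l; elim: l S El => [|b l ih] S El.
  have <- : S = upd (upd (upd S s1 (rev [::] ++ S s1)) s2 (rev [::] ++ S s2)) r [::]; last exact: EWhile0.
  by apply: funext => i; rewrite /upd; do 3 (case: eqP => [->|_] //).
pose S1 := upd (upd (upd S r l) s1 (b :: S s1)) s2 (b :: S s2).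
have -> : (7 * size (b :: l) + 1 = (5 + (7 * size l + 1)).+2)%N by rewrite /=; lia.
apply: (@EWhile1 _ _ _ S1); first by rewrite El.
  have x1 : exec (Seq (Pop r) (Seq (Push s1 b) (Push s2 b))) S S1 3.
    rewrite -[3%N]/(1 + (1 + 1))%N; apply: ESeq (EPop r S) _; rewrite El /=.
    apply: ESeq (EPush s1 b _) _.
    have -> : S1 = upd (upd (upd S r l) s1 (b :: upd S r l s1)) s2
       (b :: upd (upd S r l) s1 (b :: upd S r l s1) s2); last exact: EPush.
    rewrite /S1; congr (upd (upd _ _ (_ :: _)) _ (_ :: _)); rewrite /upd.
      by rewrite eq_sym (negbTE rs1).
    by rewrite [s2 == s1]eq_sym (negbTE ss) [s2 == r]eq_sym (negbTE rs2).
  by constructor; rewrite El; case: (b) x1.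
have := ih S1; rewrite /S1 {1}/upd (negbTE rs2) {1}/upd (negbTE rs1) {1}/upd eqxx => /(_ erefl) x2.
move: x2; congr exec; apply: funext => i; rewrite /upd; case: eqP => // _.
case: eqP => [_|_]; first by rewrite eqxx rev_cons cat_rcons.
by case: eqP => // _; rewrite eqxx (negbTE ss) rev_cons cat_rcons.
Qed.

Definition clr (r : nat) : cmd := While r (Pop r).

Lemma exec_clr r S : exec (clr r) S (upd S r [::]) (3 * size (S r) + 1).
Proof.
move El : (S r) => l; elim: l S El => [|b l ih] S El.
  have <- : S = upd S r [::]; last exact: EWhile0.
  by apply: funext => i; rewrite /upd; case: eqP => [->|].
have -> : (3 * size (b :: l) + 1 = (1 + (3 * size l + 1)).+2)%N by rewrite /=; lia.
apply: EWhile1 (EPop r S) _; first by rewrite El.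
have := ih (upd S r (behead (S r))); rewrite {1}/upd eqxx El => /(_ erefl).
by congr exec; apply: funext => i; rewrite /upd; case: eqP.
Qed.

Fixpoint pushes (r : nat) (l : seq bool) : cmd :=
  if l is b :: l' then Seq (pushes r l') (Push r b) else Nop.

Lemma exec_pushes r l S : exec (pushes r l) S (upd S r (l ++ S r)) (size l).
Proof.
elim: l => [|b l ih] /=.
  have <- : S = upd S r (S r); last exact: ENop.
  by apply: funext => i; rewrite /upd; case: eqP => [->|].
rewrite -addn1; apply: ESeq ih _.
have -> : upd S r (b :: l ++ S r) = upd (upd S r (l ++ S r)) r (b :: upd S r (l ++ S r) r); last exact: EPush.
by apply: funext => i; rewrite /upd eqxx; case: eqP.
Qed.

(* Moves the code of one tree from register 0 to register 1, reversed; register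
   2 counts the subtrees still to be read. *)
Definition parse_loop : cmd :=
  While 2 (Case 0 Nop (Seq (Pop 0) (Seq (Push 1 false) (Pop 2)))
                      (Seq (Pop 0) (Seq (Push 1 true) (Push 2 true)))).
Definition parse : cmd := Seq (Push 2 true) parse_loop.

Lemma exec_parse_loop t rest q (S S' : store) n :
  S 0%N = tcode t ++ rest -> S 2%N = true :: q ->
  exec parse_loop (upd (upd (upd S 0 rest) 1 (rev (tcode t) ++ S 1%N)) 2 q) S' n ->
  exec parse_loop S S' (n + 7 * tsize t).
Proof.
elim: t rest q S n => [|a iha b ihb] rest q S n e0 e2 h.
  have -> : (n + 7 * tsize Lf = (5 + n).+2)%N by rewrite /tsize /=; lia.
  apply: EWhile1 h; first by rewrite e2.
  constructor; rewrite e0 /= -[3%N]/(1 + (1 + 1))%N.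
  apply: ESeq (EPop _ _) _; apply: ESeq (EPush _ _ _) _.
  have := EPop 2 (upd (upd S 0 (behead (S 0%N))) 1 (false :: upd S 0 (behead (S 0%N)) 1%N)).
  congr exec; apply: funext => -[|[|[|i]]] //=; rewrite /upd /= ?e0 ?e2 //.
have -> : (n + 7 * tsize (Nd a b) = (5 + (n + 7 * tsize b + 7 * tsize a)).+2)%N by rewrite tsize_Nd; lia.
pose S1 := upd (upd (upd S 0 (tcode a ++ (tcode b ++ rest))) 1 (true :: S 1%N)) 2 (true :: true :: q).
apply: (@EWhile1 _ _ _ S1); first by rewrite e2.
  constructor; rewrite e0 /= -[3%N]/(1 + (1 + 1))%N.
  apply: ESeq (EPop _ _) _; apply: ESeq (EPush _ _ _) _.
  have := EPush 2 true (upd (upd S 0 (behead (S 0%N))) 1 (true :: upd S 0 (behead (S 0%N)) 1%N)).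
  congr exec; apply: funext => -[|[|[|i]]] //=; rewrite /upd /S1 /upd /= ?e0 ?e2 //= catA //.
apply: (iha (tcode b ++ rest) (true :: q)) => //.
apply: (ihb rest q) => //.
move: h; congr exec; apply: funext => -[|[|[|i]]] //=.
by rewrite /S1 /upd /= rev_cons rev_cat -!cats1 -!catA.
Qed.

Lemma exec_parse t rest (S : store) :
  S 0%N = tcode t ++ rest -> S 2%N = [::] ->
  exec parse S (upd (upd S 0 rest) 1 (rev (tcode t) ++ S 1%N)) (7 * tsize t + 2).
Proof.
move=> e0 e2; have -> : (7 * tsize t + 2 = 1 + (1 + 7 * tsize t))%N by lia.
apply: ESeq (EPush _ _ _) _; apply: (@exec_parse_loop t rest [::]) => //.
  by rewrite /upd /= e2.
have := @EWhile0 2 (Case 0 Nop (Seq (Pop 0) (Seq (Push 1 false) (Pop 2)))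
                      (Seq (Pop 0) (Seq (Push 1 true) (Push 2 true))))
   (upd (upd S 0 rest) 1 (rev (tcode t) ++ S 1%N)) e2.
by congr exec; apply: funext => -[|[|[|i]]] //=; rewrite /upd /=.
Qed.

Ltac stext := apply: funext => -[|[|[|[|[|i]]]]] //=; rewrite /upd /st0 /=.

Class Enc (A : Type) := enc : A -> tree.

Definition sz (A : Type) {EA : Enc A} (a : A) : nat := tsize (enc a).

(** All registers but 0 are empty at the start and at the end, so programs compose by [Seq], and
    [exec_shift] runs them beside saved data. *)
Definition PT (A B : Type) {EA : Enc A} {EB : Enc B} (f : A -> B) : Prop :=
  exists c k, forall a, exists2 n, exec c (st0 (tcode (enc a))) (st0 (tcode (enc (f a)))) n
    & (n <= (sz a).+2 ^ k)%N.

#[global] Instance enc_unit : Enc unit := fun _ => Lf.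
#[global] Instance enc_bool : Enc bool := fun b => if b then Nd Lf Lf else Lf.
(* Unary: a bound polynomial in the size of the code is one in the number. *)
#[global] Instance enc_nat : Enc nat := fun n => iter n (Nd Lf) Lf.
#[global] Instance enc_prod (A B : Type) {EA : Enc A} {EB : Enc B} : Enc (A * B) :=
  fun p => Nd (enc p.1) (enc p.2).
#[global] Instance enc_seq (A : Type) {EA : Enc A} : Enc (seq A) :=
  fun s => foldr (fun x t => Nd (enc x) t) Lf s.

Ltac pbds := repeat (apply: pbd_add || apply: pbd_mul || apply: pbd_cst || apply: pbd_id || eexists).

Lemma exec_eq s s' : s = s' -> forall C u n, exec C u s n -> exec C u s' n.
Proof. by move=> ->. Qed.

Lemma powmono a b q : (a <= b)%N -> (a.+2 ^ q <= b.+2 ^ q)%N.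
Proof. by case: q => [|q] hab; rewrite ?expn0 // leq_exp2r // !ltnS. Qed.

Section Closure.
Context {A B C : Type} {EA : Enc A} {EB : Enc B} {EC : Enc C}.

Lemma PT_ext (f g : A -> B) : f =1 g -> PT f -> PT g.
Proof. by move=> e [c [k h]]; exists c, k => a; rewrite -e; apply: h. Qed.

Lemma PT_id : PT (@id A).
Proof. by exists Nop, 0%N => t; exists 0%N => //; exact: ENop. Qed.

Lemma PT_size (f : A -> B) : PT f -> exists k, forall t, (sz (f t) <= (sz t).+2 ^ k)%N.
Proof.
move=> [c [k h]]; exists k.+1 => t; have [n x hn] := h t.
have := exec_size x 0; rewrite /st0 /= -!/(tsize _) -!/(sz _) => e; rewrite expnS; nia.
Qed.

Lemma PT_cst (b : B) : PT (fun _ : A => b).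
Proof.
have [m hm] : pbd (fun n => 3 * n + 1 + tsize (enc b))%N by pbds.
exists (Seq (clr 0) (pushes 0 (tcode (enc b)))), m => t.
exists (3 * sz t + 1 + tsize (enc b))%N; last exact: hm.
apply: ESeq (exec_clr _ _) _.
set T := tcode (enc b); set U := tcode (enc t).
have := exec_pushes 0 T (upd (st0 U) 0 [::]).
by congr exec; stext; rewrite cats0.
Qed.

Lemma PT_fst_ : PT (fun p : A * B => p.1).
Proof.
have [m hm] : pbd (fun n => 3 + (7 * n + 2 + (3 * n + 1 + (6 * n + 1))))%N by pbds.
exists (Seq (Pop 0) (Seq parse (Seq (clr 0) (mv 1 0)))), m => -[p q].
set a := enc p; set b := enc q.
exists (1 + (7 * tsize a + 2 + (3 * tsize b + 1 + (6 * tsize a + 1))))%N; last first.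
  by apply: leq_trans (hm _); rewrite /sz -[enc (p, q)]/(Nd a b) tsize_Nd; lia.
rewrite -[enc (p, q)]/(Nd a b) /=; apply: ESeq (EPop _ _) _.
apply: ESeq (exec_parse (t := a) (rest := tcode b) _ _) _ => //.
apply: ESeq (exec_clr _ _) _.
have := @exec_mv 1 0 (upd (upd (upd (upd (st0 (true :: tcode a ++ tcode b)) 0 (tcode a ++ tcode b)) 0 (tcode b)) 1
   (rev (tcode a) ++ [::])) 0 [::]) isT.
rewrite {4}/upd /= {4}/upd /= cats0 size_rev; congr exec; stext.
by rewrite revK cats0.
Qed.

Lemma PT_snd_ : PT (fun p : A * B => p.2).
Proof.
have [m hm] : pbd (fun n => 3 + (7 * n + 2 + (3 * n + 1)))%N by pbds.
exists (Seq (Pop 0) (Seq parse (clr 1))), m => -[p q].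
set a := enc p; set b := enc q.
exists (1 + (7 * tsize a + 2 + (3 * tsize a + 1)))%N; last first.
  by apply: leq_trans (hm _); rewrite /sz -[enc (p, q)]/(Nd a b) tsize_Nd; lia.
rewrite -[enc (p, q)]/(Nd a b) /=; apply: ESeq (EPop _ _) _.
apply: ESeq (exec_parse (t := a) (rest := tcode b) _ _) _ => //.
have := @exec_clr 1 (upd (upd (upd (st0 (true :: tcode a ++ tcode b)) 0 (tcode a ++ tcode b)) 0 (tcode b)) 1
   (rev (tcode a) ++ [::])).
by rewrite {4}/upd /= cats0 size_rev; congr exec; stext.
Qed.

End Closure.

Lemma PT_comp {A B C : Type} {EA : Enc A} {EB : Enc B} {EC : Enc C} (f : A -> B) (g : B -> C) :
  PT f -> PT g -> PT (fun t => g (f t)).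
Proof.
move=> hf [c [k h]]; have [l hl] := PT_size hf; move: hf => [c' [k' h']].
have [m hm] : pbd (fun n => n.+2 ^ k' + (n.+2 ^ l).+2 ^ k)%N.
  apply: pbd_add; first by exists k'.
  apply: (@pbd_comp (fun n => n.+2 ^ k)%N); first by exists k.
  by exists l.
exists (Seq c' c), m => t; have [n1 x1 b1] := h' t; have [n2 x2 b2] := h (f t).
exists (n1 + n2)%N; first exact: ESeq x1 x2.
apply: leq_trans (hm _); apply: leq_add => //; apply: leq_trans b2 _.
by apply: powmono.
Qed.

Section Closure2.
Context {A B C D : Type} {EA : Enc A} {EB : Enc B} {EC : Enc C} {ED : Enc D}.

Lemma PT_fst (f : A -> B * C) : PT f -> PT (fun a => (f a).1).
Proof. by move=> h; apply: (PT_comp h); apply: PT_fst_. Qed.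

Lemma PT_snd (f : A -> B * C) : PT f -> PT (fun a => (f a).2).
Proof. by move=> h; apply: (PT_comp h); apply: PT_snd_. Qed.

(** The input is duplicated by way of register 2; [f] runs beside the copy in register 1, and its
    result waits in register 2 while [g] runs on that copy. *)
Lemma PT_pair (f : A -> B) (g : A -> C) : PT f -> PT g -> PT (fun t => (f t, g t)).
Proof.
move=> hf [d [k h]]; have [l hl] := PT_size hf; move: hf => [c [k' h']].
have [m hm] : pbd (fun n => 6 * n + 1 + (7 * n + 1 + (n.+2 ^ k' + (6 * n.+2 ^ l + 1 +
   (6 * n + 1 + (6 * n + 1 + (n.+2 ^ k + (6 * n.+2 ^ l + 1 + 1))))))))%N by pbds.
exists (Seq (mv 0 2) (Seq (mv2 2 0 1) (Seq (ren (shiftr 3) c) (Seq (mv 0 2)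
   (Seq (mv 1 3) (Seq (mv 3 0) (Seq (ren (shiftr 3) d) (Seq (mv 2 0) (Push 0 true))))))))), m => t.
have [n1 x1 b1] := h' t; have [n2 x2 b2] := h t.
have -> : tcode (enc (f t, g t)) = true :: tcode (enc (f t)) ++ tcode (enc (g t)) by [].
have := hl t; move: x1 x2 b1 b2; rewrite /sz /tsize; set T := tcode (enc t); set F := tcode (enc (f t)); set G := tcode (enc (g t)).
move=> x1 x2 b1 b2 hF.
exists (6 * size T + 1 + (7 * size T + 1 + (n1 + (6 * size F + 1 + (6 * size T + 1 + (6 * size T + 1 +
    (n2 + (6 * size F + 1 + 1))))))))%N; last by apply: leq_trans (hm _); lia.
pose S (a b c d : seq bool) : store := fun r => nth [::] [:: a; b; c; d] r.
have e := exec_eq.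
apply: (@ESeq _ _ _ (S [::] [::] (rev T) [::])).
  apply: e (@exec_mv 0 2 (st0 T) isT); stext; by rewrite ?cats0 ?nth_nil.
apply: (@ESeq _ _ _ (S T T [::] [::])).
  have := @exec_mv2 2 0 1 (S [::] [::] (rev T) [::]) isT isT isT.
  rewrite {4}/S /= size_rev; apply: e; stext; by rewrite revK cats0.
apply: (@ESeq _ _ _ (S F T [::] [::])).
  apply: e (exec_shift (m := 3) (S := S T T [::] [::]) x1 _ _) => //; first by stext.
  by case=> [|[|[|[|i]]]] //= _; rewrite /S /= nth_nil.
apply: (@ESeq _ _ _ (S [::] T (rev F) [::])).
  apply: e (@exec_mv 0 2 (S F T [::] [::]) isT); stext; by rewrite cats0.
apply: (@ESeq _ _ _ (S [::] [::] (rev F) (rev T))).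
  apply: e (@exec_mv 1 3 (S [::] T (rev F) [::]) isT); stext; by rewrite cats0.
apply: (@ESeq _ _ _ (S T [::] (rev F) [::])).
  have := @exec_mv 3 0 (S [::] [::] (rev F) (rev T)) isT.
  rewrite {4}/S /= size_rev; apply: e; stext; by rewrite revK cats0.
apply: (@ESeq _ _ _ (S G [::] (rev F) [::])).
  apply: e (exec_shift (m := 3) (S := S T [::] (rev F) [::]) x2 _ _) => //; first by stext.
  by case=> [|[|[|[|i]]]] //= _; rewrite /S /= nth_nil.
apply: (@ESeq _ _ _ (S (F ++ G) [::] [::] [::])).
  have := @exec_mv 2 0 (S G [::] (rev F) [::]) isT.
  rewrite {4}/S /= size_rev; apply: e; stext; by rewrite revK.
apply: e (EPush 0 true (S (F ++ G) [::] [::] [::])); stext; by rewrite ?nth_nil.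
Qed.

Lemma PT_ifp (g h : A -> B) : PT g -> PT h ->
  PT (fun p : bool * A => if p.1 then g p.2 else h p.2).
Proof.
move=> [d [l hd]] [c [k hc]].
have [m hm] : pbd (fun n => 20 + n.+2 ^ k + n.+2 ^ l)%N by pbds.
exists (Seq (Pop 0) (Case 0 Nop (Seq (Pop 0) c) (Seq (Pop 0) (Seq (Pop 0) (Seq (Pop 0) d))))), m => -[[] a].
  have [n x b] := hd a; exists (1 + (1 + (1 + (1 + n))).+2)%N; last first.
    apply: leq_trans (hm _); have : ((sz a).+2 ^ l <= (sz (true, a)).+2 ^ l)%N.
      by apply: powmono; rewrite /sz -[enc (true, a)]/(Nd (Nd Lf Lf) (enc a)) tsize_Nd; lia.
    by lia.
  apply: ESeq (EPop _ _) _; apply: ECase => /=; do 3 apply: ESeq (EPop _ _) _.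
  by move: x; congr exec; stext.
have [n x b] := hc a; exists (1 + (1 + n).+2)%N; last first.
  apply: leq_trans (hm _); have : ((sz a).+2 ^ k <= (sz (false, a)).+2 ^ k)%N.
    by apply: powmono; rewrite /sz -[enc (false, a)]/(Nd Lf (enc a)) tsize_Nd; lia.
  by lia.
apply: ESeq (EPop _ _) _; apply: ECase => /=; apply: ESeq (EPop _ _) _.
by move: x; congr exec; stext.
Qed.

(** A nonempty list has the code of the pair of its head and tail, so the projections of pairs serve
    for lists; the first bit tells the empty list. *)
Lemma PT_behead_ : PT (@behead A).
Proof.
have [c [k h]] := @PT_snd_ A (seq A) _ _.
exists (Case 0 Nop Nop c), k.+1 => -[|x s].
  by exists 2%N; [apply: ECase; exact: ENop|rewrite expnS; have := expn_gt0 (sz ([::] : seq A)).+2 k; nia].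
have [n e b] := h (x, s); exists n.+2; first by apply: ECase.
move: b; have -> : sz (x, s) = sz (x :: s) by []; rewrite expnS; set m := sz (x :: s).
have h0 : (0 < m)%N by exact: tsize_gt0.
by have := expn_gt0 m.+2 k; rewrite /=; nia.
Qed.

Lemma PT_head_ (x0 : A) : PT (head x0).
Proof.
have [c [k h]] := @PT_fst_ A (seq A) _ _.
have [d [l g]] := PT_cst (A := seq A) x0.
have [m hm] : pbd (fun n => 2 + n.+2 ^ k + n.+2 ^ l)%N by pbds.
exists (Case 0 Nop d c), m => -[|x s].
  have [n e b] := g [::]; exists n.+2; first by apply: ECase.
  by apply: leq_trans (hm _); lia.
have [n e b] := h (x, s); exists n.+2; first by apply: ECase.
by apply: leq_trans (hm _); move: b; have -> : sz (x, s) = sz (x :: s) by []; lia.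
Qed.

Lemma PT_nilp_ : PT (@nilp A).
Proof.
have [d [l g]] := PT_cst (A := seq A) true.
have [d' [l' g']] := PT_cst (A := seq A) false.
have [m hm] : pbd (fun n => 2 + n.+2 ^ l + n.+2 ^ l')%N by pbds.
exists (Case 0 Nop d d'), m => -[|x s].
  have [n e b] := g [::]; exists n.+2; first by apply: ECase.
  by apply: leq_trans (hm _); lia.
have [n e b] := g' (x :: s); exists n.+2; first by apply: ECase.
by apply: leq_trans (hm _); lia.
Qed.

Lemma PT_cons_ : PT (fun p : A * seq A => p.1 :: p.2).
Proof. by exists Nop, 0%N => -[x s]; exists 0%N => //; exact: ENop. Qed.

(** The loop test. The left component will be the list of items still to be processed, and it is a
    node when that list is nonempty. *)
Definition cont (t : tree) := if t is Nd (Nd _ _) _ then true else false.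

Lemma PT_loop (init : A -> B) (g : B -> B) (f : A -> B) k : PT init -> PT g ->
  (forall a, exists n, [/\ (n <= (sz a).+2 ^ k)%N, f a = iter n g (init a), ~~ cont (enc (f a)),
     forall i, (i < n)%N -> cont (enc (iter i g (init a))) &
     forall i, (i <= n)%N -> (sz (iter i g (init a)) <= (sz a).+2 ^ k)%N]) -> PT f.
Proof.
move=> [ci [ki hi]] [c [l hc]] hf.
have [m hm] : pbd (fun n => n.+2 ^ ki + (20 + n.+2 ^ k * (20 + (n.+2 ^ k).+2 ^ l)))%N.
  apply: pbd_add; first by eexists.
  apply: pbd_add; first exact: pbd_cst.
  apply: pbd_mul; first by eexists.
  apply: pbd_add; first exact: pbd_cst.
  by apply: (@pbd_comp (fun n => n.+2 ^ l)%N); eexists.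
(* Register 1 is the loop flag. It is raised again only if the code starts like a node with a node
   on its left; the bit removed for this inspection is put back. *)
pose body := Seq (Pop 1) (Case 0 Nop Nop (Seq (Pop 0) (Case 0 Nop (Push 0 true)
   (Seq (Push 0 true) (Seq (ren (shiftr 1) c) (Push 1 true)))))).
exists (Seq ci (Seq (Push 1 true) (While 1 body))), m => a.
have [n [hn ef nc hcont hsz]] := hf a.
have [ni xi bi] := hi a.
pose S t := upd (st0 (tcode t)) 1 [:: true].
have stop s : ~~ cont s -> exists2 u, exec (While 1 body) (S s) (st0 (tcode s)) u & (u <= 12)%N.
  have e : st0 (tcode s) = upd (S s) 1 [::] by stext.
  case: s e => [|[|? ?] b] e // _.
    exists ((1 + 0.+2) + 1).+2 => //; apply: EWhile1 => //; last exact: EWhile0.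
    apply: ESeq (EPop _ _) _; apply: ECase => /=; rewrite e; exact: ENop.
  exists ((1 + (1 + 1.+2).+2) + 1).+2 => //; apply: EWhile1 => //; last exact: EWhile0.
  apply: ESeq (EPop _ _) _; apply: ECase => /=; apply: ESeq (EPop _ _) _; apply: ECase => /=.
  have := EPush 0 true (upd (upd (S (Nd Lf b)) 1 [::]) 0 (false :: tcode b)).
  by congr exec; stext.
have one s S' u : cont (enc s) -> exec (While 1 body) (S (enc (g s))) S' u ->
    exists2 u', exec (While 1 body) (S (enc s)) S' u' & (u' <= u + (sz s).+2 ^ l + 11)%N.
  move=> hcs x; have [w xw bw] := hc s.
  move: hcs bw xw; rewrite /sz; case: (enc s) => [//|[//|a1 a2] b] _ bw xw.
  exists ((1 + (1 + (1 + (w + 1)).+2).+2) + u).+2; last by lia.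
  apply: EWhile1 x => //.
  apply: ESeq (EPop _ _) _; apply: ECase => /=; apply: ESeq (EPop _ _) _; apply: ECase => /=.
  apply: ESeq (EPush _ _ _) _.
  have xs := exec_shift (m := 1) (S := st0 (tcode (Nd (Nd a1 a2) b))) xw erefl _.
  have {}xs := xs (fun i => if i is 0 then (fun h => False_ind _ (Bool.diff_false_true h)) else fun _ => erefl).
  have e1 : st0 (tcode (Nd (Nd a1 a2) b)) =
     upd (upd (upd (S (Nd (Nd a1 a2) b)) 1 (behead (S (Nd (Nd a1 a2) b) 1%N))) 0
      (behead (tcode (Nd (Nd a1 a2) b)))) 0 (true :: behead (tcode (Nd (Nd a1 a2) b))) by stext.
  move: xs; rewrite {1}e1 => xs; apply: ESeq xs _.
  set U := tcode (enc (g s)); have := EPush 1 true (upd (st0 (tcode (Nd (Nd a1 a2) b))) 0 U).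
  by congr exec; stext.
have main j : (j <= n)%N -> exists2 u, exec (While 1 body) (S (enc (iter (n - j) g (init a)))) (st0 (tcode (enc (f a)))) u
    & (u <= 12 + j * (11 + ((sz a).+2 ^ k).+2 ^ l))%N.
  elim: j => [|j ih] hj.
    by rewrite subn0 -ef; have [u xu bu] := stop _ nc; exists u => //; lia.
  have [u xu bu] := ih (ltnW hj).
  have ej : iter (n - j) g (init a) = g (iter (n - j.+1) g (init a)) by rewrite -iterS; congr iter; lia.
  rewrite ej in xu; have hlt : (n - j.+1 < n)%N by lia.
  have [u' xu' bu'] := one _ _ _ (hcont _ hlt) xu.
  exists u' => //; have hs := powmono l (hsz (n - j.+1)%N (leq_subr _ _)).
  by lia.
have [u xu bu] := main n (leqnn _).
rewrite subnn /= in xu.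
exists (ni + (1 + u))%N; last first.
  apply: leq_trans (hm _); have := leq_mul hn (leqnn (11 + ((sz a).+2 ^ k).+2 ^ l)); nia.
apply: ESeq xi _; apply: ESeq xu; set U := tcode (enc (init a)); have := EPush 1 true (st0 U); congr exec; stext.
Qed.

End Closure2.

Section Derived.
Context {E X S B : Type} {EE : Enc E} {EX : Enc X} {ES : Enc S} {EB : Enc B}.

Lemma PT_if (b : E -> bool) (f g : E -> B) : PT b -> PT f -> PT g ->
  PT (fun e => if b e then f e else g e).
Proof. by move=> hb hf hg; apply: (PT_comp (PT_pair hb PT_id) (PT_ifp hf hg)). Qed.

Lemma PT_cons (f : E -> X) (g : E -> seq X) : PT f -> PT g -> PT (fun e => f e :: g e).
Proof. by move=> hf hg; apply: (PT_comp (PT_pair hf hg) PT_cons_). Qed.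

Lemma PT_head x0 (f : E -> seq X) : PT f -> PT (fun e => head x0 (f e)).
Proof. by move=> hf; apply: (PT_comp hf); apply: PT_head_. Qed.

Lemma PT_behead (f : E -> seq X) : PT f -> PT (fun e => behead (f e)).
Proof. by move=> hf; apply: (PT_comp hf); apply: PT_behead_. Qed.

Lemma PT_nilp (f : E -> seq X) : PT f -> PT (fun e => nilp (f e)).
Proof. by move=> hf; apply: (PT_comp hf); apply: PT_nilp_. Qed.

Lemma sz_cons (x : X) (s : seq X) : sz (x :: s) = (sz x + sz s).+1.
Proof. by rewrite /sz tsize_Nd. Qed.

Lemma sz_pair (x : X) (s : S) : sz (x, s) = (sz x + sz s).+1.
Proof. by rewrite /sz tsize_Nd. Qed.

Lemma sz_suffix (s t : seq X) : (sz t <= sz (s ++ t))%N.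
Proof. by elim: s => [|x s ih] //=; rewrite sz_cons; lia. Qed.

Lemma size_sz (s : seq X) : (size s < sz s)%N.
Proof. by elim: s => [|x s ih] //=; rewrite sz_cons; lia. Qed.

End Derived.

Section Fold.
Context {E X S : Type} {EE : Enc E} {EX : Enc X} {ES : Enc S}.

Lemma PT_foldl (stp : E * (S * X) -> S) (s0 : E -> S) (l : E -> seq X) k :
  PT stp -> PT s0 -> PT l ->
  (forall e p q, l e = p ++ q ->
     (sz (foldl (fun s x => stp (e, (s, x))) (s0 e) p) <= (sz e).+2 ^ k)%N) ->
  PT (fun e => foldl (fun s x => stp (e, (s, x))) (s0 e) (l e)).
Proof.
move=> hstp hs0 hl hb.
pose St : Type := (seq X * (S * E))%type.
pose g (t : St) : St := if t.1 is x :: r then (r, (stp (t.2.2, (t.2.1, x)), t.2.2)) else t.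
pose init e : St := (l e, (s0 e, e)).
have hinit : PT init by apply: PT_pair => //; apply: PT_pair => //; apply: PT_id.
have hg : PT g.
  (* Taking the head needs a default; for empty [X] all lists are empty and the step is the
     identity. *)
  case: (pselect (inhabited X)) => [[x0]|noX]; last first.
    apply: (@PT_ext _ _ _ _ id); last exact: PT_id.
    by move=> [[|x r] q] //; case: noX.
  have h1 : PT (fun t : St => t.1) by apply: PT_fst; apply: PT_id.
  have h2 : PT (fun t : St => t.2.1) by apply: PT_fst; apply: PT_snd; apply: PT_id.
  have h3 : PT (fun t : St => t.2.2) by apply: PT_snd; apply: PT_snd; apply: PT_id.
  apply: (@PT_ext _ _ _ _ (fun t : St => if nilp t.1 then t else
     (behead t.1, (stp (t.2.2, (t.2.1, head x0 t.1)), t.2.2)))).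
    by move=> [[|x r] q].
  apply: PT_if; [exact: PT_nilp|exact: PT_id|].
  apply: PT_pair; first exact: PT_behead.
  apply: PT_pair => //; apply: (PT_comp _ hstp).
  by apply: PT_pair => //; apply: PT_pair => //; apply: PT_head.
have [kl hkl] := PT_size hl.
have iterE e j : (j <= size (l e))%N ->
    iter j g (init e) = (drop j (l e), (foldl (fun s x => stp (e, (s, x))) (s0 e) (take j (l e)), e)).
  elim: j => [|j ih] hj; first by rewrite drop0 take0.
  rewrite iterS ih 1?ltnW // /g /=; move: (hj); case: (l e) => // y r hj'.
  by rewrite (take_nth y) // foldl_rcons (drop_nth y).
have hf : PT (fun e => iter (size (l e)) g (init e)); last first.
  apply: (@PT_ext _ _ _ _ (fun e => (iter (size (l e)) g (init e)).2.1)).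
    by move=> e; rewrite iterE // take_size.
  by apply: PT_fst; apply: PT_snd; exact: hf.
have [m hm] : pbd (fun n => n.+2 ^ kl + (n.+2 ^ k + n) + 2)%N by pbds.
apply: (PT_loop (k := m) hinit hg) => e; exists (size (l e)); split=> //.
- by apply: leq_trans (ltnW (size_sz _)) _; apply: leq_trans (hkl e) _; apply: leq_trans (hm _); lia.
- by rewrite iterE // drop_size.
- move=> j hj; rewrite iterE; last exact: ltnW.
  by move: hj; case: (l e) => [|y r] hj; [|rewrite (drop_nth y)].
- move=> j hj; rewrite iterE // !sz_pair; apply: leq_trans (hm _).
  have := hb e (take j (l e)) (drop j (l e)); rewrite cat_take_drop => /(_ erefl).
  have h2 : (sz (drop j (l e)) <= sz (l e))%N by rewrite -[in leqRHS](cat_take_drop j (l e)); apply: sz_suffix.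
  by have h3 := hkl e; move: (leq_trans h2 h3); lia.
Qed.

End Fold.

Lemma PT_var (A : Type) {EA : Enc A} : PT (fun a : A => a).
Proof. exact: PT_id. Qed.

Lemma PT_app (A B C : Type) {EA : Enc A} {EB : Enc B} {EC : Enc C} (g : B -> C) (f : A -> B) :
  PT g -> PT f -> PT (fun a => g (f a)).
Proof. by move=> hg hf; apply: PT_comp hf hg. Qed.

Lemma PT_app2 (A B C D : Type) {EA : Enc A} {EB : Enc B} {EC : Enc C} {ED : Enc D}
  (g : B -> C -> D) (f : A -> B) (f' : A -> C) :
  PT (fun p : B * C => g p.1 p.2) -> PT f -> PT f' -> PT (fun a => g (f a) (f' a)).
Proof. by move=> hg hf hf'; apply: (PT_comp (PT_pair hf hf') hg). Qed.

Lemma sz_nat (n : nat) : sz n = (2 * n).+1.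
Proof. by elim: n => //= n ih; rewrite -[sz n.+1]/(tsize (Nd Lf (enc n))) tsize_Nd -/(sz n) ih /tsize /=; lia. Qed.

Lemma sz_bool (b : bool) : (sz b <= 3)%N.
Proof. by case: b. Qed.

Section Folds.
Context {E X S : Type} {EE : Enc E} {EX : Enc X} {ES : Enc S}.

Lemma PT_fold b (stp : E -> S -> X -> S) (s0 : E -> S) (l : E -> seq X) : pbd b ->
  PT (fun q : E * (S * X) => stp q.1 q.2.1 q.2.2) -> PT s0 -> PT l ->
  (forall e p q, l e = p ++ q -> (sz (foldl (stp e) (s0 e) p) <= b (sz e))%N) ->
  PT (fun e => foldl (stp e) (s0 e) (l e)).
Proof.
move=> [k hk] h1 h2 h3 h4.
apply: (PT_foldl (k := k) h1 h2 h3) => e p q /h4 h.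
exact: leq_trans h (hk _).
Qed.

(* A step may add to the accumulator an amount that does not depend on it, so
   that the accumulator stays polynomial. *)
Lemma PT_grow b (stp : E -> S -> X -> S) (s0 : E -> S) (l : E -> seq X) : pbd b ->
  PT (fun q : E * (S * X) => stp q.1 q.2.1 q.2.2) -> PT s0 -> PT l ->
  (forall e s x, (sz (stp e s x) <= sz s + b (sz e + sz x))%N) ->
  PT (fun e => foldl (stp e) (s0 e) (l e)).
Proof.
move=> [k hb] h1 h2 h3 h4; have [k0 b0] := PT_size h2; have [kl bl] := PT_size h3.
have hm : pbd (fun n => n.+2 ^ k0 + n.+2 ^ kl * (n + n.+2 ^ kl).+2 ^ k)%N.
  apply: pbd_add; first by eexists.
  apply: pbd_mul; first by eexists.
  apply: (@pbd_comp (fun n => n.+2 ^ k)%N); first by eexists.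
  by apply: pbd_add; [apply: pbd_id|eexists].
apply: (PT_fold hm) => // e p q el.
have {}bl : (sz (p ++ q) <= (sz e).+2 ^ kl)%N by rewrite -el.
have hs : forall s, (sz (foldl (stp e) s p) <= sz s + size p * (sz e + (sz e).+2 ^ kl).+2 ^ k)%N.
  have : (sz p <= (sz e).+2 ^ kl)%N.
    apply: leq_trans bl; elim: (p) => [|x r ih] /=; first by case: (q) => // *; rewrite sz_cons; lia.
    by rewrite !sz_cons; lia.
  elim: p {el bl} => [|x p ih] hp s; first by rewrite /= addn0.
  rewrite /=; move: hp; rewrite sz_cons => hp.
  apply: leq_trans (ih _ _) _; first by lia.
  have := h4 e s x; have := hb (@sz E EE e + @sz X EX x)%N; have : ((sz e + sz x).+2 ^ k <= (sz e + (sz e).+2 ^ kl).+2 ^ k)%N.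
    by apply: powmono; lia.
  by rewrite mulSn; lia.
apply: leq_trans (hs _) _; apply: leq_add; first exact: b0.
rewrite leq_mul2r; apply/orP; right; apply: leq_trans bl.
by apply: leq_trans (ltnW (size_sz _)); rewrite size_cat; lia.
Qed.

End Folds.
Arguments PT_fold {E X S EE EX ES b stp s0 l}.
Arguments PT_grow {E X S EE EX ES b stp s0 l}.

Section Lists.
Context {E X : Type} {EE : Enc E} {EX : Enc X}.

Lemma PT_catrev (f g : E -> seq X) : PT f -> PT g -> PT (fun e => catrev (f e) (g e)).
Proof.
move=> hf hg; apply: (@PT_ext _ _ _ _ (fun e => foldl (fun s x => x :: s) (g e) (f e))).
  by move=> e; elim: (f e) (g e) => //= x s ih t; rewrite ih.
apply: (PT_grow (b := fun n => n + 1)%N) => //; first by pbds.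
  by apply: PT_cons; [apply: PT_snd|apply: PT_fst]; apply: PT_snd; apply: PT_id.
by move=> e s x; rewrite sz_cons; lia.
Qed.

Lemma PT_rev (f : E -> seq X) : PT f -> PT (fun e => rev (f e)).
Proof. by move=> hf; apply: PT_catrev => //; apply: PT_cst. Qed.

End Lists.

Section Lists2.
Context {E X Y : Type} {EE : Enc E} {EX : Enc X} {EY : Enc Y}.

Lemma PT_cat (f g : E -> seq X) : PT f -> PT g -> PT (fun e => f e ++ g e).
Proof.
move=> hf hg; apply: (@PT_ext _ _ _ _ (fun e => catrev (rev (f e)) (g e))).
  by move=> e; rewrite catrevE revK.
by apply: PT_catrev => //; apply: PT_rev.
Qed.

Lemma PT_map (g : E -> X -> Y) (l : E -> seq X) :
  PT (fun p : E * X => g p.1 p.2) -> PT l -> PT (fun e => map (g e) (l e)).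
Proof.
move=> hg hl; apply: (@PT_ext _ _ _ _ (fun e => rev (foldl (fun s x => g e x :: s) [::] (l e)))).
  move=> e; rewrite -[RHS]revK; congr rev.
  have h s t : foldl (fun s x => g e x :: s) t s = catrev (map (g e) s) t.
    by elim: s t => //= x s ih t; rewrite ih.
  by rewrite h.
apply: PT_rev; have [k hk] := PT_size hg.
apply: (PT_grow (b := fun n => ((n.+1).+2 ^ k + 1)%N) (stp := fun e s x => g e x :: s)) => //.
- apply: pbd_add; last exact: pbd_cst.
  by apply: (@pbd_comp (fun n => n.+2 ^ k)%N (fun n => n.+1)); [eexists|exists 1%N => n; rewrite expn1].
- apply: PT_cons; last by apply: PT_fst; apply: PT_snd; apply: PT_id.
  apply: (PT_app2 (g := g)) => //; first by apply: PT_fst; apply: PT_id.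
  by apply: PT_snd; apply: PT_snd; apply: PT_id.
- exact: PT_cst.
by move=> e s x; have := hk (e, x); rewrite sz_cons sz_pair /=; lia.
Qed.

Lemma PT_flatten (f : E -> seq (seq X)) : PT f -> PT (fun e => flatten (f e)).
Proof.
move=> hf; apply: (@PT_ext _ _ _ _ (fun e => rev (foldl (fun s x => catrev x s) [::] (f e)))).
  move=> e; rewrite -[RHS]revK; congr rev.
  have h s t : foldl (fun s x => catrev x s) t s = catrev (@flatten X s) t.
    by elim: s t => //= x s ih t; rewrite ih !catrevE rev_cat catA.
  by rewrite h.
apply: PT_rev; apply: (PT_grow (b := id) (stp := fun _ s x => catrev x s)) => //; first exact: pbd_id.
- by apply: PT_catrev; [apply: PT_snd|apply: PT_fst]; apply: PT_snd; apply: PT_id.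
- exact: PT_cst.
move=> e s x; have : (sz (catrev x s) <= sz x + sz s)%N.
  by elim: x s => [|y x ih] s /=; rewrite ?sz_cons; [lia|apply: leq_trans (ih _) _; rewrite sz_cons; lia].
by lia.
Qed.

Lemma PT_mapc (K : Type) (f : K -> E -> X) ks : (forall k, PT (f k)) ->
  PT (fun e => [seq f k e | k <- ks]).
Proof. by move=> h; elim: ks => [|k ks ih] /=; [apply: PT_cst|apply: PT_cons]. Qed.

(** Numbers and lists of units have the same code, so that list operations provide arithmetic. *)
Lemma PT_unary (f : E -> nat) : PT f -> PT (fun e => nseq (f e) tt).
Proof.
move=> hf; apply: (PT_app (g := fun n => nseq n tt)) => //; exists Nop, 0%N => n; exists 0%N => //.
have -> : enc (nseq n tt) = enc n by elim: n => //= n ih; rewrite -[enc n.+1]/(Nd Lf (enc n)) -ih.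
exact: ENop.
Qed.

Lemma PT_sizeu (f : E -> seq unit) : PT f -> PT (fun e => size (f e)).
Proof.
move=> hf; apply: (PT_app (g := @size unit)) => //; exists Nop, 0%N => s; exists 0%N => //.
have -> : enc (size s) = enc s by elim: s => //= -[] s ih; rewrite -[enc _.+1]/(Nd Lf (enc (size s))) ih.
exact: ENop.
Qed.

End Lists2.

Section Nats.
Context {E : Type} {EE : Enc E}.

Lemma PT_succ (f : E -> nat) : PT f -> PT (fun e => (f e).+1).
Proof.
move=> hf; apply: (@PT_ext _ _ _ _ (fun e => size (tt :: nseq (f e) tt))).
  by move=> e; rewrite /= size_nseq.
by apply: PT_sizeu; apply: PT_cons; [apply: PT_cst|apply: PT_unary].
Qed.

Lemma PT_pred (f : E -> nat) : PT f -> PT (fun e => (f e).-1).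
Proof.
move=> hf; apply: (@PT_ext _ _ _ _ (fun e => size (behead (nseq (f e) tt)))).
  by move=> e; rewrite size_behead size_nseq.
by apply: PT_sizeu; apply: PT_behead; apply: PT_unary.
Qed.

Lemma PT_eq0 (f : E -> nat) : PT f -> PT (fun e => f e == 0).
Proof.
move=> hf; apply: (@PT_ext _ _ _ _ (fun e => nilp (nseq (f e) tt))).
  by move=> e; rewrite /nilp size_nseq.
by apply: PT_nilp; apply: PT_unary.
Qed.

Lemma PT_size_seq (X : Type) {EX : Enc X} (f : E -> seq X) : PT f -> PT (fun e => size (f e)).
Proof.
move=> hf; apply: (@PT_ext _ _ _ _ (fun e => size (map (fun _ => tt) (f e)))).
  by move=> e; rewrite size_map.
by apply: PT_sizeu; apply: (PT_map (g := fun _ _ => tt)) => //; apply: PT_cst.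
Qed.

Lemma PT_andb (f g : E -> bool) : PT f -> PT g -> PT (fun e => f e && g e).
Proof. by move=> hf hg; apply: PT_if => //; apply: PT_cst. Qed.

Lemma PT_orb (f g : E -> bool) : PT f -> PT g -> PT (fun e => f e || g e).
Proof. by move=> hf hg; apply: PT_if => //; apply: PT_cst. Qed.

Lemma PT_negb (f : E -> bool) : PT f -> PT (fun e => ~~ f e).
Proof. by move=> hf; apply: PT_if => //; apply: PT_cst. Qed.

End Nats.

Section Nats2.
Context {E X : Type} {EE : Enc E} {EX : Enc X}.

Lemma PT_add (f g : E -> nat) : PT f -> PT g -> PT (fun e => f e + g e)%N.
Proof.
move=> hf hg; apply: (@PT_ext _ _ _ _ (fun e => size (nseq (f e) tt ++ nseq (g e) tt))).
  by move=> e; rewrite size_cat !size_nseq.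
by apply: PT_sizeu; apply: PT_cat; apply: PT_unary.
Qed.

Lemma foldl_iter (S : Type) (g : S -> S) n s : foldl (fun s (_ : unit) => g s) s (nseq n tt) = iter n g s.
Proof. by elim: n s => //= n ih s; rewrite ih -iterSr. Qed.

Lemma PT_drop (n : E -> nat) (l : E -> seq X) : PT n -> PT l -> PT (fun e => drop (n e) (l e)).
Proof.
move=> hn hl; apply: (@PT_ext _ _ _ _ (fun e => foldl (fun s (_ : unit) => behead s) (l e) (nseq (n e) tt))).
  by move=> e; rewrite foldl_iter; elim: (n e) (l e) => [|k ih] s; [rewrite drop0|rewrite iterSr ih; case: s].
apply: (PT_grow (b := id) (stp := fun _ s (_ : unit) => behead s)) => //; first exact: pbd_id.
- by apply: PT_behead; apply: PT_fst; apply: PT_snd; apply: PT_id.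
- exact: PT_unary.
by move=> e [|x s] u; rewrite /= ?sz_cons; lia.
Qed.

Lemma PT_nth x0 (n : E -> nat) (l : E -> seq X) : PT n -> PT l -> PT (fun e => nth x0 (l e) (n e)).
Proof.
move=> hn hl; apply: (@PT_ext _ _ _ _ (fun e => head x0 (drop (n e) (l e)))).
  by move=> e; rewrite -nth0 nth_drop addn0.
by apply: PT_head; apply: PT_drop.
Qed.

Lemma PT_nseq (n : E -> nat) (f : E -> X) : PT n -> PT f -> PT (fun e => nseq (n e) (f e)).
Proof.
move=> hn hf; apply: (@PT_ext _ _ _ _ (fun e => map (fun _ => f e) (nseq (n e) tt))).
  by move=> e; rewrite map_nseq.
apply: (PT_map (g := fun e _ => f e)); last exact: PT_unary.
by apply: PT_app => //; apply: PT_fst; apply: PT_id.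
Qed.

End Nats2.

Section Nats3.
Context {E X : Type} {EE : Enc E} {EX : Enc X}.

Lemma PT_sub (f g : E -> nat) : PT f -> PT g -> PT (fun e => f e - g e)%N.
Proof.
move=> hf hg; apply: (@PT_ext _ _ _ _ (fun e => size (drop (g e) (nseq (f e) tt)))).
  by move=> e; rewrite size_drop size_nseq.
by apply: PT_sizeu; apply: PT_drop => //; apply: PT_unary.
Qed.

Lemma PT_leq (f g : E -> nat) : PT f -> PT g -> PT (fun e => f e <= g e)%N.
Proof. by move=> hf hg; apply: PT_eq0; apply: PT_sub. Qed.

Lemma PT_eqn (f g : E -> nat) : PT f -> PT g -> PT (fun e => f e == g e).
Proof.
move=> hf hg; apply: (@PT_ext _ _ _ _ (fun e => (f e <= g e) && (g e <= f e))%N).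
  by move=> e; rewrite -eqn_leq.
by apply: PT_andb; apply: PT_leq.
Qed.

Lemma PT_mul (f g : E -> nat) : PT f -> PT g -> PT (fun e => f e * g e)%N.
Proof.
move=> hf hg; apply: (@PT_ext _ _ _ _ (fun e => size (flatten (nseq (f e) (nseq (g e) tt))))).
  by move=> e; elim: (f e) => //= n ih; rewrite size_cat size_nseq ih mulSn.
by apply: PT_sizeu; apply: PT_flatten; apply: PT_nseq => //; apply: PT_unary.
Qed.

Lemma PT_exp (f : E -> nat) k : PT f -> PT (fun e => f e ^ k)%N.
Proof.
move=> hf; elim: k => [|k ih]; first exact: PT_cst.
by apply: (PT_ext _ (PT_mul hf ih)) => e; rewrite expnS.
Qed.

Lemma PT_iota (f : E -> nat) : PT f -> PT (fun e => iota 0 (f e)).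
Proof.
move=> hf; apply: (@PT_ext _ _ _ _ (fun e => rev (foldl (fun s (_ : unit) => size s :: s) [::] (nseq (f e) tt)))).
  move=> e; rewrite foldl_iter -[RHS]revK; congr rev.
  elim: (f e) => //= n ->; rewrite size_rev size_iota -[0%N :: _]/(iota 0 n.+1) -[n.+1]addn1 iotaD rev_cat //.
apply: PT_rev; have [k hk] := PT_size hf.
apply: (PT_fold (b := fun n => ((3 + n.+2 ^ k) * (3 + n.+2 ^ k) + 1)%N) (stp := fun _ s (_ : unit) => size s :: s)) => //.
- by pbds.
- by apply: PT_cons; [apply: PT_size_seq|]; apply: PT_fst; apply: PT_snd; apply: PT_id.
- exact: PT_cst.
- exact: PT_unary.
move=> e p q el; have hp : (2 * size p <= (sz e).+2 ^ k)%N.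
  have := hk e; rewrite sz_nat; have : size (p ++ q) = f e by rewrite -el size_nseq.
  by rewrite size_cat; lia.
have h : forall p : seq unit, size (foldl (fun s (_ : unit) => size s :: s) [::] p) = size p /\
    (sz (foldl (fun s (_ : unit) => size s :: s) [::] p) <= (3 + 2 * size p) * size p + 1)%N.
  elim/last_ind => [//|r [] [h1 h2]]; rewrite foldl_rcons /= h1 size_rcons sz_cons sz_nat; split=> //; nia.
by have [_ h2] := h p; nia.
Qed.

Lemma PT_all (p : E -> X -> bool) (l : E -> seq X) : PT (fun q : E * X => p q.1 q.2) -> PT l ->
  PT (fun e => all (p e) (l e)).
Proof.
move=> hp hl; apply: (@PT_ext _ _ _ _ (fun e => foldl (fun b x => b && p e x) true (l e))).
  by move=> e; have h s b : foldl (fun b x => b && p e x) b s = b && all (p e) s;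
    [elim: s b => [|x s ih] b /=; rewrite ?andbT // ih andbA|rewrite h].
apply: (PT_fold (b := fun _ => 3%N) (stp := fun e b x => b && p e x)) => //; first exact: pbd_cst.
- apply: PT_andb; first by apply: PT_fst; apply: PT_snd; apply: PT_id.
  by apply: (PT_app2 (g := p)) => //; [apply: PT_fst; apply: PT_id|apply: PT_snd; apply: PT_snd; apply: PT_id].
- exact: PT_cst.
by move=> *; apply: sz_bool.
Qed.

Lemma PT_has (p : E -> X -> bool) (l : E -> seq X) : PT (fun q : E * X => p q.1 q.2) -> PT l ->
  PT (fun e => has (p e) (l e)).
Proof.
move=> hp hl; apply: (@PT_ext _ _ _ _ (fun e => ~~ all (fun x => ~~ p e x) (l e))).
  by move=> e; rewrite -has_predC; apply: eq_has => x; rewrite /= negbK.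
by apply: PT_negb; apply: (PT_all (p := fun e x => ~~ p e x)) => //; apply: PT_negb.
Qed.

End Nats3.


(** Nested table lookup. This is how arbitrary functions on finite types, such as the label
    functions of rules, enter programs. *)
Lemma PT_finite (B : Type) {EB : Enc B} m C (F : seq nat -> B) :
  exists2 G : seq nat -> B, PT G & forall s, size s = m -> all (fun i => i < C)%N s -> G s = F s.
Proof.
elim: m F => [|m ih] F; first by exists (fun _ => F [::]); [apply: PT_cst|case].
have [G hG] := choice (fun c => let: ex_intro2 G p q := ih (fun s => F (c :: s)) in ex_intro _ G (conj p q)).
exists (fun s => nth (F [::]) [seq G c (behead s) | c <- iota 0 C] (head 0%N s)).
  apply: PT_nth; first by apply: PT_head; apply: PT_id.
  apply: PT_mapc => c; apply: PT_app; first by have [] := hG c.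
  by apply: PT_behead; apply: PT_id.
case=> // c s [hs] /= /andP[hc ha].
by rewrite (nth_map 0%N) ?size_iota // nth_iota // add0n; have [_ ->] := hG c.
Qed.

(** The input register has the last bit on top, so the code of the list is built from its end; the
    output is emitted reversed, as [polytime_exec] expects. *)
Lemma PT_polytime (f : seq bool -> seq bool) : PT f -> polytime f.
Proof.
move=> hf; have [kf bf] := PT_size hf; move: hf => [c [k hc]].
pose rd := While 0 (Case 0 Nop (Seq (Pop 0) (Seq (Push 1 false) (Push 1 true)))
  (Seq (Pop 0) (Seq (Push 1 false) (Seq (Push 1 false) (Seq (Push 1 true) (Push 1 true)))))).
pose wr := While 0 (Case 0 Nop (Pop 0) (Seq (Pop 0) (Case 0 Nop (Seq (Pop 0) (Push 1 false))
  (Seq (Pop 0) (Seq (Pop 0) (Seq (Pop 0) (Push 1 true))))))).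
pose S a b : store := upd (st0 a) 1 b.
have xrd x y : exists2 n, exec rd (S (rev x) (tcode (enc y))) (S [::] (tcode (enc (x ++ y)))) n & (n <= 10 * size x + 1)%N.
  elim/last_ind: x y => [|x b ih] y; first by exists 1%N => //; apply: EWhile0.
  have [n xn bn] := ih (b :: y); rewrite rev_rcons size_rcons cat_rcons.
  have [u xu bu] : exists2 u, exec (Case 0 Nop (Seq (Pop 0) (Seq (Push 1 false) (Push 1 true)))
  (Seq (Pop 0) (Seq (Push 1 false) (Seq (Push 1 false) (Seq (Push 1 true) (Push 1 true))))))
     (S (b :: rev x) (tcode (enc y))) (S (rev x) (tcode (enc (b :: y)))) u & (u <= 7)%N.
    case: b {xn ih}.
      exists (1 + (1 + (1 + (1 + 1)))).+2 => //; apply: ECase => /=.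
      do 4 (apply: ESeq; first by constructor).
      by apply: exec_eq (EPush _ _ _); stext.
    exists (1 + (1 + 1)).+2 => //; apply: ECase => /=.
    do 2 (apply: ESeq; first by constructor).
    by apply: exec_eq (EPush _ _ _); stext.
  by exists (u + n).+2; [apply: EWhile1 xu xn|lia].
have xwr x y : exists2 n, exec wr (S (tcode (enc x)) y) (S [::] (rev x ++ y)) n & (n <= 15 * size x + 6)%N.
  elim: x y => [|b x ih] y.
    exists (1.+2 + 1).+2 => //; apply: EWhile1 => //; last exact: EWhile0.
    by apply: ECase; apply: exec_eq (EPop _ _); stext.
  have [n xn bn] := ih (b :: y).
  have e : rev (b :: x) ++ y = rev x ++ b :: y by rewrite rev_cons cat_rcons.
  rewrite e /=.
  have [u xu bu] : exists2 u, exec (Case 0 Nop (Pop 0) (Seq (Pop 0) (Case 0 Nop (Seq (Pop 0) (Push 1 false))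
  (Seq (Pop 0) (Seq (Pop 0) (Seq (Pop 0) (Push 1 true)))))))
     (S (tcode (enc (b :: x))) y) (S (tcode (enc x)) (b :: y)) u & (u <= 10)%N.
    case: b {xn e ih}.
      exists (1 + (1 + (1 + (1 + 1))).+2).+2 => //; apply: ECase => /=.
      apply: ESeq (EPop _ _) _; apply: ECase => /=; do 3 apply: ESeq (EPop _ _) _.
      by apply: exec_eq (EPush _ _ _); stext.
    exists (1 + (1 + 1).+2).+2 => //; apply: ECase => /=.
    apply: ESeq (EPop _ _) _; apply: ECase => /=; apply: ESeq (EPop _ _) _.
    by apply: exec_eq (EPush _ _ _); stext.
  by exists (u + n).+2; [apply: EWhile1 xu xn|lia].
have szb (x : seq bool) : (sz x <= 4 * size x + 1)%N by elim: x => //= b x; rewrite sz_cons; have := sz_bool b; lia.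
have back a : exec (Seq (mv 1 2) (mv 2 0)) (S [::] a) (st0 a) (6 * size a + 1 + (6 * size a + 1)).
  apply: ESeq (@exec_mv 1 2 (S [::] a) isT) _.
  have := @exec_mv 2 0 (upd (upd (S [::] a) 2 (rev (S [::] a 1%N) ++ S [::] a 2%N)) 1 [::]) isT.
  rewrite {4}/upd /= {4}/upd /= cats0 size_rev; apply: exec_eq; stext.
  by rewrite revK cats0.
have pb : pbd (fun n => 1 + (10 * n + 1 + ((6 * (4 * n + 1) + 1 + (6 * (4 * n + 1) + 1)) +
   ((4 * n + 1).+2 ^ k + (15 * (4 * n + 1).+2 ^ kf + 6 + (6 * (4 * n + 1).+2 ^ kf + 1 + (6 * (4 * n + 1).+2 ^ kf + 1)))))))%N.
  have h q : pbd (fun n => (4 * n + 1).+2 ^ q)%N.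
    by apply: (@pbd_comp (fun n => n.+2 ^ q)%N (fun n => 4 * n + 1)%N); [eexists|pbds].
  by repeat (apply: h || apply: pbd_add || apply: pbd_mul || apply: pbd_cst || apply: pbd_id).
apply: (polytime_exec (c := Seq (Push 1 false) (Seq rd (Seq (Seq (mv 1 2) (mv 2 0)) (Seq c (Seq wr (Seq (mv 1 2) (mv 2 0))))))) pb) => x.
have [n1 x1 b1] := xrd x [::]; have [n2 x2 b2] := hc x; have [n3 x3 b3] := xwr (f x) [::].
rewrite !cats0 in x1 x3.
exists (st0 (rev (f x))), (1 + (n1 + ((6 * sz x + 1 + (6 * sz x + 1)) + (n2 + (n3 + (6 * size (rev (f x)) + 1 + (6 * size (rev (f x)) + 1)))))))%N; split=> //.
  apply: ESeq (EPush _ _ _) _.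
  apply: (@ESeq _ _ _ (S [::] (tcode (enc x)))); first by move: x1; congr exec; stext.
  apply: ESeq (back _) _; apply: ESeq x2 _; apply: ESeq (back _).
  by move: x3; congr exec; stext.
have h1 : (n2 <= (4 * size x + 1).+2 ^ k)%N by apply: leq_trans b2 (powmono _ (szb x)).
have h2 : (size (f x) <= (4 * size x + 1).+2 ^ kf)%N.
  apply: leq_trans (ltnW (size_sz _)) _; apply: leq_trans (bf x) _; exact: powmono.
have := szb x; rewrite size_rev; lia.
Qed.

Ltac pt_hook := fail.
Ltac pt1 := lazymatch goal with
| |- @PT _ _ _ _ (fun _ => ?b) => apply: PT_cst
| |- @PT _ _ _ _ (fun e => e) => apply: PT_var
| |- @PT _ _ _ _ fst => apply: PT_fst_
| |- @PT _ _ _ _ (@size _) => apply: (PT_size_seq (f := id)); apply: PT_id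
| |- @PT _ _ _ _ snd => apply: PT_snd_
| |- @PT _ _ _ _ (fun e => fst (@?f e)) => apply: PT_fst
| |- @PT _ _ _ _ (fun e => snd (@?f e)) => apply: PT_snd
| |- @PT _ _ _ _ (fun e => (@?f e, @?g e)) => apply: PT_pair
| |- @PT _ _ _ _ (fun e => @?f e :: @?g e) => apply: PT_cons
| |- @PT _ _ _ _ (fun e => @?f e ++ @?g e) => apply: PT_cat
| |- @PT _ _ _ _ (fun e => rev (@?f e)) => apply: PT_rev
| |- @PT _ _ _ _ (fun e => flatten (@?f e)) => apply: PT_flatten
| |- @PT _ _ _ _ (fun e => map (@?f e) (@?l e)) => first [apply: PT_mapc => ? | apply: PT_map]
| |- @PT _ _ _ _ (fun e => (@?f e).+1) => apply: PT_succ
| |- @PT _ _ _ _ (fun e => (@?f e).-1) => apply: PT_pred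
| |- @PT _ _ _ _ (fun e => (@?f e <= @?g e)%N) => apply: PT_leq
| |- @PT _ _ _ _ (fun e => @?f e == @?g e) => apply: PT_eqn
| |- @PT _ _ _ _ (fun e => (@?f e + @?g e)%N) => apply: PT_add
| |- @PT _ _ _ _ (fun e => (@?f e - @?g e)%N) => apply: PT_sub
| |- @PT _ _ _ _ (fun e => (@?f e * @?g e)%N) => apply: PT_mul
| |- @PT _ _ _ _ (fun e => (@?f e ^ ?k)%N) => apply: PT_exp
| |- @PT _ _ _ _ (fun e => iota 0 (@?f e)) => apply: PT_iota
| |- @PT _ _ _ _ (fun e => nseq (@?f e) (@?g e)) => apply: PT_nseq
| |- @PT _ _ _ _ (fun e => nth _ (@?f e) (@?g e)) => apply: PT_nth
| |- @PT _ _ _ _ (fun e => head _ (@?f e)) => apply: PT_head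
| |- @PT _ _ _ _ (fun e => behead (@?f e)) => apply: PT_behead
| |- @PT _ _ _ _ (fun e => nilp (@?f e)) => apply: PT_nilp
| |- @PT _ _ _ _ (fun e => size (@?f e)) => apply: PT_size_seq
| |- @PT _ _ _ _ (fun e => drop (@?f e) (@?g e)) => apply: PT_drop
| |- @PT _ _ _ _ (fun e => @?f e && @?g e) => apply: PT_andb
| |- @PT _ _ _ _ (fun e => @?f e || @?g e) => apply: PT_orb
| |- @PT _ _ _ _ (fun e => ~~ @?f e) => apply: PT_negb
| |- @PT _ _ _ _ (fun e => all (@?f e) (@?g e)) => apply: PT_all
| |- @PT _ _ _ _ (fun e => has (@?f e) (@?g e)) => apply: PT_has
| _ => first [assumption | pt_hook | apply: PT_if]
end.
Ltac pt := repeat pt1.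

(** * Labelled graphs and tables *)

Record lgraph (G C : Type) := LGraph { lv : finType; la : G -> lv -> lv; ll : lv -> C }.
Arguments la {G C} l.
Arguments ll {G C} l.

(* A graph is stored as the list of its vertices, each one given by its
   neighbours, in the order of [enum G], and by the rank of its label. *)
Definition tbl : Type := seq (seq nat * nat).
Definition tent (T : tbl) (i : nat) : seq nat * nat := nth ([::], 0%N) T i.

(** The numbering [code] is existential: a table describes a graph up to isomorphism. *)
Definition encodes (G C : finType) (T : tbl) (X : lgraph G C) : Prop :=
  exists code : lv X -> nat, [/\ injective code, size T = #|lv X|, forall v, (code v < size T)%N
    & forall v, tent T (code v) = ([seq code (la X g v) | g <- enum G], enum_rank (ll X v) : nat)].

Lemma rep_iso (G C : finType) (T : tbl) (X Y : lgraph G C) (f : lv Y -> lv X) :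
  injective f -> #|lv Y| = #|lv X| -> (forall g v, f (la Y g v) = la X g (f v)) ->
  (forall v, ll Y v = ll X (f v)) -> encodes T X -> encodes T Y.
Proof.
move=> fi fc fa fl [code [ci cs cb ce]]; exists (fun v => code (f v)); split.
- by move=> u v /ci/fi.
- by rewrite cs fc.
- by move=> v; apply: cb.
move=> v; rewrite ce -fl; congr pair; apply: eq_map => g; by rewrite fa.
Qed.

Lemma rep_surj (G C : finType) (T : tbl) (X : lgraph G C) (code : lv X -> nat) :
  injective code -> size T = #|lv X| -> (forall v, (code v < size T)%N) ->
  forall i, (i < size T)%N -> exists v, code v = i.
Proof.
move=> ci cs cb i hi.
pose h (v : lv X) : 'I_#|lv X| := Ordinal (eq_rect _ (fun n => (code v < n)%N) (cb v) _ cs).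
have hinj : injective h by move=> u v /(congr1 val) /ci.
have hc : (#|{: 'I_(#|lv X|)}| <= #|lv X|)%N by rewrite card_ord.
rewrite cs in hi; have := inj_card_onto hinj hc (Ordinal hi) => /codomP[v ev].
by exists v; rewrite -[RHS]/(val (Ordinal hi)) ev.
Qed.

Definition wk (G : finType) (T : tbl) (w : seq G) (v : nat) : nat :=
  foldl (fun v g => nth 0%N (tent T v).1 (enum_rank g)) v w.

Lemma nth_enum_map (G : finType) (B : Type) (b0 : B) (f : G -> B) g :
  nth b0 [seq f g | g <- enum G] (enum_rank g) = f g.
Proof. by rewrite (nth_map g) ?nth_enum_rank // -cardE ltn_ord. Qed.

Lemma PT_tent (E : Type) {EE : Enc E} (T : E -> tbl) v : PT T -> PT v -> PT (fun e => tent (T e) (v e)).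
Proof. by move=> hT hv; apply: PT_nth. Qed.

Ltac pt_hook ::= match goal with
| |- @PT _ _ _ _ (fun e => tent (@?f e) (@?g e)) => apply: PT_tent
end.

Lemma PT_wk (E : Type) {EE : Enc E} (G : finType) (w : seq G) (T : E -> tbl) v : PT T -> PT v -> PT (fun e => wk (T e) w (v e)).
Proof. by move=> hT; elim: w v => [|g w ih] v hv //=; apply: ih; pt. Qed.

Lemma rep_wk (G C : finType) (T : tbl) (X : lgraph G C) code w v :
  (forall v, tent T (code v) = ([seq code (la X g v) | g <- enum G], enum_rank (ll X v) : nat)) ->
  wk T w (code v) = code (walk (la X) w v).
Proof. by move=> h; elim: w v => //= g w ih v; rewrite h /= nth_enum_map ih. Qed.

Lemma divmod_inj b a r a' r' : (r < b -> r' < b -> a * b + r = a' * b + r' -> a = a' /\ r = r')%N.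
Proof.
move=> h h' e; have b0 : (0 < b)%N by apply: leq_trans h.
have q x y : (y < b)%N -> ((x * b + y) %/ b = x)%N by move=> hy; rewrite divnMDl // divn_small ?addn0.
have ea : a = a' by rewrite -(q a r h) e q.
by split=> //; move: e; rewrite ea; lia.
Qed.

Lemma mixlt a n r b : (a < n -> r < b -> a * b + r < n * b)%N.
Proof. by move=> h1 h2; apply: leq_trans (_ : a.+1 * b <= _)%N; [rewrite mulSn; lia|rewrite leq_mul2r h1 orbT]. Qed.

Lemma nth_flatten_const (B : Type) (b0 : B) b (ss : seq (seq B)) v j :
  all (fun s => size s == b) ss -> (j < b)%N -> nth b0 (flatten ss) (v * b + j) = nth b0 (nth [::] ss v) j.
Proof.
move=> + jb; elim: ss v => [|s ss ih] v /=; first by rewrite !nth_nil.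
case/andP => /eqP es ha; rewrite nth_cat es; case: v => [|v]; first by rewrite mul0n add0n jb.
by rewrite ifN ?mulSn; [rewrite -ih //; congr nth; lia|lia].
Qed.

Lemma size_flatten_const (B : Type) b (ss : seq (seq B)) :
  all (fun s => size s == b) ss -> size (flatten ss) = (size ss * b)%N.
Proof. by elim: ss => //= s ss ih /andP[/eqP es /ih e]; rewrite size_cat es e mulSn. Qed.

(* Being local, such a rewriting acts on tables in polynomial time and can be
   iterated logarithmically often: every vertex becomes a copy of [rj], new
   edges follow fixed words, new labels read the labels at the ends of [rws]. *)
Record rule (G C G' C' : finType) := Rule {
  rj : finType;
  rword : G' -> rj -> seq G;
  rtgt : G' -> rj -> rj;
  rws : seq (seq G);
  rlab : rj -> seq C -> C' }.

Section Rule.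
Variables (G C G' C' : finType) (r : rule G C G' C').

Definition rapp (X : lgraph G C) : lgraph G' C' :=
  @LGraph G' C' (lv X * rj r)%type
    (fun g p => (walk (la X) (rword g p.2) p.1, rtgt g p.2))
    (fun p => rlab p.2 [seq ll X (walk (la X) w p.1) | w <- rws r]).

(** Vertex (v, j) is numbered code v * |rj| + rank j. Words are followed by table lookups, and the
    label function becomes a constant table. *)
Lemma rule_PT : exists2 F : tbl -> tbl, PT F & forall T X, encodes T X -> encodes (F T) (rapp X).
Proof.
(* Without labels there are no vertices, and the empty table serves. *)
case: (pselect (inhabited C)) => [[c0]|noC]; last first.
  exists (fun _ => [::]); first by pt.
  move=> T X hT; exists (fun _ => 0%N).
  have no (v : lv X) : False by apply: noC; constructor; exact: ll v.
  have e : #|lv (rapp X)| = 0%N by apply: eq_card0 => -[v j]; case: (no v).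
  by split=> [[v] | | [v] | [v]] //; case: (no v).
pose d (i : nat) : C := nth c0 (enum C) i.
have hF j : exists F : seq nat -> nat, PT F /\ forall s, size s = size (rws r) -> all (fun i => i < #|C|)%N s ->
    F s = enum_rank (@rlab _ _ _ _ r j (map d s)).
  have [F h1 h2] := PT_finite (EB := enc_nat) (size (rws r)) #|C| (fun s => enum_rank (@rlab _ _ _ _ r j (map d s)) : nat).
  by exists F.
have [F hF'] := choice hF.
pose ent (T : tbl) v j : seq nat * nat :=
  ([seq wk T (rword g j) v * #|rj r| + enum_rank (rtgt g j) | g <- enum G']%N,
   F j [seq (tent T (wk T w v)).2 | w <- rws r]).
exists (fun T => flatten [seq [seq ent T v j | j <- enum (rj r)] | v <- iota 0 (size T)]).
  pt; rewrite /ent; pt; first by apply: PT_wk; pt.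
  apply: PT_app; first by apply: (proj1 (hF' _)).
  by pt; apply: PT_wk; pt.
move=> T X [code [ci cs cb ce]].
have hall : all (fun s => size s == #|rj r|) [seq [seq ent T v j | j <- enum (rj r)] | v <- iota 0 (size T)].
  by apply/allP => s /mapP[v _ ->]; rewrite size_map -cardE.
exists (fun p => (code p.1 * #|rj r| + enum_rank p.2)%N); split.
- move=> [v j] [v' j'] /= e; have hj : (enum_rank j < #|rj r|)%N := ltn_ord _; have hj' : (enum_rank j' < #|rj r|)%N := ltn_ord _.
  have [e1 e2] := divmod_inj hj hj' e.
  by rewrite (ci _ _ e1); congr pair; apply: enum_rank_inj; apply: val_inj.
- by rewrite /= (size_flatten_const hall) size_map size_iota cs card_prod.
- move=> [v j] /=; rewrite /= (size_flatten_const hall) size_map size_iota.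
  by apply: mixlt => //; apply: ltn_ord.
move=> [v j] /=; rewrite /tent (nth_flatten_const _ _ hall) ?ltn_ord //.
rewrite (nth_map 0%N) ?size_iota // nth_iota // add0n nth_enum_map /ent; congr pair.
  by apply: eq_map => g; rewrite (rep_wk _ _ ce).
have [_ ->] := hF' j; first 1 last.
- by rewrite size_map.
- by apply/allP => i /mapP[w _ ->]; rewrite (rep_wk _ _ ce) ce /=.
congr (nat_of_ord (enum_rank (rlab _ _))); rewrite -map_comp; apply: eq_map => w /=.
by rewrite (rep_wk _ _ ce) ce /= /d nth_enum_rank.
Qed.

End Rule.

Definition lprod (G1 C1 G2 C2 C : Type) (cmb : C1 -> C2 -> C) (X1 : lgraph G1 C1) (X2 : lgraph G2 C2) :
    lgraph (G1 * G2) C :=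
  @LGraph (G1 * G2)%type C (lv X1 * lv X2)%type
    (fun g p => (la X1 g.1 p.1, la X2 g.2 p.2)) (fun p => cmb (ll X1 p.1) (ll X2 p.2)).

Lemma lprod_PT (G1 C1 G2 C2 C : finType) (cmb : C1 -> C2 -> C) :
  exists2 F : tbl * tbl -> tbl, PT F & forall T1 T2 (X1 : lgraph G1 C1) (X2 : lgraph G2 C2),
    encodes T1 X1 -> encodes T2 X2 -> encodes (G := (G1 * G2)%type) (F (T1, T2)) (lprod cmb X1 X2).
Proof.
pose ct : seq (seq nat) := [seq [seq (enum_rank (cmb c1 c2) : nat) | c2 <- enum C2] | c1 <- enum C1].
pose ent (q : tbl * tbl) v1 v2 : seq nat * nat :=
  ([seq nth 0%N (tent q.1 v1).1 (enum_rank g.1) * size q.2 + nth 0%N (tent q.2 v2).1 (enum_rank g.2) | g : G1 * G2 <- enum {: G1 * G2}]%N,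
   nth 0%N (nth [::] ct (tent q.1 v1).2) (tent q.2 v2).2).
exists (fun q => flatten [seq [seq ent q v1 v2 | v2 <- iota 0 (size q.2)] | v1 <- iota 0 (size q.1)]).
  pt; apply: PT_pair; pt.
move=> T1 T2 X1 X2 [code1 [ci1 cs1 cb1 ce1]] [code2 [ci2 cs2 cb2 ce2]].
have hall : all (fun s => size s == size T2) [seq [seq ent (T1, T2) v1 v2 | v2 <- iota 0 (size T2)] | v1 <- iota 0 (size T1)].
  by apply/allP => s /mapP[v _ ->]; rewrite size_map size_iota.
exists (fun p => code1 p.1 * size T2 + code2 p.2)%N; split.
- move=> [v j] [v' j'] /= e; have hj := cb2 j; have hj' := cb2 j'.
  have [e1 e2] := divmod_inj hj hj' e.
  by rewrite (ci1 _ _ e1) (ci2 _ _ e2).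
- by rewrite /= (size_flatten_const hall) size_map size_iota card_prod -cs1 -cs2.
- move=> [v j] /=; rewrite /= (size_flatten_const hall) size_map size_iota.
  exact: mixlt.
move=> [v j] /=; rewrite /tent (nth_flatten_const _ _ hall) //.
rewrite (nth_map 0%N) ?size_iota // nth_iota // add0n (nth_map 0%N) ?size_iota // nth_iota // add0n /ent /= ce1 ce2 /=.
congr pair; first by apply: eq_map => g; rewrite !nth_enum_map.
by rewrite /ct !nth_enum_map.
Qed.

(** Numbers are unary, but every entry is a vertex number or the rank of a label, so the code is at
    most quadratic in the number of vertices. This keeps the iterations of rules polynomial. *)
Lemma rep_sz (G C : finType) T (X : lgraph G C) : encodes T X ->
  (sz T <= size T * (#|G| * (2 * size T + 2) + 2 * #|C| + 4) + 1)%N.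
Proof.
move=> [code [ci cs cb ce]].
have h i : (i < size T)%N -> (sz (tent T i) <= #|G| * (2 * size T + 2) + 2 * #|C| + 3)%N.
  move=> hi; have [v <-] := rep_surj ci cs cb hi; rewrite ce sz_pair sz_nat.
  have hr : (enum_rank (ll X v) < #|C|)%N := ltn_ord _.
  have : (sz [seq code (la X g v) | g <- enum G] <= size (enum G) * (2 * size T + 2) + 1)%N.
    elim: (enum G) => //= g s ih; rewrite sz_cons sz_nat mulSn.
    by have := cb (la X g v); lia.
  have eG : size (enum G) = #|G| by rewrite -cardE.
  rewrite eG; move: (sz (map _ _)) (#|G| * _)%N hr => x y; lia.
have : forall n, (n <= size T)%N -> (sz (drop (size T - n) T) <= n * (#|G| * (2 * size T + 2) + 2 * #|C| + 4) + 1)%N.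
  elim=> [|n ih] hn; first by rewrite subn0 drop_size.
  rewrite (drop_nth ([::], 0%N)); last by lia.
  rewrite sz_cons -/(tent _ _); have := h (size T - n.+1)%N.
  have -> : (size T - n.+1).+1 = (size T - n)%N by lia.
  by have := ih (ltnW hn); move: (sz (tent _ _)) (sz (drop _ _)) => x y; rewrite mulSn => ? /(_ _); lia.
by move/(_ (size T) (leqnn _)); rewrite subnn drop0.
Qed.

(** * One round of gap amplification *)

Lemma pad_pow B n : (1 < B)%N -> (0 < n)%N -> exists i, (n <= B ^ i <= B * n)%N.
Proof.
move=> hB hn; exists (up_log B n); rewrite up_logP //=.
case: (leqP n 1) => h1; first by have -> : n = 1%N; [lia|rewrite up_log1 expn0; lia].
have [/= h _] := andP (up_log_bounds hB h1).
have -> : up_log B n = (up_log B n).-1.+1 by rewrite prednK // up_log_gt0; lia.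
by rewrite expnS leq_mul2l ltnW ?orbT.
Qed.

Lemma embed_ord (T : finType) n : (#|T| <= n)%N -> exists f : T -> 'I_n, injective f.
Proof.
move=> h; exists (fun x => widen_ord h (enum_rank x)) => x y e.
by apply: enum_rank_inj; apply: val_inj; move/(congr1 val): e.
Qed.

Lemma walk_flatten (V K G : Type) (act : G -> V -> V) (kw : K -> seq G) s v :
  walk act (flatten (map kw s)) v = walk (fun k => walk act (kw k)) s v.
Proof. by elim: s v => //= k s ih v; rewrite walk_cat ih. Qed.

Lemma isg_ext (V K : Type) (a b : K -> V -> V) inv : (forall k v, a k v = b k v) -> isg a inv -> isg b inv.
Proof. by move=> e [h1 h2]; split=> // k v; rewrite -!e. Qed.

Lemma ar_ratio (R : realFieldType) (c L J D Rn K V : nat) (XX VV : R) :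
  (0 < J)%N -> (0 < D)%N -> (0 < Rn)%N -> (0 < K)%N -> (0 < V)%N -> 0 <= VV ->
  Rn%:R * XX <= c%:R * VV -> (c * J * D <= L * Rn * K)%N ->
  XX / (V%:R * K%:R) <= L%:R * (VV / (V%:R * J%:R * D%:R)).
Proof.
move=> J0 D0 R0 K0 V0 v0 hs key.
have [j0 d0 r0 k0 w0] : [/\ 0 < J%:R :> R, 0 < D%:R :> R, 0 < Rn%:R :> R, 0 < K%:R :> R & 0 < V%:R :> R] by rewrite !ltr0n.
have keyR : c%:R * (J%:R * D%:R) <= L%:R * (Rn%:R * K%:R) :> R by rewrite -!natrM ler_nat !mulnA.
rewrite ler_pdivrMr ?mulr_gt0 // -(ler_pM2l r0); apply: le_trans hs _.
have -> : Rn%:R * (L%:R * (VV / (V%:R * J%:R * D%:R)) * (V%:R * K%:R)) =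
   (L%:R * (Rn%:R * K%:R)) / (J%:R * D%:R) * VV :> R.
  by field; rewrite !gt_eqF.
by apply: ler_wpM2r => //; rewrite ler_pdivlMr ?mulr_gt0.
Qed.

(** Relative to |Rnd| * |K'|, the checks count 6 and the copies at most 2 Bq + 24 Bq. Rounding up to
    a power of [Bq] costs one factor, and the exponent demanded by [lift_gens] four more, whence
    Bq^5. *)
Lemma ar_size (c Bq x1 x2 x3 x5 x6 x7 n0 J D : nat) :
  (x6 <= Bq * (x5 * 2 * (x2 * (x3 * x3 * x3))))%N -> (x7 <= Bq * (6 * 4 * (x1 * x2 * (x3 * x3))))%N ->
  n0 = (x5 * 6 * (x1 * x2 * (x3 * x3 * x3)) + (x1 * x6 + x5 * x3 * x7))%N -> (J <= Bq ^ 5 * n0)%N ->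
  (c * J * D <= c * (Bq ^ 5 * (6 + 26 * Bq)) * D * (x1 * x2 * (x3 * x3 * x3)) * x5)%N.
Proof.
move=> h1 h2 en hJ; pose y := (x1 * x2 * (x3 * x3 * x3) * x5)%N.
have h1' : (x1 * x6 <= 2 * Bq * y)%N.
  apply: leq_trans (leq_mul (leqnn x1) h1) _; rewrite leq_eqVlt; apply/orP; left; apply/eqP; rewrite /y; ring.
have h2' : (x5 * x3 * x7 <= 24 * Bq * y)%N.
  apply: leq_trans (leq_mul (leqnn _) h2) _; rewrite leq_eqVlt; apply/orP; left; apply/eqP; rewrite /y; ring.
have hn : (n0 <= (6 + 26 * Bq) * y)%N.
  rewrite en; have -> : (x5 * 6 * (x1 * x2 * (x3 * x3 * x3)) = 6 * y)%N by rewrite /y; ring.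
  move: h1' h2'; move: (x1 * x6)%N (x5 * x3 * x7)%N => y1 y2.
  by rewrite mulnDl -!mulnA; move: (Bq * y)%N => y3; lia.
apply: leq_trans (leq_mul (leq_mul (leqnn c) (leq_trans hJ (leq_mul (leqnn _) hn))) (leqnn D)) _.
by rewrite leq_eqVlt; apply/orP; left; apply/eqP; rewrite /y; ring.
Qed.

Section Family.
Variables (R : realFieldType) (K1 : finType) (inv1 : K1 -> K1).
Hypotheses (K1gt : (1 < #|K1|)%N).
Hypothesis fam : forall i (M : finType), #|M| = ((#|K1| ^ 2) ^ i)%N ->
  exists2 act : K1 -> M -> M, isg act inv1 & contr act (1 / 4%:R : R).

Definition xK : finType := ((K1 * K1) * (K1 * K1))%type.
Definition xinv (k : xK) : xK := ((inv1 k.2.2, inv1 k.2.1), (inv1 k.1.2, inv1 k.1.1)).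
Definition gD : finType := ar_D K1.
(** The generators [xK] carry no constraint and only provide mixing. The label of a vertex, in [gC],
    tabulates the constraints of all generators [gD] there. *)
Definition gG : finType := (xK + gD)%type.
Definition gC : finType := {ffun gD * (ar_S * ar_S) -> bool}.

Definition xgood (G C : Type) (ex : xK -> G) (X : lgraph G C) : Prop :=
  [/\ (0 < #|lv X|)%N, isg (fun k => la X (ex k)) xinv & contr (fun k => la X (ex k)) (1 / 4%:R : R)].

Definition good (X : lgraph gG gC) : Prop :=
  [/\ xgood inl X, isg (fun d => la X (inr d)) (ar_inv inv1)
    & forall v d, exists s s', ll X v (d, (s, s'))].

Definition vio (X : lgraph gG gC) (a : lv X -> ar_S) : R :=
  avg (fun v => avg (fun d : gD => (~~ ll X v (d, (a v, a (la X (inr d) v))))%:R)).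

Definition satisfiable (X : lgraph gG gC) : Prop :=
  exists a : lv X -> ar_S, forall v d, ll X v (d, (a v, a (la X (inr d) v))).

Let Bq := (#|K1| ^ 2)%N.
(* Independent of the alphabet and of the number of generators: this is why the
   gain of powering survives alphabet reduction. *)
Definition ar_loss : nat := (384 * (Bq ^ 5 * (6 + 26 * Bq)) * #|gD|)%N.

Lemma Bq_gt1 : (1 < Bq)%N.
Proof. by rewrite /Bq -[X in (X < _)%N](exp1n 2) ltn_exp2r. Qed.

(** Alphabet reduction as a local rule. The constraint graph is given by words [kw] and by a
    function [dl] of the labels found along [ws], so that one statement serves both the tableau and
    the powered graph. *)
Theorem ar_step (G C K' A : finType) (ex : xK -> G) (kw : K' -> seq G) (inv' : K' -> K') (a0 : A)
    (ws : seq (seq G)) (dl : K' -> seq C -> {ffun A * A -> bool}) : (0 < #|K'|)%N ->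
  exists2 r : rule G C gG gC, (0 < #|rj r|)%N &
  forall X : lgraph G C, xgood ex X -> isg (fun k => walk (la X) (kw k)) inv' ->
  let cst v k := dl k [seq ll X (walk (la X) w v) | w <- ws] in
  [/\ good (rapp r X),
   (exists a : lv X -> A, forall v k, cst v k (a v, a (walk (la X) (kw k) v))) -> satisfiable (rapp r X)
   & forall a', exists sg : lv X -> A,
      avg (fun v => avg (fun k => (~~ cst v k (sg v, sg (walk (la X) (kw k) v)))%:R)) <=
      ar_loss%:R * @vio (rapp r X) a'].
Proof.
move=> K0.
pose Dl : finType := {ffun A * A -> bool}; pose cU := cube (U A Dl).
pose RU : finType := (cube A * cube Dl * (cU * cU))%type.
pose RA : finType := (cube Dl * (cU * cU * cU))%type.
pose Rnd : finType := Rand A Dl.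
have B1 := Bq_gt1.
have cube0 (T : finType) : (0 < #|cube T|)%N by rewrite card_ffun expn_gt0 card_bool.
have [i1 /andP[l1 u1]] := @pad_pow Bq #|{: K' * bool * RA}| B1 ltac:(by rewrite !card_prod !muln_gt0 K0 card_bool !cube0).
have [i2 /andP[l2 u2]] := @pad_pow Bq #|{: 'I_6 * 'I_4 * RU}| B1 ltac:(by rewrite !card_prod !muln_gt0 !card_ord !cube0).
have [iv iv_inj] := embed_ord l1; have [ie ie_inj] := embed_ord l2.
pose Mv : finType := 'I_(Bq ^ i1); pose Me : finType := 'I_(Bq ^ i2).
have [hv sgv cv] := @fam i1 Mv (card_ord _); have [he sge ce] := @fam i2 Me (card_ord _).
pose n0 := (#|ar_chk K' A| + #|ar_copy K' A Mv Me|)%N.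
have n00 : (0 < n0)%N by rewrite addn_gt0 !card_prod !muln_gt0 K0 !card_ord !cube0.
have [i3 /andP[l3 u3]] := pad_pow B1 n00.
(* Padding turns the number of new vertices per old one into a power of [Bq] with exponent at least
   4, as [lift_gens] requires. *)
pose nD := (Bq ^ (i3 + 4) - n0)%N.
have l3' : (n0 <= Bq ^ (i3 + 4))%N.
  by apply: leq_trans l3 _; rewrite leq_exp2l //; lia.
pose J : finType := ar_J K' A Mv Me 'I_nD.
have cJ : #|J| = (Bq ^ (i3 + 4))%N by rewrite [LHS]card_sum card_ord [X in (X + _)%N]card_sum -/n0 /nD subnKC.
have J0 : (0 < #|J|)%N by rewrite cJ expn_gt0 ltnW.
have [h sgh ch] := @fam (i3 + 4)%N J cJ.
have [lw [lt hlift]] := @lift_gens R K1 inv1 J h (i3 + 4)%N K1gt ltac:(by lia) cJ sgh ch.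
pose r : rule G C gG gC := @Rule G C gG gC J
  (fun g j => match g with
     | inl k => [:: ex (lw k j).1; ex (lw k j).2]
     | inr d => flatten (map kw (jword inv' iv ie d j)) end)
  (fun g j => match g with inl k => lt k j | inr d => jtgt iv ie hv he d j end)
  ws
  (fun j cs => [ffun q : gD * (ar_S * ar_S) => jcst (fun k => dl k cs) q.1 j q.2.1 q.2.2]).
exists r; first exact: J0.
move=> X [V0 sgX cX] sgK cst.
set act := fun k => walk (la X) (kw k).
have laD d p : la (rapp r X) (inr d) p = jact act inv' iv ie hv he d p.
  by rewrite /= walk_flatten.
have labE p (d : gD) s s' : ll (rapp r X) p (d, (s, s')) = jcst (cst p.1) d p.2 s s'.
  by rewrite /= ffunE.
have K10 : (0 < #|K1|)%N by lia.
have V0' : (0 < #|lv (rapp r X)|)%N by rewrite card_prod muln_gt0 V0; exact: J0.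
split.
- split; last by move=> p d; have [s [s' hs]] := jcst_nonempty (cst p.1) d p.2; exists s, s'; rewrite labE.
    have [hx1 hx2] := hlift _ _ sgX cX.
    by split.
  apply: (@isg_ext _ _ (jact act inv' iv ie hv he)) => [d p|]; first by rewrite laD.
  exact: (isg_jact sgK 'I_nD iv_inj ie_inj sgv sge).
- move=> [a ha]; have [a' ha'] := ar_complete inv' 'I_nD iv ie hv he ha.
  by exists a' => p d; rewrite labE laD; apply: ha'.
move=> a'; exists (ar_sigma R (Dummy := 'I_nD) a0 a').
have := ar_sound sgK cst a0 iv_inj ie_inj sgv sge cv ce K10 a'.
set XX := ar_X _ _ _ _ _; set VV := ar_VV _ _ _ _ _ _ _ _ _ => hs.
have eX : avg (fun v => avg (fun k => (~~ cst v k (ar_sigma R (Dummy := 'I_nD) a0 a' v, ar_sigma R (Dummy := 'I_nD) a0 a' (act k v)))%:R)) =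
    XX / (#|lv X|%:R * #|K'|%:R).
  by rewrite /avg -mulr_suml -mulrA invfM [_^-1 * _^-1]mulrC.
have eV : vio a' = VV / (#|lv X|%:R * #|J|%:R * #|gD|%:R).
  rewrite /vio /avg -mulr_suml -mulrA; congr (_ * _).
    by apply: eq_bigr => p _; apply: eq_bigr => d _; rewrite labE laD.
  have -> : #|lv (rapp r X)| = (#|lv X| * #|J|)%N by rewrite card_prod.
  by rewrite natrM !invfM mulrC.
rewrite eX eV.
have VV0 : 0 <= VV by apply: sumr_ge0 => p _; apply: sumr_ge0 => d _; rewrite ler0n.
have D0 : (0 < #|gD|)%N by rewrite card_sum card_ord.
have Rn0 : (0 < #|Rnd|)%N by rewrite !card_prod !muln_gt0 !cube0.
have key : (384 * #|J| * #|gD| <= ar_loss * #|Rnd| * #|K'|)%N.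
  have c1 : #|ar_chk K' A| = (#|K'| * 6 * #|Rnd|)%N by rewrite [LHS]card_prod [X in (X * _)%N]card_prod card_ord.
  have c2 : #|ar_copy K' A Mv Me| = (#|cube A| * Bq ^ i1 + #|K'| * #|cU| * Bq ^ i2)%N.
    by rewrite [LHS]card_sum !card_prod !card_ord.
  have c3 : #|{: K' * bool * RA}| = (#|K'| * 2 * (#|cube Dl| * (#|cU| * #|cU| * #|cU|)))%N by rewrite !card_prod card_bool.
  have c4 : #|{: 'I_6 * 'I_4 * RU}| = (6 * 4 * (#|cube A| * #|cube Dl| * (#|cU| * #|cU|)))%N by rewrite !card_prod !card_ord.
  have cRnd : #|Rnd| = (#|cube A| * #|cube Dl| * (#|cU| * #|cU| * #|cU|))%N by rewrite !card_prod.
  have hJ : (#|J| <= Bq ^ 5 * n0)%N.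
    rewrite cJ expnD; apply: leq_trans (leq_mul u3 (leqnn _)) _.
    by rewrite mulnAC -expnS.
  rewrite cRnd; rewrite c3 in u1; rewrite c4 in u2.
  by apply: ar_size u1 u2 _ hJ; rewrite /n0 c1 c2 cRnd.
by apply: ar_ratio key.
Qed.

(** The flag decides which component acts, so expander and constraint steps have probability 1/2
    each, whatever the sizes of [xK] and [gD]. *)
Definition pE : finType := (bool * xK * gD)%type.
Definition emb (e : pE) : gG := if e.1.1 then inl e.1.2 else inr e.2.
Definition pinvE (e : pE) : pE := (e.1.1, xinv e.1.2, ar_inv inv1 e.2).

Lemma isg_emb X : good X -> isg (fun e => la X (emb e)) pinvE.
Proof.
move=> [[_ [sx ix] _] [sd id] _]; split=> [[[[] k] d] v|[[b k] d]]; rewrite /emb /=; [exact: sx|exact: sd|].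
by rewrite /pinvE /= ix id.
Qed.

Lemma avg_bool (f : bool -> R) : avg f = (f true + f false) / 2.
Proof. by rewrite /avg big_bool card_bool. Qed.

Lemma xK_gt0 : (0 < #|xK|)%N. Proof. by rewrite !card_prod !muln_gt0 (ltnW K1gt). Qed.
Lemma gD_gt0 : (0 < #|gD|)%N. Proof. by rewrite card_sum card_ord. Qed.

Lemma pE_gt0 : (0 < #|pE|)%N.
Proof. by rewrite card_prod muln_gt0 gD_gt0 card_prod muln_gt0 card_bool xK_gt0. Qed.

Lemma ar_loss_gt0 : (0 < ar_loss)%N.
Proof.
have B1 := Bq_gt1; have h5 : (0 < Bq ^ 5)%N by rewrite expn_gt0; lia.
by rewrite /ar_loss -/Bq muln_gt0 gD_gt0 andbT muln_gt0 /= muln_gt0 h5 /=; lia.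
Qed.

Lemma avg_emb (f : gG -> R) : avg (fun e => f (emb e)) = (avg (fun k => f (inl k)) + avg (fun d => f (inr d))) / 2.
Proof.
rewrite avg_pair avg_pair avg_bool /emb /=; congr ((_ + _) / _).
  by apply: eq_avg => k; rewrite avg_cst ?gD_gt0.
by rewrite avg_cst ?xK_gt0.
Qed.

(** Convexity gives (1/4 + 1)/2 = 5/8 <= 16/25, and the square root of 16/25 is rational. *)
Lemma contr_emb X : good X -> contr (fun e => la X (emb e)) (16%:R / 25%:R : R).
Proof.
move=> [[_ sx cx] sd _] f f0.
apply: le_trans (_ : _ <= avg (fun v => (avg (fun k => f (la X (inl k) v)) ^+ 2 + avg (fun d : gD => f (la X (inr d) v)) ^+ 2) / 2)) _.
  apply: le_avg => v; rewrite (avg_emb (fun g => f (la X g v))).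
  set x := avg _; set y := avg _; have := sqr_ge0 (x - y); nra.
rewrite avgZr avgD; have h1 := cx f f0.
have h2 : avg (fun v => avg (fun d : gD => f (la X (inr d) v)) ^+ 2) <= avg (fun v => f v ^+ 2).
  apply: le_trans (_ : _ <= avg (fun v => avg (fun d : gD => f (la X (inr d) v) ^+ 2))) _.
    by apply: le_avg => v; apply: avg_sqr.
  by rewrite (avg_act (fun v => f v ^+ 2) sd gD_gt0).
have h3 : 0 <= avg (fun v => f v ^+ 2) by apply: avg_ge0 => v; apply: sqr_ge0.
by move: h1 h2 h3; set x := avg _; set y := avg _; set z := avg _; lra.
Qed.

Lemma walk_emb (X : lgraph gG gC) s v : walk (la X) (map emb s) v = walk (fun e => la X (emb e)) s v.
Proof. by elim: s v => //= e s ih v. Qed.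

(** * Powering as a constraint system on words *)

Section Powering.
Variable B : nat.
Hypothesis B0 : (0 < B)%N.

Definition pK : finType := ('I_(B + B) * (B + B).-tuple pE)%type.
Definition pkw (k : pK) : seq gG := map emb (take k.1.+1 k.2).
(** Only the prefix actually walked is reversed; keeping the rest makes this an involution. *)
Definition pinv (k : pK) : pK :=
  (k.1, insubd k.2 (winv pinvE (take k.1.+1 k.2) ++ drop k.1.+1 k.2)).
Definition pA : finType := {ffun B.-bseq pE -> ar_S}.
Definition opin (l : pA) (w : seq pE) : ar_S := l (insub_bseq B w).
Definition pws : seq (seq gG) := [seq map emb w | w : B.-bseq pE <- enum {: B.-bseq pE}].
Definition pdl (k : pK) (cs : seq gC) : {ffun pA * pA -> bool} :=
  [ffun q : pA * pA => [forall j : 'I_B, forall m : 'I_B, (j + m == k.1)%N ==>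
    (if drop j k.2 is e :: u then e.1.1 ||
       (nth [ffun=> true] cs (enum_rank (insub_bseq B (take j k.2)))
          (e.2, (opin q.1 (take j k.2), opin q.2 (winv pinvE (take m u)))))
     else true)]].
Definition pcs (X : lgraph gG gC) (v : lv X) (e : pE) (s s' : ar_S) : bool :=
  e.1.1 || ll X v (e.2, (s, s')).

Lemma val_insub_bseq (w : seq pE) : (size w <= B)%N -> insub_bseq B w = w :> seq pE.
Proof. by move=> h; rewrite /insub_bseq val_insubd h. Qed.

Lemma pdlE (X : lgraph gG gC) v k (q : pA * pA) :
  pdl k [seq ll X (walk (la X) w v) | w <- pws] q =
  pcst (fun e => la X (emb e)) pinvE (@pcs X) v k (opin q.1) (opin q.2).
Proof.
rewrite ffunE /pcst; apply: eq_forallb => j; apply: eq_forallb => m; congr (_ ==> _).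
case: (drop j k.2) => // e u; rewrite /pcs -map_comp; congr (_ || _).
rewrite nth_enum_map /= val_insub_bseq ?walk_emb //.
by rewrite size_take; case: ltnP; have := ltn_ord j; lia.
Qed.

Lemma pinv_tuple (k : pK) : (pinv k).2 = winv pinvE (take k.1.+1 k.2) ++ drop k.1.+1 k.2 :> seq pE.
Proof.
rewrite val_insubd size_cat size_winv size_drop size_takel ?size_tuple //.
by have := ltn_ord k.1; case: ifP => // /eqP; lia.
Qed.

Lemma take_pinv (k : pK) : take (pinv k).1.+1 (pinv k).2 = winv pinvE (take k.1.+1 k.2).
Proof.
rewrite pinv_tuple take_size_cat // size_winv size_takel // size_tuple.
exact: ltn_ord.
Qed.

Lemma isg_pkw X : good X -> isg (fun k => walk (la X) (pkw k)) pinv.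
Proof.
move=> gX; have sg := isg_emb gX; split=> [k v|k].
  by rewrite /pkw !walk_emb take_pinv walk_winv.
rewrite [LHS]surjective_pairing [RHS]surjective_pairing; congr pair; apply: val_inj.
rewrite -[LHS]/(tval (pinv (pinv k)).2) -[RHS]/(tval k.2).
rewrite pinv_tuple take_pinv (winvK sg) pinv_tuple drop_size_cat ?cat_take_drop //.
by rewrite size_winv size_takel // size_tuple; exact: ltn_ord.
Qed.

Lemma pow_complete X : good X -> satisfiable X -> exists a : lv X -> pA,
  forall v k, pdl k [seq ll X (walk (la X) w v) | w <- pws] (a v, a (walk (la X) (pkw k) v)).
Proof.
move=> gX [a ha]; have sg := isg_emb gX; pose act e := la X (emb e).
exists (fun v => [ffun w : B.-bseq pE => a (walk act w v)]) => v k.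
rewrite pdlE; apply/forallP => j; apply/forallP => m; apply/implyP => /eqP ejm.
case E: (drop j k.2) => [//|e u].
have sz_t : size (tval k.2) = (B + B)%N by rewrite size_tuple.
have hj := ltn_ord j; have hm := ltn_ord m.
have su : (size u).+1 = (B + B - j)%N by move/(congr1 size): E; rewrite size_drop sz_t /=.
have smu : (size (take m u) <= B)%N by rewrite size_take; case: ltnP; lia.
rewrite /opin !ffunE /= !val_insub_bseq ?size_winv //; last by rewrite size_take; case: ltnP; lia.
have et : take k.1.+1 k.2 = take j k.2 ++ e :: take m u.
  rewrite -ejm -addnS -{1}(cat_take_drop j k.2) takeD; congr (_ ++ _).
    by rewrite cat_take_drop.
  by rewrite drop_size_cat ?E // size_takel // sz_t; lia.
rewrite /pkw walk_emb et walk_cat /= -/act -/(walk act _ _) (walk_winv sg) /pcs.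
set y := walk act _ v; rewrite /act /emb; case: e.1.1 => //=.
Qed.

Lemma pow_sound X (sg : lv X -> pA) : good X -> exists a : lv X -> ar_S,
  let rj : R := avg (fun v => avg (fun k : pK =>
    (~~ pdl k [seq ll X (walk (la X) w v) | w <- pws] (sg v, sg (walk (la X) (pkw k) v)))%:R)) in
  let mu : R := vio a / 2 in
  (B%:R * mu / (2 * #|ar_S|%:R ^+ 2)) ^+ 2 <= rj * (B%:R * (11%:R * mu) + B%:R ^+ 2 * mu ^+ 2).
Proof.
move=> gX; have [[V0 _ _] _ _] := gX; have sge := isg_emb gX; have ce := contr_emb gX.
have E0 := pE_gt0.
pose A v := opin (sg v); pose s0 : ar_S := [ffun=> false].
have := power_sound sge E0 V0 s0 (@pcs X) ce B0 A.
pose a := sgm R (fun e : pE => la X (emb e)) pinvE s0 B A => H; exists a; cbv zeta; move: H.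
have -> : mu R (fun e => la X (emb e)) pinvE s0 (@pcs X) B A = vio a / 2.
  rewrite /mu /vio -avgZr; apply: eq_avg => v; rewrite /chi -/a.
  rewrite (eq_avg (g := fun e => (fun g => if g is inr d then (~~ ll X v (d, (a v, a (la X g v))))%:R else 0) (emb e))).
    rewrite (avg_emb (fun g => if g is inr d then (~~ ll X v (d, (a v, a (la X g v))))%:R else 0)).
    by rewrite (avg_cst 0 xK_gt0) add0r.
  by move=> [[[] k] d].
rewrite /prej; move/le_trans; apply; rewrite le_eqVlt; apply/orP; left; apply/eqP; congr (_ * _).
by apply: eq_avg => v; apply: eq_avg => k; rewrite pdlE /pkw walk_emb.
Qed.

End Powering.

(** Put z = B w / 2, where w >= m is the violation of the plurality assignment. Powering gives z <=
    q rej (11 + z). If z <= 1, then 12 q rej >= z >= B m / 2 = 24 q m loss; otherwise 12 q rej >= 1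
    >= 24 q m loss by the cap [m0]. Either way rej >= 2 m loss, and alphabet reduction divides by
    the loss. *)
Theorem round : exists (r : rule gG gC gG gC) (m0 : R), [/\ (0 < #|rj r|)%N, 0 < m0 &
  forall X, good X -> [/\ good (rapp r X), satisfiable X -> satisfiable (rapp r X) &
    forall m, 0 <= m -> 2 * m <= m0 -> (forall a : lv X -> ar_S, m <= vio a) ->
    forall a : lv (rapp r X) -> ar_S, 2 * m <= vio a]].
Proof.
pose q := (4 * #|ar_S| ^ 4)%N; pose B := (48 * q * ar_loss)%N.
have S0 : (0 < #|ar_S|)%N by rewrite card_ffun expn_gt0 card_bool.
have q0 : (0 < q)%N by rewrite /q muln_gt0 expn_gt0 S0.
have B10 := Bq_gt1.
have L0 := ar_loss_gt0.
have B0 : (0 < B)%N by rewrite /B muln_gt0 L0 andbT muln_gt0 q0.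
have K0 : (0 < #|pK B|)%N.
  by rewrite card_prod card_ord card_tuple muln_gt0 expn_gt0 pE_gt0 addn_gt0 B0.
have [r r0 hr] := @ar_step gG gC (pK B) (pA B) inl (@pkw B) (@pinv B) [ffun=> [ffun=> false]] (pws B) (@pdl B) K0.
exists r, (12%:R * q%:R * ar_loss%:R)^-1; split=> //.
  by rewrite invr_gt0 !mulr_gt0 ?ltr0n.
move=> X gX; have [xg _ _] := gX.
have sk : isg (fun k : pK B => walk (la X) (pkw k)) (@pinv B) by apply: isg_pkw.
have := hr X xg sk; cbv zeta; case=> h1 h2 h3.
split=> //; first by move=> cs; apply: h2; apply: pow_complete.
move=> m m_ge0 hm gap a'; have [sg] := h3 a'; have [a] := pow_sound B0 sg gX.
cbv zeta; set rej := avg _ => hp hl; have := gap a; set w := vio a in hp *; set w' := vio a' in hl * => hw.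
have w'0 : 0 <= w' by apply: avg_ge0 => v; apply: avg_ge0 => d; rewrite ler0n.
have [->|mn0] := eqVneq m 0; first by rewrite mulr0.
have m_gt0 : 0 < m by rewrite lt_def mn0.
have qR : 0 < q%:R :> R by rewrite ltr0n.
have LR : 0 < ar_loss%:R :> R by rewrite ltr0n.
have SR : 0 < #|ar_S|%:R :> R by rewrite ltr0n.
have qE : q%:R = 4%:R * #|ar_S|%:R ^+ 4 :> R by rewrite natrM natrX.
have BE : B%:R = 48%:R * q%:R * ar_loss%:R :> R by rewrite !natrM.
have BR : 0 < B%:R :> R by rewrite ltr0n.
have rej0 : 0 <= rej by apply: avg_ge0 => v; apply: avg_ge0 => k; rewrite ler0n.
pose z := B%:R * (w / 2).
have z0 : 0 < z by rewrite /z mulr_gt0 // divr_gt0 //; lra.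
have hz : z <= q%:R * rej * (11%:R + z).
  have := hp; have -> : (B%:R * (w / 2) / (2 * #|ar_S|%:R ^+ 2)) ^+ 2 = z * (z / q%:R).
    by rewrite qE /z; field; rewrite gt_eqF.
  have -> : rej * (B%:R * (11%:R * (w / 2)) + B%:R ^+ 2 * (w / 2) ^+ 2) = z * (rej * (11%:R + z)) by rewrite /z; field.
  by rewrite ler_pM2l // ler_pdivrMr // => h; apply: le_trans h _; rewrite le_eqVlt; apply/orP; left; apply/eqP; ring.
have rq : 0 <= q%:R * rej by rewrite mulr_ge0 // ltW.
have goal : 2 * m * ar_loss%:R <= rej.
  rewrite -(ler_pM2l (_ : 0 < 12%:R * q%:R)); last by rewrite mulr_gt0.
  have [z1|z1] := lerP z 1.
    have : z <= q%:R * rej * 12%:R.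
      by apply: le_trans hz _; apply: ler_wpM2l => //; lra.
    have : B%:R * (m / 2) <= z by rewrite /z ler_pM2l //; lra.
    rewrite BE; move: rq; set u := q%:R * rej.
    have -> : 12%:R * q%:R * rej = 12%:R * u by rewrite /u; ring.
    have -> : 12%:R * q%:R * (2 * m * ar_loss%:R) = 48%:R * q%:R * ar_loss%:R * (m / 2) by field.
    by lra.
  have h12 : 1 <= 12%:R * (q%:R * rej).
    rewrite -(ler_pM2l z0) mulr1; apply: le_trans hz _.
    have : q%:R * rej * (11%:R + z) <= q%:R * rej * (12%:R * z) by apply: ler_wpM2l => //; lra.
    by move=> h; apply: le_trans h _; rewrite le_eqVlt; apply/orP; left; apply/eqP; ring.
  have : 2 * m * (12%:R * q%:R * ar_loss%:R) <= 1.
    by rewrite -ler_pdivlMr ?mulr_gt0 // mul1r.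
  have -> : 2 * m * (12%:R * q%:R * ar_loss%:R) = 12%:R * q%:R * (2 * m * ar_loss%:R) by ring.
  by rewrite -[X in _ -> _ <= X]mulrA => h; apply: le_trans h h12.
rewrite -(ler_pM2r LR); apply: le_trans goal _; by rewrite [w' * _]mulrC.
Qed.

End Family.

(** * Computation tableaux *)

Section Tableau.
Variable M : turing_machine.

Definition cell : finType := (option (bool + tm_aux M) * option (tm_state M))%type.
Definition blank : cell := (None, None).

Definition sym_next (b : cell) : option (bool + tm_aux M) :=
  if b.2 is Some q then if tm_delta q b.1 is Some (_, s, _) then s else b.1 else b.1.
Definition from_left (a : cell) : option (tm_state M) :=
  if a.2 is Some q then if tm_delta q a.1 is Some (q', _, MoveRight) then Some q' else None else None.
Definition from_right (c : cell) : option (tm_state M) :=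
  if c.2 is Some q then if tm_delta q c.1 is Some (q', _, MoveLeft) then Some q' else None else None.
Definition from_self (b : cell) : option (tm_state M) :=
  if b.2 is Some q then
    match tm_delta q b.1 with
    | None => Some q
    | Some (q', _, MoveStay) => Some q'
    | Some _ => None
    end
  else None.
Definition oor (T : Type) (a b : option T) : option T := if a is Some _ then a else b.
(** A halted head stays in place through [from_self], so that a final configuration persists to the
    last row. *)
Definition lstep (a b c : cell) : cell :=
  (sym_next b, oor (from_self b) (oor (from_left a) (from_right c))).

(** The number is the absolute column of the head, which a configuration does not record. *)
Definition pcfg : Type := (config M * nat)%type.

Definition stepH (p : pcfg) : pcfg :=
  let: (Config q l r, h) := p in
  match tm_delta q (head None r) with
  | None => p
  | Some (q', a, MoveLeft) => (Config q' (behead l) (head None l :: a :: behead r), h.-1)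
  | Some (q', a, MoveStay) => (Config q' l (a :: behead r), h)
  | Some (q', a, MoveRight) => (Config q' (a :: l) (behead r), h.+1)
  end.

Definition rowof (p : pcfg) (i : nat) : cell :=
  let: (Config q l r, h) := p in
  (if (i < h)%N then nth None l (h.-1 - i) else nth None r (i - h), if i == h then Some q else None).

Lemma nth_consE (T : Type) (x0 a : T) s k : nth x0 (a :: s) k = if k == 0%N then a else nth x0 s k.-1.
Proof. by case: k. Qed.

Ltac decide_ifs := repeat match goal with
  | |- context [if ?b then _ else _] =>
      first [have -> : b = false by lia | have -> : b = true by lia]
  end.

Ltac row_case := rewrite /= ?nth_behead ?nth_consE ?nth_behead; decide_ifs; rewrite -?nth0 //=;
  try (congr (nth _ _ _, _); lia).

Lemma row_step p i : (0 < p.2)%N -> (0 < i)%N ->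
  rowof (stepH p) i = lstep (rowof p i.-1) (rowof p i) (rowof p i.+1).
Proof.
case: p => -[q l r] h; rewrite [(_, _).2]/=; case: h => // h _; case: i => // i _.
rewrite /stepH /lstep /rowof /sym_next /from_self /from_left /from_right [i.+1.-1]/= [h.+1.-1]/= -nth0.
have [eih|nih] := eqVneq i h.
  rewrite {}eih /= subnn; decide_ifs.
  by case: (tm_delta q (nth None r 0)) => [[[q' a] []]|]; row_case.
have [e2|n2] := eqVneq i h.+1.
  rewrite {}e2 /= subnn; decide_ifs.
  by case: (tm_delta q (nth None r 0)) => [[[q' a] []]|]; row_case.
have [e3|n3] := eqVneq i.+1 h.
  rewrite -{}e3 /= !subnn; decide_ifs.
  by case: (tm_delta q (nth None r 0)) => [[[q' a] []]|]; row_case.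
rewrite /=; case: (ltngtP i h) => hih; last by rewrite hih eqxx in nih.
  by decide_ifs; case: (tm_delta q (nth None r 0)) => [[[q' a] []]|]; row_case.
by decide_ifs; case: (tm_delta q (nth None r 0)) => [[[q' a] []]|]; row_case.
Qed.

Section Grid.
Variables (pre : seq bool) (m T h0 W : nat).
(** The head starts beyond column [T], and more than [T] cells follow the input zone, so the head
    stays away from both borders for [T] steps. *)
Hypotheses (pre0 : (0 < size pre)%N) (T0 : (0 < T)%N) (h0T : (T < h0)%N) (WT : (h0 + size pre + m + T + 2 <= W)%N).

Definition pinit (y : seq bool) : pcfg := (tm_init M y, h0).
Definition prun t y : pcfg := iter t stepH (pinit y).

Definition accepts (y : seq bool) : Prop :=
  let: (Config q l r, h) := prun T y in tm_delta q (head None r) = None /\ read_bits r = [:: true].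

Definition bitc (c : cell) : bool := if c.1 is Some (inl _) then true else false.

(* What is required of a single cell: a given content, an input symbol of the
   witness, acceptance, nothing. *)
Definition cspec : finType := (cell + 'I_3)%type.
Definition sWit : cspec := inr ord0.
Definition sFin : cspec := inr (inord 1).
Definition sFree : cspec := inr (inord 2).

Definition cok (u : cspec) (b c : cell) : bool :=
  match u with
  | inl g => b == g
  | inr j => if j == ord0 then [&& b.2 == None, bitc b || (b.1 == None) & (b.1 == None) ==> (c.1 == None)]
             else if j == inord 1 then
               if b.2 is Some q then [&& ~~ isSome (tm_delta q b.1), b.1 == Some (inl true) & ~~ bitc c]
               else true
             else true
  end.

Lemma cok_free b c : cok sFree b c.
Proof.
rewrite /cok /sFree; case: eqP => [/(congr1 (@nat_of_ord 3))|_]; first by rewrite /= inordK.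
by case: eqP => // /(congr1 (@nat_of_ord 3)); rewrite /= !inordK.
Qed.

Definition bitcell (b : bool) : cell := (Some (inl b), None).

Definition spec (r i : nat) : cspec :=
  if r == 0%N then
    if (i < h0)%N then inl blank
    else if (i - h0 < size pre)%N then
      inl (Some (inl (nth false pre (i - h0))), if i == h0 then Some (tm_start M) else None)
    else if (i - h0 - size pre < m)%N then sWit else inl blank
  else if (i == 0%N) || (i.+1 == W) then inl blank
  else if r == T then sFin else sFree.

Definition grid_ok (g : nat -> nat -> cell) : Prop :=
  (forall r i, (r <= T)%N -> (i < W)%N -> cok (spec r i) (g r i) (g r i.+1)) /\
  (forall r i, (r < T)%N -> (0 < i)%N -> (i.+1 < W)%N -> g r.+1 i = lstep (g r i.-1) (g r i) (g r i.+1)).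

Lemma prun_bounds t y : (t <= T)%N -> let: (Config q l r, h) := prun t y in
  [/\ (size l + h0 <= h + t)%N & (h + size r <= h0 + size y + t)%N].
Proof.
elim: t => [|t ih] ht; first by rewrite /prun /= size_map; split; lia.
rewrite /prun iterS -/(prun t y); have := ih (ltnW ht); case: (prun t y) => -[q l r] h [h1 h2].
rewrite /stepH; case: (tm_delta _ _) => [[[q' a] []]|]; split; rewrite /= ?size_behead; lia.
Qed.

Lemma prun_blank t y (i : nat) : (t <= T)%N -> (size y <= size pre + m)%N -> (i == 0%N) || (i.+1 == W) ->
  rowof (prun t y) i = blank.
Proof.
move=> ht hy hi; have := prun_bounds y ht; case: (prun t y) => -[q l r] h [h1 h2].
case/orP: hi => /eqP hi.
  have hl : (size l <= h.-1 - i)%N by lia.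
  by rewrite /rowof; decide_ifs; rewrite nth_default.
have hr : (size r <= i - h)%N by lia.
by rewrite /rowof; decide_ifs; rewrite nth_default.
Qed.

Lemma prun_row t y i : (t < T)%N -> (0 < i)%N ->
  rowof (prun t.+1 y) i = lstep (rowof (prun t y) i.-1) (rowof (prun t y) i) (rowof (prun t y) i.+1).
Proof.
move=> ht i0; rewrite [prun t.+1 y]/(stepH (prun t y)) row_step //.
by have := prun_bounds y (ltnW ht); case: (prun t y) => -[q l r] h [h1 h2] /=; lia.
Qed.

Lemma row0 y i : rowof (pinit y) i =
  (if (i < h0)%N then None else nth None [seq Some (inl b) | b <- y] (i - h0), if i == h0 then Some (tm_start M) else None).
Proof. by rewrite /rowof /=; case: ltnP => //; rewrite nth_nil. Qed.

Lemma accepts_row y q l r h : prun T y = (Config q l r, h) -> accepts y <->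
  cok sFin (rowof (prun T y) h) (rowof (prun T y) h.+1).
Proof.
move=> e; rewrite /accepts e /cok /sFin /=.
have -> : (inord 1 == ord0 :> 'I_3) = false by apply/eqP => /(congr1 val); rewrite /= inordK.
rewrite eqxx ltnn subnn eqxx /= (_ : (h.+1 < h)%N = false) ?subSnn; last by lia.
rewrite nth0 /bitc /=; case: (tm_delta q (head None r)) => [?|] /=; first by split=> // -[].
split=> [[_]|].
  by case: r e => [|[[b|g]|] r] //= _ [->]; case: r => [|[[b'|g']|] r] //=.
case: r e => [|[[b|g]|] r] //= _ /andP[/eqP[->]]; case: r => [|[[b'|g']|] r] //=.
Qed.

Lemma grid_complete w : (size w <= m)%N -> accepts (pre ++ w) ->
  grid_ok (fun r i => rowof (prun r (pre ++ w)) i).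
Proof.
move=> hw hacc; have hy : (size (pre ++ w) <= size pre + m)%N by rewrite size_cat; lia.
split=> [r i hr hi|r i hr i0 hi]; last exact: prun_row.
rewrite /spec; have [r0|rn0] := eqVneq r 0%N.
  rewrite r0 [prun 0 _]/(pinit _) !row0; case: ltnP => hi0; first by rewrite (_ : i == h0 = false) //=; lia.
  rewrite (_ : (i.+1 < h0)%N = false); last by lia.
  case: ltnP => h1.
    by rewrite /= (nth_map false) ?size_cat; [rewrite nth_cat h1 eqxx|lia].
  have nh : (i == h0) = false by lia.
  case: ltnP => h2; last first.
    by rewrite /= nh nth_default // size_map size_cat; lia.
  rewrite /cok /sWit eqxx nh /= map_cat !nth_cat !size_map ltnNge h1 /=.
  rewrite (_ : (i.+1 - h0 < size pre)%N = false); last by lia.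
  have -> : (i.+1 - h0 - size pre = (i - h0 - size pre).+1)%N by lia.
  move: (i - h0 - size pre)%N => k; case: (ltnP k (size w)) => hk.
    by rewrite /bitc /= (nth_map false).
  by rewrite /bitc /= nth_default ?size_map // nth_default ?size_map //=; lia.
case: ifP => hb; first by rewrite /= prun_blank.
case: eqP => [eT|_]; last first.
  exact: cok_free.
rewrite eT; case e: (prun T (pre ++ w)) => [[q l rr] h].
have [->|nh] := eqVneq i h; first by rewrite -e; apply/(accepts_row e).
rewrite /cok /sFin; case: eqP => [/(congr1 val)|_]; first by rewrite /= inordK.
by rewrite eqxx /= (negbTE nh).
Qed.

(** The witness is the initial block of bits of the witness zone. The cell conditions forbid any
    symbol after a blank there, so the first row is a start configuration, and the local rule
    determines the other rows. *)
Lemma grid_sound g : grid_ok g -> exists2 w, (size w <= m)%N & accepts (pre ++ w).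
Proof.
move=> [hu hs].
pose wb k := g 0%N (h0 + size pre + k)%N.
have hspec k : (k < m)%N -> cok sWit (wb k) (wb k.+1).
  move=> hk; have := hu 0%N (h0 + size pre + k)%N (leq0n _); rewrite /spec eqxx.
  have -> : (h0 + size pre + k < h0)%N = false by lia.
  have -> : (h0 + size pre + k - h0 < size pre)%N = false by lia.
  have -> : (h0 + size pre + k - h0 - size pre < m)%N by lia.
  by rewrite /wb addnS; apply; lia.
pose n := find (fun k => ~~ bitc (wb k)) (iota 0 m).
pose bval (c : cell) := if c.1 is Some (inl b) then b else false.
pose w := [seq bval (wb k) | k <- iota 0 n].
have nm : (n <= m)%N by rewrite /n -[X in (_ <= X)%N](size_iota 0 m) find_size.
have hlt k : (k < n)%N -> wb k = bitcell (bval (wb k)).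
  move=> hk; have := before_find 0%N hk; rewrite nth_iota ?add0n; last by lia.
  move/negbFE; have := hspec k; rewrite /cok /sWit eqxx /bitc /bval /bitcell.
  case: (wb k) => -[[b|?]|] s //= /(_ _) h _; have /andP[/eqP-> //] : (s == None) && true.
  by rewrite andbT; have /h/andP[] : (k < m)%N by lia.
have hge k : (n <= k)%N -> (k < m)%N -> wb k = blank.
  move=> + hkm; have hn : (n < m)%N -> (wb n).1 == None.
    move=> hn; have : has (fun k => ~~ bitc (wb k)) (iota 0 m) by rewrite has_find size_iota.
    move/(nth_find 0%N); rewrite nth_iota // add0n -/n => nb.
    by have := hspec n hn; rewrite /cok /sWit eqxx (negbTE nb) /= => /and3P[].
  have all d : (n + d < m)%N -> (wb (n + d)%N).1 == None.
    elim: d => [|d ih] hd; first by rewrite addn0; apply: hn; lia.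
    have h1 : (n + d < m)%N by lia.
    have := hspec _ h1; rewrite /cok /sWit eqxx => /and3P[_ _]; rewrite ih //=.
    by rewrite addnS.
  move=> hk; have := all (k - n)%N; rewrite subnKC // => /(_ hkm) hN.
  have := hspec k hkm; rewrite /cok /sWit eqxx => /and3P[/eqP h2 _ _].
  by rewrite [wb k]surjective_pairing h2 (eqP hN).
have sw : size w = n by rewrite size_map size_iota.
exists w; first by rewrite sw.
have hy : (size (pre ++ w) <= size pre + m)%N by rewrite size_cat sw; lia.
have row_eq t : (t <= T)%N -> forall i, (i < W)%N -> g t i = rowof (prun t (pre ++ w)) i.
  elim: t => [|t ih] ht i hi.
    rewrite [prun 0 _]/(pinit _) row0.
    have := hu 0%N i (leq0n _) hi; rewrite /spec eqxx.
    case: (ltnP i h0) => hi0 /=; first by move/eqP->; rewrite (_ : i == h0 = false) //; lia.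
    case: (ltnP (i - h0) (size pre)) => h1 /=.
      by move/eqP->; rewrite (nth_map false) ?size_cat ?nth_cat ?h1 //; lia.
    have nh : (i == h0) = false by lia.
    case: (ltnP (i - h0 - size pre) m) => h2.
      move=> _; rewrite nh map_cat nth_cat size_map ltnNge h1 /=.
      have ei : i = (h0 + size pre + (i - h0 - size pre))%N by lia.
      rewrite {1}ei -/(wb _); case: (ltnP (i - h0 - size pre) n) => h3.
        rewrite hlt // (nth_map false) ?sw // /w (nth_map 0%N) ?size_iota // nth_iota //.
      by rewrite hge // nth_default // size_map sw.
    by move/eqP->; rewrite nh nth_default // size_map size_cat sw; lia.
  have [hb|hb] := boolP ((i == 0%N) || (i.+1 == W)).
    rewrite (prun_blank ht hy hb); have := hu t.+1 i ht hi; rewrite /spec hb.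
    by move/eqP.
  rewrite hs //; [|lia|lia].
  rewrite prun_row //; last by lia.
  by rewrite !ih //; lia.
case e: (prun T (pre ++ w)) => [[q l r] h].
have [h1 h2] : (size l + h0 <= h + T)%N /\ (h + size r <= h0 + size (pre ++ w) + T)%N.
  by have := prun_bounds (pre ++ w) (leqnn T); rewrite e => -[].
have hhW : (h.+1 < W)%N by move: hy h2; lia.
apply/(accepts_row e); rewrite -!row_eq //; last by lia.
have := hu T h (leqnn _); rewrite /spec (_ : T == 0 = false)%N; last by lia.
rewrite (_ : (h == 0%N) || (h.+1 == W) = false); last by apply/negbTE; rewrite negb_or; lia.
by rewrite eqxx; apply; lia.
Qed.

End Grid.
End Tableau.

(** * From NP to constraint graphs with a constant gap *)

Lemma pbd_horner (p : {poly nat}) : pbd (fun n => p.[n]).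
Proof.
elim/poly_ind: p => [|p c ih]; first by apply: (@pbd_le _ (fun _ => 0%N)) (pbd_cst 0) => n; rewrite horner0.
apply: (@pbd_le _ (fun n => p.[n] * n + c)%N) => [n|]; first by rewrite hornerD hornerMX hornerC.
by apply: pbd_add; [apply: pbd_mul; [|apply: pbd_id]|apply: pbd_cst].
Qed.

Lemma PT_horner (E : Type) {EE : Enc E} (p : {poly nat}) (f : E -> nat) : PT f -> PT (fun e => p.[f e]).
Proof.
move=> hf; elim/poly_ind: p => [|p c ih].
  by apply: (@PT_ext _ _ _ _ (fun _ => 0%N)) => [e|]; [rewrite horner0|pt].
apply: (@PT_ext _ _ _ _ (fun e => p.[f e] * f e + c)%N) => [e|]; first by rewrite hornerD hornerMX hornerC.
by pt.
Qed.

Lemma tm_run_stepH (M : turing_machine) t (c c' : config M) h : tm_run t c = Some c' ->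
  forall T, (t <= T)%N -> (iter T (@stepH M) (c, h)).1 = c' /\ tm_step c' = None.
Proof.
have sE (c0 : config M) h0 : (stepH (c0, h0)).1 = odflt c0 (tm_step c0).
  by case: c0 => q l r; rewrite /stepH /tm_step; case: (tm_delta _ _) => [[[q' a] []]|].
have hE T : forall (p : pcfg M), tm_step p.1 = None -> (iter T (@stepH M) p).1 = p.1.
  elim: T => // T ih p hp; rewrite iterSr ih; case: p hp => c0 h0 hp; by rewrite sE hp.
elim: t c h => [|t ih] c h /=; case E: (tm_step c) => [c1|] //.
- by move=> [<-] T _; rewrite hE.
- move=> hr [//|T] hT; rewrite iterSr; have := sE c h; rewrite E.
  move: (stepH (c, h)) => [c2 h2]; rewrite [(_, _).1]/= [odflt _ _]/= => ->; exact: ih.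
- by move=> [<-] T _; rewrite hE.
Qed.

(** * The cyclic grid *)

Section Shift.
Variables (N W : nat).
Hypothesis (WN : (W <= N)%N) (N0 : (0 < N)%N).
Definition Sh : finType := (bool * bool)%type.
Definition sinv (s : Sh) : Sh := (s.1, ~~ s.2).
Definition shd (s : Sh) : nat := if s.1 then W else 1%N.
(** Addition and subtraction of 1 or [W] modulo [N]: in row-major order these lead to the horizontal
    and vertical neighbours. *)
Definition shift (s : Sh) (v : nat) : nat :=
  if s.2 then if (v + shd s < N)%N then (v + shd s)%N else (v + shd s - N)%N
  else if (shd s <= v)%N then (v - shd s)%N else (v + N - shd s)%N.

Lemma shd_le s : (shd s <= N)%N. Proof. by rewrite /shd; case: s.1. Qed.

Lemma shift_lt s v : (v < N)%N -> (shift s v < N)%N.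
Proof.
by have := shd_le s; rewrite /shift; case: s.2; case: ifP; lia.
Qed.

Lemma shiftK s v : (v < N)%N -> shift (sinv s) (shift s v) = v.
Proof.
move=> hv; have := shd_le s; rewrite /shift /sinv /=.
have -> : shd (s.1, ~~ s.2) = shd s by [].
by case: s.2 => /=; do 2 case: ifP; lia.
Qed.
End Shift.

Section Start.
Variables (R : realFieldType) (K1 : finType) (inv1 : K1 -> K1).
Hypotheses (K1gt : (1 < #|K1|)%N).
Hypothesis fam : forall i (M : finType), #|M| = ((#|K1| ^ 2) ^ i)%N ->
  exists2 act : K1 -> M -> M, isg act inv1 & contr act (1 / 4%:R : R).
Notation xK := (xK K1).

Lemma inv1K : involutive inv1.
Proof. by have [|act []] := @fam 0 unit; rewrite ?card_unit. Qed.

Lemma lift_rule : exists2 r : rule xK unit xK unit, (1 < #|rj r|)%N &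
  forall X, xgood R inv1 id X -> xgood R inv1 id (rapp r X).
Proof.
pose J : finType := 'I_((#|K1| ^ 2) ^ 4).
have cJ : #|J| = ((#|K1| ^ 2) ^ 4)%N by rewrite card_ord.
have J1 : (1 < #|J|)%N by rewrite cJ -(exp1n 4) ltn_exp2r // -(exp1n 2) ltn_exp2r.
have [h sgh ch] := fam cJ.
have [lw [lt hl]] := @lift_gens R K1 inv1 J h 4 K1gt isT cJ sgh ch.
exists (@Rule xK unit xK unit J (fun k j => [:: (lw k j).1; (lw k j).2]) (fun k j => lt k j) [::] (fun _ _ => tt)) => //.
move=> X [V0 sg ct]; have [h1 h2] := hl _ _ sg ct.
by split=> //; rewrite card_prod muln_gt0 V0 ltnW.
Qed.

(** Lifting is repeated until [M] vertices are reached. The number i of liftings is returned as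
    well: the table has J^i vertices, and the number of amplification rounds is computed from i. *)
Lemma start_expander : exists (J : nat) (F : nat -> tbl * nat), [/\ (1 < J)%N, PT F & forall M,
  exists X : lgraph xK unit, [/\ xgood R inv1 id X, encodes (F M).1 X, size (F M).1 = (J ^ (F M).2)%N & (M <= size (F M).1)%N]].
Proof.
have [r J1 hr] := lift_rule; have [G pG hG] := rule_PT r.
pose J := #|rj r|; pose T0 : tbl := [:: (nseq #|xK| 0%N, 0%N)].
(* A table that is large enough is frozen, so its size stays below J (M + 1). *)
pose stp (M : nat) (s : tbl * nat) (_ : unit) := if (M <= size s.1)%N then s else (G s.1, s.2.+1).
exists J, (fun M => foldl (stp M) (T0, 0%N) (nseq M tt)).
pose P M (s : tbl * nat) := exists X : lgraph xK unit, [/\ xgood R inv1 id X, encodes s.1 X, size s.1 = (J ^ s.2)%N & (size s.1 <= J * M.+1)%N].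
have P0 M : P M (T0, 0%N).
  exists (@LGraph xK unit unit (fun _ v => v) (fun v => tt)); split=> //=.
  - split; first by rewrite card_unit.
      by split=> // -[[a b] [c d]]; rewrite /xinv /= !inv1K.
    move=> f; rewrite /avg card_unit divr1 => hf.
    have f0 v : f v = 0 by move: hf; rewrite (bigD1 v) //= big1 ?addr0 // => -[]; case: v.
    rewrite big1 => [|v _]; last by rewrite big1 ?mul0r ?expr0n // => k _.
    by rewrite big1 => [|v _]; rewrite ?f0 ?expr0n // mul0r mulr0.
  - exists (fun _ => 0%N); split=> //=; first by case=> [] [].
      by rewrite card_unit.
    move=> v; rewrite /tent /=; congr pair; last first.
      have h1 : (enum_rank tt < 1)%N by rewrite -[X in (_ < X)%N]card_unit ltn_ord.
      by case: (nat_of_ord (enum_rank tt)) h1.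
    by rewrite cardE; elim: (enum _) => //= k s ->.
  - by rewrite muln_gt0 ltnW.
have PS M s u : P M s -> P M (stp M s u).
  move=> [X [h1 h2 h3 h4]]; rewrite /stp; case: leqP => hM; first by exists X.
  have hrep := hG _ _ h2.
  have sz1 : size (G s.1) = (size s.1 * J)%N.
    have [code [_ cs _ _]] := h2; have [code' [_ cs' _ _]] := hrep.
    by rewrite cs' cs card_prod.
  exists (rapp r X); split=> //=; [exact: hr|by rewrite sz1 h3 -expnSr|].
  by rewrite sz1 mulnC leq_mul2l; apply/orP; right; lia.
have Pl M p : P M (foldl (stp M) (T0, 0%N) p).
  by elim/last_ind: p => [|p u ih] //; rewrite foldl_rcons; apply: PS.
split=> //.
  have [kx ekx] : exists k, k = #|xK| by eexists.
  apply: (PT_fold (b := fun n => ((J * n.+1) * (kx * (2 * (J * n.+1) + 2) + 2 * 1 + 4) + 1 + (2 * (J * n.+1) + 1) + 1)%N) (stp := stp)) => //.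
  - by repeat (apply: pbd_add || apply: pbd_mul || apply: pbd_cst || apply: pbd_id || (exists 1%N => n; rewrite expn1)).
  - by rewrite /stp; pt; apply: PT_app => //; pt.
  - by pt.
  - by pt.
  move=> M p q _; have [X [h1 h2 h3 h4]] := Pl M p; move: h2 h3 h4.
  case: (foldl _ _ p) => T i /= h2 h3 h4; rewrite sz_pair sz_nat.
  have h5 := rep_sz h2; rewrite card_unit -ekx in h5.
  have hi : (i < size T)%N by rewrite h3 ltn_expl.
  have hM : (size T <= J * (sz M).+1)%N by apply: leq_trans h4 _; rewrite leq_mul2l sz_nat; apply/orP; right; lia.
  move: h5 hi hM; move: (sz T) (size T) (J * (sz M).+1)%N => a b c h5 hi hM.
  have : (b * (kx * (2 * b + 2) + 2 * 1 + 4) <= c * (kx * (2 * c + 2) + 2 * 1 + 4))%N.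
    apply: leq_mul => //; rewrite !leq_add2r leq_mul2l; apply/orP; right; lia.
  by lia.
move=> M; have [X [h1 h2 h3 h4]] := Pl M (nseq M tt); exists X; split=> //.
have h n : let s := foldl (stp M) (T0, 0%N) (nseq n tt) in (M <= size s.1)%N \/ s.2 = n.
  elim: n => [|n ih] /=; first by right.
  have -> : foldl (stp M) (stp M (T0, 0%N) tt) (nseq n tt) = stp M (foldl (stp M) (T0, 0%N) (nseq n tt)) tt.
    by rewrite -(foldl_rcons (stp M)) -[in RHS]cats1 -[[:: tt]]/(nseq 1 tt) -nseqD addn1.
  move: ih; set s := foldl _ _ _; rewrite /stp; case: (leqP M (size s.1)) => hM; first by left.
  by case=> [//|->]; right.
by case: (h M) => // e; rewrite h3 e ltnW // ltn_expl.
Qed.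

Notation G0 := (xK + Sh)%type.

(** The vertex numbers of the expander are read as positions in the cyclic grid, so both live on the
    same vertices. *)
Definition mrg (T : tbl) (W : nat) (kd : seq nat) : tbl :=
  [seq ([seq (match g with inl k => nth 0%N (tent T v).1 (enum_rank k)
                         | inr s => shift (size T) W s v end) | g <- enum {: G0}], nth 0%N kd v)
  | v <- iota 0 (size T)].

Lemma merge_rep (C : finType) T (X : lgraph xK unit) W kd (c : nat -> C) : xgood R inv1 id X -> encodes T X -> (W <= size T)%N ->
  (forall v, (v < size T)%N -> nth 0%N kd v = enum_rank (c v)) ->
  exists (Y : lgraph G0 C) (code : lv Y -> nat),
  [/\ encodes (mrg T W kd) Y, xgood R inv1 inl Y, #|lv Y| = size T & isg (fun s => la Y (inr s)) sinv] /\
  [/\ injective code, forall v, (code v < size T)%N, forall i, (i < size T)%N -> exists v, code v = i,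
      forall s v, code (la Y (inr s) v) = shift (size T) W s (code v) & forall v, ll Y v = c (code v)].
Proof.
move=> [V0 sg ct] [code [ci cs cb ce]] hW hk.
have N0 : (0 < size T)%N by rewrite cs.
have surj := rep_surj ci cs cb.
have [v0 _] := surj _ N0.
pose dec i := odflt v0 [pick v | code v == i].
have decK i : (i < size T)%N -> code (dec i) = i.
  by move=> /surj[v hv]; rewrite /dec; case: pickP => [u /eqP //|/(_ v)]; rewrite hv eqxx.
have codeK v : dec (code v) = v by apply: ci; rewrite decK.
pose act (g : G0) v := match g with inl k => la X k v | inr s => dec (shift (size T) W s (code v)) end.
pose Y : lgraph G0 C := @LGraph G0 C (lv X) act (fun v => c (code v)).
exists Y, code; split; split=> //.
- exists code; rewrite /mrg size_map size_iota; split=> // v.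
  rewrite {1}/tent (nth_map 0%N) ?size_iota // nth_iota // add0n hk // ce /=; congr pair.
  apply: eq_map => -[k|s] /=; first by rewrite nth_enum_map.
  by rewrite decK // shift_lt.
- split=> [s v|[b s]]; last by rewrite /sinv /= negbK.
  by rewrite /= decK ?shift_lt // shiftK.
- by move=> s v /=; rewrite decK // shift_lt.
Qed.

Lemma PT_mrg (E : Type) {EE : Enc E} (T : E -> tbl) (W : E -> nat) (kd : E -> seq nat) :
  PT T -> PT W -> PT kd -> PT (fun e => mrg (T e) (W e) (kd e)).
Proof.
move=> hT hW hk; rewrite /mrg; apply: PT_map; last by pt.
have h1 : PT (fun p : E * nat => T p.1) by apply: PT_app => //; pt.
have h2 : PT (fun p : E * nat => W p.1) by apply: PT_app => //; pt.
have h3 : PT (fun p : E * nat => kd p.1) by apply: PT_app => //; pt.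
apply: PT_pair; last by pt.
apply: PT_mapc => -[k|[[] []]]; first by pt.
all: by rewrite /shift /shd /=; pt.
Qed.

(** * The constraint graph of a verifier *)

Section Language.
Variables (M : turing_machine) (p1 : {poly nat}) (k2 : nat).
Notation cell := (cell M).
Definition prex (x : seq bool) : seq bool := nseq (size x) true ++ false :: x.
Definition wlen (x : seq bool) : nat := p1.[size x].
Definition tT (x : seq bool) : nat := ((size (prex x) + wlen x).+2 ^ k2)%N.
Definition tH (x : seq bool) : nat := (tT x).+1.
Definition tW (x : seq bool) : nat := (tH x + size (prex x) + wlen x + tT x + 2)%N.
Definition tN (x : seq bool) : nat := ((tT x).+1 * tW x)%N.
(** Whether the cell has a right neighbour, whether the local rule determines the cell below it, and
    what is required of its content. *)
Definition kC : finType := (bool * bool * cspec M)%type.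
Definition xspec x := @spec M (prex x) (wlen x) (tT x) (tH x) (tW x).
Definition kgrid x r i : kC := ((i.+1 < tW x)%N, [&& (r < tT x)%N, (0 < i)%N & (i.+1 < tW x)%N], xspec x r i).
Definition kfree : kC := (false, false, sFree M).
Definition kind x v : kC :=
  if (v < tN x)%N then kgrid x (v %/ tW x)%N (v %% tW x)%N else kfree.
Definition kinds x n : seq nat :=
  flatten [seq [seq (enum_rank (kgrid x r i) : nat) | i <- iota 0 (tW x)] | r <- iota 0 (tT x).+1] ++ nseq n (enum_rank kfree : nat).

Lemma tW_gt0 x : (0 < tW x)%N. Proof. by rewrite /tW addn2. Qed.

Lemma tT_gt0 x : (0 < tT x)%N. Proof. by rewrite expn_gt0. Qed.

Lemma kindsE x n v : (v < n)%N -> nth 0%N (kinds x n) v = enum_rank (kind x v).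
Proof.
move=> hv; set ss := [seq [seq (enum_rank (kgrid x r i) : nat) | i <- iota 0 (tW x)] | r <- iota 0 (tT x).+1].
have hall : all (fun s => size s == tW x) ss by apply/allP => s /mapP[r _ ->]; rewrite size_map size_iota.
rewrite /kinds -/ss nth_cat (size_flatten_const hall) size_map size_iota -/(tN x) /kind.
case: ltnP => h; last by rewrite nth_nseq ifT //; lia.
have W0 := tW_gt0 x.
rewrite {1}(divn_eq v (tW x)) (nth_flatten_const _ _ hall) ?ltn_mod //.
have hr : (v %/ tW x < (tT x).+1)%N by rewrite ltn_divLR.
rewrite (nth_map 0%N) ?size_iota // nth_iota // add0n (nth_map 0%N) ?size_iota ?ltn_mod //.
by rewrite nth_iota ?ltn_mod.
Qed.

Lemma PT_prex (E : Type) {EE : Enc E} (f : E -> seq bool) : PT f -> PT (fun e => prex (f e)).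
Proof. by move=> hf; rewrite /prex; pt. Qed.
Lemma PT_wlen (E : Type) {EE : Enc E} (f : E -> seq bool) : PT f -> PT (fun e => wlen (f e)).
Proof. by move=> hf; rewrite /wlen; apply: PT_horner; pt. Qed.
Lemma PT_tT (E : Type) {EE : Enc E} (f : E -> seq bool) : PT f -> PT (fun e => tT (f e)).
Proof. by move=> hf; rewrite /tT; pt; [apply: PT_prex|apply: PT_wlen]. Qed.
Lemma PT_tW (E : Type) {EE : Enc E} (f : E -> seq bool) : PT f -> PT (fun e => tW (f e)).
Proof. by move=> hf; rewrite /tW /tH; pt; [apply: PT_tT|apply: PT_prex|apply: PT_wlen|apply: PT_tT]. Qed.

Lemma PT_kinds (f : seq bool -> nat) : PT f -> PT (fun x => kinds x (f x)).
Proof.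
move=> hf; rewrite /kinds; apply: PT_cat; last by pt.
apply: PT_flatten; apply: PT_map; last by pt; apply: PT_tT; pt.
apply: PT_map; last by pt; apply: PT_tW; pt.
pose Q := (seq bool * nat * nat)%type.
have hx : PT (fun q : Q => q.1.1) by pt.
have hr : PT (fun q : Q => q.1.2) by pt.
have hi : PT (fun q : Q => q.2) by pt.
have hpre := PT_prex hx; have hm := PT_wlen hx; have hT := PT_tT hx; have hW := PT_tW hx.
pose rk (u : cspec M) : nat := enum_rank u.
pose bc (b s : bool) : cspec M := inl (Some (inl b), if s then Some (tm_start M) else None).
pose ur (q : Q) : nat :=
  if q.1.2 == 0%N then
    if (q.2 < tH q.1.1)%N then rk (inl (blank M))
    else if (q.2 - tH q.1.1 < size (prex q.1.1))%N then
      if nth false (prex q.1.1) (q.2 - tH q.1.1) then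
        if q.2 == tH q.1.1 then rk (bc true true) else rk (bc true false)
      else if q.2 == tH q.1.1 then rk (bc false true) else rk (bc false false)
    else if (q.2 - tH q.1.1 - size (prex q.1.1) < wlen q.1.1)%N then rk (sWit M) else rk (inl (blank M))
  else if (q.2 == 0%N) || (q.2.+1 == tW q.1.1) then rk (inl (blank M))
  else if q.1.2 == tT q.1.1 then rk (sFin M) else rk (sFree M).
have pur : PT ur by rewrite /ur /tH; pt.
have urE q : ur q = rk (xspec q.1.1 q.1.2 q.2).
  rewrite /ur /xspec /spec; case: (q.1.2 == 0%N); last by case: ifP => // _; case: ifP.
  case: (q.2 < tH q.1.1)%N => //; case: (q.2 - tH q.1.1 < size (prex q.1.1))%N; last by case: ifP.
  by case: (nth false (prex q.1.1) _); case: (q.2 == tH q.1.1).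
pose lk (b1 b2 : bool) : seq nat := [seq (enum_rank (b1, b2, u) : nat) | u <- enum (cspec M)].
apply: (@PT_ext _ _ _ _ (fun q : Q => nth 0%N
   (if (q.2.+1 < tW q.1.1)%N then if [&& (q.1.2 < tT q.1.1)%N, (0 < q.2)%N & (q.2.+1 < tW q.1.1)%N] then lk true true else lk true false
    else if [&& (q.1.2 < tT q.1.1)%N, (0 < q.2)%N & (q.2.+1 < tW q.1.1)%N] then lk false true else lk false false) (ur q))).
  move=> q; rewrite urE /rk /kgrid.
  move: (q.2.+1 < tW q.1.1)%N [&& (q.1.2 < tT q.1.1)%N, (0 < q.2)%N & (q.2.+1 < tW q.1.1)%N] => b1 b2.
  by case: b1; case: b2; rewrite /lk nth_enum_map.
by pt.
Qed.

Definition acc x y := @accepts M (tT x) (tH x) y.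

(** A vertex holds its cell and both neighbours, which makes the ternary local rule a binary
    constraint with the vertex below; horizontal constraints force the triples to overlap. *)
Definition kA : finType := (cell * cell * cell)%type.
Definition kdl (s : Sh) (cs : seq kC) : {ffun kA * kA -> bool} :=
  [ffun q : kA * kA =>
    let c := head kfree cs in let: (l1, b1, r1) := q.1 in let: (l2, b2, r2) := q.2 in
    if s.2 then if s.1 then c.1.2 ==> (b2 == lstep l1 b1 r1)
                else cok c.2 b1 r1 && (c.1.1 ==> ((l2 == b1) && (b2 == r1)))
    else true].

Section Instance.
Variables (x : seq bool) (N : nat) (V : Type) (code : V -> nat) (sh : Sh -> V -> V).
Hypotheses (ci : injective code) (hN : (tN x <= N)%N) (hc : forall v, (code v < N)%N)
  (hs : forall i, (i < N)%N -> exists v, code v = i)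
  (hsh : forall s v, code (sh s v) = shift N (tW x) s (code v)).

Let W := tW x. Let T := tT x.
Let W0 : (0 < W)%N. Proof. exact: tW_gt0. Qed.
Let hWN : (tW x <= N)%N. Proof. by apply: leq_trans hN; rewrite /tN leq_pmull. Qed.
Let gT0 : (0 < size (prex x))%N. Proof. by rewrite size_cat /=; lia. Qed.

Lemma tab_complete w : (size w <= wlen x)%N -> acc x (prex x ++ w) ->
  exists a : V -> kA, forall v s, kdl s [:: kind x (code v)] (a v, a (sh s v)).
Proof.
move=> hw ha.
have [hu hst] := @grid_complete M (prex x) (wlen x) (tT x) (tH x) (tW x) gT0 (tT_gt0 x) (leqnn _) (leqnn _) w hw ha.
pose g r i := rowof (prun M (tH x) r (prex x ++ w)) i; rewrite -/(xspec x) in hu.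
pose tr v : kA := (g (v %/ W)%N (v %% W).-1, g (v %/ W)%N (v %% W)%N, g (v %/ W)%N (v %% W).+1).
exists (fun v => tr (code v)) => v s; rewrite ffunE /= hsh /kind.
case: (ltnP (code v) (tN x)) => hv; last by case: s => -[] [] //; apply/andP; split=> //; exact: cok_free.
have hr : (code v %/ W <= T)%N by rewrite -ltnS ltn_divLR.
have hi : (code v %% W < W)%N by rewrite ltn_mod.
case: s => -[] [] //=.
  apply/implyP => /and3P[h1 h2 h3]; rewrite /shift /=.
  have lt : (code v + W < N)%N.
    apply: leq_trans hN; rewrite /tN -/W -/T {1}(divn_eq (code v) W).
    apply: leq_trans (_ : (code v %/ W).+2 * W <= _)%N.
      by rewrite !mulSn; move: hi; move: (_ %/ _ * _)%N (_ %% _)%N => A B; lia.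
    by rewrite leq_mul2r; apply/orP; right; exact: h1.
  rewrite lt divnDr ?dvdnn // divnn W0 addn1 modnDr.
  by apply/eqP; apply: hst.
apply/andP; split; first exact: hu.
apply/implyP => h3; rewrite /shift /=.
have e1 : (code v + 1 = (code v %/ W) * W + (code v %% W).+1)%N by rewrite {1}(divn_eq (code v) W); lia.
have lt : (code v + 1 < N)%N.
  apply: leq_trans hN; rewrite e1 /tN -/W -/T.
  apply: leq_trans (_ : (code v %/ W).+1 * W <= _)%N.
    by rewrite mulSn; move: h3; rewrite -/W; move: (_ %/ _ * _)%N (_ %% _)%N => A B; lia.
  by rewrite leq_mul2r; apply/orP; right; exact: hr.
have ed : ((code v %/ W * W + (code v %% W).+1) %/ W = code v %/ W)%N.
  by rewrite divnMDl // [X in (_ + X)%N]divn_small ?addn0.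
have em : ((code v %/ W * W + (code v %% W).+1) %% W = (code v %% W).+1)%N by rewrite modnMDl modn_small.
by rewrite [shd _ _]/= lt e1 ed em /= !eqxx.
Qed.

Lemma tab_sound (a : V -> kA) : (forall v s, kdl s [:: kind x (code v)] (a v, a (sh s v))) ->
  exists2 w, (size w <= wlen x)%N & acc x (prex x ++ w).
Proof.
move=> ha; have [dec decK] := choice (fun i : 'I_N => hs (ltn_ord i)).
have N0 : (0 < N)%N by apply: leq_trans hWN.
pose dc i := dec (insubd (Ordinal N0) i); pose at_ i := a (dc i).
have codeK i : (i < N)%N -> code (dc i) = i by move=> hi; rewrite decK val_insubd hi.
have lt r i : (r <= T)%N -> (i < W)%N -> (r * W + i < N)%N.
  by move=> hr hi; apply: leq_trans hN; apply: mixlt.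
have kE r i : (r <= T)%N -> (i < W)%N -> kind x (r * W + i)%N = kgrid x r i.
  by move=> hr hi; rewrite /kind mixlt // divnMDl // modnMDl divn_small // modn_small // addn0.
have H r i s : (r <= T)%N -> (i < W)%N -> kdl s [:: kgrid x r i] (at_ (r * W + i)%N, at_ (shift N W s (r * W + i)%N)).
  move=> hr hi; have := ha (dc (r * W + i)%N) s; rewrite codeK ?kE //; last exact: lt.
  suff -> : sh s (dc (r * W + i)%N) = dc (shift N W s (r * W + i)%N) by [].
  by apply: ci; rewrite hsh !codeK ?shift_lt //; apply: lt.
pose g r i := (at_ (r * W + i)%N).1.2.
have ov r i : (r <= T)%N -> (i.+1 < W)%N -> (at_ (r * W + i)%N).2 = g r i.+1 /\ (at_ (r * W + i.+1)%N).1.1 = g r i.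
  move=> hr hi; have := H r i (false, true) hr (ltnW hi); rewrite ffunE /g /shift /= -addnA addn1 lt //.
  case: (at_ (r * W + i)%N) => -[l1 b1] r1; case: (at_ (r * W + i.+1)%N) => -[l2 b2] r2 /= /andP[_].
  by rewrite hi => /andP[/eqP-> /eqP->].
apply: (@grid_sound M (prex x) (wlen x) (tT x) (tH x) (tW x) gT0 (tT_gt0 x) (leqnn _) (leqnn _) g); split.
  move=> r i hr hi; have := H r i (false, true) hr hi; rewrite ffunE /=.
  have [hiW|hiW] := ltnP i.+1 W.
    have [e _] := ov r i hr hiW; rewrite -e /g.
    case: (at_ (r * W + i)%N) => -[l1 b1] r1; by case: (at_ _) => -[l2 b2] r2 /= /andP[].
  (* In the last column the shift by 1 leaves the row, but the cell there must be blank whatever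
     follows it. *)
  have eW : i.+1 = W by apply/eqP; rewrite eqn_leq hi hiW.
  have -> : spec M (prex x) (wlen x) (tT x) (tH x) (tW x) r i = inl (blank M).
    rewrite /spec -/W -eW eqxx orbT; case: ifP => // _; have : (i.+1 = tW x)%N by [].
    by rewrite /tW => e; do ![rewrite ifF; [|lia]].
  have -> : xspec x r i = inl (blank M).
    rewrite /xspec /spec -/W -eW eqxx orbT; case: ifP => // _; have : (i.+1 = tW x)%N by [].
    by rewrite /tW => e; do ![rewrite ifF; [|lia]].
  rewrite /g; case: (at_ (r * W + i)%N) => -[l1 b1] r1; by case: (at_ _) => -[l2 b2] r2 /= /andP[].
move=> r i hr i0 hi; have := H r i (true, true) (ltnW hr) (ltnW hi); rewrite ffunE /shift /=.
have e1 : (r * W + i + W = r.+1 * W + i)%N by rewrite mulSn; lia.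
rewrite e1 lt //; last exact: ltnW.
have [eR _] := ov r i (ltnW hr) hi.
have hi1 : (i.-1.+1 < W)%N by rewrite prednK // ltnW.
have [_ eL] := ov r i.-1 (ltnW hr) hi1.
move: eR eL; rewrite prednK // /g.
case: (at_ (r * W + i)%N) => -[l1 b1] r1; case: (at_ (r.+1 * W + i)%N) => -[l2 b2] r2 /= <- ->.
by rewrite hr i0 hi /= => /eqP.
Qed.

End Instance.

End Language.

(** Outside [L] some constraint is violated by every assignment, one among the 4 J^i of the grid
    graph, and alphabet reduction divides this by [ar_loss] at most. *)
Theorem start_graph (L : seq bool -> Prop) : in_NP L ->
  exists (J c : nat) (F : seq bool -> tbl * nat), [/\ (1 < J)%N, (0 < c)%N, PT F & forall x,
    exists Z : lgraph (gG K1) (gC K1), [/\ good R inv1 Z, encodes (F x).1 Z & (J ^ (F x).2 <= size (F x).1)%N] /\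
      [/\ L x -> satisfiable Z & ~ L x -> forall a : lv Z -> ar_S, (c%:R * (J ^ (F x).2)%:R)^-1 <= vio R a]].
Proof.
move=> [Vf [p1 [[M [p2 hM]] hL]]].
have [k2 hk2] := pbd_horner p2.
have [J [FX [J1 pFX hFX]]] := start_expander.
pose FN x := FX (tN p1 k2 x).
have accE x w : (size w <= wlen p1 x)%N -> acc M p1 k2 x (prex x ++ w) <-> Vf (encode_pair x w) = [:: true].
  move=> hw; have eP : encode_pair x w = prex x ++ w by rewrite /prex /encode_pair -catA.
  have [c hc ho] := hM (encode_pair x w).
  have ht : (p2.[size (encode_pair x w)] <= tT p1 k2 x)%N.
    apply: leq_trans (hk2 _) _; apply: powmono; rewrite eP size_cat; lia.
  have [h1 h2] := tm_run_stepH (tH p1 k2 x) hc ht.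
  rewrite -ho /acc /accepts /prun /pinit -eP.
  case: (iter _ _ _) h1 => -[q l r] h /= e; rewrite -e /tm_output /=.
  move: h2; rewrite -e /=; case: (tm_delta q (head None r)) => [[[? ?] []]|] // _.
  by split=> [[]|].
have LE x : L x <-> exists2 w, (size w <= wlen p1 x)%N & acc M p1 k2 x (prex x ++ w).
  by rewrite hL; split=> -[w h1 h2]; exists w => //; apply/accE.
have K0 : (0 < #|Sh|)%N by rewrite card_prod card_bool.
have [r r0 hr] := @ar_step R K1 inv1 K1gt fam (xK + Sh)%type (kC M) Sh (kA M) inl (fun s => [:: inr s]) sinv
  (blank M, blank M, blank M) [:: [::]] (@kdl M) K0.
have [G pG hG] := rule_PT r.
pose F x := (G (mrg (FN x).1 (tW p1 k2 x) (kinds M p1 k2 x (size (FN x).1))), (FN x).2).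
have pFN : PT FN by apply: PT_app => //; rewrite /tN; pt; [apply: PT_tT|apply: PT_tW]; pt.
exists J, (4 * ar_loss K1)%N, F; split=> //.
- by rewrite muln_gt0 /=; apply: ar_loss_gt0.
- rewrite /F; apply: PT_pair; last by pt.
  apply: PT_app => //; apply: PT_mrg; [by pt|by apply: PT_tW; pt|].
  by apply: PT_kinds; pt.
move=> x; have [X [xg xr xs xM]] := hFX (tN p1 k2 x).
rewrite -/(FN x) in xr xs xM.
have W0 := tW_gt0 p1 k2 x.
have hW : (tW p1 k2 x <= size (FN x).1)%N by apply: leq_trans xM; rewrite /tN leq_pmull.
have [Y [code [[yr yg yc ysg] [ci cb cs csh cl]]]] := merge_rep xg xr hW (@kindsE M p1 k2 x (size (FN x).1)).
have := hr Y yg ysg; cbv zeta; case=> h1 h2 h3.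
have labE v : [seq ll Y (walk (la Y) w v) | w <- [:: [::]]] = [:: kind M p1 k2 x (code v)] by rewrite /= cl.
exists (rapp r Y); split; split=> //.
- exact: hG.
- have [code' [_ cs' _ _]] := hG _ _ yr.
  by rewrite cs' card_prod yc /= xs leq_pmulr.
- move=> /LE[w hw ha]; apply: h2.
  have [a hk] : exists a : lv Y -> kA M, forall v s, kdl s [:: kind M p1 k2 x (code v)] (a v, a (la Y (inr s) v)).
    exact: (tab_complete (N := size (FN x).1)) hw ha.
  by exists a => v k; rewrite labE; apply: hk.
move=> nL a'; have [sg] := h3 a'; set av := avg _ => hav.
have [v [s hvs]] : exists v s, ~~ kdl s [:: kind M p1 k2 x (code v)] (sg v, sg (la Y (inr s) v)).
  apply: contrapT => hn; apply: nL; apply/LE.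
  apply: (@tab_sound M p1 k2 x (size (FN x).1) (lv Y) code (fun s => la Y (inr s)) ci xM cs csh sg) => v s.
  by apply/negPn/negP => h; apply: hn; exists v, s.
have avg1 (T : finType) (f : T -> R) t : (forall t, 0 <= f t) -> f t / #|T|%:R <= avg f.
  move=> f0; apply: ler_wpM2r; first by rewrite invr_ge0 ler0n.
  by rewrite (bigD1 t) //= lerDl sumr_ge0.
have lo : (4%:R * (J ^ (FN x).2)%:R)^-1 <= av.
  apply: le_trans (avg1 _ _ v _); last by move=> u; apply: avg_ge0 => k; rewrite ler0n.
  rewrite yc xs invfM; apply: ler_wpM2r; first by rewrite invr_ge0 ler0n.
  apply: le_trans (avg1 _ _ s _); last by move=> k; rewrite ler0n.
  by rewrite labE hvs card_prod card_bool div1r.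
have L0 : 0 < (ar_loss K1)%:R :> R by rewrite ltr0n; apply: ar_loss_gt0.
have := le_trans lo hav; rewrite -[X in _ <= X](mulrC) -ler_pdivrMr // => h; apply: le_trans h.
by rewrite natrM -!invfM le_eqVlt; apply/orP; left; apply/eqP; congr (_^-1); ring.
Qed.

(** The number of rounds is n = iJ + c, enough because 2^J >= J and 2^c >= c. Each round multiplies
    the table by q; as q <= J^q and J^i is at most the size of the first table, q^(iJ) is polynomial
    in that size. *)
Theorem pcp (L : seq bool -> Prop) (m0 : R) (r : rule (gG K1) (gC K1) (gG K1) (gC K1)) : in_NP L ->
  (0 < #|rj r|)%N -> 0 < m0 -> m0 <= 1 ->
  (forall X, good R inv1 X -> [/\ good R inv1 (rapp r X), satisfiable X -> satisfiable (rapp r X) &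
    forall m, 0 <= m -> 2 * m <= m0 -> (forall a : lv X -> ar_S, m <= vio R a) ->
    forall a : lv (rapp r X) -> ar_S, 2 * m <= vio R a]) ->
  exists2 F : seq bool -> tbl, PT F & forall x, exists Z : lgraph (gG K1) (gC K1),
    [/\ good R inv1 Z, encodes (F x) Z, L x -> satisfiable Z & ~ L x -> forall a : lv Z -> ar_S, m0 <= vio R a].
Proof.
move=> hL r0 m0_gt0 m0_le1 hr; have [J [c [F0 [J1 c0 pF0 hF0]]]] := start_graph hL.
have [G pG hG] := rule_PT r; pose q := #|rj r|.
pose n x := ((F0 x).2 * J + c)%N.
pose F x := foldl (fun T (_ : unit) => G T) (F0 x).1 (nseq (n x) tt).
have inv x t : exists Z : lgraph (gG K1) (gC K1),
    [/\ good R inv1 Z, encodes (iter t G (F0 x).1) Z & size (iter t G (F0 x).1) = (size (F0 x).1 * q ^ t)%N] /\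
    [/\ L x -> satisfiable Z & ~ L x -> forall m, m <= 2 ^+ t * (c%:R * (J ^ (F0 x).2)%:R)^-1 -> m <= m0 ->
      forall a : lv Z -> ar_S, m <= vio R a].
  elim: t => [|t [Z [[h1 h2 h3] [h4 h5]]]].
    have [Z [[h1 h2 h3] [h4 h5]]] := hF0 x; exists Z; split; split=> //=; first by rewrite muln1.
    by move=> nL m hm _ a; apply: le_trans hm _; rewrite expr0 mul1r; apply: h5.
  have [g1 g2 g3] := hr Z h1; have hrep := hG _ _ h2; exists (rapp r Z); split; split=> //.
  - have [code [_ cs _ _]] := h2; have [code' [_ cs' _ _]] := hrep.
    by rewrite iterS cs' card_prod -cs h3 expnSr mulnA.
  - by move=> /h4.
  move=> nL m hm hm0 a; have [mneg|mpos] := ltrP m 0.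
    by apply: le_trans (ltW mneg) _; apply: avg_ge0 => v; apply: avg_ge0 => d; rewrite ler0n.
  have := g3 (m / 2); rewrite [2 * _]mulrC divfK ?pnatr_eq0 //; apply=> //; first by rewrite divr_ge0.
  by move=> a0; apply: h5 => //; [move: hm; rewrite exprS -mulrA; set z := _ * _^-1; lra|lra].
exists F.
  apply: (PT_ext (f := fun x => foldl ((fun _ T _ => G T) x) (F0 x).1 (nseq (n x) tt))) => //.
  have pF01 : PT (fun x => (F0 x).1) by pt.
  have [k hk] := PT_size pF01.
  pose B (z : nat) := (z * (z ^ q) ^ J * q ^ c)%N.
  pose b (z : nat) := (B (z.+2 ^ k) * (#|gG K1| * (2 * B (z.+2 ^ k) + 2) + 2 * #|gC K1| + 4) + 1)%N.
  apply: (PT_fold (b := b) (stp := fun _ T (_ : unit) => G T)).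
  - have hB : pbd (fun z => B (z.+2 ^ k)%N).
      have hz : pbd (fun z => z.+2 ^ k)%N by exists k.
      by apply: pbd_mul (pbd_cst _); apply: pbd_mul => //; do 2 apply: pbd_exp.
    apply: pbd_add (pbd_cst _); apply: pbd_mul => //; apply: pbd_add (pbd_cst _); apply: pbd_add (pbd_cst _).
    by apply: pbd_mul (pbd_cst _) _; apply: pbd_add (pbd_cst _); apply: pbd_mul (pbd_cst _) hB.
  - by apply: PT_app => //; pt.
  - by [].
  - by rewrite /n; pt.
  move=> x p q' ep; have -> : foldl (fun T (_ : unit) => G T) (F0 x).1 p = iter (size p) G (F0 x).1.
    by rewrite -foldl_iter; congr foldl; elim: (p) => //= -[] s {1}->.
  have ht : (size p <= n x)%N by move/(congr1 size): ep; rewrite size_nseq size_cat; lia.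
  have [Z [[h1 h2 h3] _]] := inv x (size p).
  have [_ [[_ _ hJ] _]] := hF0 x.
  have q0 : (0 < q)%N by [].
  have J0 : (0 < J)%N by lia.
  have hS : (size (iter (size p) G (F0 x).1) <= B ((sz x).+2 ^ k))%N.
    have hs : (size (F0 x).1 <= (sz x).+2 ^ k)%N by apply: leq_trans (ltnW (size_sz _)) (hk x).
    rewrite h3; apply: leq_trans (leq_mul hs (leq_pexp2l q0 ht)) _.
    rewrite /n expnD /B -mulnA leq_mul2l; apply/orP; right; rewrite leq_mul2r; apply/orP; right.
    rewrite mulnC expnM; apply: leq_trans (_ : (q ^ (F0 x).2) ^ J <= _)%N.
      by rewrite -!expnM mulnC.
    rewrite leq_exp2r //; apply: leq_trans (_ : (J ^ q) ^ (F0 x).2 <= _)%N.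
      by case: (F0 x).2 => // i; rewrite leq_exp2r // ltnW // ltn_expl.
    rewrite -expnM mulnC expnM leq_exp2r //; exact: leq_trans hJ hs.
  apply: leq_trans (rep_sz h2) _; rewrite /b leq_add2r; apply: leq_mul => //.
  by rewrite !leq_add2r leq_mul2l; apply/orP; right; rewrite leq_add2r leq_mul2l hS orbT.
move=> x; have [Z [[h1 h2 _] [h3 h4]]] := inv x (n x); exists Z; split=> //; first by rewrite /F foldl_iter.
move=> nL a; apply: h4 => //; apply: le_trans m0_le1 _.
have cJ0 : 0 < c%:R * (J ^ (F0 x).2)%:R :> R by rewrite mulr_gt0 ?ltr0n // expn_gt0; lia.
rewrite ler_pdivlMr // mul1r -natrX -natrM ler_nat /n expnD mulnC; apply: leq_mul.
  rewrite mulnC expnM -[X in (X <= _)%N]expn1; rewrite expn1; case: (F0 x).2 => // i; rewrite leq_exp2r // ltnW // ltn_expl //.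
by rewrite ltnW // ltn_expl.
Qed.

End Start.

(** * Repeated games *)

Section Games.
Variables (R : realFieldType) (K1 : finType) (inv1 : K1 -> K1).
Hypotheses (K1gt : (1 < #|K1|)%N).
Notation xK := (xK K1).
Notation gD := (gD K1).
Notation gG := (gG K1).
Notation gC := (gC K1).

Definition gw (Th P : finType) (Y : lgraph Th P) (y : lv Y) (th : Th) : lv Y := la Y th y.
Definition gp (Th L S : finType) (Y : lgraph Th {ffun Th * L -> S}) (y : lv Y) (th : Th) (l : L) : S :=
  ll Y y (th, l).

Section Fort.
Variable T : nat.
Notation Th1 := (fg_Th xK gD T).
Notation L1 := (fg_L xK gD ar_S T).

Definition labc (lb : gC) (i : gD) (s s' : ar_S) : bool := lb (i, (s, s')).
Definition fort_word (th : Th1) : seq gG :=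
  (if th.1.2 then [:: inr (ar_inv inv1 th.1.1)] else [::]) ++ map inl th.2.
(** The constraint sits at the source of the selected edge: entry 0 is the label of the vertex
    itself, entry rank + 1 that of its predecessor along the generator. *)
Definition fort_lab (cs : seq gC) : {ffun Th1 * L1 -> ar_S} :=
  [ffun q : Th1 * L1 =>
    let lb := nth [ffun=> true] cs (if q.1.1.2 then (enum_rank q.1.1.1).+1 else 0%N) in
    let s := fixc (fun _ : unit => labc lb) tt q.1.1.1 (q.2 (tinv (xinv inv1) q.1.2, q.1.1.1)) in
    if q.1.1.2 then s.2 else s.1].
Definition fort_rule : rule gG gC Th1 {ffun Th1 * L1 -> ar_S} :=
  @Rule _ _ _ _ unit (fun th _ => fort_word th) (fun _ j => j)
    ([::] :: [seq [:: inr (ar_inv inv1 d)] | d <- enum gD]) (fun _ cs => fort_lab cs).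
Definition fort (Z : lgraph gG gC) : lgraph Th1 {ffun Th1 * L1 -> ar_S} :=
  @LGraph _ _ (lv Z) (fun th y => (la (rapp fort_rule Z) th (y, tt)).1) (fun y => ll (rapp fort_rule Z) (y, tt)).

Lemma fort_rep Tb Z : encodes Tb (rapp fort_rule Z) -> encodes Tb (fort Z).
Proof.
apply: (@rep_iso _ _ _ _ _ (fun y : lv (fort Z) => (y, tt) : lv (rapp fort_rule Z))) => //.
- by move=> u v [].
- by rewrite card_prod card_unit muln1.
Qed.

Variable Z : lgraph gG gC.
Let cZ v i s s' := labc (ll Z v) i s s'.

Lemma fort_w y th : la (fort Z) th y = fg_w (fun k => la Z (inl k)) (fun d => la Z (inr d)) (ar_inv inv1) y th.
Proof.
rewrite /= /fort_word walk_cat /fg_w /fg_v; set v := walk _ _ y.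
have -> : v = if th.1.2 then la Z (inr (ar_inv inv1 th.1.1)) y else y by rewrite /v; case: th.1.2.
by elim: (tval th.2) (if _ then _ else _) => //= k s ih u.
Qed.

Lemma fort_p y th l : gp (Y := fort Z) y th l =
  fg_p (xinv inv1) (fun d => la Z (inr d)) (ar_inv inv1) cZ y th l.
Proof.
rewrite /gp /= ffunE /fg_p /=.
set lb := nth _ _ _; suff -> : lb = ll Z (fg_v (fun d => la Z (inr d)) (ar_inv inv1) y th) by [].
by rewrite /lb /fg_v; case: th.1.2 => //=; rewrite -map_comp nth_enum_map.
Qed.

End Fort.

Lemma val_le_ext (V Th L S : finType) (w w' : V -> Th -> V) (p p' : V -> Th -> L -> S) (b : R) :
  (forall y th, w y th = w' y th) -> (forall y th l, p y th l = p' y th l) -> val_le w p b -> val_le w' p' b.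
Proof.
move=> ew ep h phi hphi; have <- : Qval w p phi = Qval w' p' phi; last exact: h.
apply: eq_avg => y; apply: eq_bigr => s _; congr (_ ^+ 2); apply: eq_avg => th; apply: eq_bigr => l _.
by rewrite ew ep.
Qed.

Definition pcmb (Th1 L1 S1 Th2 L2 S2 : finType) (P1 : {ffun Th1 * L1 -> S1}) (P2 : {ffun Th2 * L2 -> S2}) :
    {ffun (Th1 * Th2) * (L1 * L2) -> S1 * S2} :=
  [ffun q : (Th1 * Th2) * (L1 * L2) => (P1 (q.1.1, q.2.1), P2 (q.1.2, q.2.2))].

(** Recursion on [k] from the one-point game, one fortified factor at a time. Each factor
    contributes 1 - m/2 and an error of at most |S|^k 2^(1-T). The bound |L| >= T serves to make
    [kap] small. *)
Lemma games (T k : nat) : exists (Th L S : finType) (l0 : L) (F : tbl -> tbl),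
  [/\ (0 < #|Th|)%N, PT F, #|S| = (#|ar_S| ^ k)%N & (0 < k)%N -> (T <= #|L|)%N] /\
  forall Tb Z, good R inv1 Z -> encodes Tb Z -> exists Y : lgraph Th {ffun Th * L -> S},
  [/\ encodes (F Tb) Y, (0 < #|lv Y|)%N & forall th, injective (la Y th)] /\
  [/\ satisfiable Z -> exists (l : lv Y -> L) (ka : lv Y -> S), forall y th, gp y th (l (gw y th)) = ka y
    & forall m : R, 0 <= m <= 1 -> (forall a : lv Z -> ar_S, m <= vio R a) ->
      val_le (gw (Y := Y)) (gp (Y := Y)) ((1 - m / 2) ^+ k + k%:R * (#|ar_S| ^ k)%:R * (2 * 2^-1 ^+ T))].
Proof.
have S0 : (0 < #|ar_S|)%N by rewrite card_ffun expn_gt0 card_bool.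
elim: k => [|k [Th [L [S [l0 [F [[Th0 pF cS hL] hF]]]]]]].
  exists unit, unit, unit, tt, (fun _ => [:: ([:: 0%N], 0%N)]); split.
    by split=> //; rewrite ?card_unit //; pt.
  move=> Tb Z gZ rZ.
  exists (@LGraph unit {ffun unit * unit -> unit} unit (fun _ y => y) (fun _ => [ffun=> tt])).
  split.
    split; rewrite ?card_unit //; last by move=> th [] [].
    exists (fun _ => 0%N); split=> //=; [by case=> [] []|by rewrite card_unit|].
    move=> v; rewrite /tent /=; congr pair; first by rewrite enumT unlock.
    set e := enum_rank _; have : (e < 1)%N.
      by apply: leq_trans (ltn_ord e) _; rewrite card_ffun card_unit exp1n.
    by case: (nat_of_ord e).
  split; first by exists (fun _ => tt), (fun _ => tt) => y th; case: (gp _ _ _).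
  move=> m hm _ phi [phi0 phi1]; rewrite expr0 mul0r mul0r addr0.
  have U1 (X : R) : avg (fun _ : unit => X) = X by rewrite avg_cst ?card_unit.
  apply: le_avg1 => // -[]; rewrite (bigD1 tt) //= [X in _ + X]big1 ?addr0 => [|[]] //.
  set a := avg _; have a01 : 0 <= a <= 1.
    apply/andP; split; first by apply: avg_ge0 => th; apply: sumr_ge0 => l _; rewrite mulr_ge0 ?ler0n.
    apply: le_avg1 => // th; apply: le_trans (phi1 (gw (Y := @LGraph unit {ffun unit * unit -> unit} unit (fun _ y => y) (fun _ => [ffun=> tt])) tt th)).
    by apply: ler_sum => l _; rewrite mul1r.
  by rewrite expr2; nra.
have [F1 pF1 hF1] := rule_PT (fort_rule T).
have [F2 pF2 hF2] := @lprod_PT (fg_Th xK gD T) {ffun fg_Th xK gD T * fg_L xK gD ar_S T -> ar_S} Th {ffun Th * L -> S}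
  {ffun (fg_Th xK gD T * Th) * (fg_L xK gD ar_S T * L) -> ar_S * S} (@pcmb _ _ _ _ _ _).
have K0 : (0 < #|xK|)%N := xK_gt0 K1gt.
have D0 : (0 < #|gD|)%N := gD_gt0 K1.
exists (fg_Th xK gD T * Th)%type, (fg_L xK gD ar_S T * L)%type, (ar_S * S)%type.
exists ([ffun=> ([ffun=> false], [ffun=> false])], l0), (fun Tb => F2 (F1 Tb, F Tb)); split.
  split.
  - by rewrite card_prod muln_gt0 Th0 andbT /fg_Th !card_prod card_bool card_tuple !muln_gt0 D0 expn_gt0 K0.
  - by apply: PT_app => //; apply: PT_pair.
  - by rewrite card_prod cS expnS.
  move=> _; rewrite card_prod; apply: leq_trans (leq_pmulr _ _); last by apply/card_gt0P; exists l0.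
  rewrite /fg_L card_ffun [X in (_ ^ X)%N]card_prod card_tuple [X in (X ^ _)%N]card_prod.
  have h1 : (T <= #|xK| ^ T)%N.
    apply: leq_trans (ltnW (ltn_expl T (isT : 1 < 2)%N)) _; case: (T) => // t; rewrite leq_exp2r //.
    rewrite !card_prod; have : (1 < #|K1|)%N := K1gt; nia.
  apply: leq_trans h1 _; apply: leq_trans (leq_pmulr _ D0) _; apply: ltnW; apply: ltn_expl.
  have : (1 < #|ar_S|)%N by rewrite card_ffun card_bool card_ord.
  by nia.
move=> Tb Z gZ rZ; have [Y [[rY V0Y injY] [cY sY]]] := hF Tb Z gZ rZ.
have [[V0 sgx cx] sgd ne] := gZ.
have rY1 := fort_rep (hF1 _ _ rZ).
exists (lprod (@pcmb _ _ _ _ _ _) (fort T Z) Y); split; split.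
- exact: hF2.
- by rewrite card_prod muln_gt0 V0.
- move=> [th1 th] [u v] [u' v'] e.
  have e1 : la (fort T Z) th1 u = la (fort T Z) th1 u' by exact: (congr1 fst e).
  have e2 : la Y th v = la Y th v' by exact: (congr1 snd e).
  rewrite !fort_w in e1.
  by congr pair; [apply: (fg_w_inj sgx sgd e1)|apply: injY e2].
- move=> sZ; have [l [ka hka]] := cY sZ; case: sZ => a ha.
  have [l1 hl1] := fg_complete sgx sgd (c := fun v => labc (ll Z v)) T ha.
  exists (fun y => (l1 y.1, l y.2)), (fun y => (a y.1, ka y.2)) => -[y1 y] [th1 th].
  rewrite /gp /= ffunE /=; congr pair; last exact: hka.
  by have := hl1 y1 th1; rewrite -fort_w -fort_p.
move=> m /andP[m0 m1] gap.
have hv : val_le (gw (Y := Y)) (gp (Y := Y)) _ := sY m (introT andP (conj m0 m1)) gap.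
have hf := game_fortified sgx sgd V0 K0 D0 cx (c := fun v => labc (ll Z v)) ne (T := T) gap.
have del0 : 0 <= 2 * 2^-1 ^+ T :> R by rewrite mulr_ge0 // exprn_ge0 // invr_ge0.
have rho0 : 0 <= 1 - m / 2 by lra.
have := game_product V0 V0Y rho0 del0 hf hv.
have le : (1 - m / 2) * ((1 - m / 2) ^+ k + k%:R * (#|ar_S| ^ k)%:R * (2 * 2^-1 ^+ T)) + #|S|%:R * (2 * 2^-1 ^+ T)
   <= (1 - m / 2) ^+ k.+1 + k.+1%:R * (#|ar_S| ^ k.+1)%:R * (2 * 2^-1 ^+ T).
  rewrite cS exprS; set r := (1 - m / 2) ^+ k; set d := 2 * _; set s := (#|ar_S| ^ k)%:R.
  have s0 : 0 <= s by rewrite ler0n.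
  have s1 : s <= (#|ar_S| ^ k.+1)%:R by rewrite ler_nat leq_exp2l // card_ffun card_bool card_ord.
  set s' := (#|ar_S| ^ k.+1)%:R in s1 *.
  have kR : 0 <= k%:R :> R by rewrite ler0n.
  have e1 : (1 - m / 2) * (k%:R * s * d) <= k%:R * s' * d.
    apply: le_trans (_ : _ <= 1 * (k%:R * s * d)) _.
      apply: ler_wpM2r; last by lra.
      by apply: mulr_ge0 => //; apply: mulr_ge0.
    by rewrite mul1r; apply: ler_wpM2r => //; apply: ler_wpM2l.
  have e2 : s * d <= s' * d by apply: ler_wpM2r.
  have -> : k.+1%:R * s' * d = k%:R * s' * d + s' * d by rewrite -natr1; ring.
  by rewrite mulrDr; lra.
move=> h phi hphi; apply: le_trans le.
apply: (val_le_ext _ _ h) hphi.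
  by move=> [y1 y] [th1 th]; rewrite /wprod /gw /=; congr pair; rewrite -[RHS]/(la (fort T Z) th1 y1) fort_w.
by move=> [y1 y] [th1 th] [l1 l2]; rewrite /pprod /= /gp /= ffunE /=; congr pair; rewrite -fort_p.
Qed.

End Games.

(** * The reduction *)

Lemma uniq_scan (s : seq nat) :
  uniq s = all (fun i => ~~ has (fun y => nth 0%N s i == y) (drop i.+1 s)) (iota 0 (size s)).
Proof.
elim: s => //= x s ->; rewrite drop0; congr (_ && _).
  by rewrite -has_pred1 (eq_has (a2 := fun y => x == y)) // => y; rewrite /= eq_sym.
by rewrite -[1%N]addn0 iotaDl all_map; apply: eq_all => i.
Qed.

Lemma PT_uniq (E : Type) {EE : Enc E} (f : E -> seq nat) : PT f -> PT (fun e => uniq (f e)).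
Proof.
move=> hf; apply: (@PT_ext _ _ _ _ (fun e => all (fun i => ~~ has (fun y => nth 0%N (f e) i == y) (drop i.+1 (f e))) (iota 0 (size (f e))))).
  by move=> e; rewrite -uniq_scan.
have h1 : PT (fun p : E * nat => f p.1) by apply: PT_app => //; pt.
have h2 : PT (fun p : E * nat * nat => f p.1.1) by apply: PT_app => //; pt.
by pt.
Qed.

Definition reqn : Type := (seq nat * bool)%type.
Definition rok (n : nat) (e : reqn) : bool := [&& uniq e.1, size e.1 == 4%N & all (fun i => i < n)%N e.1].
Definition mkeq (n : nat) (e : reqn) : equation n := (\row_(i < n) ((i : nat) \in e.1)%:R, e.2%:R).

Lemma natF2_neq0 (b : bool) : (b%:R != 0 :> 'F_2) = b.
Proof. by case: b. Qed.

Lemma mkeq_vars n e : equation_vars (mkeq n e) = [set i : 'I_n | (i : nat) \in e.1].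
Proof. by apply/setP => i; rewrite !inE mxE natF2_neq0. Qed.

Lemma mkeq_4vars n es : all (fun e => #|equation_vars e| == 4%N) [seq mkeq n e | e <- es & rok n e].
Proof.
apply/allP => _ /mapP[e /[!mem_filter] /andP[/and3P[ue /eqP se ae] _] ->]; rewrite mkeq_vars; apply/eqP.
pose s : seq 'I_n := pmap insub e.1.
have vs : map val s = e.1 by rewrite pmap_filter; [apply/all_filterP; apply/allP => i /(allP ae) h; rewrite /= insubT|exact: insubK].
have us : uniq s by rewrite -(map_inj_uniq val_inj) vs.
rewrite -se -vs size_map -(card_uniqP us); apply: eq_card => i; rewrite inE.
by rewrite (mem_map val_inj).
Qed.

(** Degenerate equations are filtered out by [rok], which supplies the proof component. *)
Definition sysof (q : nat * seq reqn) : system4 := System4 (mkeq_4vars q.1 q.2).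

Definition sysbits (q : nat * seq reqn) : seq bool :=
  nseq q.1 true ++ false :: flatten [seq (if rok q.1 e then
     [seq has (fun j => i == j) e.1 | i <- iota 0 q.1] ++ [:: e.2] else [::]) | e <- q.2].

Lemma sysbitsE q : encode_system (sysof q) = sysbits q.
Proof.
case: q => n es; rewrite /encode_system /sysbits /=; congr (_ ++ _ :: _).
elim: es => //= e es ih; case: (rok n e) => //=; rewrite ih; congr (_ ++ _).
rewrite /encode_equation -cats1 /= natF2_neq0; congr (_ ++ _).
rewrite -val_enum_ord -map_comp; apply: eq_map => i /=.
rewrite mxE natF2_neq0 -has_pred1; apply: eq_has => j; by rewrite /= eq_sym.
Qed.

Lemma PT_sysbits : PT sysbits.
Proof.
have h : PT (fun p : nat * seq reqn * reqn => p.2.1) by pt.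
have hu := PT_uniq h.
by rewrite /sysbits /rok; pt.
Qed.

Lemma F2_addb (x y : 'F_2) : (x + y != 0) = (x != 0) (+) (y != 0).
Proof. by case: x => -[|[|//]] hx; case: y => -[|[|//]] hy. Qed.

Lemma F2_sum (I : Type) (s : seq I) (f : I -> 'F_2) :
  (\sum_(i <- s) f i != 0) = \big[addb/false]_(i <- s) (f i != 0).
Proof. by elim: s => [|i s ih]; rewrite ?big_nil ?eqxx // !big_cons F2_addb ih. Qed.

Lemma F2_eq (x : 'F_2) (b : bool) : (x == b%:R) = ((x != 0) == b).
Proof. by case: x => -[|[|//]] hx; case: b. Qed.

Lemma mkeq_sat n (I : eqType) (idx : I -> 'I_n) (s : seq I) (b : bool) (a : {ffun 'I_n -> 'F_2}) :
  injective idx -> uniq s ->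
  satisfies a (mkeq n ([seq val (idx z) | z <- s], b)) = (\big[addb/false]_(z <- s) (a (idx z) != 0) == b).
Proof.
move=> ii us; rewrite /satisfies /= F2_eq -F2_sum; congr ((_ != _) == _).
transitivity (\sum_(i in map idx s) a i).
  rewrite [RHS]big_mkcond /=; apply: eq_bigr => i _; rewrite mxE.
  rewrite (_ : [seq val (idx z) | z <- s] = map val (map idx s)) -?map_comp // map_comp (mem_map val_inj).
  by case: (_ \in _); rewrite ?mul1r ?mul0r.
by rewrite -big_uniq ?map_inj_uniq //= big_map.
Qed.

Lemma rok_map n (I : eqType) (idx : I -> 'I_n) (s : seq I) b : injective idx ->
  rok n ([seq val (idx z) | z <- s], b) = uniq s && (size s == 4%N).
Proof.
move=> ii; rewrite /rok /= (map_inj_uniq (f := fun z => val (idx z))) ?size_map ?all_map.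
  by rewrite (_ : all _ s) ?andbT //; apply/allP => z _ /=; apply: ltn_ord.
by move=> x y /val_inj/ii.
Qed.

Lemma sub_map n (I : eqType) (idx : I -> 'I_n) (s : seq I) b (A : {set 'I_n}) :
  (equation_vars (mkeq n ([seq val (idx z) | z <- s], b)) \subset A) = all (fun z => idx z \in A) s.
Proof.
rewrite mkeq_vars; apply/subsetP/allP => [h z zs|h i].
  by apply: h; rewrite inE /=; apply/mapP; exists z.
by rewrite inE /= => /mapP[z zs ez]; have -> : i = idx z; [exact: val_inj|exact: h].
Qed.

Section Equations.
Variables (Th L S : finType) (m : nat) (l0 : L).
Notation P := {ffun Th * L -> S}.
Notation hl := (hlf Th L m).
Notation O' := (cube S * hl * hl)%type.
Notation nX := #|X0 l0|.

Definition hpt (p : P) (g : cube S) (t : hl) : seq (Th * cube L) :=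
  [:: (t.1.1, t.2); (t.1.1, xadd t.2 (xadd [ffun l => g (p (t.1.1, l))] (nu t.1.2)))].
Definition pts' (p : P) (o : O') : seq (Th * cube L) := hpt p o.1.1 o.1.2 ++ hpt p o.1.1 o.2.
Definition ths (o : O') : seq Th := [:: o.1.2.1.1; o.1.2.1.1; o.2.1.1; o.2.1.1].

(** Everything except the vertex is of constant size, so points and right-hand sides are looked up
    in tables indexed by the rank of the projection. *)
Definition teqn (T : tbl) (v : nat) (o : O') : reqn :=
  ([seq nth 0%N (tent T v).1 (enum_rank (nth o.1.2.1.1 (ths o) i)) * nX +
     nth 0%N [seq (enum_rank (foldx l0 (nth (o.1.2.1.1, o.1.2.2) (pts' p o) i).2) : nat) | p <- enum {: P}] (tent T v).2
   | i <- iota 0 4]%N,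
   nth false [seq \big[addb/false]_(q <- pts' p o) q.2 l0 | p <- enum {: P}] (tent T v).2).
Definition rsys (T : tbl) : nat * seq reqn :=
  ((size T * nX)%N, flatten [seq [seq teqn T v o | o <- enum {: O'}] | v <- iota 0 (size T)]).

Lemma PT_rsys : PT rsys.
Proof. by rewrite /rsys; pt; rewrite /teqn; pt. Qed.

Variables (Y : lgraph Th P) (T : tbl) (code : lv Y -> nat).
Hypotheses (ci : injective code) (cs : size T = #|lv Y|) (cb : forall v, (code v < size T)%N)
  (ce : forall v, tent T (code v) = ([seq code (la Y g v) | g <- enum Th], enum_rank (ll Y v) : nat)).
Notation n := (size T * nX)%N.
Notation gv := (gvar (lv Y) l0).
Notation Om := (Omega (lv Y) Th L S m).
Notation GV := (gvars (gw (Y := Y)) (gp (Y := Y)) l0).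

Lemma idx_lt (z : gv) : (code z.1 * nX + enum_rank z.2 < n)%N.
Proof. by apply: mixlt => //; apply: ltn_ord. Qed.

Definition idx (z : gv) : 'I_n := Ordinal (idx_lt z).

Lemma idx_inj : injective idx.
Proof.
move=> [v z] [v' z'] /(congr1 val) /= e.
have h1 : (enum_rank z < nX)%N := ltn_ord _; have h2 : (enum_rank z' < nX)%N := ltn_ord _.
have [e1 e2] := divmod_inj h1 h2 e.
by rewrite (ci e1); congr pair; apply: enum_rank_inj; apply: val_inj.
Qed.

Definition mkO (v : lv Y) (o : O') : Om := (v, o.1.1, o.1.2, o.2).

Lemma teqnE v o : teqn T (code v) o = ([seq val (idx z) | z <- GV (mkO v o)],
  grhs (gw (Y := Y)) (gp (Y := Y)) l0 (mkO v o)).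
Proof.
rewrite /teqn ce /=; congr pair; last first.
  by rewrite nth_enum_map /grhs /pts /pts' /hpts /hpt /= !big_cons !big_nil.
by rewrite !nth_enum_map.
Qed.

Lemma rok_teqn v o : rok n (teqn T (code v) o) = uniq (GV (mkO v o)).
Proof. by rewrite teqnE (rok_map _ _ idx_inj) andbT. Qed.

(** Turns counts over the list of equations into cardinals of sets of tests, to which the analytic
    bounds apply. *)
Lemma count_rsys (Q : pred (equation n)) (Q' : pred Om) :
  (forall v o, uniq (GV (mkO v o)) -> Q (mkeq n (teqn T (code v) o)) = Q' (mkO v o)) ->
  count Q (equations (sysof (rsys T))) = #|[pred o : Om | uniq (GV o) & Q' o]|.
Proof.
move=> hQ; have surj := rep_surj ci cs cb.
have hdec (i : 'I_(size T)) : exists v, code v = i by apply: surj.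
have [dec decK] := choice hdec.
pose lst := flatten [seq [seq mkO (dec i) o | o <- enum {: O'}] | i <- enum 'I_(size T)].
have e1 : (rsys T).2 = [seq teqn T (code o.1.1.1) (o.1.1.2, o.1.2, o.2) | o <- lst].
  rewrite /rsys /lst /= map_flatten -map_comp -val_enum_ord -map_comp; congr flatten.
  apply: eq_map => i /=; rewrite -map_comp; apply: eq_map => -[[g t] t'] /=.
  by rewrite decK.
have lp : perm_eq lst (enum {: Om}).
  apply: uniq_perm; rewrite ?enum_uniq //.
    apply: allpairs_uniq; rewrite ?enum_uniq // => -[i [[g t] t']] [j [[g' t2] t2']] _ _ [] e -> -> ->.
    by congr pair; apply: val_inj; rewrite /= -decK e decK.
  move=> [[[v g] t] t']; rewrite mem_enum inE; apply/flatten_mapP.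
  exists (Ordinal (cb v)); first by rewrite mem_enum.
  apply/mapP; exists (g, t, t'); first by rewrite mem_enum.
  by rewrite /mkO /=; congr (_, _, _, _); apply: ci; rewrite decK.
transitivity (count [pred o : Om | uniq (GV o) & Q' o] lst); last first.
  by rewrite (permP lp) -size_filter cardE enumT.
transitivity (count Q [seq mkeq n e | e <- (rsys T).2 & rok n e]); first by [].
rewrite e1 filter_map !count_map count_filter; apply: eq_count => -[[[v g] t] t'].
transitivity (Q (mkeq n (teqn T (code v) (g, t, t'))) && rok n (teqn T (code v) (g, t, t'))); first by [].
transitivity (uniq (GV (mkO v (g, t, t'))) && Q' (mkO v (g, t, t'))); last by [].
by rewrite rok_teqn andbC; case: (boolP (uniq _)) => // hu; rewrite hQ.
Qed.

Lemma sat_teqn (a : {ffun 'I_n -> 'F_2}) v o : uniq (GV (mkO v o)) ->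
  satisfies a (mkeq n (teqn T (code v) o)) =
  gsat (gw (Y := Y)) (gp (Y := Y)) (fun z => a (idx z) != 0) (mkO v o).
Proof. by move=> hu; rewrite teqnE (mkeq_sat _ _ idx_inj hu). Qed.

Lemma sub_teqn (A : {set 'I_n}) v o :
  (equation_vars (mkeq n (teqn T (code v) o)) \subset A) = all (fun z => idx z \in A) (GV (mkO v o)).
Proof.
by rewrite teqnE sub_map.
Qed.

Section Bounds.
Variables (R : realType) (m1 : (1 < m)%N).
Hypotheses (V0 : (0 < #|lv Y|)%N) (Th0 : (0 < #|Th|)%N) (winj : forall th, injective (la Y th)).

Lemma idx_surj i : exists z, idx z = i.
Proof.
have hc : (#|{: 'I_n}| <= #|gv|)%N by rewrite card_ord /gvar card_prod cs.
by have /codomP[z ->] := inj_card_onto idx_inj hc i; exists z.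
Qed.

Lemma rsys_complete (eta : R) (l : lv Y -> L) (ka : lv Y -> S) :
  (forall y th, gp y th (l (gw y th)) = ka y) -> 2 / m%:R + kap R L m <= eta ->
  yes_case eta (sysof (rsys T)).
Proof.
move=> hl hm; have [a ha] := eqs_complete l0 m1 V0 Th0 hl hm.
have [dec decK] := choice idx_surj.
exists [ffun i => (a (dec i))%:R]; rewrite /satisfies_fraction.
have -> : size (equations (sysof (rsys T))) = #|[pred o : Om | uniq (GV o)]|.
  rewrite -count_predT (count_rsys (Q' := predT)) //; apply: eq_card => o; by rewrite !inE andbT.
rewrite (count_rsys (Q' := gsat (gw (Y := Y)) (gp (Y := Y)) a)) // => v o hu.
rewrite sat_teqn //; congr (gsat _ _ _ _); apply: funext => z; rewrite ffunE natF2_neq0.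
by congr a; apply: idx_inj; rewrite decK.
Qed.

Lemma rsys_sound (b al nuu : R) : val_le (gw (Y := Y)) (gp (Y := Y)) b -> 0 < al -> 0 < nuu ->
  (m%:R / 2) ^+ 2 * b + kap R L m < 2 * nuu * (al ^+ 4 - kap R L m) ->
  no_case al nuu (sysof (rsys T)).
Proof.
move=> hv al0 nu0 hk A hA [a]; rewrite /satisfies_fraction /induced_system.
pose P z := idx z \in (A : {set 'I_n}); pose a' z := (a : {ffun 'I_n -> 'F_2}) (idx z) != 0.
have cP : #|P| = #|A|.
  rewrite -(card_imset (mem P) idx_inj); apply: eq_card => i; apply/imsetP/idP => [[z zP ->] //|hi].
  by have [z ez] := idx_surj i; exists z; rewrite // -[_ \in _]/(P z) /P ez.
have := @eqs_sound R _ _ _ _ (gw (Y := Y)) (gp (Y := Y)) m l0 m1 V0 Th0 winj P a' b al nuu hv (ltW al0) nu0 hk.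
have -> : al * #|gvar (lv Y) l0|%:R <= #|P|%:R.
  by move: hA; rewrite cP /gvar card_prod -cs.
move=> /(_ isT) hlt.
have e1 : count (satisfies a) [seq e <- equations (sysof (rsys T)) | equation_vars e \subset A] =
    #|[pred o : Om | [&& uniq (GV o), all P (GV o) & gsat (gw (Y := Y)) (gp (Y := Y)) a' o]]|.
  rewrite count_filter (count_rsys (Q' := fun o => all P (GV o) && gsat (gw (Y := Y)) (gp (Y := Y)) a' o)) //.
  by move=> v o hu; rewrite /predI /= sat_teqn // sub_teqn andbC.
have e2 : size [seq e <- equations (sysof (rsys T)) | equation_vars e \subset A] =
    #|[pred o : Om | uniq (GV o) && all P (GV o)]|.
  rewrite size_filter (count_rsys (Q' := fun o => all P (GV o))) //.
  by move=> v o hu; rewrite sub_teqn.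
by rewrite e1 e2 => hle; move: (le_lt_trans hle hlt); rewrite ltxx.
Qed.

End Bounds.
End Equations.

(** From the Bernoulli inequality in the form r^n (1 + n (1 - r)) <= 1. *)
Lemma geom_small (R : archiRealFieldType) (r e : R) : 0 <= r < 1 -> 0 < e ->
  exists n0, forall n, (n0 <= n)%N -> r ^+ n <= e.
Proof.
move=> /andP[r0 r1] e0; pose d := 1 - r; have d0 : 0 < d by rewrite subr_gt0.
have x0 : 0 <= (d * e)^-1 by rewrite invr_ge0 mulr_ge0 // ltW.
exists (Num.bound (d * e)^-1) => n hn.
have bern k : r ^+ k * (1 + k%:R * d) <= 1.
  elim: k => [|k ih]; first by rewrite expr0 mul0r addr0 mulr1.
  have : r * (1 + d) <= 1 by have := sqr_ge0 (1 - r); rewrite /d; nra.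
  have rk : 0 <= r ^+ k by rewrite exprn_ge0.
  have kd : 0 <= k%:R * d by rewrite mulr_ge0 ?ler0n // ltW.
  have : 1 + k.+1%:R * d <= (1 + k%:R * d) * (1 + d) by rewrite -natr1; nra.
  move=> h1 h2; rewrite exprSr; apply: le_trans (_ : _ <= r ^+ k * r * ((1 + k%:R * d) * (1 + d))) _.
    by apply: ler_wpM2l => //; rewrite mulr_ge0.
  have -> : r ^+ k * r * ((1 + k%:R * d) * (1 + d)) = (r ^+ k * (1 + k%:R * d)) * (r * (1 + d)) by ring.
  have rd : 0 <= r * (1 + d) by rewrite mulr_ge0 // addr_ge0 // ltW.
  apply: le_trans (ler_wpM2r rd ih) _; by rewrite mul1r.
have hb : (d * e)^-1 <= n%:R.
  apply: le_trans (ltW (archi_boundP x0)) _; by rewrite ler_nat.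
have nd : e^-1 <= n%:R * d.
  by move: hb; rewrite invfM mulrC ler_pdivrMr // => h; apply: le_trans h _.
have h1 := bern n; have rn : 0 <= r ^+ n by rewrite exprn_ge0.
have h2 : r ^+ n * e^-1 <= 1.
  by apply: le_trans h1; apply: ler_wpM2l => //; apply: le_trans nd _; rewrite lerDr.
by move: h2; rewrite ler_pdivrMr // mul1r.
Qed.

Theorem theorem1p11 (R : realType) (alpha eta nu : R)
    (halpha : 0 < alpha < 1) (heta : 0 < eta < 1) (hnu : 0 < nu < 1) :
  NP_hard_to_distinguish encode_system (yes_case eta) (no_case alpha nu).
Proof.
move=> L hL; case/andP: halpha => al0 al1; case/andP: heta => eta0 eta1; case/andP: hnu => nu0 nu1.
have [K1 [inv1 [K1gt fam]]] := expander_family R.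
have [r [m0' [r0 m0'_gt0 hr]]] := round K1gt fam.
pose m0 := Num.min m0' 1.
have m0_gt0 : 0 < m0 by rewrite lt_min m0'_gt0 ltr01.
have m0_le1 : m0 <= 1 by rewrite ge_min lexx orbT.
have m0_le : m0 <= m0' by rewrite ge_min lexx.
have [F pF hF] : exists2 F : seq bool -> tbl, PT F & forall x, exists Z : lgraph (gG K1) (gC K1),
    [/\ good R inv1 Z, encodes (F x) Z, L x -> satisfiable Z & ~ L x -> forall a : lv Z -> ar_S, m0 <= vio R a].
  apply: (pcp K1gt fam hL r0 m0_gt0 m0_le1) => X gX; have [h1 h2 h3] := hr X gX.
  by split=> // m hm h2m; apply: h3 => //; apply: le_trans m0_le.
(* Half of [eta] goes to the noise, the other half to the degenerate tests. *)
have [m m_gt1 hm] : exists2 m : nat, (1 < m)%N & 2 / m%:R <= eta / 2.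
  have b0 : 0 <= 4%:R / eta by rewrite divr_ge0 // ltW.
  exists (Num.bound (4%:R / eta)).+2 => //.
  rewrite ler_pdivrMr ?ltr0n // mulrAC ler_pdivlMr //.
  have : 4%:R / eta <= (Num.bound (4%:R / eta)).+2%:R.
    by apply: le_trans (ltW (archi_boundP b0)) _; rewrite ler_nat (leq_trans (leqnSn _)).
  by rewrite ler_pdivrMr // => h; rewrite mulrC [eta * _]mulrC; lra.
have m_gt0 : 0 < m%:R :> R by rewrite ltr0n ltnW.
pose s := nu * alpha ^+ 4; have s0 : 0 < s by rewrite mulr_gt0 // exprn_gt0.
(* Target value of the repeated game: (m/2)^2 t = s/2. *)
pose t := s / (2 * (m%:R / 2) ^+ 2).
have m2 : 0 < (m%:R / 2) ^+ 2 :> R by rewrite exprn_gt0 // divr_gt0.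
have t0 : 0 < t by rewrite divr_gt0 // mulr_gt0.
have [k0 hk0] := @geom_small R (1 - m0 / 2) (t / 2) ltac:(apply/andP; split; lra) ltac:(by rewrite divr_gt0).
pose k := k0.+1; have k_gt0 : (0 < k)%N by [].
have hk : (1 - m0 / 2) ^+ k <= t / 2 by apply: hk0; exact: leqnSn.
have S0 : (0 < #|ar_S|)%N by rewrite card_ffun expn_gt0 card_bool.
pose c := k%:R * (#|ar_S| ^ k)%:R : R.
have c0 : 0 < c by rewrite mulr_gt0 // ltr0n // expn_gt0 S0.
(* The additive error of fortification carries the factor [c], which depends on [k]. *)
have [T1 hT1] := @geom_small R 2^-1 (t / (4%:R * c)) ltac:(apply/andP; split; lra) ltac:(by rewrite divr_gt0 // mulr_gt0).
pose kp := Num.min (s / 3%:R) (eta / 2).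
have kp0 : 0 < kp by rewrite lt_min !divr_gt0.
have q01 : (0 <= 1 - m%:R^-1 :> R) && (1 - m%:R^-1 < 1 :> R).
  rewrite subr_ge0 invf_le1 // ler1n (ltnW m_gt1) /= ltrBlDr ltrDl invr_gt0 //.
(* A long walk means a large label set, hence a small share of degenerate tests. *)
have [T2 hT2] := @geom_small R (1 - m%:R^-1) (kp / 12%:R) q01 ltac:(by rewrite divr_gt0).
pose T := maxn T1 T2.
have [Th [Lt [S [l0 [G [[Th0 pG cS hLt] hG]]]]]] := games R inv1 K1gt T k.
have kapP : kap R Lt m <= kp.
  have := hT2 #|Lt| (leq_trans (leq_maxr _ _) (hLt k_gt0)); rewrite /kap; lra.
have [kap1 kap2] : kap R Lt m <= s / 3%:R /\ kap R Lt m <= eta / 2.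
  by move: kapP; rewrite le_min => /andP[].
have kap_ge0 : 0 <= kap R Lt m by rewrite mulr_ge0 // exprn_ge0 //; case/andP: q01.
have hb : (1 - m0 / 2) ^+ k + c * (2 * 2^-1 ^+ T) <= t.
  have c4 : 0 < 4%:R * c by rewrite mulr_gt0.
  have := hT1 T (leq_maxl _ _); rewrite ler_pdivlMr //.
  by have -> : 2^-1 ^+ T * (4%:R * c) = 2 * (c * (2 * 2^-1 ^+ T)); [ring|lra].
exists (fun x => sysof (@rsys Th Lt S m l0 (G (F x)))); split.
  apply: PT_polytime; apply: (@PT_ext _ _ _ _ (fun x => sysbits (@rsys Th Lt S m l0 (G (F x))))).
    by move=> x; rewrite /= sysbitsE.
  apply: (PT_app PT_sysbits); apply: (PT_app (@PT_rsys Th Lt S m l0)); exact: PT_app.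
move=> x; have [Z [gZ rZ cZ nZ]] := hF x.
have [Y [[[code [ci cs cb ce]] V0 winj] [cY nY]]] := hG _ _ gZ rZ.
split=> hx.
  have [l [ka hl]] := cY (cZ hx).
  by apply: (rsys_complete l0 ci cs cb ce m_gt1 V0 Th0 hl); lra.
have hv := nY m0 (introT andP (conj (ltW m0_gt0) m0_le1)) (nZ hx).
apply: (rsys_sound ci cs cb ce m_gt1 V0 Th0 winj hv al0 nu0).
have : (m%:R / 2) ^+ 2 * ((1 - m0 / 2) ^+ k + k%:R * (#|ar_S| ^ k)%:R * (2 * 2^-1 ^+ T)) <= s / 2.
  apply: le_trans (_ : _ <= (m%:R / 2) ^+ 2 * t) _; first by rewrite ler_pM2l.
  by rewrite le_eqVlt; apply/orP; left; apply/eqP; rewrite /t; field; rewrite gt_eqF.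
have e4 : 2 * nu * (alpha ^+ 4 - kap R Lt m) = 2 * s - 2 * (nu * kap R Lt m) by rewrite /s; ring.
have nk : nu * kap R Lt m <= kap R Lt m by rewrite -[X in _ <= X]mul1r; apply: ler_wpM2r => //; exact: ltW.
(* The slack is s/2 + s/3 < 2s - 2s/3. *)
have fin (w y z u : R) : z <= u / 3%:R -> 0 <= z -> y <= z -> 0 < u -> w <= u / 2 -> w + z < 2 * u - 2 * y by lra.
by rewrite e4 => h; apply: fin kap1 kap_ge0 nk s0 h.
Qed.
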